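(* Assume $A$ is a unital C*-algebra of finite stable rank. (1) If $U_0(M_n(A))$ is definable for all $n$, then $K_1(A)$ belongs to $A^{\mathrm{eq}}$. (2) If $A$ has real rank zero, then $K_1(A)$ belongs to $A^{\mathrm{eq}}$. (3) If $B$ is such that $A\prec B$, then $K_1(A)$ is a subgroup of $K_1(B)$. (4) If $B$ is such that $A\prec B$ and $U_0(M_n(B))$ is definable for all $n$, then $K_1(A)\prec K_1(B)$.
   Context: Continuous logic for C*-algebras: a unital C*-algebra $A$ is a metric structure whose sorts are the balls $\{a:\|a\|\le n\}$, $n\in\mathbb N$, with metric $\|x-y\|$, and functions the restrictions of $+,\cdot,{}^*$, scalar multiplications, the constants $0,1$, and inclusions between balls; formulas are built from distances between *-polynomial terms by applying continuous functions $\mathbb R^n\to\mathbb R$ and $\sup_x,\inf_x$ over the sorts; $\varphi^A(\bar a)$ is the value. $A\prec B$ ($A$ is an elementary submodel of $B$) if $A\subseteq B$ and $\varphi^A(\bar a)=\varphi^B(\bar a)$ for all formulas $\varphi$ and $\bar a$ in $A$. A definable predicate relative to a theory $T$ is a limit of formulas uniform over all models of $T$. A uniform assignment $A\mapsto X(A)$ of closed subsets of a finite product of sorts is a definable set if for every formula $\psi(\bar x,\bar y)$, $\sup_{\bar x\in X(A)}\psi(\bar x,\bar y)$ and $\inf_{\bar x\in X(A)}\psi(\bar x,\bar y)$ are definable predicates; for a subset of a single algebra $A$ definability is understood relative to the theory of $A$ (class of algebras elementarily equivalent to $A$). $A^{\mathrm{eq}}$ is the structure obtained from $A$ by iteratively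 adding as new (imaginary) sorts: countable products of sorts with their projections; definable sets; and quotients of sorts (or finite products of sorts) by definable pseudometrics (with the quotient maps). For example, $M_n(A)$ is in $A^{\mathrm{eq}}$. A structure ''belongs to $A^{\mathrm{eq}}$'' if its universe is such a sort and its operations and relations are definable. $U(C)$ is the unitary group of $C$ and $U_0(C)$ its connected component of the identity. $A$ has stable rank $\le n$ if the $n$-tuples generating an improper right ideal are dense in $A^n$; finite stable rank means this holds for some $n$. Real rank zero: invertible self-adjoint elements are dense among self-adjoint elements. For groups (discrete structures), $\prec$ is the usual first-order elementary substructure relation, via the map induced by the inclusion $A\subseteq B$. *)

(* Defs.v *)
From HB Require Import structures.
From mathcomp Require Import all_boot all_order all_algebra.
From mathcomp Require Import generic_quotient complex.
From mathcomp Require Import lra.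
From mathcomp Require Import all_classical all_reals all_analysis.

Set Implicit Arguments.
Unset Strict Implicit.
Unset Printing Implicit Defensive.

Import Order.TTheory GRing.Theory Num.Theory.
Import numFieldNormedType.Exports.

Local Open Scope classical_set_scope.
Local Open Scope ring_scope.
Local Open Scope complex_scope.
Local Open Scope quotient_scope.

(* A record rather than a join of GRing.Algebra and CompleteNormedModule: that
   join cannot be declared below Num.NumDomain. The zero algebra is allowed. *)
Record cstarAlg (R : realType) := CstarAlg {
  cs_base : completeNormedModType R[i] ;
  cs_mul : cs_base -> cs_base -> cs_base ;
  cs_one : cs_base ;
  cs_star : cs_base -> cs_base ;
  cs_mulA : associative cs_mul ;
  cs_mul1l : left_id cs_one cs_mul ;
  cs_mul1r : right_id cs_one cs_mul ;
  cs_mulDl : left_distributive cs_mul +%R ;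
  cs_mulDr : right_distributive cs_mul +%R ;
  cs_scalel : forall (k : R[i]) a b, k *: cs_mul a b = cs_mul (k *: a) b ;
  cs_scaler : forall (k : R[i]) a b, k *: cs_mul a b = cs_mul a (k *: b) ;
  cs_starK : involutive cs_star ;
  cs_starD : {morph cs_star : a b / a + b} ;
  cs_starZ : forall (k : R[i]) a, cs_star (k *: a) = k^* *: cs_star a ;
  cs_starM : forall a b, cs_star (cs_mul a b) = cs_mul (cs_star b) (cs_star a) ;
  cs_normM : forall a b, `|cs_mul a b| <= `|a| * `|b| ;
  cs_normC : forall a, `|cs_mul (cs_star a) a| = `|a| ^+ 2
}.

Definition cs_sort (R : realType) (A : cstarAlg R) : Type := cs_base A.
Coercion cs_sort : cstarAlg >-> Sortclass.

Section CstarInstances.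
Context (R : realType) (A : cstarAlg R).
HB.instance Definition _ := CompleteNormedModule.copy (cs_sort A) (cs_base A).
HB.instance Definition _ := GRing.Zmodule_isPzRing.Build (cs_sort A)
  (@cs_mulA R A) (@cs_mul1l R A) (@cs_mul1r R A) (@cs_mulDl R A) (@cs_mulDr R A).
End CstarInstances.

Definition star (R : realType) (A : cstarAlg R) (a : A) : A := cs_star a.

Section CstarTheory.
Context (R : realType) (A : cstarAlg R).
Implicit Types a b : A.

Lemma starK a : star (star a) = a. Proof. exact: cs_starK. Qed.
Lemma starD a b : star (a + b) = star a + star b. Proof. exact: cs_starD. Qed.
Lemma starM a b : star (a * b) = star b * star a. Proof. exact: cs_starM. Qed.
Lemma cnormM a b : `|a * b| <= `|a| * `|b|. Proof. exact: cs_normM. Qed.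
Lemma cnormC a : `|star a * a| = `|a| ^+ 2. Proof. exact: cs_normC. Qed.

Lemma star0 : star (0 : A) = 0.
Proof. by apply: (addrI (star 0)); rewrite -starD !addr0. Qed.

Lemma star1 : star (1 : A) = 1.
Proof. by have := starM (star 1) 1; rewrite mulr1 starK mulr1. Qed.

Lemma star_sum I (r : seq I) (P : pred I) (F : I -> A) :
  star (\sum_(i <- r | P i) F i) = \sum_(i <- r | P i) star (F i).
Proof. exact: (big_morph _ starD star0). Qed.

Lemma cnorm_star a : `|star a| = `|a|.
Proof.
have le b : `|b| <= `|star b|.
  have [->|b0] := eqVneq b 0; first by rewrite normr0.
  by rewrite -(ler_pM2r (x := `|b|)) ?normr_gt0// -expr2 -cnormC cnormM.
by apply/eqP; rewrite eq_le le andbT -{2}[a]starK le.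
Qed.

Lemma cnorm1 : `|1 : A| <= 1.
Proof.
have := cnormC (1 : A); rewrite star1 mul1r expr2 => e.
have [->|n0] := eqVneq `|1 : A| 0; first exact: ler01.
by rewrite -(mulfI n0 (etrans (mulr1 _) e)) lexx.
Qed.

End CstarTheory.

Section UnitaryMatrices.
Context (R : realType) (A : cstarAlg R).

Definition adjmx m n (u : 'M[A]_(m, n)) : 'M[A]_(n, m) :=
  (map_mx (@star R A) u)^T.

Lemma adjmxE m n (u : 'M[A]_(m, n)) i j : adjmx u i j = star (u j i).
Proof. by rewrite !mxE. Qed.

Lemma adjmxK m n (u : 'M[A]_(m, n)) : adjmx (adjmx u) = u.
Proof. by apply/matrixP => i j; rewrite !adjmxE starK. Qed.

Lemma adjmxM m n p (u : 'M[A]_(m, n)) (v : 'M[A]_(n, p)) :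
  adjmx (u *m v) = adjmx v *m adjmx u.
Proof.
apply/matrixP => i j; rewrite adjmxE !mxE star_sum.
by apply: eq_bigr => k _; rewrite !adjmxE starM.
Qed.

Lemma adjmx1 n : adjmx (1%:M : 'M[A]_n) = 1%:M.
Proof.
apply/matrixP => i j; rewrite adjmxE !mxE eq_sym.
by case: (i == j); rewrite ?star1 ?star0.
Qed.

Definition is_unitarymx n (u : 'M[A]_n) : bool :=
  (adjmx u *m u == 1%:M) && (u *m adjmx u == 1%:M).

Lemma is_unitarymx1 n : is_unitarymx (1%:M : 'M[A]_n).
Proof. by rewrite /is_unitarymx adjmx1 mul1mx eqxx. Qed.

Lemma is_unitarymxV n (u : 'M[A]_n) : is_unitarymx u -> is_unitarymx (adjmx u).
Proof. by rewrite /is_unitarymx adjmxK andbC. Qed.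

Lemma is_unitarymxM n (u v : 'M[A]_n) :
  is_unitarymx u -> is_unitarymx v -> is_unitarymx (u *m v).
Proof.
move=> /andP[/eqP u1 /eqP u2] /andP[/eqP v1 /eqP v2]; apply/andP.
rewrite adjmxM !mulmxA -(mulmxA _ (adjmx u)) u1 mulmx1 v1.
by rewrite -(mulmxA u) v2 mulmx1 u2.
Qed.

(* The entrywise topology of 'M[A]_n is that of the C*-norm of M_n(A). *)
Definition U0 n : set 'M[A]_n :=
  connected_component [set u | is_unitarymx u] 1%:M.

Lemma U0_unitary n (u : 'M[A]_n) : U0 u -> is_unitarymx u.
Proof. exact: connected_component_sub. Qed.

Lemma unitary_component n m (f : 'M[A]_n -> 'M[A]_m) (x y : 'M[A]_n) :
    continuous f -> (forall u, is_unitarymx u -> is_unitarymx (f u)) ->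
  connected_component [set u | is_unitarymx u] x y ->
  connected_component [set u | is_unitarymx u] (f x) (f y).
Proof.
move=> cf fU [C [Cx CU Cc] Cy].
exists (f @` C); last by exists y.
split; first by exists x.
- by move=> _ [u Cu <-]; apply: fU; exact: CU.
- by apply: connected_continuous_connected => //; exact: continuous_subspaceT.
Qed.

Lemma mx_continuous n m (f : 'M[A]_n -> 'M[A]_m) :
  (forall i j, continuous (fun u => f u i j)) -> continuous f.
Proof.
move=> cf u P [B nB sub].
have FF : Filter (nbhs u) := nbhs_filter u.
suff : \forall x \near u, forall i j, B i j (f x i j).
  by apply: filterS => x Hx; exact: sub.
apply: (@filter_forall _ _ (fun i x => forall j, B i j (f x i j)) _ FF) => i.
apply: (@filter_forall _ _ (fun j x => B i j (f x i j)) _ FF) => j.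
exact: (cf i j u _ (nB i j)).
Qed.

Lemma cmul_continuousl (a : A) : continuous (fun x : A => a * x).
Proof.
move=> x; apply/cvgrPdist_lt => e e0.
have a0 : 0 < `|a| + 1 by rewrite ltr_pwDr ?ltr01.
near=> y; rewrite -mulrBr (le_lt_trans (cnormM _ _))//.
rewrite (@le_lt_trans _ _ ((`|a| + 1) * `|x - y|))//.
  by rewrite ler_wpM2r// lerDl ler01.
rewrite mulrC -ltr_pdivlMr//; near: y.
by apply: cvgr_dist_lt; [exact: cvg_id|exact: divr_gt0].
Unshelve. all: by end_near. Qed.

Lemma cmul_continuousr (a : A) : continuous (fun x : A => x * a).
Proof.
move=> x; apply/cvgrPdist_lt => e e0.
have a0 : 0 < `|a| + 1 by rewrite ltr_pwDr ?ltr01.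
near=> y; rewrite -mulrBl (le_lt_trans (cnormM _ _))//.
rewrite (@le_lt_trans _ _ (`|x - y| * (`|a| + 1)))//.
  by rewrite ler_wpM2l// lerDl ler01.
rewrite -ltr_pdivlMr//; near: y.
by apply: cvgr_dist_lt; [exact: cvg_id|exact: divr_gt0].
Unshelve. all: by end_near. Qed.

Lemma mxcoord_continuous m n i j : continuous (fun u : 'M[A]_(m, n) => u i j).
Proof.
move=> /= M s /= /(nbhs_ballP (M i j)) [e e0 es].
by apply/nbhs_ballP; exists e => //= N [_ MN]; exact/es/MN.
Qed.

Lemma sum_continuous (T : topologicalType) (I : Type) (r : seq I)
    (F : I -> T -> A) :
  (forall k, continuous (F k)) -> continuous (fun x => \sum_(k <- r) F k x).
Proof.
move=> cF; elim: r => [|k r IH] x.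
  rewrite (_ : (fun x => _) = fun=> 0 : A); first exact: cvg_cst.
  by apply/funext => y; rewrite big_nil.
rewrite (_ : (fun x => _) = fun x => F k x + \sum_(k <- r) F k x).
  by apply: cvgD; [exact: cF|exact: IH].
by apply/funext => y; rewrite big_cons.
Qed.

Lemma mulmx_continuousl n (w : 'M[A]_n) :
  continuous (fun v : 'M[A]_n => w *m v).
Proof.
apply: mx_continuous => i j.
rewrite (_ : (fun v : 'M[A]_n => _) =
             (fun v : 'M[A]_n => \sum_k w i k * v k j)); last first.
  by apply/funext => v; rewrite mxE.
apply: sum_continuous => k v.
apply: (@continuous_comp _ _ _ (fun v : 'M[A]_n => v k j)).
  exact: mxcoord_continuous.
exact: cmul_continuousl.
Qed.

Lemma mulmx_continuousr n (w : 'M[A]_n) :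
  continuous (fun v : 'M[A]_n => v *m w).
Proof.
apply: mx_continuous => i j.
rewrite (_ : (fun v : 'M[A]_n => _) =
             (fun v : 'M[A]_n => \sum_k v i k * w k j)); last first.
  by apply/funext => v; rewrite mxE.
apply: sum_continuous => k v.
apply: (@continuous_comp _ _ _ (fun v : 'M[A]_n => v i k) (fun a => a * w k j)).
  exact: mxcoord_continuous.
exact: cmul_continuousr.
Qed.

Lemma U0_1 n : U0 (1%:M : 'M[A]_n).
Proof. by apply: connected_component_refl; exact: is_unitarymx1. Qed.

Lemma U0M n (u v : 'M[A]_n) : U0 u -> U0 v -> U0 (u *m v).
Proof.
move=> Uu Uv; apply: (connected_component_trans Uu).
rewrite -{1}[u]mulmx1.
apply: (@unitary_component _ _ (mulmx u)) => //.
  exact: mulmx_continuousl.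
by move=> w; apply: is_unitarymxM; exact: U0_unitary.
Qed.

Lemma U0V n (u : 'M[A]_n) : U0 u -> U0 (adjmx u).
Proof.
move=> Uu; have uU := U0_unitary Uu.
apply: connected_component_sym.
have := @unitary_component _ _ (mulmx (adjmx u)) 1%:M u.
rewrite mulmx1; have /andP[/eqP -> _] := uU; apply => //.
  exact: mulmx_continuousl.
by move=> w; apply: is_unitarymxM; exact: is_unitarymxV.
Qed.

Lemma U0J n (w u : 'M[A]_n) : is_unitarymx w -> U0 u -> U0 (w *m u *m adjmx w).
Proof.
move=> wU Uu.
have := @unitary_component _ _ (fun v => w *m v *m adjmx w) 1%:M u.
rewrite mulmx1; have /andP[_ /eqP ->] := wU; apply => //.
  move=> v; apply: (@continuous_comp _ _ _ (mulmx w) (fun v => v *m adjmx w)).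
    exact: mulmx_continuousl.
  exact: mulmx_continuousr.
by move=> v vU; rewrite !is_unitarymxM// is_unitarymxV.
Qed.

(* diag(u, 1) in M_k(A), for u in M_n(A) with n <= k. *)
Definition pad k n (u : 'M[A]_n) : 'M[A]_k :=
  \matrix_(i, j) match insub (i : nat), insub (j : nat) with
    | Some i', Some j' => u i' j'
    | _, _ => (i == j)%:R
    end.

Lemma padE d n (u : 'M[A]_n) : pad (n + d) u = block_mx u 0 0 1%:M.
Proof.
apply/matrixP => i j; rewrite mxE.
case: (split_ordP i) => i' ->; case: (split_ordP j) => j' -> /=.
- rewrite block_mxEul.
  case: insubP => [i2 _ ei|]; last by rewrite ltn_ord.
  case: insubP => [j2 _ ej|]; last by rewrite ltn_ord.
  by congr (u _ _); apply: val_inj.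
- rewrite block_mxEur mxE; case: insubP => [i2 _ ei|]; last by rewrite ltn_ord.
  case: insubP => [j2|_]; first by rewrite ltnNge leq_addr.
  by rewrite eq_lrshift.
- rewrite block_mxEdl mxE; case: insubP => [j2|_]; first by rewrite ltnNge leq_addr.
  by rewrite eq_rlshift.
- rewrite block_mxEdr mxE; case: insubP => [j2|_]; first by rewrite ltnNge leq_addr.
  by rewrite eq_rshift.
Qed.

Lemma padM k n (u v : 'M[A]_n) : (n <= k)%N ->
  pad k (u *m v) = pad k u *m pad k v.
Proof.
move=> /subnKC <-; rewrite !padE mulmx_block.
by rewrite !mulmx0 !mul0mx !addr0 !add0r mulmx1.
Qed.

Lemma pad1 k n : pad k (1%:M : 'M[A]_n) = 1%:M.
Proof.
apply/matrixP => i j; rewrite !mxE.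
case: insubP => [i' _ ei|] //; case: insubP => [j' _ ej|] //.
by rewrite mxE -(inj_eq val_inj) ei ej (inj_eq val_inj).
Qed.

Lemma adjmx_pad k n (u : 'M[A]_n) : adjmx (pad k u) = pad k (adjmx u).
Proof.
apply/matrixP => i j; rewrite !mxE.
have starb (b : bool) : star (b%:R : A) = b%:R.
  by case: b; rewrite ?star1 ?star0.
case: insubP => [j' _ ej|_]; case: insubP => [i' _ ei|_];
  by rewrite ?mxE// starb eq_sym.
Qed.

Lemma pad_pad k l n (u : 'M[A]_n) : (n <= k)%N -> (k <= l)%N ->
  pad l (pad k u) = pad l u.
Proof.
move=> nk kl; apply/matrixP => i j; rewrite !mxE.
case: insubP => [i' _ ei|ik]; last first.
  by case: insubP => // i2 /leq_trans/(_ nk) i2k _; rewrite i2k in ik.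
case: insubP => [j' _ ej|jk]; last first.
  case: insubP => // i2 _ _; case: insubP => // j2 /leq_trans/(_ nk) j2k _.
  by rewrite j2k in jk.
have eij : (i' == j') = (i == j).
  by rewrite -(inj_eq val_inj) ei ej (inj_eq val_inj).
by rewrite mxE ei ej eij.
Qed.

Lemma is_unitarymx_pad k n (u : 'M[A]_n) : (n <= k)%N ->
  is_unitarymx u -> is_unitarymx (pad k u).
Proof.
move=> nk /andP[/eqP u1 /eqP u2]; apply/andP.
by rewrite adjmx_pad -!padM// u1 u2 pad1.
Qed.

Lemma pad_continuous k n : continuous (@pad k n).
Proof.
apply: mx_continuous => i j.
rewrite (_ : (fun v : 'M[A]_n => _) = fun v : 'M[A]_n =>
    match insub (i : nat), insub (j : nat) with
    | Some i', Some j' => v i' j' | _, _ => (i == j)%:R end); last first.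
  by apply/funext => v; rewrite mxE.
case: insubP => [i' _ _|_]; last exact: (@cst_continuous _ A).
case: insubP => [j' _ _|_]; last exact: (@cst_continuous _ A).
exact: mxcoord_continuous.
Qed.

Lemma U0_pad k n (u : 'M[A]_n) : (n <= k)%N -> U0 u -> U0 (pad k u).
Proof.
move=> nk Uu; rewrite /U0 -(pad1 k n).
apply: unitary_component => //; first exact: pad_continuous.
by move=> w; exact: is_unitarymx_pad.
Qed.

End UnitaryMatrices.

Section K1.
Context (R : realType) (A : cstarAlg R).

Definition unitary n := {u : 'M[A]_n | is_unitarymx u}.

(* A pair (n, u) stands for diag(u, 1, 1, ...); the size n = 0 only adds
   another name for the trivial class. *)
Definition k1rep := {n : nat & unitary n}.

Definition padr k (x : k1rep) : 'M[A]_k := pad k (val (tagged x)).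

(* Equality in the direct limit of the groups U(M_k(A)) / U_0(M_k(A)). *)
Definition k1eq (x y : k1rep) : bool :=
  `[< exists k, [/\ (tag x <= k)%N, (tag y <= k)%N &
        U0 (padr k x *m adjmx (padr k y))] >].

Lemma k1eqP x y : reflect
  (exists k, forall l, (k <= l)%N -> [/\ (tag x <= l)%N, (tag y <= l)%N &
     U0 (padr l x *m adjmx (padr l y))]) (k1eq x y).
Proof.
apply: (iffP (asboolP _)) => [[k [xk yk Uk]]|[k Hk]]; last by exists k; exact: Hk.
exists k => l kl; split; [exact: leq_trans kl|exact: leq_trans kl|].
have := U0_pad kl Uk.
by rewrite padM// -adjmx_pad !pad_pad.
Qed.

Lemma unitary_padr k x : (tag x <= k)%N -> is_unitarymx (padr k x).
Proof. by move=> xk; apply: is_unitarymx_pad => //; exact: (valP (tagged x)). Qed.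

Lemma k1eq_refl : reflexive k1eq.
Proof.
move=> x; apply/k1eqP; exists (tag x) => l xl; split => //.
by have /andP[_ /eqP ->] := unitary_padr xl; exact: U0_1.
Qed.

Lemma k1eq_symm : symmetric k1eq.
Proof.
have s x y : k1eq x y -> k1eq y x.
  move=> /k1eqP[k Hk]; apply/k1eqP; exists k => l /Hk[xl yl /U0V].
  by rewrite adjmxM adjmxK.
by move=> x y; apply/idP/idP; exact: s.
Qed.

Lemma k1eq_trans : transitive k1eq.
Proof.
move=> y x z /k1eqP[k Hk] /k1eqP[l Hl]; apply/k1eqP; exists (maxn k l) => m.
rewrite geq_max => /andP[/Hk[xm ym U1] /Hl[_ zm U2]]; split => //.
have := U0M U1 U2; rewrite mulmxA -(mulmxA (padr m x)).
by have /andP[/eqP -> _] := unitary_padr ym; rewrite mulmx1.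
Qed.

Canonical k1equiv := EquivRel k1eq k1eq_refl k1eq_symm k1eq_trans.

Definition K1 : Type := {eq_quot k1equiv}.
HB.instance Definition _ := Choice.on K1.

Definition k1rep_of (x : K1) : k1rep := repr (x : {eq_quot k1equiv}).

Definition k1pi (x : k1rep) : K1 := \pi_({eq_quot k1equiv}) x.

Definition k1class n (u : unitary n) : K1 := k1pi (Tagged unitary u).

Lemma k1pi_repr x : k1pi (k1rep_of x) = x.
Proof. by rewrite /k1pi /k1rep_of reprK. Qed.

Lemma k1piP x y : reflect (k1pi x = k1pi y) (k1eq x y).
Proof. exact: (@eqmodP _ k1equiv x y). Qed.

Lemma k1rep_pi x : k1eq (k1rep_of (k1pi x)) x.
Proof. by apply/k1piP; rewrite k1pi_repr. Qed.

Definition mulr_rep (x y : k1rep) : k1rep :=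
  let k := (tag x + tag y)%N in
  Tagged unitary (exist _ (padr k x *m padr k y)
    (is_unitarymxM (unitary_padr (leq_addr _ _)) (unitary_padr (leq_addl _ _)))).

Definition invr_rep (x : k1rep) : k1rep :=
  Tagged unitary (exist _ (adjmx (val (tagged x))) (is_unitarymxV (valP (tagged x)))).

Definition one_rep : k1rep :=
  Tagged unitary (exist _ (1%:M : 'M[A]_1) (is_unitarymx1 A 1)).

Lemma padr_mul l x y : (tag x + tag y <= l)%N ->
  padr l (mulr_rep x y) = padr l x *m padr l y.
Proof. by move=> kl; rewrite /padr /= padM// !pad_pad// ?leq_addr ?leq_addl. Qed.

Lemma padr_inv l x : padr l (invr_rep x) = adjmx (padr l x).
Proof. by rewrite /padr /= adjmx_pad. Qed.

Lemma padr_one l : padr l one_rep = 1%:M.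
Proof. by rewrite /padr /= pad1. Qed.

Lemma k1eq_pad k x y : (tag x <= k)%N -> (tag y <= k)%N ->
  padr k x = padr k y -> k1eq x y.
Proof.
move=> xk yk e; apply/asboolP; exists k; split=> //; rewrite e.
by have /andP[_ /eqP ->] := unitary_padr yk; exact: U0_1.
Qed.

Definition k1mul (x y : K1) : K1 := k1pi (mulr_rep (k1rep_of x) (k1rep_of y)).
Definition k1inv (x : K1) : K1 := k1pi (invr_rep (k1rep_of x)).
Definition k1one : K1 := k1pi one_rep.

Lemma k1mul_pi x y : k1mul (k1pi x) (k1pi y) = k1pi (mulr_rep x y).
Proof.
apply/k1piP; have := k1rep_pi x; have := k1rep_pi y.
move: (k1rep_of (k1pi x)) (k1rep_of (k1pi y)) => x' y' /k1eqP[k Hk] /k1eqP[l Hl].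
pose m := (k + l + (tag x + tag y) + (tag x' + tag y'))%N.
have km : (k <= m)%N by rewrite /m -!addnA leq_addr.
have lm : (l <= m)%N by rewrite /m -!addnA addnCA leq_addr.
have xym : (tag x + tag y <= m)%N by rewrite /m addnAC leq_addl.
have xym' : (tag x' + tag y' <= m)%N by rewrite /m leq_addl.
have [y'm ym Uy] := Hk m km; have [x'm xm Ux] := Hl m lm.
apply/asboolP; exists m; split; rewrite ?padr_mul//.
have := U0M (U0J (unitary_padr x'm) Uy) Ux.
rewrite adjmxM !mulmxA -(mulmxA _ (adjmx (padr m x')) (padr m x')).
by have /andP[/eqP -> _] := unitary_padr x'm; rewrite mulmx1.
Qed.

Lemma k1inv_pi x : k1inv (k1pi x) = k1pi (invr_rep x).
Proof.
apply/k1piP; have := k1rep_pi x; move: (k1rep_of _) => x' /k1eqP[k Hk].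
apply/k1eqP; exists k => l /Hk [x'l xl Ux]; split => //.
rewrite !padr_inv adjmxK.
have := U0J (is_unitarymxV (unitary_padr xl)) (U0V Ux).
rewrite adjmxM !adjmxK !mulmxA.
have /andP[/eqP -> _] := unitary_padr xl.
by rewrite mul1mx.
Qed.

Lemma k1mulA : associative k1mul.
Proof.
move=> x y z; rewrite -(k1pi_repr x) -(k1pi_repr y) -(k1pi_repr z).
move: (k1rep_of x) (k1rep_of y) (k1rep_of z) => {}x {}y {}z.
rewrite !k1mul_pi; apply/k1piP.
apply: (@k1eq_pad (tag x + (tag y + tag z))); rewrite /= ?addnA//.
by rewrite !padr_mul ?mulmxA//= ?addnA// -?addnA ?leq_addl// addnA leq_addr.
Qed.

Lemma k1mul1 : left_id k1one k1mul.
Proof.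
move=> x; rewrite -(k1pi_repr x) k1mul_pi; apply/k1piP.
apply: (@k1eq_pad (1 + tag (k1rep_of x))); rewrite /= ?leq_addl//.
by rewrite padr_mul// padr_one mul1mx.
Qed.

Lemma k1mulr1 : right_id k1one k1mul.
Proof.
move=> x; rewrite -(k1pi_repr x) k1mul_pi; apply/k1piP.
apply: (@k1eq_pad (tag (k1rep_of x) + 1)); rewrite /= ?leq_addr//.
by rewrite padr_mul// padr_one mulmx1.
Qed.

Lemma k1mulV : left_inverse k1one k1inv k1mul.
Proof.
move=> x; rewrite -(k1pi_repr x) k1inv_pi k1mul_pi; apply/k1piP.
set y := k1rep_of x.
apply: (@k1eq_pad (1 + (tag y + tag y))); rewrite ?leq_addl ?leq_addr//.
rewrite padr_mul ?leq_addl// padr_one padr_inv.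
have yk : (tag y <= 1 + (tag y + tag y))%N by rewrite addnA leq_addl.
by have /andP[/eqP -> _] := unitary_padr yk.
Qed.

Lemma k1mulrV : right_inverse k1one k1inv k1mul.
Proof.
move=> x; rewrite -(k1pi_repr x) k1inv_pi k1mul_pi; apply/k1piP.
set y := k1rep_of x.
apply: (@k1eq_pad (1 + (tag y + tag y))); rewrite ?leq_addl ?leq_addr//.
rewrite padr_mul ?leq_addl// padr_one padr_inv.
have yk : (tag y <= 1 + (tag y + tag y))%N by rewrite addnA leq_addl.
by have /andP[_ /eqP ->] := unitary_padr yk.
Qed.

HB.instance Definition _ := isGroup.Build K1
  k1mulA k1mul1 k1mulr1 k1mulV k1mulrV.

End K1.

(* Many-sorted continuous logic; the only predicate symbols are the metrics. *)
Record language := Language {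
  srt : Type ;
  fsym : Type ;
  arity : fsym -> finType ;
  fdom : forall f, arity f -> srt ;
  fcod : fsym -> srt
}.

Record structure (R : realType) (L : language) := Structure {
  car :> srt L -> metricType R ;
  fint : forall f, (forall k : arity f, car (fdom k)) -> car (fcod f)
}.

Inductive term (L : language) (I : finType) (g : I -> srt L) : srt L -> Type :=
| Var k : term g (g k)
| App (f : fsym L) : (forall k : arity f, term g (fdom k)) -> term g (fcod f).

Definition ext_ctx (S : Type) (I : finType) (g : I -> S) (s : S) : option I -> S :=
  fun o => if o is Some k then g k else s.

Definition sum_ctx (S : Type) (I J : finType) (g : I -> S) (h : J -> S) : I + J -> S :=
  fun k => match k with inl i => g i | inr j => h j end.

(* g : I -> srt L gives the sorts of the free variables. *)
Inductive formula (R : realType) (L : language) :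
    forall I : finType, (I -> srt L) -> Type :=
| Dist (I : finType) (g : I -> srt L) s (t u : term g s) : formula R g
| Conn (I : finType) (g : I -> srt L) n (c : 'rV[R]_n -> R) (cc : continuous c)
    (p : 'I_n -> formula R g) : formula R g
| SupF (I : finType) (g : I -> srt L) s (p : formula R (ext_ctx g s)) : formula R g
| InfF (I : finType) (g : I -> srt L) s (p : formula R (ext_ctx g s)) : formula R g.

Section Semantics.
Context (R : realType) (L : language).
Implicit Types M N : structure R L.

Definition env M (I : finType) (g : I -> srt L) := forall k, M (g k).

Definition ext_env M (I : finType) (g : I -> srt L) s (v : env M g) (x : M s) :
    env M (ext_ctx g s) :=
  fun o => match o return M (ext_ctx g s o) with
           | Some k => v k | None => x end.

Definition sum_env M (I J : finType) (g : I -> srt L) (h : J -> srt L)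
    (v : env M g) (w : env M h) : env M (sum_ctx g h) :=
  fun k => match k return M (sum_ctx g h k) with
           | inl i => v i | inr j => w j end.

Fixpoint tval M (I : finType) (g : I -> srt L) (v : env M g) s (t : term g s) : M s :=
  match t with
  | Var k => v k
  | App f ts => fint (fun k => tval v (ts k))
  end.

Fixpoint fval M (I : finType) (g : I -> srt L) (p : formula R g) : env M g -> R :=
  match p with
  | Dist _ _ _ t u => fun v => mdist (tval v t) (tval v u)
  | Conn _ _ _ c _ p => fun v => c (\row_k fval (p k) v)
  | SupF _ _ _ p => fun v => sup (range (fun x => fval p (ext_env v x)))
  | InfF _ _ _ p => fun v => inf (range (fun x => fval p (ext_env v x)))
  end.

Definition elementarily_equivalent M N :=
  forall (p : formula R (@of_void (srt L))) (v : env M _) (w : env N _),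
    fval p v = fval p w.

Definition elementary_map M N (h : forall s, M s -> N s) :=
  forall (I : finType) (g : I -> srt L) (p : formula R g) (v : env M g),
    fval p v = fval p (fun k => h _ (v k)).

End Semantics.

(* A class of structures is given as an indexed family. *)
Section Definability.
Context (R : realType) (L : language) (Idx : Type) (M : Idx -> structure R L).

Definition definable_predicate (I : finType) (g : I -> srt L) (P : forall i, env (M i) g -> R) :=
  forall e : R, 0 < e -> exists p : formula R g,
    forall i (v : env (M i) g), `|fval p v - P i v| <= e.

(* Compatibility with elementary embeddings follows, the distance to X being a
   definable predicate. As sup set0 = inf set0 = 0, X is empty in every member
   of an elementary class or in none. *)
Definition definable_set (I : finType) (g : I -> srt L) (X : forall i, set (env (M i) g)) :=
  (forall i, closed (X i : set (prod_topology (fun k => M i (g k))))) /\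
  forall (J : finType) (h : J -> srt L) (p : formula R (sum_ctx g h)),
    definable_predicate (fun i (w : env (M i) h) =>
      sup [set fval p (sum_env v w) | v in X i]) /\
    definable_predicate (fun i (w : env (M i) h) =>
      inf [set fval p (sum_env v w) | v in X i]).

Definition definable_set_at i0 (I : finType) (g : I -> srt L) (X0 : set (env (M i0) g)) :=
  exists X, definable_set X /\ X i0 = X0.

Definition definable_function_at i0 (I : finType) (g : I -> srt L) s
    (f : env (M i0) g -> M i0 s) :=
  exists P : forall i, env (M i) (ext_ctx g s) -> R,
    definable_predicate P /\
    forall v y, P i0 (ext_env v y) = mdist (f v) y.

End Definability.

Section MetricConstructions.
Context (R : realType).

Section Product.
Variable S : nat -> metricType R.

Definition prod_sort := forall n, S n.
Definition prod_dist (x y : prod_sort) : R :=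
  sup (range (fun n => Num.min (2^-1 ^+ n) (mdist (x n) (y n)))).

Let term_le (x y : prod_sort) n :
  Num.min (2^-1 ^+ n) (mdist (x n) (y n)) <= prod_dist x y.
Proof.
apply: ub_le_sup; last by exists n.
exists 1 => _ [k _ <-]; rewrite ge_min exprn_ile1//.
by rewrite invf_le1// ler1n.
Qed.

Let prod_dist_le (x y : prod_sort) (c : R) :
  (forall n, Num.min (2^-1 ^+ n) (mdist (x n) (y n)) <= c) -> prod_dist x y <= c.
Proof. by move=> H; apply: ge_sup; [exists (Num.min (2^-1 ^+ 0) (mdist (x 0) (y 0))), 0%N|move=> _ [n _ <-]]. Qed.

Let prod_distxx x : prod_dist x x = 0.
Proof.
apply/eqP; rewrite eq_le; apply/andP; split.
  by apply: prod_dist_le => n; rewrite mdistxx ge_min lexx orbT.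
by apply: le_trans (term_le x x 0); rewrite le_min expr0 ler01 mdist_ge0.
Qed.

Let prod_dist_pos x y : prod_dist x y = 0 -> x = y.
Proof.
move=> d0; apply: functional_extensionality_dep => n; apply: (@mdist_positivity R).
apply/eqP; rewrite eq_le mdist_ge0 andbT.
have := term_le x y n; rewrite d0 ge_min => /orP[|//].
by rewrite leNgt exprn_gt0// invr_gt0 ltr0n.
Qed.

Let prod_dist_sym x y : prod_dist x y = prod_dist y x.
Proof. by rewrite /prod_dist; congr sup; apply: eq_imagel => n _; rewrite metric_sym. Qed.

Let prod_dist_tri y x z : prod_dist x z <= prod_dist x y + prod_dist y z.
Proof.
apply: prod_dist_le => n.
apply: le_trans (lerD (term_le x y n) (term_le y z n)).
have e0 : 0 <= 2^-1 ^+ n :> R by rewrite exprn_ge0// invr_ge0 ler0n.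
have := metric_triangle (x n) (y n) (z n).
have := mdist_ge0 (x n) (y n); have := mdist_ge0 (y n) (z n).
by rewrite /Num.min; do 3 case: ifPn; rewrite -?leNgt; lra.
Qed.

HB.instance Definition _ := gen_eqMixin prod_sort.
HB.instance Definition _ := gen_choiceMixin prod_sort.
HB.instance Definition _ := isMetric.Build R prod_sort
  prod_distxx prod_dist_pos prod_dist_sym prod_dist_tri.
End Product.

Section Subspace.
Context (I : finType) (S : I -> metricType R).

Definition max_dist (v w : forall k, S k) : R :=
  \big[Num.max/0]_(k : I) mdist (v k) (w k).

Variable X : set (forall k, S k).
Definition sub_sort := {v | X v}.
Definition sub_dist (v w : sub_sort) : R := max_dist (sval v) (sval w).

Let sub_distxx v : sub_dist v v = 0.
Proof.
apply/eqP; rewrite eq_le; apply/andP; split.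
  by apply: bigmax_le => // k _; rewrite mdistxx.
exact: bigmax_ge_id.
Qed.

Let sub_dist_pos v w : sub_dist v w = 0 -> v = w.
Proof.
case: v w => [v Xv] [w Xw] d0; apply: eq_exist; apply: functional_extensionality_dep => k.
apply: (@mdist_positivity R).
apply/eqP; rewrite eq_le mdist_ge0 andbT -d0.
exact: (@le_bigmax _ _ _ 0 (fun k => mdist (v k) (w k))).
Qed.

Let sub_dist_sym v w : sub_dist v w = sub_dist w v.
Proof. by apply: eq_bigr => k _; rewrite metric_sym. Qed.

Let sub_dist_tri w v u : sub_dist v u <= sub_dist v w + sub_dist w u.
Proof.
apply: bigmax_le => [|k _]; first by rewrite addr_ge0// bigmax_ge_id.
apply: le_trans (metric_triangle _ (sval w k) _) _.
apply: lerD.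
  exact: (@le_bigmax _ _ _ 0 (fun k => mdist (sval v k) (sval w k))).
exact: (@le_bigmax _ _ _ 0 (fun k => mdist (sval w k) (sval u k))).
Qed.

HB.instance Definition _ := gen_eqMixin sub_sort.
HB.instance Definition _ := gen_choiceMixin sub_sort.
HB.instance Definition _ := isMetric.Build R sub_sort
  sub_distxx sub_dist_pos sub_dist_sym sub_dist_tri.
End Subspace.

End MetricConstructions.

Section Imaginaries.
Context (R : realType) (L0 : language) (Idx : Type) (M0 : Idx -> structure R L0).

(* Raw imaginary sorts. The index is the interpretation in each M0 i; the tree
   records how the sort was built, so that distinct constructions are distinct
   sorts. Admissibility of a construction is imposed below by eq_sorts. *)
Inductive isort : (Idx -> metricType R) -> Type :=
| ISbase (s : srt L0) : isort (fun i => M0 i s)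
| ISprod (S : nat -> Idx -> metricType R) :
    (forall n, isort (S n)) -> isort (fun i => prod_sort (fun n => S n i))
| ISsub (I : finType) (S : I -> Idx -> metricType R) :
    (forall k, isort (S k)) ->
    forall X : (forall i, set (forall k, S k i)), isort (fun i => sub_sort (X i))
| ISquot (I : finType) (S : I -> Idx -> metricType R) :
    (forall k, isort (S k)) ->
    forall Q : Idx -> metricType R, (forall i, (forall k, S k i) -> Q i) -> isort Q.

Definition imsort := {S : Idx -> metricType R & isort S}.
Definition imcar (s : imsort) : Idx -> metricType R := projT1 s.

Inductive imsym :=
| IMbase (f : fsym L0)
| IMproj (S : nat -> Idx -> metricType R) (c : forall n, isort (S n)) (n : nat)
| IMcoord (I : finType) (S : I -> Idx -> metricType R)
    (c : forall k, isort (S k)) (X : forall i, set (forall k, S k i)) (k : I)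
| IMquot (I : finType) (S : I -> Idx -> metricType R) (c : forall k, isort (S k))
    (Q : Idx -> metricType R) (pi : forall i, (forall k, S k i) -> Q i).

Definition im_arity (f : imsym) : finType :=
  match f with
  | IMbase f => arity f
  | IMproj _ _ _ => unit
  | IMcoord _ _ _ _ _ => unit
  | IMquot J _ _ _ _ => J
  end.

Definition im_dom (f : imsym) : im_arity f -> imsort :=
  match f return im_arity f -> imsort with
  | IMbase f => fun k => existT _ _ (ISbase (fdom k))
  | IMproj _ c _ => fun=> existT _ _ (ISprod c)
  | IMcoord _ _ c X _ => fun=> existT _ _ (ISsub c X)
  | IMquot _ _ c _ _ => fun k => existT _ _ (c k)
  end.

Definition im_cod (f : imsym) : imsort :=
  match f with
  | IMbase f => existT _ _ (ISbase (fcod f))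
  | IMproj _ c n => existT _ _ (c n)
  | IMcoord _ _ c _ k => existT _ _ (c k)
  | IMquot _ _ c _ pi => existT _ _ (ISquot c pi)
  end.

Definition im_int i (f : imsym) :
    (forall k, imcar (im_dom (f := f) k) i) -> imcar (im_cod f) i :=
  match f return (forall k, imcar (im_dom (f := f) k) i) -> imcar (im_cod f) i with
  | IMbase f => fun v => fint v
  | IMproj _ _ n => fun v => v tt n
  | IMcoord _ _ _ _ k => fun v => sval (v tt) k
  | IMquot _ _ _ _ pi => fun v => pi i v
  end.

Section Sublanguage.
Variable T : imsort -> Prop.

Definition sublang : language := {|
  srt := {s : imsort | T s} ;
  fsym := {f : imsym | (forall k, T (im_dom (f := f) k)) /\ T (im_cod f)} ;
  arity := fun f => im_arity (sval f) ;
  fdom := fun f k => exist _ _ (proj1 (svalP f) k) ;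
  fcod := fun f => exist _ _ (proj2 (svalP f))
|}.

Definition substr i : structure R sublang := {|
  car := fun s : srt sublang => imcar (sval s) i ;
  fint := fun f : fsym sublang => @im_int i (sval f)
|}.
End Sublanguage.

(* Q, via pi, is the completion of the quotient by the pseudometric rho
   (rho being the pullback of a metric, it is a pseudometric). *)
Definition completed_quotient (X : Type) (rho : X -> X -> R) (Q : metricType R)
    (pi : X -> Q) :=
  [/\ forall x y, mdist (pi x) (pi y) = rho x y, dense (range pi) &
      forall F : set_system Q, ProperFilter F -> cauchy F -> exists q : Q, F --> q].

(* Sets of sorts that can be reached by iteratively adding imaginary sorts to
   those of L0; A^eq consists of all the sorts so reached. *)
Inductive eq_sorts : (imsort -> Prop) -> Prop :=
| EQbase : eq_sorts (fun s => exists b, s = existT _ _ (ISbase b))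
| EQunion (K : Type) (T : K -> imsort -> Prop) :
    (forall k, eq_sorts (T k)) -> eq_sorts (fun s => exists k, T k s)
| EQprod (T : imsort -> Prop) (S : nat -> srt (sublang T)) :
    eq_sorts T ->
    eq_sorts (fun s => T s \/
      s = existT _ _ (ISprod (fun n => projT2 (sval (S n)))))
| EQset (T : imsort -> Prop) (I : finType) (g : I -> srt (sublang T))
    (X : forall i, set (env (substr T i) g)) :
    eq_sorts T -> definable_set X ->
    eq_sorts (fun s => T s \/
      s = existT _ _ (ISsub (fun k => projT2 (sval (g k))) X))
| EQquot (T : imsort -> Prop) (I : finType) (g : I -> srt (sublang T))
    (rho : forall i, env (substr T i) g -> env (substr T i) g -> R)
    (Q : Idx -> metricType R) (pi : forall i, env (substr T i) g -> Q i) :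
    eq_sorts T ->
    definable_predicate (fun i (v : env (substr T i) (sum_ctx g g)) =>
      rho i (fun k => v (inl k)) (fun k => v (inr k))) ->
    (forall i, completed_quotient (rho i) (@pi i)) ->
    eq_sorts (fun s => T s \/
      s = existT _ _ (ISquot (fun k => projT2 (sval (g k))) pi)).

(* The discrete group G, regarded as a metric structure with the {0,1}-valued
   metric, belongs to (M0 i0)^eq. *)
Definition group_belongs_to_eq (i0 : Idx) (G : groupType) :=
  exists T : imsort -> Prop, eq_sorts T /\
  exists (s : srt (sublang T)) (phi : substr T i0 s -> G)
    (mul : substr T i0 s -> substr T i0 s -> substr T i0 s)
    (inv : substr T i0 s -> substr T i0 s) (one : substr T i0 s),
  [/\ bijective phi,
      forall x y, mdist x y = (phi x != phi y)%:R,
      [/\ forall x y, phi (mul x y) = (phi x * phi y)%g,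
          forall x, phi (inv x) = (phi x)^-1%g & phi one = 1%g],
      definable_function_at (M := substr T) (i0 := i0) (g := fun _ : bool => s)
        (fun v => mul (v true) (v false)) &
      definable_function_at (M := substr T) (i0 := i0) (g := fun _ : unit => s)
        (fun v => inv (v tt)) /\
      definable_function_at (M := substr T) (i0 := i0) (g := @of_void _)
        (fun=> one)].

End Imaginaries.

Section CstarStructure.
Context (R : realType).

Definition cball (A : cstarAlg R) (n : nat) := {a : A | `|a| <= n%:R}.

Section BallMetric.
Variables (A : cstarAlg R) (n : nat).
Implicit Types x y : cball A n.

(* The norm takes its values in the nonnegative reals of R[i]. *)
Definition cball_dist x y : R := complex.Re `|sval x - sval y|.

Lemma normRe (a : A) : (complex.Re `|a|)%:C = `|a|.
Proof. by rewrite RRe_real ?normr_real. Qed.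

Let cball_distxx x : cball_dist x x = 0.
Proof. by rewrite /cball_dist subrr normr0. Qed.

Let cball_dist_pos x y : cball_dist x y = 0 -> x = y.
Proof.
rewrite /cball_dist => d0; apply/val_inj/eqP.
by rewrite -subr_eq0 -normr_eq0 -normRe d0.
Qed.

Let cball_dist_sym x y : cball_dist x y = cball_dist y x.
Proof. by rewrite /cball_dist distrC. Qed.

Let cball_dist_tri y x z : cball_dist x z <= cball_dist x y + cball_dist y z.
Proof.
by rewrite /cball_dist -lecR rmorphD /= !normRe ler_distD.
Qed.

HB.instance Definition _ := Choice.on (cball A n).
HB.instance Definition _ := isMetric.Build R (cball A n)
  cball_distxx cball_dist_pos cball_dist_sym cball_dist_tri.
End BallMetric.

(* Sort n is the ball of radius n. *)
Inductive cstar_op :=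
| OpAdd (m n : nat)
| OpMul (m n : nat)
| OpStar (n : nat)
| OpScale (k : R[i]) (m n : nat) of `|k| * m%:R <= n%:R
| OpZero
| OpOne
| OpIncl (m n : nat) of (m <= n)%N.

Definition cstar_arity (f : cstar_op) : finType :=
  match f with
  | OpAdd _ _ | OpMul _ _ => bool
  | OpStar _ | OpScale _ _ _ _ | OpIncl _ _ _ => unit
  | OpZero | OpOne => void
  end.

Definition cstar_dom (f : cstar_op) : cstar_arity f -> nat :=
  match f return cstar_arity f -> nat with
  | OpAdd m n | OpMul m n => fun b => if b then m else n
  | OpStar n => fun=> n
  | OpScale _ m _ _ | OpIncl m _ _ => fun=> m
  | OpZero | OpOne => fun=> 0%N
  end.

Definition cstar_cod (f : cstar_op) : nat :=
  match f with
  | OpAdd m n => m + n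
  | OpMul m n => m * n
  | OpStar n | OpScale _ _ n _ | OpIncl _ n _ => n
  | OpZero => 0
  | OpOne => 1
  end%N.

Definition cstar_lang : language := {|
  srt := nat ; fsym := cstar_op ; arity := cstar_arity ;
  fdom := cstar_dom ; fcod := cstar_cod |}.

Section Operations.
Variable A : cstarAlg R.

Definition mk_cball n (a : A) (h : `|a| <= n%:R) : cball A n := exist _ a h.

Lemma ball_add m n (x : cball A m) (y : cball A n) :
  `|sval x + sval y| <= (m + n)%:R.
Proof. by rewrite natrD (le_trans (ler_normD _ _))// lerD// (svalP x, svalP y). Qed.

Lemma ball_mul m n (x : cball A m) (y : cball A n) :
  `|sval x * sval y| <= (m * n)%:R.
Proof. by rewrite natrM (le_trans (cnormM _ _))// ler_pM ?(svalP x) ?(svalP y). Qed.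

Lemma ball_star n (x : cball A n) : `|star (sval x)| <= n%:R.
Proof. by rewrite cnorm_star (svalP x). Qed.

Lemma ball_scale k m n (h : `|k| * m%:R <= n%:R :> R[i]) (x : cball A m) :
  `|k *: sval x| <= n%:R.
Proof. by rewrite normrZ (le_trans _ h)// ler_wpM2l// (svalP x). Qed.

Lemma ball_zero : `|0 : A| <= 0%:R. Proof. by rewrite normr0. Qed.

Lemma ball_incl m n (h : (m <= n)%N) (x : cball A m) : `|sval x| <= n%:R.
Proof. by rewrite (le_trans (svalP x))// ler_nat. Qed.

Definition cstar_int (f : cstar_op) :
    (forall k, cball A (cstar_dom (f := f) k)) -> cball A (cstar_cod f) :=
  match f return (forall k, cball A (cstar_dom (f := f) k)) ->
                 cball A (cstar_cod f) with
  | OpAdd m n => fun v => mk_cball (@ball_add m n (v true) (v false))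
  | OpMul m n => fun v => mk_cball (@ball_mul m n (v true) (v false))
  | OpStar n => fun v => mk_cball (@ball_star n (v tt))
  | OpScale k m n h => fun v => mk_cball (ball_scale h (v tt))
  | OpZero => fun=> mk_cball ball_zero
  | OpOne => fun=> mk_cball (cnorm1 A : _ <= 1%:R)
  | OpIncl m n h => fun v => mk_cball (ball_incl h (v tt))
  end.

Definition cstar_str : structure R cstar_lang :=
  @Structure R cstar_lang (fun n : nat => cball A n) cstar_int.

End Operations.

Definition models (A : cstarAlg R) :=
  {C : cstarAlg R | elementarily_equivalent (cstar_str A) (cstar_str C)}.

Lemma elementarily_equivalent_refl A :
  elementarily_equivalent (cstar_str A) (cstar_str A).
Proof. by move=> p v w; congr (fval p _); apply: functional_extensionality_dep; case. Qed.

Definition self A : models A := exist _ A (@elementarily_equivalent_refl A).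

Definition model_str A (C : models A) : structure R cstar_lang :=
  cstar_str (sval C).

Record cstar_embedding (A B : cstarAlg R) := CstarEmbedding {
  emb :> A -> B ;
  embD : {morph emb : a b / a + b} ;
  embZ : forall (k : R[i]) a, emb (k *: a) = k *: emb a ;
  embM : {morph emb : a b / a * b} ;
  emb1 : emb 1 = 1 ;
  emb_star : forall a, emb (star a) = star (emb a) ;
  emb_norm : forall a, `|emb a| = `|a|
}.

Section Embeddings.
Variables (A B : cstarAlg R) (j : cstar_embedding A B).

Lemma cball_map_subproof n (x : cball A n) : `|j (sval x)| <= n%:R.
Proof. by rewrite emb_norm (svalP x). Qed.

Definition cball_map n (x : cball A n) : cball B n :=
  mk_cball (cball_map_subproof x).

Definition elementary_embedding :=
  @elementary_map R cstar_lang (cstar_str A) (cstar_str B) cball_map.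

Lemma unitary_map_subproof n (u : unitary A n) : is_unitarymx (map_mx j (val u)).
Proof.
have j0 : j 0 = 0 by apply: (addrI (j 0)); rewrite -embD !addr0.
have jM (v w : 'M[A]_n) : map_mx j v *m map_mx j w = map_mx j (v *m w).
  apply/matrixP => a b; rewrite !mxE (big_morph _ (embD j) j0).
  by apply: eq_bigr => k _; rewrite !mxE embM.
have jS (v : 'M[A]_n) : adjmx (map_mx j v) = map_mx j (adjmx v).
  by apply/matrixP => a b; rewrite !mxE emb_star.
have j1 : map_mx j (1%:M : 'M[A]_n) = 1%:M.
  by apply/matrixP => a b; rewrite !mxE; case: eqP; rewrite ?emb1 ?j0.
have /andP[/eqP u1 /eqP u2] := valP u.
by rewrite /is_unitarymx jS !jM u1 u2 j1 eqxx.
Qed.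

Definition unitary_map n (u : unitary A n) : unitary B n :=
  exist _ (map_mx j (val u)) (unitary_map_subproof u).

(* h is the map K_1(A) -> K_1(B) induced by j. *)
Definition K1_induced (h : K1 A -> K1 B) :=
  forall n (u : unitary A n), h (k1class u) = k1class (unitary_map u).

End Embeddings.

(* U_0(M_n(A)) as a subset of the n^2-th power of the unit ball of A, which
   contains the entries of every unitary matrix. *)
Definition U0_set (A : cstarAlg R) n :
    set (env (cstar_str A) (fun _ : 'I_n * 'I_n => 1%N)) :=
  [set v | U0 (\matrix_(i, j) sval (v (i, j)))].

Definition U0_definable (A : cstarAlg R) n :=
  definable_set_at (M := @model_str A) (i0 := self A) (@U0_set A n).

Definition K1_belongs_to_eq (A : cstarAlg R) :=
  group_belongs_to_eq (@model_str A) (self A) (K1 A).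

Definition generates_improper_ideal (A : cstarAlg R) n (a : 'rV[A]_n) :=
  [set \sum_k a 0 k * b 0 k | b in [set: 'rV[A]_n]] = [set: A].

Definition stable_rank_le (A : cstarAlg R) n :=
  dense [set a : 'rV[A]_n | generates_improper_ideal a].

Definition finite_stable_rank (A : cstarAlg R) := exists n, stable_rank_le A n.

Definition self_adjoint (A : cstarAlg R) : set A := [set a | star a = a].

Definition invertible (A : cstarAlg R) : set A :=
  [set a | exists b, a * b = 1 /\ b * a = 1].

Definition real_rank_zero (A : cstarAlg R) :=
  self_adjoint (A := A) `<=`
    closure (self_adjoint (A := A) `&` invertible (A := A)).

End CstarStructure.

(* First-order formulas in the language of groups; variables are de Bruijn
   indices into an infinite environment. *)
Inductive gterm :=
| GVar of nat | GOne | GInv of gterm | GMul of gterm & gterm.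

Inductive gformula :=
| GEq of gterm & gterm | GNot of gformula | GAnd of gformula & gformula
| GForall of gformula.

Fixpoint gval (G : groupType) (e : nat -> G) (t : gterm) : G :=
  match t with
  | GVar n => e n
  | GOne => 1
  | GInv t => (gval e t)^-1
  | GMul t u => gval e t * gval e u
  end%g.

Fixpoint gsat (G : groupType) (e : nat -> G) (p : gformula) : Prop :=
  match p with
  | GEq t u => gval e t = gval e u
  | GNot p => ~ gsat e p
  | GAnd p q => gsat e p /\ gsat e q
  | GForall p => forall x : G, gsat (fun n => if n is m.+1 then e m else x) p
  end.

Definition group_elementary (G H : groupType) (h : G -> H) :=
  forall (p : gformula) (e : nat -> G), gsat e p <-> gsat (h \o e) p.

(* Main.v *)
(* For finite stable rank and n large, K_1(A) is the set of classes of unitaries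
   of M_n(A), and [x] = [y][z] iff x and yz lie in the same component of GL_n(A).
   K_1(A) is therefore the quotient of the definable set U(M_n(A)) by a
   {0,1}-valued definable pseudometric as soon as the relation [x] <> [y][z] is a
   definable predicate R3. If X = U_0(M_n) is definable, R3 is a truncated
   multiple of the distance from yz to xX. If A has real rank zero, U_0 consists
   of the unitaries joined to 1 by a chain of invertibles whose length, mesh and
   norms are bounded independently of the unitary, so R3 is an infimum over such
   chains: a long chain of unitaries is coded by one self-adjoint matrix over A,
   which real rank zero makes invertible, and the path to its sign contracts in
   boundedly many steps. Chains of any fixed length also show that an elementary
   embedding is injective on K_1; and as products in K_1 are expressed by R3 and
   quantifiers over K_1 by quantifiers over unitaries, group formulas become
   definable predicates. *)
Require Import Defs.
From HB Require Import structures.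
From mathcomp Require Import all_boot all_order all_algebra.
From mathcomp Require Import generic_quotient complex.
From mathcomp Require Import ring lra zify.
From mathcomp Require Import all_classical all_reals all_analysis.

Set Implicit Arguments.
Unset Strict Implicit.
Unset Printing Implicit Defensive.

Import Order.TTheory GRing.Theory Num.Theory.
Import numFieldNormedType.Exports.

Local Open Scope classical_set_scope.
Local Open Scope ring_scope.
Local Open Scope complex_scope.

(** * C*-algebras: norm, square roots, positivity *)

(** Definability quantifies over all models of the theory of [A], while [R3] is known to speak of
    K_1 only at [A]. So [R3] is one expression that makes sense in every C*-algebra, and the
    quotient is taken by the sup over [t1, t2] of [|R3(t1, x, t2) - R3(t1, x', t2)|], a pseudometric
    whatever [R3] means elsewhere. Moduli and gaps must not depend on the algebra; hence square
    roots come from one explicit iteration with an explicit rate, not from spectral theory.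

    In real rank zero the danger is that the chain length N enters the estimates. The chain is
    spread over N + 1 sites of a band matrix, and a Schur test bounds its errors by the mesh alone.
    Squares at neighbouring sites compensate each other except at the first site, so everything
    close to 1 - H^2 sits in one corner, and the corner entry of a path of matrices gives a path in
    the algebra.

    In (4) the stable rank of [B] must be obtained from [A]. Density of left invertible columns is
    not a sentence, as left inverses have no a priori bound; [gap] supplies one. It is also needed
    that a component of U_n can be tested in GL_n, where elementary matrices and small perturbations
    are available; the polar part makes this possible. *)

Section CstarNorm.
Context (R : realType) (A : cstarAlg R).
Implicit Types (a b c : A) (r s : R).

(** The norm of the structure is valued in [R[i]]; a real-valued copy makes [lra] and [nra]
    applicable. *)
Definition nrm a : R := complex.Re `|a|.

Lemma nrmE a : `|a| = (nrm a)%:C.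
Proof. by rewrite /nrm normRe. Qed.

Lemma nrm_le a r : (`|a| <= r%:C) = (nrm a <= r).
Proof. by rewrite nrmE lecR. Qed.

Lemma nrm_ge0 a : 0 <= nrm a.
Proof. by rewrite -lecR -nrmE normr_ge0. Qed.

Lemma nrm0 : nrm 0 = 0. Proof. by rewrite /nrm normr0. Qed.

Lemma nrm0_eq0 a : nrm a = 0 -> a = 0.
Proof. by move=> h; apply/eqP; rewrite -normr_eq0 nrmE h. Qed.

Lemma nrmD a b : nrm (a + b) <= nrm a + nrm b.
Proof. by rewrite -lecR rmorphD /= -!nrmE ler_normD. Qed.

Lemma nrmN a : nrm (- a) = nrm a. Proof. by rewrite /nrm normrN. Qed.

Lemma nrmBC a b : nrm (a - b) = nrm (b - a).
Proof. by rewrite -nrmN opprB. Qed.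

Lemma nrmM a b : nrm (a * b) <= nrm a * nrm b.
Proof. by rewrite -lecR rmorphM /= -!nrmE cnormM. Qed.

Lemma nrm_star a : nrm (star a) = nrm a.
Proof. by rewrite /nrm cnorm_star. Qed.

Lemma nrmC a : nrm (star a * a) = nrm a ^+ 2.
Proof. 
have := cnormC a; rewrite !nrmE -rmorphXn /=.
by move=> /(congr1 (@complex.Re R)).
Qed.

(** Not an equality, because the zero algebra is allowed. *)
Lemma nrm1 : nrm 1 <= 1.
Proof. by rewrite -lecR -nrmE cnorm1. Qed.

Lemma nrmZ r a : nrm (r%:C *: a) = `|r| * nrm a.
Proof.
have := normrZ r%:C a; rewrite !nrmE normc_def /= expr0n addr0 sqrtr_sqr.
by rewrite -rmorphM /= => /(congr1 (@complex.Re R)).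
Qed.

Lemma nrm_sum I (r : seq I) (P : pred I) (F : I -> A) :
  nrm (\sum_(i <- r | P i) F i) <= \sum_(i <- r | P i) nrm (F i).
Proof.
elim/big_ind2: _ => [|x u y v xu yv|//]; first by rewrite nrm0.
exact: le_trans (nrmD _ _) (lerD _ _).
Qed.

Lemma scaleAlc (k : R[i]) a b : k *: (a * b) = (k *: a) * b.
Proof. exact: cs_scalel. Qed.

Lemma scaleArc (k : R[i]) a b : k *: (a * b) = a * (k *: b).
Proof. exact: cs_scaler. Qed.

Lemma starZ (k : R[i]) a : star (k *: a) = k^* *: star a.
Proof. exact: cs_starZ. Qed.

Lemma starZr r a : star (r%:C *: a) = r%:C *: star a.
Proof. rewrite starZ; congr (_ *: _). by apply/eqP; rewrite eq_complex /= oppr0 !eqxx. Qed.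

Lemma starN a : star (- a) = - star a.
Proof. by apply: (addIr (star a)); rewrite -starD !addNr star0. Qed.

Lemma starB a b : star (a - b) = star a - star b.
Proof. by rewrite starD starN. Qed.

Lemma nbhs_nrmP a (P : set A) :
  nbhs a P <-> exists2 e : R, 0 < e & forall b, nrm (b - a) < e -> P b.
Proof.
split=> [/nbhs_ballP [e /= e0 eP]|[e e0 eP]].
  have er : e \is Num.real by exact: gtr0_real.
  exists (complex.Re e); first by rewrite -ltcR RRe_real.
  move=> b ab; apply: eP; rewrite -ball_normE /= distrC nrmE.
  by rewrite -(RRe_real er) ltcR.
apply/nbhs_ballP; exists e%:C; first by rewrite /= ltcR.
by move=> b; rewrite -ball_normE /= distrC nrmE ltcR; exact: eP.
Qed.

Lemma nrm_complete (u : nat -> A) :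
  (forall e : R, 0 < e -> exists N, forall m n, (N <= m)%N -> (N <= n)%N ->
     nrm (u m - u n) <= e) ->
  exists l, forall e : R, 0 < e -> exists N, forall n, (N <= n)%N ->
     nrm (u n - l) <= e.
Proof.
move=> uC.
have : cvg (u @ \oo).
  apply/cauchy_cvgP/cauchy_ballP => e e0.
  have er : e \is Num.real by exact: gtr0_real.
  have e2 : 0 < complex.Re e / 2 by rewrite divr_gt0// -ltcR RRe_real.
  have [N uN] := uC _ e2.
  rewrite near_map2; near=> m n => /=.
  rewrite -ball_normE /= nrmE -(RRe_real er) ltcR.
  apply: (@le_lt_trans _ _ (complex.Re e / 2)).
    by apply: uN; near: m + near: n; exact: nbhs_infty_ge.
  by rewrite ltr_pdivrMr// ltr_pMr ?ltr1n// -ltcR RRe_real.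
move=> /cvg_ex[l ul]; exists l => e e0.
have e0c : 0 < e%:C :> R[i] by rewrite ltcR.
have /cvgrPdist_le /(_ _ e0c) := ul.
case=> N _ uN; exists N => n Nn; have := uN n Nn.
by rewrite /= distrC nrmE lecR.
Unshelve. all: by end_near. Qed.

End CstarNorm.

(* Decision procedure for identities in (noncommutative) rings: both sides are
   expanded into signed multisets of words in the atoms. *)
Inductive ncexpr :=
| NCvar of nat | NC0 | NC1 | NCadd of ncexpr & ncexpr | NCopp of ncexpr
| NCmul of ncexpr & ncexpr.

Fixpoint nceval (A : pzRingType) (e : seq A) (t : ncexpr) : A :=
  match t with
  | NCvar n => nth 0 e n
  | NC0 => 0
  | NC1 => 1
  | NCadd t u => nceval e t + nceval e u
  | NCopp t => - nceval e t
  | NCmul t u => nceval e t * nceval e u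
  end.

Fixpoint ncnorm (t : ncexpr) : seq (seq nat) * seq (seq nat) :=
  match t with
  | NCvar n => ([:: [:: n]], [::])
  | NC0 => ([::], [::])
  | NC1 => ([:: [::]], [::])
  | NCadd t u => let: (p, n) := ncnorm t in let: (p', n') := ncnorm u in
      (p ++ p', n ++ n')
  | NCopp t => let: (p, n) := ncnorm t in (n, p)
  | NCmul t u => let: (p, n) := ncnorm t in let: (p', n') := ncnorm u in
      ([seq v ++ w | v <- p, w <- p'] ++ [seq v ++ w | v <- n, w <- n'],
       [seq v ++ w | v <- p, w <- n'] ++ [seq v ++ w | v <- n, w <- p'])
  end.

Section NCRing.
Context (A : pzRingType) (e : seq A).

Definition ncword (w : seq nat) : A := \prod_(i <- w) nth 0 e i.
Definition ncsum (s : seq (seq nat)) : A := \sum_(w <- s) ncword w.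

Lemma ncsumM s t :
  ncsum [seq v ++ w | v <- s, w <- t] = ncsum s * ncsum t.
Proof.
rewrite /ncsum big_allpairs_dep /= mulr_suml; apply: eq_bigr => v _.
by rewrite mulr_sumr; apply: eq_bigr => w _; rewrite /ncword big_cat.
Qed.

Lemma ncnormP t : nceval e t = ncsum (ncnorm t).1 - ncsum (ncnorm t).2.
Proof.
have catE s s' : ncsum (s ++ s') = ncsum s + ncsum s' by rewrite /ncsum big_cat.
have nil0 : ncsum [::] = 0 by rewrite /ncsum big_nil.
elim: t => [n|||t IHt u IHu|t IHt|t IHt u IHu] /=.
- by rewrite nil0 subr0 /ncsum big_seq1 /ncword big_seq1.
- by rewrite nil0 subrr.
- by rewrite nil0 subr0 /ncsum big_seq1 /ncword big_nil.
- rewrite IHt IHu; case: (ncnorm t) (ncnorm u) => p n [p' n'] /=.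
  by rewrite !catE opprD addrACA.
- by rewrite IHt; case: (ncnorm t) => p n /=; rewrite opprB.
- rewrite IHt IHu; case: (ncnorm t) (ncnorm u) => p n [p' n'] /=.
  by rewrite !catE !ncsumM mulrBl !mulrBr opprB opprD addrACA.
Qed.

Definition nctest t u :=
  let: (p, n) := ncnorm t in let: (p', n') := ncnorm u in
  perm_eq (p ++ n') (p' ++ n).

Lemma nctestP t u : nctest t u -> nceval e t = nceval e u.
Proof.
rewrite /nctest !ncnormP; case: (ncnorm t) (ncnorm u) => p n [p' n'] /= h.
apply/eqP; rewrite subr_eq addrAC eq_sym subr_eq.
by rewrite /ncsum -!big_cat eq_sym; apply/eqP; exact: perm_big.
Qed.

(** The variant for commuting atoms: words are compared up to the order of their letters, which is
    sound under [ncomm]. *)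
Definition cctest t u :=
  let srt := map (sort leq) in
  let: (p, n) := ncnorm t in let: (p', n') := ncnorm u in
  perm_eq (srt (p ++ n')) (srt (p' ++ n)).

Fixpoint ncomm (s : seq A) : Prop :=
  if s is a :: s' then foldr (fun b P => a * b = b * a /\ P) True s' /\ ncomm s'
  else True.

Lemma ncommP : ncomm e -> forall i j, nth 0 e i * nth 0 e j = nth 0 e j * nth 0 e i.
Proof.
elim: e => [|a s IH] /= => [_ i j|[ha /IH hs]]; first by rewrite !nth_nil mulr0.
have h j : a * nth 0 s j = nth 0 s j * a.
  elim: s ha {IH hs} j => [_ j|b s IHs /= [ab ha] [|j]]; last exact: IHs.
    by rewrite nth_nil mulr0 mul0r.
  exact: ab.
case=> [|i] [|j]; [by []|exact: h|by rewrite /= -h|exact: hs].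
Qed.

Lemma cctestP t u : ncomm e -> cctest t u -> nceval e t = nceval e u.
Proof.
move=> /ncommP ce.
have swp w : ncword (sort leq w) = ncword w.
  rewrite /ncword; have h := permEl (perm_sort leq w).
  suff g (s1 s2 : seq nat) : perm_eq s1 s2 ->
      \prod_(i <- s1) nth 0 e i = \prod_(i <- s2) nth 0 e i.
    exact: g.
  elim: s1 s2 => [|x s1 IH] s2 p12.
    by have /nilP -> : nilp s2 by rewrite /nilp -(perm_size p12).
  have xs2 : x \in s2 by rewrite -(perm_mem p12) mem_head.
  have [i [l [r [_ e2]]]] : exists i l r, i = size l /\ s2 = l ++ x :: r.
    by case/splitPr: xs2 => l r; exists (size l), l, r.
  have p1 : perm_eq s1 (l ++ r).
    by rewrite -(perm_cons x) (perm_trans p12)// e2 -cat1s perm_catCA.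
  rewrite big_cons (IH _ p1) e2 !big_cat big_cons /= !mulrA; congr (_ * _).
  elim: l {e2 p1} => [|y l IHl]; first by rewrite big_nil mulr1 mul1r.
  by rewrite !big_cons mulrA ce -mulrA IHl mulrA.
have sws s : ncsum (map (sort leq) s) = ncsum s.
  by rewrite /ncsum big_map; apply: eq_bigr => w _.
rewrite /cctest !ncnormP; case: (ncnorm t) (ncnorm u) => p n [p' n'] /= h.
apply/eqP; rewrite subr_eq addrAC eq_sym subr_eq.
have catE s s' : ncsum (s ++ s') = ncsum s + ncsum s' by rewrite /ncsum big_cat.
by rewrite -!catE eq_sym -sws -[eqbRHS]sws; apply/eqP; exact: perm_big.
Qed.
End NCRing.

Ltac nc_index a l :=
  lazymatch l with
  | a :: _ => constr:(0%N)
  | _ :: ?l' => let n := nc_index a l' in constr:(n.+1)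
  end.
Ltac nc_mem a l :=
  lazymatch l with
  | nil => constr:(false) | a :: _ => constr:(true) | _ :: ?l' => nc_mem a l'
  end.
Ltac nc_add a l :=
  let b := nc_mem a l in
  lazymatch b with true => l | false => constr:(a :: l) end.
Ltac nc_atoms t l :=
  lazymatch t with
  | (?a + ?b)%R => let l' := nc_atoms a l in nc_atoms b l'
  | (?a * ?b)%R => let l' := nc_atoms a l in nc_atoms b l'
  | (- ?a)%R => nc_atoms a l
  | 0%R => l
  | 1%R => l
  | ?a => nc_add a l
  end.
Ltac nc_reify t l :=
  lazymatch t with
  | (?a + ?b)%R => let a' := nc_reify a l in let b' := nc_reify b l in
      constr:(NCadd a' b')
  | (?a * ?b)%R => let a' := nc_reify a l in let b' := nc_reify b l in
      constr:(NCmul a' b')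
  | (- ?a)%R => let a' := nc_reify a l in constr:(NCopp a')
  | 0%R => constr:(NC0)
  | 1%R => constr:(NC1)
  | ?a => let n := nc_index a l in constr:(NCvar n)
  end.
Ltac nc_main lem :=
  lazymatch goal with |- @eq ?T ?x ?y =>
    let l0 := constr:(@nil T) in
    let l1 := nc_atoms x l0 in let l := nc_atoms y l1 in
    let t := nc_reify x l in let u := nc_reify y l in
    lem l t u
  end.
Ltac ncring := rewrite ?expr2 ?mulr2n;
  nc_main ltac:(fun l t u => apply: (@nctestP _ l t u); vm_compute; reflexivity).
Ltac ccring := rewrite ?expr2 ?mulr2n;
  nc_main ltac:(fun l t u => apply: (@cctestP _ l t u);
    [rewrite /=; repeat split; try done; try (symmetry; done) | vm_compute; reflexivity]).

Section Scalars.
Context (R : realType) (A : cstarAlg R).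
Implicit Types (a b c : A) (r s : R).

(** Scalars are turned into central elements of the ring, so that the ring tactics can treat them as
    atoms. *)
Definition rc r : A := r%:C *: (1 : A).
Definition ii : A := 'i *: (1 : A).

Lemma rcE r a : r%:C *: a = rc r * a.
Proof. by rewrite /rc -scaleAlc mul1r. Qed.
Lemma rcC r a : rc r * a = a * rc r.
Proof. by rewrite -rcE /rc -scaleArc mulr1. Qed.
Lemma iiC a : ii * a = a * ii.
Proof. by rewrite /ii -scaleAlc mul1r -scaleArc mulr1. Qed.
Lemma rcD r s : rc (r + s) = rc r + rc s.
Proof. by rewrite /rc rmorphD /= scalerDl. Qed.
Lemma rcN r : rc (- r) = - rc r.
Proof. by rewrite /rc rmorphN /= scaleNr. Qed.
Lemma rcB r s : rc (r - s) = rc r - rc s.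
Proof. by rewrite rcD rcN. Qed.
Lemma rcM r s : rc (r * s) = rc r * rc s.
Proof. by rewrite -rcE /rc scalerA -rmorphM. Qed.
Lemma rc1 : rc 1 = 1. Proof. by rewrite /rc rmorph1 scale1r. Qed.
Lemma rc0 : rc 0 = 0. Proof. by rewrite /rc rmorph0 scale0r. Qed.
Lemma rc2 : rc 2 = 1 + 1.
Proof. by rewrite -rc1 -rcD. Qed.
Lemma iiM : ii * ii = -1.
Proof.
rewrite /ii -scaleAlc mul1r scalerA -expr2.
rewrite (_ : 'i ^+ 2 = -1 :> R[i]) ?scaleN1r//; exact: sqr_i.
Qed.
Lemma star_rc r : star (rc r) = rc r.
Proof. by rewrite /rc starZr star1. Qed.
Lemma star_ii : star ii = - ii.
Proof.
rewrite /ii starZ star1 -scaleNr; congr (_ *: _).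
by apply/eqP; rewrite eq_complex /= oppr0 !eqxx.
Qed.
Lemma nrm_rc r : nrm (rc r) <= `|r|.
Proof. by rewrite nrmZ ler_piMr// nrm1. Qed.
Lemma nrm_rcM r a : nrm (rc r * a) = `|r| * nrm a.
Proof. by rewrite -rcE nrmZ. Qed.
Lemma nrm_iiM a : nrm (ii * a) = nrm a.
Proof.
rewrite /ii -scaleAlc mul1r /nrm normrZ.
suff -> : `|'i : R[i]| = 1 by rewrite mul1r.
by rewrite normc_def /= expr0n expr1n add0r sqrtr1.
Qed.

Lemma cmM a b c : c * a = a * c -> c * b = b * c -> c * (a * b) = a * b * c.
Proof. by move=> ca cb; rewrite mulrA ca -mulrA cb mulrA. Qed.
Lemma cmD a b c : c * a = a * c -> c * b = b * c -> c * (a + b) = (a + b) * c.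
Proof. by move=> ca cb; rewrite mulrDr ca cb mulrDl. Qed.
Lemma cmN a c : c * a = a * c -> c * (- a) = - a * c.
Proof. by move=> ca; rewrite mulrN ca mulNr. Qed.
Lemma cmB a b c : c * a = a * c -> c * b = b * c -> c * (a - b) = (a - b) * c.
Proof. by move=> ca cb; apply: cmD => //; apply: cmN. Qed.
Lemma cm1 c : c * 1 = 1 * c. Proof. by rewrite mulr1 mul1r. Qed.
Lemma cm_rc r c : c * rc r = rc r * c. Proof. by rewrite rcC. Qed.

Lemma rcK r a : r != 0 -> rc r^-1 * (rc r * a) = a.
Proof. by move=> r0; rewrite mulrA -rcM mulVf// rc1 mul1r. Qed.

Lemma rcKV r a : r != 0 -> rc r * (rc r^-1 * a) = a.
Proof. by move=> r0; rewrite mulrA -rcM mulfV// rc1 mul1r. Qed.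

Lemma rc_inj r a b : r != 0 -> rc r * a = rc r * b -> a = b.
Proof. by move=> r0 h; rewrite -(rcK a r0) h rcK. Qed.

Lemma nrm_le_trans b a c : nrm (a - c) <= nrm (a - b) + nrm (b - c).
Proof. by apply: le_trans (nrmD _ _); rewrite addrA subrK. Qed.

Lemma nrm_le_dist a b : nrm a <= nrm b + nrm (a - b).
Proof. by rewrite -{1}(subrK b a) addrC (le_trans (nrmD _ _)). Qed.

Lemma nrm_small0 a : (forall e : R, 0 < e -> nrm a <= e) -> a = 0.
Proof.
move=> h; apply: nrm0_eq0; apply/eqP; rewrite eq_le nrm_ge0 andbT.
by apply/ler_addgt0Pr => e e0; rewrite add0r h.
Qed.

Lemma nrm_small a b : (forall e : R, 0 < e -> nrm (a - b) <= e) -> a = b.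
Proof. by move=> /nrm_small0/eqP; rewrite subr_eq0 => /eqP. Qed.

End Scalars.

(** Commutation of two atoms is either in the context, in one of the two directions, or due to one
    of them being a real scalar or [ii]. *)
Ltac comm_solve := first
  [done | symmetry; done | apply: rcC | symmetry; apply: rcC
  | apply: iiC | symmetry; apply: iiC].
Ltac ccring ::= rewrite ?expr2 ?mulr2n;
  nc_main ltac:(fun l t u => apply: (@cctestP _ l t u);
    [rewrite /=; repeat split; comm_solve | vm_compute; reflexivity]).

(** * Square roots by iteration *)

Section SquareRoot.
Context (R : realType).

Fixpoint rho_iter (n : nat) : R :=
  if n is m.+1 then 2^-1 * (1 + rho_iter m ^+ 2) else 0.

Lemma rho_iterS n : rho_iter n.+1 = 2^-1 * (1 + rho_iter n ^+ 2).
Proof. by []. Qed.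

(** The defect [t = 1 - rho_iter n] satisfies [t' = t - t^2 / 2], and [2 / (n + 2)] is a
    supersolution of this recursion. The fixed point 1 is a double root, whence the slow rate. *)
Lemma rho_iter_bound n : 0 <= rho_iter n <= 1 /\ 1 - rho_iter n <= 2 / (n%:R + 2).
Proof.
elim: n => [|n [/andP[h0 h1] h2]] /=.
  by rewrite lexx ler01 subr0 add0r divff ?pnatr_eq0.
split; first by apply/andP; split; nra.
have n2 : 0 < n%:R + 2 :> R by rewrite ltr_wpDl.
set t := 1 - rho_iter n in h2.
have -> : rho_iter n = 1 - t by rewrite /t; lra.
have t1 : t <= 1 by rewrite /t; lra.
have t0 : 0 <= t by rewrite /t; lra.
set u := 2 / (n%:R + 2) in h2.
have u1 : u <= 1 by rewrite /u ler_pdivrMr// mul1r lerDr.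
have -> : 1 - 2^-1 * (1 + (1 - t) ^+ 2) = t - t ^+ 2 / 2 by field.
apply: (@le_trans _ _ (u - u ^+ 2 / 2)); first by nra.
have n3 : 0 < (n.+1)%:R + 2 :> R by rewrite ltr_wpDl.
rewrite -subr_ge0 /u -[n.+1%:R]natr1.
have -> : 2 / (n%:R + 1 + 2) - (2 / (n%:R + 2) - (2 / (n%:R + 2)) ^+ 2 / 2) =
   2 / ((n%:R + 1 + 2) * (n%:R + 2) ^+ 2) :> R.
  by rewrite natr1; field; rewrite (gt_eqF n2) -natr1 (gt_eqF (_ : 0 < _)) ?ltr_wpDl// natr1.
by rewrite divr_ge0// mulr_ge0 ?exprn_ge0// ?ltW// natr1.
Qed.

Lemma inv_nat_small (e : R) : 0 < e -> exists N, forall n, (N <= n)%N -> 2 / (n%:R + 2) <= e.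
Proof.
move=> e0; exists (Num.truncn (2 / e)).+1 => n Nn.
have n2 : 0 < n%:R + 2 :> R by rewrite ltr_wpDl.
rewrite ler_pdivrMr// mulrC -ler_pdivrMr//.
have : 2 / e <= n%:R.
  apply: (@le_trans _ _ (Num.truncn (2 / e)).+1%:R); last by rewrite ler_nat.
  by rewrite ltW// truncnS_gt.
by move=> h; rewrite (le_trans h)// lerDl.
Qed.

Context (A : cstarAlg R).
Implicit Types y z c a b : A.

(** A fixed point [z] of the iteration satisfies [(1 - z)^2 = 1 - y]. *)
Fixpoint sq_iter y (n : nat) : A :=
  if n is m.+1 then rc A 2^-1 * (y + sq_iter y m * sq_iter y m) else 0.

Lemma sq_iterS y n :
  sq_iter y n.+1 = rc A 2^-1 * (y + sq_iter y n * sq_iter y n).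
Proof. by []. Qed.

Lemma sq_iter_le y n : nrm y <= 1 -> nrm (sq_iter y n) <= rho_iter n.
Proof.
move=> y1; elim: n => [|n IH] /=; first by rewrite nrm0.
rewrite nrm_rcM ger0_norm ?invr_ge0// ler_pM2l ?invr_gt0//.
apply: le_trans (nrmD _ _) (lerD y1 _); apply: le_trans (nrmM _ _) _.
by rewrite expr2 ler_pM ?nrm_ge0.
Qed.

Lemma sqrB a b : a * a - b * b = (a - b) * a + b * (a - b).
Proof. ncring. Qed.

(** By [sqrB] the increments obey the recursion of the scalar increments at [y = 1], which dominate
    them by induction. *)
Lemma sq_iter_step y n : nrm y <= 1 ->
  nrm (sq_iter y n.+1 - sq_iter y n) <= rho_iter n.+1 - rho_iter n.
Proof.
move=> y1; elim: n => [|n IH].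
  rewrite /= !subr0 mul0r addr0 nrm_rcM expr0n addr0 mulr1 ger0_norm ?invr_ge0//.
  by rewrite ler_piMr// invr_ge0.
have -> : sq_iter y n.+2 - sq_iter y n.+1 = rc A 2^-1 *
    ((sq_iter y n.+1 - sq_iter y n) * sq_iter y n.+1 +
     sq_iter y n * (sq_iter y n.+1 - sq_iter y n)).
  rewrite -sqrB [sq_iter y n.+2]sq_iterS [X in _ - X = _]sq_iterS -mulrBr.
  by congr (_ * _); ncring.
have h1 := sq_iter_le n.+1 y1; have h0 := sq_iter_le n y1.
set u := sq_iter y n.+1 in h1 IH *; set v := sq_iter y n in h0 IH *.
rewrite nrm_rcM ger0_norm ?invr_ge0//.
have -> : rho_iter n.+2 - rho_iter n.+1 = 2^-1 *
   ((rho_iter n.+1 - rho_iter n) * rho_iter n.+1 +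
     rho_iter n * (rho_iter n.+1 - rho_iter n)).
  rewrite [rho_iter n.+2]rho_iterS [X in _ - X = _]rho_iterS.
  by move: (rho_iter n.+1) (rho_iter n) => u' v'; field.
rewrite ler_pM2l ?invr_gt0//; apply: le_trans (nrmD _ _) _.
by apply: lerD; apply: le_trans (nrmM _ _) _; rewrite ler_pM ?nrm_ge0.
Qed.

Lemma sq_iter_cauchy y m n : nrm y <= 1 -> (n <= m)%N ->
  nrm (sq_iter y m - sq_iter y n) <= rho_iter m - rho_iter n.
Proof.
move=> y1 /subnKC <-; elim: (m - n)%N => [|k IH].
  by rewrite addn0 !subrr nrm0.
rewrite addnS; apply: le_trans (nrm_le_trans (sq_iter y (n + k)) _ _) _.
have -> : rho_iter (n + k).+1 - rho_iter n =
  (rho_iter (n + k).+1 - rho_iter (n + k)) + (rho_iter (n + k) - rho_iter n) by ring.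
by rewrite lerD// sq_iter_step.
Qed.

(* 1 - sqrt(1 - y), as the limit of an iteration dominated by the real one at y = 1. *)
Definition sq_lim y : A :=
  xget 0 [set z : A | forall n, nrm (z - sq_iter y n) <= 2 / (n%:R + 2)].

(** The rate depends neither on [y] nor on the algebra; every uniformity over a class of algebras
    rests on this. *)
Lemma sq_limP y n : nrm y <= 1 -> nrm (sq_lim y - sq_iter y n) <= 2 / (n%:R + 2).
Proof.
move=> y1; rewrite /sq_lim; case: xgetP => [z _ /(_ n)//|ne]; exfalso.
have [e e0|l ul] := @nrm_complete _ A (sq_iter y).
  have [N hN] := inv_nat_small e0; exists N.
  have main m k : (N <= k)%N -> (k <= m)%N -> nrm (sq_iter y m - sq_iter y k) <= e.
    move=> Nk km; apply: le_trans (sq_iter_cauchy y1 km) _.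
    apply: le_trans (hN k Nk); have [_] := rho_iter_bound k.
    by have [/andP[_ +] _] := rho_iter_bound m; lra.
  move=> m k Nm Nk; have [km|/ltnW mk] := leqP k m; first exact: main.
  by rewrite nrmBC main.
apply: (ne l) => k; apply/ler_addgt0Pr => e e0.
have [N hN] := ul e e0.
apply: le_trans (nrm_le_trans (sq_iter y (maxn N k)) _ _) _.
rewrite addrC lerD//; last by rewrite nrmBC hN// leq_maxl.
apply: le_trans (sq_iter_cauchy y1 (leq_maxr _ _)) _.
have [_] := rho_iter_bound k.
by have [/andP[_ +] _] := rho_iter_bound (maxn N k); lra.
Qed.

Lemma sq_lim_approx y e : nrm y <= 1 -> 0 < e ->
  exists N, forall n, (N <= n)%N -> nrm (sq_lim y - sq_iter y n) <= e.
Proof.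
move=> y1 e0; have [N hN] := inv_nat_small e0; exists N => n /hN.
exact: le_trans (sq_limP n y1).
Qed.

Lemma sq_lim_le1 y : nrm y <= 1 -> nrm (sq_lim y) <= 1.
Proof.
move=> y1; apply/ler_addgt0Pr => e e0; have [N hN] := sq_lim_approx y1 e0.
apply: le_trans (nrm_le_dist _ (sq_iter y N)) _; apply: lerD; last exact: hN.
by apply: le_trans (sq_iter_le N y1) _; have [/andP[]] := rho_iter_bound N.
Qed.

(** [r] is a supersolution of the scalar iteration with datum [rho], hence bounds every iterate. For
    [rho < 1] there is such an [r < 1], so that [1 - sq_lim y] is invertible. *)
Lemma sq_lim_le y rho r : nrm y <= 1 -> nrm y <= rho -> 0 <= r ->
  rho + r ^+ 2 <= 2 * r -> nrm (sq_lim y) <= r.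
Proof.
move=> y1 yr r0 rr; apply/ler_addgt0Pr => e e0; have [N hN] := sq_lim_approx y1 e0.
apply: le_trans (nrm_le_dist _ (sq_iter y N)) _; apply: lerD; last exact: hN.
elim: {hN} N => [|n IH] /=; first by rewrite nrm0.
rewrite nrm_rcM ger0_norm ?invr_ge0// ler_pdivrMl//.
apply: le_trans rr; apply: le_trans (nrmD _ _) (lerD yr _).
by apply: le_trans (nrmM _ _) _; rewrite expr2 ler_pM ?nrm_ge0.
Qed.

Lemma sq_limE y : nrm y <= 1 -> rc A 2 * sq_lim y = y + sq_lim y * sq_lim y.
Proof.
move=> y1; apply: nrm_small => e e0.
have e4 : 0 < e / 4 by rewrite divr_gt0.
have [N hN] := sq_lim_approx y1 e4.
have h0 := hN N (leqnn _); have h1 := hN N.+1 (leqnSn _).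
set z := sq_lim y in h0 h1 *; set u := sq_iter y N in h0 h1 *.
have -> : rc A 2 * z - (y + z * z) =
  rc A 2 * (z - sq_iter y N.+1) - ((z - u) * z + u * (z - u)).
  rewrite -sqrB /= mulrBr rcKV ?pnatr_eq0// /u; ncring.
apply: le_trans (nrmD _ _) _; rewrite nrm_rcM nrmN ger0_norm//.
have z1 : nrm z <= 1 by exact: sq_lim_le1.
have u1 : nrm u <= 1.
  by apply: le_trans (sq_iter_le N y1) _; have [/andP[]] := rho_iter_bound N.
have := nrmD ((z - u) * z) (u * (z - u)).
have := nrmM (z - u) z; have := nrmM u (z - u).
have := nrm_ge0 (z - u); have := nrm_ge0 u; have := nrm_ge0 z.
nra.
Qed.

(** Stands in for the fact that the root lies in the closed subalgebra generated by [y] and 1. *)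
Lemma sq_lim_comm y c : nrm y <= 1 -> c * y = y * c -> c * sq_lim y = sq_lim y * c.
Proof.
move=> y1 cy.
have it n : c * sq_iter y n = sq_iter y n * c.
  elim: n => [|n IH] /=; first by rewrite mulr0 mul0r.
  by rewrite mulrA -rcC -!mulrA; congr (_ * _); rewrite mulrDl mulrDr cy mulrA IH -!mulrA IH.
apply: nrm_small => e e0.
have c0 : 0 < 2 * nrm c + 1 by rewrite ltr_wpDl// mulr_ge0// nrm_ge0.
have [N hN] := sq_lim_approx y1 (divr_gt0 e0 c0).
have h := hN N (leqnn _); set z := sq_lim y in h *; set u := sq_iter y N in h *.
have -> : c * z - z * c = c * (z - u) - (z - u) * c.
  by rewrite mulrBr mulrBl (it N : c * u = u * c); ncring.
apply: le_trans (nrmD _ _) _; rewrite nrmN.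
have := nrmM c (z - u); have := nrmM (z - u) c.
rewrite ler_pdivlMr// in h; have := nrm_ge0 (z - u); have := nrm_ge0 c; nra.
Qed.

Lemma sq_lim_star y : nrm y <= 1 -> star y = y -> star (sq_lim y) = sq_lim y.
Proof.
move=> y1 ys.
have it n : star (sq_iter y n) = sq_iter y n.
  elim: n => [|n IH] /=; first exact: star0.
  by rewrite starM star_rc -rcC starD starM ys IH.
apply: nrm_small => e e0; have [N hN] := sq_lim_approx y1 (divr_gt0 e0 (ltr0Sn R 1)).
have h := hN N (leqnn _); rewrite -(subrK (sq_iter y N) (sq_lim y)).
rewrite starD it opprD addrACA subrr addr0; apply: le_trans (nrmD _ _) _.
by rewrite nrmN nrm_star; lra.
Qed.

Lemma sq_iter_lip y y' n : nrm y <= 1 -> nrm y' <= 1 ->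
  nrm (sq_iter y n - sq_iter y' n) <= n%:R * nrm (y - y').
Proof.
move=> y1 y'1; elim: n => [|n IH] /=; first by rewrite subrr nrm0 mul0r.
have bd x : nrm x <= 1 -> nrm (sq_iter x n) <= 1.
  move=> x1; apply: le_trans (sq_iter_le n x1) _.
  by have [/andP[]] := rho_iter_bound n.
move: (bd y y1) (bd y' y'1) IH; set u := sq_iter y n; set v := sq_iter y' n => u1 v1 IH.
rewrite -mulrBr nrm_rcM ger0_norm ?invr_ge0// ler_pdivrMl// -natr1.
have -> : y + u * u - (y' + v * v) = (y - y') + ((u - v) * u + v * (u - v)).
  by rewrite -sqrB; ncring.
have := nrmD (y - y') ((u - v) * u + v * (u - v)).
have := nrmD ((u - v) * u) (v * (u - v)).
have := nrmM (u - v) u; have := nrmM v (u - v).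
have := nrm_ge0 (u - v); have := nrm_ge0 u; have := nrm_ge0 v; have := nrm_ge0 (y - y').
have := ler0n R n; nra.
Qed.

(** The difference of the two fixed point equations. It is a Lipschitz bound as soon as [r < 1],
    that is, away from a vanishing root. *)
Lemma sq_lim_lip y y' r : nrm y <= 1 -> nrm y' <= 1 ->
  nrm (sq_lim y) <= r -> nrm (sq_lim y') <= r ->
  (1 - r) * nrm (sq_lim y - sq_lim y') <= nrm (y - y') / 2.
Proof.
move=> y1 y'1; have := sq_limE y1; have := sq_limE y'1.
set z := sq_lim y; set z' := sq_lim y' => e' e zr z'r.
have h : rc A 2 * (z - z') = (y - y') + ((z - z') * z + z' * (z - z')).
  by rewrite -sqrB mulrBr e e'; ncring.
have := nrm_rcM 2 (z - z'); rewrite h ger0_norm// => eq2.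
have := nrmD (y - y') ((z - z') * z + z' * (z - z')).
have := nrmD ((z - z') * z) (z' * (z - z')).
have := nrmM (z - z') z; have := nrmM z' (z - z').
have := nrm_ge0 (z - z'); have := nrm_ge0 z; have := nrm_ge0 z'.
nra.
Qed.

End SquareRoot.

(** Up to norm 1 the root is not Lipschitz, but it is within [e / 3] of an iterate whose Lipschitz
    constant is its index. *)
Lemma sq_lim_unif (R : realType) (e : R) : 0 < e -> exists2 d : R, 0 < d &
  forall (A : cstarAlg R) (y y' : A), nrm y <= 1 -> nrm y' <= 1 ->
    nrm (y - y') <= d -> nrm (sq_lim y - sq_lim y') <= e.
Proof.
move=> e0; have e3 : 0 < e / 3 by rewrite divr_gt0.
have [N hN] := inv_nat_small e3.
exists (e / 3 / N.+1%:R); first by rewrite divr_gt0// ltr0Sn.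
move=> A y y' y1 y'1; rewrite ler_pdivlMr ?ltr0Sn// => h.
have := sq_limP N y1; have := sq_limP N y'1; have := hN N (leqnn _).
have := sq_iter_lip N y1 y'1.
have := nrm_le_trans (sq_iter y N) (sq_lim y) (sq_lim y').
have := nrm_le_trans (sq_iter y' N) (sq_iter y N) (sq_lim y').
rewrite (nrmBC (sq_iter y' N)); have := nrm_ge0 (y - y').
rewrite -natr1 in h; nra.
Qed.

(** * Positive elements, absolute values and inverses *)

Section Positive.
Context (R : realType) (A : cstarAlg R).
Implicit Types (a b c d h k p q x y : A) (r s t e : R).
Local Notation rc := (rc A).
Local Notation ii := (ii A).

(** Positivity without spectra: for self-adjoint [h], the inequality says that the spectrum lies in
    [[0, 2 t]]. In this form sums of positive elements are positive at once. *)
Definition pos h := star h = h /\ exists2 t : R, 0 <= t & nrm (rc t - h) <= t.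

Lemma pos_rc t : 0 <= t -> pos (rc t).
Proof.
move=> t0; split; first exact: star_rc.
by exists t => //; rewrite subrr nrm0.
Qed.

Lemma pos0 : pos 0. Proof. by rewrite -(rc0 A); apply: pos_rc. Qed.

Lemma posD h k : pos h -> pos k -> pos (h + k).
Proof.
move=> [hs [t t0 ht]] [ks [s s0 ks']]; split; first by rewrite starD hs ks.
exists (t + s); first by rewrite addr_ge0.
have -> : rc (t + s) - (h + k) = (rc t - h) + (rc s - k) by rewrite rcD; ncring.
exact: le_trans (nrmD _ _) (lerD ht ks').
Qed.

Lemma pos_sum I (r : seq I) (P : pred I) (F : I -> A) :
  (forall i, P i -> pos (F i)) -> pos (\sum_(i <- r | P i) F i).
Proof. by move=> h; elim/big_ind: _ => [|x y|//]; [exact: pos0|exact: posD]. Qed.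

Lemma pos_scale r h : 0 <= r -> pos h -> pos (rc r * h).
Proof.
move=> r0 [hs [t t0 ht]]; split; first by rewrite starM star_rc hs rcC.
exists (r * t); first by rewrite mulr_ge0.
by rewrite rcM -mulrBr nrm_rcM ger0_norm// ler_wpM2l.
Qed.

Lemma pos_shift h t : star h = h -> nrm h <= t -> pos (rc t - h).
Proof.
move=> hs ht; split; first by rewrite starB star_rc hs.
exists t; first exact: le_trans (nrm_ge0 h) ht.
by rewrite opprB addrC subrK.
Qed.

Lemma sq_sqrt1m y : nrm y <= 1 -> (1 - sq_lim y) * (1 - sq_lim y) = 1 - y.
Proof.
move=> y1; have := sq_limE y1; rewrite rc2 => e.
have -> : (1 - sq_lim y) * (1 - sq_lim y) =
  1 - (1 + 1) * sq_lim y + sq_lim y * sq_lim y by ncring.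
by rewrite e; ncring.
Qed.

(** With [s = sqrt(1 - k^2)], which commutes with [k], the element [u = k + i s] satisfies
    [star u * u = 1]. Hence [u], and with it its imaginary part [s], has norm at most 1, and
    [1 - k^2 = s^2]. *)
Lemma sq1_pos k : star k = k -> nrm k <= 1 -> nrm (1 - k * k) <= 1.
Proof.
move=> ks k1; set y := k * k.
have y1 : nrm y <= 1 by apply: le_trans (nrmM _ _) _; rewrite mulr_ile1 ?nrm_ge0.
have ys : star y = y by rewrite starM ks.
pose s := 1 - sq_lim y.
have ss : star s = s by rewrite starB star1 sq_lim_star.
have sE : s * s = 1 - y by exact: sq_sqrt1m.
have ksC : k * s = s * k.
  by rewrite mulrBr mulrBl mulr1 mul1r sq_lim_comm// /y mulrA.
pose u := k + ii * s.
have us : star u = k - ii * s.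
  by rewrite starD starM ss ks star_ii mulrN -iiC.
have u1 : nrm u <= 1.
  rewrite -(ler_pXn2r (n := 2)) ?nnegrE ?nrm_ge0// expr1n -nrmC us.
  have -> : (k - ii * s) * u = k * k + s * s + (- (ii * ii) - 1) * (s * s).
    by rewrite /u; ccring.
  by rewrite iiM opprK subrr mul0r addr0 sE addrC subrK nrm1.
have s1 : nrm s <= 1.
  rewrite -(nrm_iiM s) -[nrm _]mulr1 -(@ler_pM2l _ 2)//.
  have -> : 2 * (nrm (ii * s) * 1) = nrm (rc 2 * (ii * s)).
    by rewrite nrm_rcM ger0_norm// mulr1.
  have -> : rc 2 * (ii * s) = u - star u by rewrite us rc2 /u; ncring.
  by apply: le_trans (nrmD _ _) _; rewrite nrmN nrm_star; lra.
by rewrite -sE; apply: le_trans (nrmM _ _) _; rewrite mulr_ile1 ?nrm_ge0.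
Qed.

Lemma sq_ball k t : star k = k -> nrm k ^+ 2 <= t -> nrm (rc t - k * k) <= t.
Proof.
move=> ks; rewrite le_eqVlt => /orP[/eqP kt|kt].
  have [k0|k0] := eqVneq (nrm k) 0.
    by rewrite -kt k0 (nrm0_eq0 k0) mulr0 expr0n /= rc0 subrr nrm0.
  pose k' := rc (nrm k)^-1 * k.
  have kk' : k = rc (nrm k) * k' by rewrite /k' rcKV.
  have k's : star k' = k' by rewrite /k' starM star_rc ks rcC.
  have k'1 : nrm k' <= 1.
    by rewrite nrm_rcM ger0_norm ?invr_ge0 ?nrm_ge0// mulVf.
  rewrite [X in X * X]kk' -kt.
  have -> : rc (nrm k) * k' * (rc (nrm k) * k') = rc (nrm k ^+ 2) * (k' * k').
    by rewrite expr2 rcM; ccring.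
  rewrite -{1}[rc _]mulr1 -mulrBr nrm_rcM ger0_norm ?exprn_ge0 ?nrm_ge0//.
  by rewrite ler_piMr ?exprn_ge0 ?nrm_ge0// sq1_pos.
have t0 : 0 < t by apply: le_lt_trans kt; rewrite exprn_ge0 ?nrm_ge0.
pose w := Num.sqrt t; have w0 : 0 < w by rewrite sqrtr_gt0.
have wE : w ^+ 2 = t by rewrite sqr_sqrtr// ltW.
pose k' := rc w^-1 * k.
have kk' : k = rc w * k' by rewrite /k' rcKV// gt_eqF.
have k's : star k' = k' by rewrite /k' starM star_rc ks rcC.
have k'1 : nrm k' <= 1.
  rewrite nrm_rcM gtr0_norm ?invr_gt0// ler_pdivrMl// mulr1.
  by rewrite -(ler_pXn2r (n := 2)) ?nnegrE ?nrm_ge0 ?ltW// wE.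
rewrite [X in X * X]kk' -wE.
have -> : rc w * k' * (rc w * k') = rc (w ^+ 2) * (k' * k').
  by rewrite expr2 rcM; ccring.
rewrite -{1}[rc _]mulr1 -mulrBr nrm_rcM gtr0_norm ?exprn_gt0//.
by rewrite wE ler_piMr ?(ltW t0)// sq1_pos.
Qed.

Lemma pos_sqr k : star k = k -> pos (k * k).
Proof.
move=> ks; split; first by rewrite starM ks.
by exists (nrm k ^+ 2); [rewrite exprn_ge0 ?nrm_ge0|exact: sq_ball].
Qed.

Lemma pos_sqrt h : pos h -> exists k, [/\ star k = k, k * k = h, pos k &
  forall c, c * h = h * c -> c * k = k * c].
Proof.
move=> [hs [t t0 ht]].
(* [t] may be 0; [T] is another witness of positivity by which one can divide. *)
pose T := t + 1; have T0 : 0 < T by rewrite /T ltr_wpDl.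
have hT : nrm (rc T - h) <= T.
  rewrite rcD rc1 addrAC; apply: le_trans (nrmD _ _) _; rewrite lerD//; exact: nrm1.
pose y := 1 - rc T^-1 * h.
have yE : y = rc T^-1 * (rc T - h).
  by rewrite mulrBr -rcM mulVf ?rc1// gt_eqF.
have y1 : nrm y <= 1.
  by rewrite yE nrm_rcM gtr0_norm ?invr_gt0// ler_pdivrMl// mulr1.
have ys : star y = y by rewrite /y starB star1 starM star_rc hs rcC.
pose w := Num.sqrt T; have w0 : 0 < w by rewrite sqrtr_gt0.
have wE : w * w = T by rewrite -expr2 sqr_sqrtr// ltW.
have ps : star (1 - sq_lim y) = 1 - sq_lim y by rewrite starB star1 sq_lim_star.
have pp : pos (1 - sq_lim y).
  split=> //; exists 1 => //; rewrite rc1 opprB addrC subrK; exact: sq_lim_le1.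
exists (rc w * (1 - sq_lim y)); split.
- by rewrite starM star_rc ps rcC.
- have -> : rc w * (1 - sq_lim y) * (rc w * (1 - sq_lim y)) =
     rc (w * w) * ((1 - sq_lim y) * (1 - sq_lim y)).
    by rewrite rcM; set z := 1 - _; ccring.
  by rewrite sq_sqrt1m// wE /y opprB addrC subrK rcKV// gt_eqF.
- by apply: pos_scale => //; exact: ltW.
- move=> c ch; have cy : c * y = y * c.
    by apply: cmB; [exact: cm1|apply: cmM => //; exact: cm_rc].
  apply: cmM; first exact: cm_rc.
  by apply: cmB; [exact: cm1|exact: sq_lim_comm].
Qed.

(** The witness of positivity can be any bound of the norm: write [h] as a square and use
    [sq_ball]. *)
Lemma pos_ball h t : pos h -> nrm h <= t -> nrm (rc t - h) <= t.
Proof.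
move=> /pos_sqrt[k [ks kE _ _]]; rewrite -kE -{1}ks nrmC; exact: sq_ball.
Qed.

(** [k] is the real part of [u = k + i l], and [star u * u = k^2 + l^2] because [k] and [l]
    commute. *)
Lemma sqrD_sa k l : star k = k -> star l = l -> k * l = l * k ->
  nrm k ^+ 2 <= nrm (k * k + l * l).
Proof.
move=> ks ls kl; pose u := k + ii * l.
have us : star u = k - ii * l by rewrite starD starM ls ks star_ii mulrN -iiC.
have uE : star u * u = k * k + l * l.
  rewrite us; have -> : (k - ii * l) * u = k * k + l * l + (- (ii * ii) - 1) * (l * l).
    by rewrite /u; ccring.
  by rewrite iiM opprK subrr mul0r addr0.
rewrite -uE nrmC ler_pXn2r ?nnegrE ?nrm_ge0//.
rewrite -(@ler_pM2l _ 2)//.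
have -> : 2 * nrm k = nrm (rc 2 * k) by rewrite nrm_rcM ger0_norm.
have -> : rc 2 * k = u + star u by rewrite us rc2 /u; ncring.
by apply: le_trans (nrmD _ _) _; rewrite nrm_star; lra.
Qed.

Lemma pos_nrm_leD h k : pos h -> pos k -> h * k = k * h -> nrm h <= nrm (h + k).
Proof.
move=> /pos_sqrt[a [sa aE _ ac]] /pos_sqrt[b [bs bE _ bc]] hk.
have ab : a * b = b * a by apply: bc; symmetry; apply: ac; rewrite hk.
by rewrite -aE -bE -{1}sa nrmC sqrD_sa.
Qed.

Lemma pos_le_nrm h t : 0 <= t -> pos h -> pos (rc t - h) -> nrm h <= t.
Proof.
move=> t0 ph pth; apply: le_trans (pos_nrm_leD ph pth _) _.
  by rewrite mulrBr mulrBl rcC.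
by rewrite addrC subrK; apply: le_trans (nrm_rc _ _) _; rewrite ger0_norm.
Qed.

Lemma pos_anti h : pos h -> pos (- h) -> h = 0.
Proof.
move=> p n; apply: nrm0_eq0; apply/eqP; rewrite eq_le nrm_ge0 andbT.
apply: le_trans (pos_nrm_leD p n _) _; first by rewrite mulrN mulNr.
by rewrite subrr nrm0.
Qed.

Lemma pos_nrm h : pos h -> pos (rc (nrm h) - h).
Proof. by move=> [hs _]; apply: pos_shift. Qed.

Lemma pos_le_trans a b c : pos (b - a) -> pos (c - b) -> pos (c - a).
Proof. by move=> ba cb; rewrite -(subrK b c) -addrA; exact: posD. Qed.

Lemma nrm_mono p q : pos p -> pos (q - p) -> nrm p <= nrm q.
Proof.
move=> pp pq; apply: pos_le_nrm => //; first exact: nrm_ge0.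
apply: (pos_le_trans pq); apply: pos_nrm.
by rewrite -(subrK p q); exact: posD.
Qed.

Lemma posM a b : pos a -> pos b -> a * b = b * a -> pos (a * b).
Proof.
move=> /pos_sqrt[k [ks kE _ kc]] /pos_sqrt[l [ls lE _ lc]] ab.
have kl : k * l = l * k by apply: lc; symmetry; apply: kc; rewrite ab.
have -> : a * b = (k * l) * (k * l) by rewrite -kE -lE; ccring.
by apply: pos_sqr; rewrite starM ks ls.
Qed.

Lemma pos_closed h : star h = h ->
  (forall e : R, 0 < e -> exists2 k, pos k & nrm (h - k) <= e) -> pos h.
Proof.
move=> hs H; split=> //; exists (nrm h + 1); first by rewrite addr_ge0 ?nrm_ge0.
apply/ler_addgt0Pr => e e0.
have m0 : 0 < Num.min e 1 by rewrite lt_min e0 ltr01.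
have [k pk] := H _ m0; rewrite le_min => /andP[ke k1].
apply: le_trans (nrm_le_trans k _ _) _; apply: lerD; last by rewrite nrmBC.
by apply: pos_ball => //; apply: le_trans (nrm_le_dist _ h) _; rewrite lerD2l nrmBC.
Qed.

Lemma neumann x : nrm (1 - x) < 1 -> exists g, [/\ g * x = 1, x * g = 1 &
  forall c, c * x = x * c -> c * g = g * c].
Proof.
set y := 1 - x => y1.
have xE : x = 1 - y by rewrite /y opprB addrC subrK.
pose r := nrm y; have r0 : 0 <= r := nrm_ge0 y.
(* Partial sums of the geometric series in [y], in Horner form. *)
pose fix u n : A := if n is m.+1 then 1 + y * u m else 0.
have uD n : u n.+1 - u n = iter n (fun a => y * a) 1.
  elim: n => [|n IH] /=; first by rewrite mulr0 addr0 subr0.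
  have -> : 1 + y * (1 + y * u n) - (1 + y * u n) = y * (u n.+1 - u n) by rewrite /=; ncring.
  by rewrite IH.
have itn n : nrm (iter n (fun a => y * a) 1) <= r ^+ n.
  elim: n => [|n IH]; first by rewrite expr0 nrm1.
  by rewrite exprS; apply: le_trans (nrmM _ _) _; rewrite ler_wpM2l.
have r1 : 0 < 1 - r by rewrite subr_gt0.
have uC (n k : nat) : nrm (u (n + k)%N - u n) <= r ^+ n / (1 - r).
  suff : nrm (u (n + k)%N - u n) <= r ^+ n * (1 - r ^+ k) / (1 - r).
    move=> h; apply: le_trans h _; rewrite ler_pM2r ?invr_gt0// ler_piMr ?exprn_ge0//.
    by rewrite gerBl exprn_ge0.
  elim: k => [|k IH]; first by rewrite addn0 subrr nrm0 expr0 subrr mulr0 mul0r.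
  rewrite addnS; apply: le_trans (nrm_le_trans (u (n + k)%N) _ _) _.
  rewrite uD; apply: le_trans (lerD (itn _) IH) _.
  rewrite -subr_ge0 [X in 0 <= X](_ : _ = 0)// exprD exprS; field.
  by rewrite gt_eqF.
have small e : 0 < e -> exists N, r ^+ N / (1 - r) <= e.
  move=> e0; have : (fun n => r ^+ n) @ \oo --> (0 : R).
    by apply: cvg_expr; rewrite ger0_norm.
  move=> /cvgrPdist_le /(_ _ (mulr_gt0 e0 r1)) [N _ /(_ N (leqnn _))] /=.
  by rewrite sub0r normrN normrX ger0_norm// => h; exists N; rewrite ler_pdivrMr.
have [e e0|g ug] := @nrm_complete _ A u.
  have [N hN] := small _ (divr_gt0 e0 (ltr0Sn R 1)); exists N => m n Nm Nn.
  apply: le_trans (nrm_le_trans (u N) _ _) _; rewrite [nrm (u N - _)]nrmBC.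
  by have := uC N (m - N)%N; have := uC N (n - N)%N; rewrite !subnKC//; lra.
have cg c : c * y = y * c -> c * g = g * c.
  move=> cy; have cu n : c * u n = u n * c.
    elim: n => [|n IH]; first by rewrite /= mulr0 mul0r.
    have -> : u n.+1 = 1 + y * u n by [].
    have -> : c * (1 + y * u n) = c + (c * y) * u n by ncring.
    have -> : (1 + y * u n) * c = c + y * (u n * c) by ncring.
    by rewrite cy -IH mulrA.
  apply: nrm_small => e e0.
  have c0 : 0 < 2 * nrm c + 1 by rewrite ltr_wpDl// mulr_ge0// nrm_ge0.
  have [N /(_ N (leqnn _))] := ug _ (divr_gt0 e0 c0).
  rewrite nrmBC => h.
  have -> : c * g - g * c = c * (g - u N) - (g - u N) * c.
    by rewrite mulrBr mulrBl cu; ncring.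
  apply: le_trans (nrmD _ _) _; rewrite nrmN.
  have := nrmM c (g - u N); have := nrmM (g - u N) c.
  rewrite ler_pdivlMr// in h; have := nrm_ge0 (g - u N); have := nrm_ge0 c; nra.
have gE : g = 1 + y * g.
  apply: nrm_small => e e0.
  have [N hN] := ug _ (divr_gt0 e0 (ltr0Sn R 1)).
  have h0 := hN N (leqnn _); have h1 := hN N.+1 (leqnSn _).
  have -> : g - (1 + y * g) = (g - u N.+1) + y * (u N - g) by rewrite /=; ncring.
  apply: le_trans (nrmD _ _) _; have := nrmM y (u N - g).
  by rewrite nrmBC in h1; have := nrm_ge0 (u N - g); rewrite -/r; nra.
have yg : y * g = g * y by apply: cg.
exists g; rewrite xE; split.
- by rewrite mulrBr mulr1 -yg {1}gE addrK.
- by rewrite mulrBl mul1r {1}gE addrK.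
- move=> c; rewrite mulrBr mulrBl mulr1 mul1r => /addrI/oppr_inj; exact: cg.
Qed.

Lemma pos_inv h e : 0 < e -> pos h -> exists g,
  [/\ pos g, g * (rc e + h) = 1, (rc e + h) * g = 1, nrm g <= e^-1 &
      forall c, c * h = h * c -> c * g = g * c].
Proof.
move=> e0 ph; have [hs [t t0 ht]] := ph.
have te : 0 < t + e by rewrite ltr_wpDl.
(* Rescaled so that [1 - x = (t - h) / (t + e)] has norm at most [t / (t + e) < 1]. *)
pose x := rc (t + e)^-1 * (rc e + h).
have [|g [gx xg gc]] := @neumann x.
  have -> : 1 - x = rc (t + e)^-1 * (rc t - h).
    have h1 : rc (t + e)^-1 * rc (t + e) = 1 by rewrite -rcM mulVf ?rc1// gt_eqF.
    by rewrite /x -[X in X - _]h1 [rc (t + e)]rcD; ncring.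
  rewrite nrm_rcM gtr0_norm ?invr_gt0// ltr_pdivrMl// mulr1.
  by apply: le_lt_trans ht _; rewrite ltrDl.
pose k := rc (t + e)^-1 * g.
have kl : k * (rc e + h) = 1 by rewrite /k rcC -mulrA.
have kr : (rc e + h) * k = 1.
  by rewrite /k mulrA -rcC.
have kc c : c * h = h * c -> c * k = k * c.
  move=> ch; have cx : c * x = x * c.
    by apply: cmM; [exact: cm_rc|apply: cmD => //; exact: cm_rc].
  by apply: cmM; [exact: cm_rc|exact: gc].
have ks : star k = k.
  have h1 : star k * (rc e + h) = 1.
    have es : star (rc e + h) = rc e + h by rewrite starD star_rc hs.
    by rewrite -es -starM kr star1.
  by rewrite -[star k]mulr1 -kr mulrA h1 mul1r.
have hk : h * k = k * h by apply: kc.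
have pk : pos k.
  have -> : k = (k * k) * (rc e + h) by rewrite -mulrA kl mulr1.
  apply: posM; [exact: pos_sqr|by apply: posD => //; apply: pos_rc; exact: ltW|].
  by rewrite -mulrA kl mulr1 mulrA kr mul1r.
exists k; split=> //.
apply: pos_le_nrm => //; first by rewrite invr_ge0 ltW.
have -> : rc e^-1 - k = rc e^-1 * (k * h).
  rewrite -[X in X - _]mulr1 -kl mulrDr mulrDr -(rcC e k) rcK ?gt_eqF//.
  by rewrite addrC addKr.
by apply: pos_scale; [rewrite invr_ge0 ltW|apply: posM].
Qed.

(** The lower bound is read off the inverse: [h - 1/m = h (m - g) / m], a product of commuting
    positive elements when [m] exceeds the norm of [g]. *)
Lemma pos_invertible_lb h g : pos h -> h * g = 1 -> g * h = 1 ->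
  exists2 e : R, 0 < e & pos (h - rc e).
Proof.
move=> ph hg gh; have [hs _] := ph.
have gs : star g = g.
  have h1 : star g * h = 1 by rewrite -{1}hs -starM hg star1.
  by rewrite -[star g]mulr1 -hg mulrA h1 mul1r.
have pg : pos g.
  have -> : g = (g * g) * h by rewrite -mulrA gh mulr1.
  by apply: posM => //; [exact: pos_sqr|rewrite -mulrA gh mulr1 mulrA hg mul1r].
pose m := nrm g + 1; have m0 : 0 < m by rewrite /m ltr_wpDl// nrm_ge0.
exists m^-1; first by rewrite invr_gt0.
have -> : h - rc m^-1 = rc m^-1 * (h * (rc m - g)).
  by rewrite mulrBr hg -rcC mulrBr rcK ?gt_eqF// mulr1.
apply: pos_scale; first by rewrite invr_ge0 ltW.
apply: posM => //; first by apply: pos_shift => //; rewrite /m lerDl.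
by rewrite mulrBr mulrBl rcC gh hg.
Qed.

Lemma sqr_eq0 k : star k = k -> k * k = 0 -> k = 0.
Proof.
move=> ks kk; apply: nrm0_eq0; apply/eqP; rewrite -sqrf_eq0 -nrmC ks kk nrm0 //.
Qed.

(** The point is that [m + d] is positive. For [w = sqrt(e^2 + d^2)], which is invertible,
    [2 (w + d) = w^-1 ((w + d)^2 + e^2)] is a sum of products of commuting positive elements, and
    [w] tends to [m] with [e]. *)
Lemma abs_exists d : star d = d -> exists m,
  [/\ pos m, m * m = d * d, pos (m - d), pos (m + d) &
      forall c, c * d = d * c -> c * m = m * c].
Proof.
move=> ds; have pd : pos (d * d) by apply: pos_sqr.
have [m [ms mE pm mc]] := pos_sqrt pd.
have mc' c : c * d = d * c -> c * m = m * c.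
  by move=> cd; apply: mc; rewrite mulrA cd -mulrA cd mulrA.
have dm : d * m = m * d by apply: mc'.
suff main (s : A) : star s = s -> s * s = d * d -> s * m = m * s -> pos (m + s).
  exists m; split=> //; last exact: main.
  by apply: main; rewrite ?starN ?ds// ?mulrNN// mulrN mulNr dm.
move=> ss sE sm; apply: pos_closed; first by rewrite starD ms ss.
move=> e e0; pose pe := rc (e ^+ 2) + d * d.
have e20 : 0 < e ^+ 2 by rewrite exprn_gt0.
have ppe : pos pe by apply: posD => //; apply: pos_rc; exact: ltW.
have [w [ws wE pw wc]] := pos_sqrt ppe.
have wm : w * m = m * w.
  by symmetry; apply: wc; rewrite /pe mulrDr mulrDl rcC -mE mulrA.
have ws' : s * w = w * s.
  by apply: wc; rewrite /pe mulrDr mulrDl rcC -sE mulrA.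
have wge : pos (w - rc e).
  have [g [pg g1 g2 _ gc]] := pos_inv e0 pw.
  have -> : w - rc e = (d * d) * g.
    have -> : d * d = (w - rc e) * (rc e + w).
      have -> : (w - rc e) * (rc e + w) = w * w - rc e * rc e by ccring.
      by rewrite wE /pe expr2 rcM addrAC subrr add0r.
    by rewrite -mulrA g2 mulr1.
  apply: posM => //; apply: gc; rewrite -mE -mulrA -wm mulrA -wm mulrA //.
have [g [pg g1 g2 gn gc]] := pos_inv e0 (posD wge pm).
have wmE : rc e + (w - rc e + m) = w + m by ncring.
rewrite wmE in g1 g2.
exists (w + s); last first.
  have -> : m + s - (w + s) = - (rc (e ^+ 2) * g).
    have -> : rc (e ^+ 2) = (w - m) * (w + m).
      have -> : (w - m) * (w + m) = w * w - m * m by ccring.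
      by rewrite wE /pe mE addrK.
    by rewrite -mulrA g2; ncring.
  rewrite nrmN nrm_rcM gtr0_norm//.
  apply: (@le_trans _ _ (e ^+ 2 * e^-1)); first by rewrite ler_pM2l.
  by rewrite expr2 mulfK ?gt_eqF.
have [f [pf f1 f2 _ fc]] := pos_inv e0 wge.
have wE' : rc e + (w - rc e) = w by ncring.
rewrite wE' in f1 f2.
have fw : w * f = f * w by rewrite f1 f2.
have fs : s * f = f * s by apply: fc; rewrite mulrBr mulrBl ws' rcC.
suff : pos (rc 2 * (w + s)).
  by move=> /(@pos_scale 2^-1); rewrite rcK ?pnatr_eq0//; apply; rewrite invr_ge0.
have -> : rc 2 * (w + s) = f * ((w + s) * (w + s)) + rc (e ^+ 2) * f.
  have -> : f * ((w + s) * (w + s)) = f * w * w + (f * w) * s + (f * w) * s + f * (s * s).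
    by ccring.
  have -> : s * s = w * w - rc (e ^+ 2) by rewrite wE /pe sE addrC addKr.
  have -> : f * (w * w - rc (e ^+ 2)) = f * w * w - rc (e ^+ 2) * f.
    by rewrite mulrBr mulrA rcC.
  by rewrite f1 mul1r rc2; ncring.
have pws : pos ((w + s) * (w + s)) by apply: pos_sqr; rewrite starD ws ss.
apply: posD; last by apply: pos_scale => //; exact: ltW.
by apply: posM => //; ccring.
Qed.

(** Let [n] be the negative part of [h] and [y = x n], so that [star y * y = - n^3]. The sum
    [star y * y + y * star y] is twice a sum of squares of self-adjoint elements, hence [y * star y]
    is positive; as the two products have the same spectrum up to 0, this forces [n^3 = 0]. *)
Lemma pos_starM x : pos (star x * x).
Proof.
set h := star x * x.
have hs : star h = h by rewrite starM starK.
have [m [pm mE pmh pmh' mc]] := abs_exists hs.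
have hm : h * m = m * h by apply: mc.
pose n := rc 2^-1 * (m - h).
have pn : pos n by apply: pos_scale => //; rewrite invr_ge0.
have ns : star n = n by case: pn.
have hn : h * n = - (n * n).
  apply: (@rc_inj _ _ 4); first by rewrite pnatr_eq0.
  have mh : m - h = rc 2 * n by rewrite /n rcKV ?pnatr_eq0.
  have -> : rc 4 = rc 2 * rc 2 by rewrite -rcM -natrM.
  have -> : rc 2 * rc 2 * - (n * n) = - ((rc 2 * n) * (rc 2 * n)) by ccring.
  have -> : rc 2 * rc 2 * (h * n) = rc 2 * h * (rc 2 * n).
    have e : rc 2 * (h * n) = h * (rc 2 * n) by rewrite mulrA (rcC 2 h) -mulrA.
    by rewrite -mulrA e mulrA.
  rewrite -mh rc2.
  have -> : (1 + 1) * h * (m - h) = - ((m - h) * (m - h)) + (m * m - h * h) by ccring.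
  by rewrite mE subrr addr0.
pose y := x * n.
have yy : star y * y = - (n * n * n).
  by rewrite /y starM ns mulrA -(mulrA n) -/h -mulrA hn mulrN mulrA.
have nh : h * n = n * h by rewrite hn -[n * h]starK starM hs ns hn starN starM ns.
have pn3 : pos (n * n * n) by apply: posM => //; [exact: pos_sqr|rewrite mulrA].
pose a := rc 2^-1 * (y + star y); pose b := rc 2^-1 * (ii * (y - star y)).
have sa : star a = a by rewrite /a starM star_rc starD starK rcC [star y + _]addrC.
have sb : star b = b.
  by rewrite /b starM star_rc starM star_ii starB starK -rcC mulrN -mulNr opprB -iiC.
have pv : pos (y * star y).
  have -> : y * star y = rc 2 * (a * a + b * b) + n * n * n.
    rewrite -[n * n * n]opprK -yy.
    apply: (@rc_inj _ _ 2); first by rewrite pnatr_eq0.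
    have a2 : y + star y = rc 2 * a by rewrite /a rcKV ?pnatr_eq0.
    have b2 : ii * (y - star y) = rc 2 * b by rewrite /b rcKV ?pnatr_eq0.
    have -> : rc 2 * (rc 2 * (a * a + b * b) - star y * y) =
       (rc 2 * a) * (rc 2 * a) + (rc 2 * b) * (rc 2 * b) - rc 2 * (star y * y).
      by rewrite !(mulrA _ (rc 2)) -!(rcC 2) rc2; ncring.
    rewrite -a2 -b2.
    have -> : ii * (y - star y) * (ii * (y - star y)) =
      ii * ii * ((y - star y) * (y - star y)).
      by rewrite mulrA -(mulrA ii) -iiC; ncring.
    by rewrite iiM rc2; ncring.
  apply: posD => //; apply: pos_scale => //.
  by apply: posD; apply: pos_sqr.
(* If [q = n^3] is not 0 and [l] is its norm, then [l - q] is not invertible, since otherwise it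
   would be bounded below and [q] would have norm less than [l]. But [l - q = l + star y * y] is
   invertible together with [l + y * star y]. *)
have y0 : n * n * n = 0.
  set q := n * n * n in pn3 yy *; apply/eqP; apply/negPn/negP => q0.
  pose l := nrm q.
  have l0 : 0 < l.
    rewrite lt_neqAle nrm_ge0 andbT eq_sym; apply/eqP => /nrm0_eq0 q0'.
    by rewrite q0' eqxx in q0.
  have [g [_ g1 g2 _ _]] := pos_inv l0 pv.
  have yyE : star y * y = - q by [].
  (* The inverse of [l + star y * y] in terms of the inverse [g] of [l + y * star y]. *)
  have e1 : (rc l - q) * (rc l^-1 * (1 - star y * (g * y))) = 1.
    rewrite -yyE mulrA -rcC -mulrA.
    have -> : (rc l + star y * y) * (1 - star y * (g * y)) =
       rc l + star y * y - star y * ((rc l + y * star y) * g) * y.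
      have := rcC l (star y * (g * y)) => e.
      rewrite mulrDr mulr1 mulrDl mulrN mulrN.
      have -> : star y * ((rc l + y * star y) * g) * y =
         (star y * rc l) * (g * y) + star y * y * (star y * (g * y)) by ncring.
      by rewrite -rcC; ncring.
    by rewrite g2 mulr1 addrK -rcM mulVf ?rc1// gt_eqF.
  have e2 : (rc l^-1 * (1 - star y * (g * y))) * (rc l - q) = 1.
    rewrite -yyE -mulrA.
    have -> : (1 - star y * (g * y)) * (rc l + star y * y) =
       rc l + star y * y - star y * (g * (rc l + y * star y)) * y.
      rewrite mulrDr mulrDl mul1r mulNr -[star y * (g * y) * rc l]rcC.
      have -> : star y * (g * (rc l + y * star y)) * y =
         star y * (g * rc l) * y + star y * (g * y) * (star y * y) by ncring.
      rewrite -(rcC l g) !mulrA -(rcC l (star y)); ncring.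
    by rewrite g1 mulr1 addrK -rcM mulVf ?rc1// gt_eqF.
  have ps : pos (rc l - q) by exact: pos_nrm.
  have [e e0 pe] := pos_invertible_lb ps e1 e2.
  pose f := Num.min e l.
  have f0 : 0 < f by rewrite lt_min e0.
  have : l <= l - f.
    apply: pos_le_nrm => //; first by rewrite subr_ge0 ge_min lexx orbT.
    have -> : rc (l - f) - q = (rc l - q - rc e) + rc (e - f) by rewrite !rcB; ncring.
    by apply: posD => //; apply: pos_rc; rewrite subr_ge0 ge_min lexx.
  by rewrite lerBrDr gerDl leNgt f0.
have n0 : n = 0.
  apply: sqr_eq0 => //; apply: sqr_eq0; first by rewrite starM ns.
  by rewrite mulrA y0 mul0r.
have mh : m = h.
  apply/eqP; rewrite -subr_eq0; apply/eqP.
  by rewrite -[m - h](rcKV (r := 2)) ?pnatr_eq0// -/n n0 mulr0.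
by rewrite -mh.
Qed.

Lemma pos_conj x h : pos h -> pos (star x * h * x).
Proof.
move=> /pos_sqrt[k [ks <- _ _]].
by have := pos_starM (k * x); rewrite starM ks !mulrA.
Qed.

End Positive.

(** * The C*-algebra M_n(A) *)

Section ColumnNorm.
Context (R : realType) (A : cstarAlg R).
Implicit Types (a b : A).

Lemma nrm_scale (k : R[i]) a : nrm (k *: a) = complex.Re `|k| * nrm a.
Proof.
rewrite /nrm normrZ -{1}(RRe_real (normr_real k)) -{1}(RRe_real (normr_real a)).
by rewrite -rmorphM.
Qed.

(** The [A]-valued inner product of the Hilbert module [A^n]. *)
Definition ip n (v w : 'cV[A]_n) : A := \sum_i star (v i 0) * w i 0.

Lemma ipE n (v w : 'cV[A]_n) : ip v w = (adjmx v *m w) 0 0.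
Proof. by rewrite mxE; apply: eq_bigr => i _; rewrite adjmxE. Qed.

Lemma ip_pos n (v : 'cV[A]_n) : pos (ip v v).
Proof. by apply: pos_sum => i _; exact: pos_starM. Qed.

Lemma ip_adj n m (T : 'M[A]_(m, n)) v w : ip (T *m v) w = ip v (adjmx T *m w).
Proof. by rewrite !ipE adjmxM mulmxA. Qed.

Lemma ip_star n (v w : 'cV[A]_n) : star (ip v w) = ip w v.
Proof.
by rewrite star_sum; apply: eq_bigr => i _; rewrite starM starK.
Qed.

Lemma ipDl n (u v w : 'cV[A]_n) : ip (u + v) w = ip u w + ip v w.
Proof. by rewrite -big_split; apply: eq_bigr => i _; rewrite mxE starD mulrDl. Qed.
Lemma ipDr n (u v w : 'cV[A]_n) : ip w (u + v) = ip w u + ip w v.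
Proof. by rewrite -big_split; apply: eq_bigr => i _; rewrite mxE mulrDr. Qed.
Lemma ipNl n (v w : 'cV[A]_n) : ip (- v) w = - ip v w.
Proof. by rewrite -sumrN; apply: eq_bigr => i _; rewrite mxE starN mulNr. Qed.
Lemma ipNr n (v w : 'cV[A]_n) : ip w (- v) = - ip w v.
Proof. by rewrite -sumrN; apply: eq_bigr => i _; rewrite mxE mulrN. Qed.

Definition colscale n (v : 'cV[A]_n) a : 'cV[A]_n := \col_i (v i 0 * a).

Lemma ip_scaler n (v w : 'cV[A]_n) a : ip w (colscale v a) = ip w v * a.
Proof. by rewrite mulr_suml; apply: eq_bigr => i _; rewrite mxE mulrA. Qed.
Lemma ip_scalel n (v w : 'cV[A]_n) a : ip (colscale v a) w = star a * ip v w.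
Proof. by rewrite -[LHS]starK ip_star ip_scaler starM ip_star. Qed.

Definition vn n (v : 'cV[A]_n) : R := Num.sqrt (nrm (ip v v)).

Lemma vn_ge0 n (v : 'cV[A]_n) : 0 <= vn v. Proof. exact: sqrtr_ge0. Qed.
Lemma vn2 n (v : 'cV[A]_n) : vn v ^+ 2 = nrm (ip v v).
Proof. by rewrite sqr_sqrtr// nrm_ge0. Qed.

(** Expand the square of [w - v (s a)]. The real number [s] with [s N <= 1] replaces the inverse of
    [ip v v], which need not exist. *)
Lemma cauchy_schwarz n (v w : 'cV[A]_n) : nrm (ip v w) <= vn v * vn w.
Proof.
set a := ip v w; set N := nrm (ip v v); set W := nrm (ip w w).
have N0 : 0 <= N := nrm_ge0 _; have W0 : 0 <= W := nrm_ge0 _.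
have main s : 0 <= s -> s * N <= 1 -> s * nrm a ^+ 2 <= W.
  move=> s0 sN.
  have aa : pos (star a * a) by exact: pos_starM.
  have -> : s * nrm a ^+ 2 = nrm (rc A s * (star a * a)).
    by rewrite nrm_rcM ger0_norm// nrmC.
  apply: nrm_mono; first exact: pos_scale.
  have h1 := ip_pos (w - colscale v (rc A s * a)).
  have h2 : pos (rc A s * (star a * (1 - rc A s * ip v v) * a)).
    apply: pos_scale => //; apply: pos_conj; rewrite -(rc1 A).
    apply: pos_shift.
      by rewrite starM star_rc; case: (ip_pos v) => -> _; rewrite rcC.
    by rewrite nrm_rcM ger0_norm.
  have -> : ip w w - rc A s * (star a * a) = ip (w - colscale v (rc A s * a))
       (w - colscale v (rc A s * a)) + rc A s * (star a * (1 - rc A s * ip v v) * a).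
    rewrite !(ipDl, ipDr, ipNl, ipNr) !ip_scaler !ip_scalel -/a.
    have -> : ip w v = star a by rewrite ip_star.
    rewrite starM star_rc; set S := rc A s; set b := star a; set z := ip v v.
    have cS x : x * S = S * x by rewrite rcC.
    have -> : b * (S * a) = S * b * a by rewrite mulrA cS.
    have -> : b * S * z * (S * a) = S * (S * b * z * a).
      by rewrite cS -!mulrA; congr (_ * _); rewrite (mulrA z) cS !mulrA cS.
    have -> : S * (b * (1 - S * z) * a) = S * b * a - S * (b * S * z * a) by ncring.
    by rewrite cS; ncring.
  exact: posD.
rewrite -(ler_pXn2r (n := 2)) ?nnegrE ?mulr_ge0 ?vn_ge0 ?nrm_ge0// exprMn !vn2 -/N -/W.
have [N00|N00] := eqVneq N 0; last first.
  have N1 : 0 < N by rewrite lt_neqAle eq_sym N00.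
  have := main N^-1; rewrite mulVf// lexx invr_ge0 => /(_ N0 isT).
  by rewrite ler_pdivrMl.
have [->|a0] := eqVneq (nrm a) 0; first by rewrite expr0n mulr_ge0.
have a1 : 0 < nrm a ^+ 2 by rewrite exprn_gt0// lt_neqAle eq_sym a0 nrm_ge0.
(* If [N = 0] every [s >= 0] is allowed, and this one would give [W + 1 <= W]. *)
have s0 : 0 <= (W + 1) / nrm a ^+ 2 by rewrite divr_ge0 ?addr_ge0 ?exprn_ge0 ?nrm_ge0.
have := main _ s0; rewrite N00 mulr0 ler01 divfK ?gt_eqF// => /(_ isT); lra.
Qed.

Lemma vnD n (v w : 'cV[A]_n) : vn (v + w) <= vn v + vn w.
Proof.
rewrite -(ler_pXn2r (n := 2)) ?nnegrE ?addr_ge0 ?vn_ge0// vn2.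
rewrite ipDl !ipDr; apply: le_trans (nrmD _ _) _.
have := nrmD (ip v v) (ip v w); have := nrmD (ip w v) (ip w w).
have := cauchy_schwarz v w; have := cauchy_schwarz w v; rewrite -!vn2; nra.
Qed.

Lemma vn0 n : vn (0 : 'cV[A]_n) = 0.
Proof.
rewrite /vn /ip big1 ?nrm0 ?sqrtr0// => i _.
by rewrite mxE mulr0.
Qed.

Lemma vn_entry n (v : 'cV[A]_n) i : nrm (v i 0) <= vn v.
Proof.
rewrite -(ler_pXn2r (n := 2)) ?nnegrE ?vn_ge0 ?nrm_ge0// vn2 -nrmC.
apply: nrm_mono; first exact: pos_starM.
rewrite /ip (bigD1 i)//= addrC addrK.
by apply: pos_sum => j _; exact: pos_starM.
Qed.

Lemma sum_sqr_le (I : finType) (f : I -> R) : (forall i, 0 <= f i) ->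
  \sum_i f i ^+ 2 <= (\sum_i f i) ^+ 2.
Proof.
move=> f0; rewrite expr2 mulr_suml ler_sum// => i _.
rewrite expr2 ler_wpM2l// (bigD1 i)//= lerDl sumr_ge0//.
Qed.

Lemma vn_le_sum n (v : 'cV[A]_n) : vn v <= \sum_i nrm (v i 0).
Proof.
have s0 : 0 <= \sum_i nrm (v i 0) by apply: sumr_ge0 => i _; exact: nrm_ge0.
rewrite -(ler_pXn2r (n := 2)) ?nnegrE ?vn_ge0// vn2.
apply: le_trans (nrm_sum _ _ _) _.
rewrite (eq_bigr (fun i => nrm (v i 0) ^+ 2)); last by move=> i _; rewrite nrmC.
by apply: sum_sqr_le => i; exact: nrm_ge0.
Qed.

Definition mxsum n m (T : 'M[A]_(m, n)) : R := \sum_i \sum_j nrm (T i j).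

Lemma mxsum_ge0 n m (T : 'M[A]_(m, n)) : 0 <= mxsum T.
Proof. by apply: sumr_ge0 => i _; apply: sumr_ge0 => j _; exact: nrm_ge0. Qed.

Lemma vn_mul_le n m (T : 'M[A]_(m, n)) v : vn (T *m v) <= mxsum T * vn v.
Proof.
apply: le_trans (vn_le_sum _) _; rewrite mulr_suml ler_sum// => i _.
rewrite mxE mulr_suml; apply: le_trans (nrm_sum _ _ _) _.
apply: ler_sum => j _; apply: le_trans (nrmM _ _) _.
by rewrite ler_wpM2l ?nrm_ge0// vn_entry.
Qed.

Lemma vn_scale n (v : 'cV[A]_n) (r : R) : vn (colscale v (rc A r)) = `|r| * vn v.
Proof.
rewrite /vn ip_scaler ip_scalel star_rc -mulrA -rcC nrm_rcM nrm_rcM mulrA.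
by rewrite -expr2 sqrtrM ?exprn_ge0// sqrtr_sqr normr_id.
Qed.

Lemma mulmx_colscale n m (T : 'M[A]_(m, n)) v a :
  T *m colscale v a = colscale (T *m v) a.
Proof.
apply/matrixP => i j; rewrite !mxE mulr_suml; apply: eq_bigr => k _.
by rewrite !mxE mulrA.
Qed.

(** The operator norm on the Hilbert module [A^n]; it yields the C*-norm of [M_n(A)] without
    representing [A] on a Hilbert space. *)
Definition mn n m (T : 'M[A]_(m, n)) : R :=
  sup [set vn (T *m v) | v in [set v : 'cV[A]_n | vn v <= 1]].

Lemma mn_hassup n m (T : 'M[A]_(m, n)) :
  has_sup [set vn (T *m v) | v in [set v : 'cV[A]_n | vn v <= 1]].
Proof.
split; first by exists (vn (T *m 0)), 0 => //=; rewrite vn0 ler01.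
exists (mxsum T) => _ [v /= v1 <-]; apply: le_trans (vn_mul_le _ _) _.
by rewrite ler_piMr ?mxsum_ge0.
Qed.

Lemma mnP n m (T : 'M[A]_(m, n)) v : vn (T *m v) <= mn T * vn v.
Proof.
have [v0|v0] := eqVneq (vn v) 0.
  by rewrite v0 mulr0; have := vn_mul_le T v; rewrite v0 mulr0.
have v1 : 0 < vn v by rewrite lt_neqAle eq_sym v0 vn_ge0.
have h : vn (T *m colscale v (rc A (vn v)^-1)) <= mn T.
  apply: ub_le_sup; first by case: (mn_hassup T).
  exists (colscale v (rc A (vn v)^-1)) => //=.
  by rewrite vn_scale ger0_norm ?invr_ge0 ?vn_ge0// mulVf.
move: h; rewrite mulmx_colscale vn_scale ger0_norm ?invr_ge0 ?vn_ge0//.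
by rewrite ler_pdivrMl// mulrC.
Qed.

Lemma mn_le n m (T : 'M[A]_(m, n)) c : 0 <= c ->
  (forall v, vn (T *m v) <= c * vn v) -> mn T <= c.
Proof.
move=> c0 h; apply: ge_sup; first by case: (mn_hassup T).
by move=> _ [v /= v1 <-]; apply: le_trans (h v) _; rewrite ler_piMr.
Qed.

Lemma mn_ge0 n m (T : 'M[A]_(m, n)) : 0 <= mn T.
Proof.
apply: le_trans (vn_ge0 (T *m 0)) _; apply: ub_le_sup; first by case: (mn_hassup T).
by exists 0 => //=; rewrite vn0 ler01.
Qed.

Lemma mn_le_mxsum n m (T : 'M[A]_(m, n)) : mn T <= mxsum T.
Proof. by apply: mn_le => [|v]; [exact: mxsum_ge0|exact: vn_mul_le]. Qed.

Lemma mnD n m (S T : 'M[A]_(m, n)) : mn (S + T) <= mn S + mn T.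
Proof.
apply: mn_le => [|v]; first by rewrite addr_ge0 ?mn_ge0.
by rewrite mulmxDl (le_trans (vnD _ _))// mulrDl lerD ?mnP.
Qed.

Lemma mnM n m p (S : 'M[A]_(m, n)) (T : 'M[A]_(n, p)) : mn (S *m T) <= mn S * mn T.
Proof.
apply: mn_le => [|v]; first by rewrite mulr_ge0 ?mn_ge0.
rewrite -mulmxA; apply: le_trans (mnP _ _) _.
by rewrite -mulrA ler_wpM2l ?mn_ge0// mnP.
Qed.

Lemma vn_delta n (j : 'I_n) : vn (delta_mx j 0 : 'cV[A]_n) <= 1.
Proof.
apply: le_trans (vn_le_sum _) _; rewrite (bigD1 j)//= big1 ?addr0.
  by rewrite mxE !eqxx nrm1.
by move=> i /negPf ij; rewrite mxE ij nrm0.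
Qed.

Lemma mn_entry n m (T : 'M[A]_(m, n)) i j : nrm (T i j) <= mn T.
Proof.
have := vn_entry (T *m delta_mx j 0) i.
rewrite mxE (bigD1 j)//= big1 ?addr0 => [|k /negPf kj]; last first.
  by rewrite mxE kj mulr0.
rewrite mxE !eqxx mulr1 => h; apply: le_trans h _; apply: le_trans (mnP _ _) _.
by rewrite ler_piMr ?mn_ge0 ?vn_delta.
Qed.

Lemma mn_adj_le n m (T : 'M[A]_(m, n)) : mn (adjmx T) <= mn T.
Proof.
apply: mn_le => [|v]; first exact: mn_ge0.
have [->|v0] := eqVneq (vn (adjmx T *m v)) 0; first by rewrite mulr_ge0 ?mn_ge0 ?vn_ge0.
rewrite -(ler_pM2r (x := vn (adjmx T *m v))) ?lt_neqAle ?[0 == _]eq_sym ?v0 ?vn_ge0//.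
rewrite -expr2 vn2 ip_adj adjmxK; apply: le_trans (cauchy_schwarz _ _) _.
by rewrite mulrAC mulrC ler_wpM2r ?vn_ge0// mnP.
Qed.

Lemma mn_star n (T : 'M[A]_n) : mn (adjmx T *m T) = mn T ^+ 2.
Proof.
apply/eqP; rewrite eq_le; apply/andP; split.
  by rewrite expr2; apply: le_trans (mnM _ _) _; rewrite ler_wpM2r ?mn_ge0// mn_adj_le.
have s0 : 0 <= Num.sqrt (mn (adjmx T *m T)) by exact: sqrtr_ge0.
rewrite -[leRHS]sqr_sqrtr ?mn_ge0// ler_pXn2r ?nnegrE ?mn_ge0//.
apply: mn_le => // v.
rewrite -(ler_pXn2r (n := 2)) ?nnegrE ?mulr_ge0 ?vn_ge0// exprMn (sqr_sqrtr (mn_ge0 _)).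
rewrite vn2 ip_adj; apply: le_trans (cauchy_schwarz _ _) _.
by rewrite expr2 mulrA mulrC ler_wpM2r ?vn_ge0// mulmxA mnP.
Qed.

Lemma mn0_eq0 n m (T : 'M[A]_(m, n)) : mn T = 0 -> T = 0.
Proof.
move=> h; apply/matrixP => i j; rewrite mxE; apply: nrm0_eq0.
by apply/eqP; rewrite eq_le nrm_ge0 -h mn_entry.
Qed.

Definition mxscale n m (k : R[i]) (T : 'M[A]_(m, n)) : 'M[A]_(m, n) :=
  map_mx (fun a : A => k *: a) T.

Lemma vn_mxscale n (k : R[i]) (v : 'cV[A]_n) :
  vn (mxscale k v) = complex.Re `|k| * vn v.
Proof.
have k0 : 0 <= complex.Re `|k| by rewrite -lecR RRe_real ?normr_real// normr_ge0.
apply/eqP; rewrite -(@eqrXn2 _ 2)// ?mulr_ge0 ?vn_ge0// exprMn !vn2.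
have -> : ip (mxscale k v) (mxscale k v) = (k^* * k) *: ip v v.
  rewrite scaler_sumr; apply: eq_bigr => i _.
  by rewrite !mxE starZ -scaleAlc -scaleArc scalerA.
rewrite nrm_scale; apply/eqP; congr (_ * _).
have -> : `|k^* * k| = (`|k| ^+ 2) by rewrite normrM norm_conjC expr2.
by rewrite -{1}(RRe_real (normr_real k)) -rmorphXn.
Qed.

Lemma mxscale_mul n m p k (S : 'M[A]_(m, n)) (T : 'M[A]_(n, p)) :
  mxscale k (S *m T) = mxscale k S *m T.
Proof.
apply/matrixP => i j; rewrite !mxE scaler_sumr; apply: eq_bigr => l _.
by rewrite mxE scaleAlc.
Qed.

Lemma mxscale_mulr n m p k (S : 'M[A]_(m, n)) (T : 'M[A]_(n, p)) :
  mxscale k (S *m T) = S *m mxscale k T.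
Proof.
apply/matrixP => i j; rewrite !mxE scaler_sumr; apply: eq_bigr => l _.
by rewrite mxE scaleArc.
Qed.

Lemma mn_mxscale n m (k : R[i]) (T : 'M[A]_(m, n)) :
  mn (mxscale k T) = complex.Re `|k| * mn T.
Proof.
have k0 c : 0 <= complex.Re `|c : R[i]|.
  by rewrite -lecR RRe_real ?normr_real// normr_ge0.
have le c (S : 'M[A]_(m, n)) : mn (mxscale c S) <= complex.Re `|c| * mn S.
  apply: mn_le => [|v]; first by rewrite mulr_ge0 ?mn_ge0.
  by rewrite -mxscale_mul vn_mxscale -mulrA ler_wpM2l// mnP.
apply/eqP; rewrite eq_le le andTb.
have [->|kn] := eqVneq k 0.
  by rewrite normr0 mul0r mn_ge0.
have kp : 0 < complex.Re `|k| by rewrite -ltcR RRe_real ?normr_real// normr_gt0.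
rewrite -ler_pdivlMl//; have := le k^-1 (mxscale k T).
have -> : mxscale k^-1 (mxscale k T) = T.
  by apply/matrixP => i j; rewrite !mxE scalerA mulVf// scale1r.
suff -> : complex.Re `|k^-1| = (complex.Re `|k|)^-1 by [].
rewrite normfV -{1}(RRe_real (normr_real k)) -fmorphV //.
Qed.

End ColumnNorm.

(** An alias, so that the operator norm does not compete with the entrywise uniform structure
    carried by matrices. *)
Definition mxcar (R : realType) (A : cstarAlg R) (n : nat) : Type := 'M[A]_n.

Section MatrixAlgebra.
Context (R : realType) (A : cstarAlg R) (n : nat).
Local Notation V := (mxcar A n).

HB.instance Definition _ := GRing.Zmodule.copy V 'M[A]_n.

Let mxscaleA (k l : R[i]) (T : V) : mxscale k (mxscale l T) = mxscale (k * l) T.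
Proof. by apply/matrixP => i j; rewrite !mxE scalerA. Qed.
Let mxscale1 : left_id 1 (@mxscale R A n n).
Proof. by move=> T; apply/matrixP => i j; rewrite !mxE scale1r. Qed.
Let mxscaleDr : right_distributive (@mxscale R A n n) +%R.
Proof. by move=> k S T; apply/matrixP => i j; rewrite !mxE scalerDr. Qed.
Let mxscaleDl (T : V) : {morph (@mxscale R A n n)^~ T : k l / k + l}.
Proof. by move=> k l; apply/matrixP => i j; rewrite !mxE scalerDl. Qed.

HB.instance Definition _ := GRing.Zmodule_isLmodule.Build R[i] V
  mxscaleA mxscale1 mxscaleDr mxscaleDl.

Let mxnorm (T : V) : R[i] := (mn (T : 'M[A]_n))%:C.

Let mxnormD (S T : V) : mxnorm (S + T) <= mxnorm S + mxnorm T.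
Proof. by rewrite /mxnorm -rmorphD lecR; exact: mnD. Qed.
Let mxnormZ (k : R[i]) (T : V) : mxnorm (k *: T) = `|k| * mxnorm T.
Proof.
rewrite /mxnorm -[in RHS](RRe_real (normr_real k)) -rmorphM /=; congr (_%:C).
exact: mn_mxscale.
Qed.
Let mxnorm0 (T : V) : mxnorm T = 0 -> T = 0.
Proof. by move=> /(congr1 (@complex.Re R)) /= h; apply: mn0_eq0. Qed.

HB.instance Definition _ := Lmodule_isNormed.Build R[i] V mxnormD mxnormZ mxnorm0.

Lemma mxcar_normE (T : V) : `|T| = (mn (T : 'M[A]_n))%:C.
Proof. by []. Qed.

Let mx_complete (F : set_system V) : ProperFilter F -> cauchy F -> cvg F.
Proof.
move=> FF FC.
have ent i j : cvg ((fun T : V => (T : 'M[A]_n) i j) @ F).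
  apply/cauchy_cvgP/cauchy_ballP => e e0.
  have /cauchy_ballP/(_ e e0) [[P Q] /= [FP FQ] PQ] := FC.
  rewrite near_map2; exists (P, Q) => //= -[S T] /PQ /=.
  rewrite -!ball_normE /= mxcar_normE => h; apply: le_lt_trans h.
  rewrite nrm_le; have := mn_entry ((S : 'M[A]_n) - T) i j.
  by rewrite !mxE.
pose L : 'M[A]_n := \matrix_(i, j) lim ((fun T : V => (T : 'M[A]_n) i j) @ F).
apply/cvg_ex; exists (L : V); apply/cvgrPdist_lt => e e0.
have er : e \is Num.real by exact: gtr0_real.
have er0 : 0 < complex.Re e by rewrite -ltcR RRe_real.
pose d : R := complex.Re e / (n * n).+1%:R.
have d0 : 0 < d by rewrite divr_gt0 ?ltr0Sn.
have dc : 0 < d%:C by rewrite ltcR.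
have H : \forall T \near F, forall i j, nrm (L i j - (T : 'M[A]_n) i j) < d.
  apply: filter_forall => i; apply: filter_forall => j.
  have /cvgrPdist_lt/(_ _ dc) := ent i j.
  by apply: filterS => T /=; rewrite nrmE ltcR mxE.
apply: filterS H => T H; rewrite mxcar_normE -(RRe_real er) ltcR.
apply: le_lt_trans (mn_le_mxsum _) _.
apply: (@le_lt_trans _ _ (\sum_(i < n) \sum_(j < n) d)).
  by apply: ler_sum => i _; apply: ler_sum => j _; rewrite !mxE ltW//; have := H i j; rewrite mxE.
rewrite !sumr_const !card_ord -!mulrnA -mulr_natr /d.
by rewrite mulrAC ltr_pdivrMr ?ltr0Sn// ltr_pM2l// ltr_nat.
Qed.

HB.instance Definition _ := Uniform_isComplete.Build V mx_complete.

End MatrixAlgebra.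

Section MatrixCstar.
Context (R : realType) (A : cstarAlg R) (n : nat).
Implicit Types S T : 'M[A]_n.

Let mxmulA : associative (fun S T : mxcar A n => (S : 'M[A]_n) *m T : mxcar A n).
Proof. by move=> *; exact: mulmxA. Qed.
Let mxmul1l : left_id (1%:M : mxcar A n) (fun S T : mxcar A n => (S : 'M[A]_n) *m T).
Proof. by move=> *; exact: mul1mx. Qed.
Let mxmul1r : right_id (1%:M : mxcar A n) (fun S T : mxcar A n => (S : 'M[A]_n) *m T).
Proof. by move=> *; exact: mulmx1. Qed.
Let mxmulDl : left_distributive (fun S T : mxcar A n => (S : 'M[A]_n) *m T : mxcar A n) +%R.
Proof. by move=> *; exact: mulmxDl. Qed.
Let mxmulDr : right_distributive (fun S T : mxcar A n => (S : 'M[A]_n) *m T : mxcar A n) +%R.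
Proof. by move=> *; exact: mulmxDr. Qed.
Let mxadjD : {morph (fun T : mxcar A n => adjmx (T : 'M[A]_n) : mxcar A n) : S T / S + T}.
Proof. by move=> S T; apply/matrixP => i j; rewrite !mxE starD. Qed.
Let mxadjZ (k : R[i]) (T : mxcar A n) :
  adjmx (k *: T : mxcar A n) = k^* *: (adjmx (T : 'M[A]_n) : mxcar A n).
Proof. by apply/matrixP => i j; rewrite !mxE starZ. Qed.
Let mxnormM (S T : mxcar A n) :
  `|((S : 'M[A]_n) *m T : mxcar A n)| <= `|S| * `|T|.
Proof. by rewrite !mxcar_normE -rmorphM lecR mnM. Qed.
Let mxnormC (T : mxcar A n) :
  `|(adjmx (T : 'M[A]_n) *m (T : 'M[A]_n) : mxcar A n)| = `|T| ^+ 2.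
Proof. by rewrite !mxcar_normE -rmorphXn mn_star. Qed.

Definition mxC : cstarAlg R := @CstarAlg R (mxcar A n) _ (1%:M : 'M[A]_n)
  (fun T => adjmx (T : 'M[A]_n)) mxmulA mxmul1l mxmul1r mxmulDl mxmulDr
  (fun k S T => @mxscale_mul R A n n n k S T)
  (fun k S T => @mxscale_mulr R A n n n k S T)
  (fun T => @adjmxK R A n n T) mxadjD mxadjZ
  (fun S T => @adjmxM R A n n n S T) mxnormM mxnormC.

Lemma nrm_mxC T : nrm (T : mxC) = mn T. Proof. by []. Qed.
Lemma mul_mxC S T : (S : mxC) * (T : mxC) = S *m T. Proof. by []. Qed.
Lemma star_mxC T : star (T : mxC) = adjmx T. Proof. by []. Qed.

End MatrixCstar.

(** * Topology of matrices and components of GL_n *)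

Section Topology.
Context (R : realType) (A : cstarAlg R).

Lemma nbhs_mxP m n (T0 : 'M[A]_(m, n)) (P : set 'M[A]_(m, n)) :
  nbhs T0 P <-> exists2 e : R, 0 < e &
    forall T : 'M[A]_(m, n), (forall i j, nrm (T i j - T0 i j) < e) -> P T.
Proof.
split=> [/nbhs_ballP [e /= e0 eP]|[e e0 eP]].
  have er : e \is Num.real by exact: gtr0_real.
  exists (complex.Re e); first by rewrite -ltcR RRe_real.
  move=> T TT; apply: eP; split=> // i j; rewrite -ball_normE /= distrC nrmE.
  by rewrite -(RRe_real er) ltcR.
apply/nbhs_ballP; exists e%:C; first by rewrite /= ltcR.
move=> T [_ TT]; apply: eP => i j; have := TT i j.
by rewrite -ball_normE /= distrC nrmE ltcR.
Qed.

Lemma nbhs_mnP m n (T0 : 'M[A]_(m, n)) (P : set 'M[A]_(m, n)) :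
  nbhs T0 P <-> exists2 e : R, 0 < e & forall T, mn (T - T0) < e -> P T.
Proof.
rewrite nbhs_mxP; split=> [[e e0 eP]|[e e0 eP]].
  exists e => // T Te; apply: eP => i j; apply: le_lt_trans Te.
  by have := mn_entry (T - T0) i j; rewrite !mxE.
pose d : R := e / (m * n).+1%:R.
have d0 : 0 < d by rewrite divr_gt0 ?ltr0Sn.
exists d => // T Td; apply: eP; apply: le_lt_trans (mn_le_mxsum _) _.
apply: (@le_lt_trans _ _ (\sum_(i < m) \sum_(j < n) d)).
  by apply: ler_sum => i _; apply: ler_sum => j _; rewrite !mxE ltW.
rewrite !sumr_const !card_ord -!mulrnA -mulr_natr /d.
by rewrite mulrAC ltr_pdivrMr ?ltr0Sn// ltr_pM2l// ltr_nat mulnC.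
Qed.

Definition linpath m n (S T : 'M[A]_(m, n)) (t : R) : 'M[A]_(m, n) :=
  S + mxscale t%:C T.

Lemma linpathE m n (S T : 'M[A]_(m, n)) t i j :
  linpath S T t i j = S i j + rc A t * T i j.
Proof. by rewrite !mxE rcE. Qed.

Lemma linpath_mulr m n p (Q : 'M[A]_(n, p)) (S T : 'M[A]_(m, n)) t :
  linpath S T t *m Q = linpath (S *m Q) (T *m Q) t.
Proof. by rewrite /linpath mulmxDl mxscale_mul. Qed.

Lemma linpath0 m n (S T : 'M[A]_(m, n)) : linpath S T 0 = S.
Proof. by apply/matrixP => i j; rewrite linpathE rc0 mul0r addr0. Qed.

Lemma linpath1 m n (S T : 'M[A]_(m, n)) : linpath S T 1 = S + T.
Proof. by apply/matrixP => i j; rewrite linpathE rc1 mul1r mxE. Qed.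

Lemma linpath_continuous m n (S T : 'M[A]_(m, n)) : continuous (linpath S T).
Proof.
move=> t P /nbhs_mxP[e e0 eP].
have m0 : 0 < mn T + 1 by rewrite ltr_wpDl// mn_ge0.
apply/nbhs_ballP; exists (e / (mn T + 1)); first by rewrite /= divr_gt0.
move=> s; rewrite -ball_normE /= distrC => st; apply: eP => i j; rewrite !linpathE.
have -> : S i j + rc A s * T i j - (S i j + rc A t * T i j) = rc A (s - t) * T i j.
  by rewrite rcB; ncring.
rewrite nrm_rcM; rewrite ltr_pdivlMr// in st; apply: le_lt_trans st.
by rewrite ler_wpM2l// (le_trans (mn_entry T i j))// lerDl.
Qed.

End Topology.

(** Connectedness as an induction principle: the class of [x] has open interior and complement. It
    takes the place of paths, since [U0] and [glc] are connected components and not path components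
    by definition. *)
Lemma locally_constant (T : topologicalType) (D : set T) (r : T -> T -> Prop) :
  connected D -> (forall x y, r x y -> r y x) ->
  (forall x y z, r x y -> r y z -> r x z) ->
  (forall d, D d -> nbhs d [set d' | D d' -> r d d']) ->
  forall x y, D x -> D y -> r x y.
Proof.
move=> cD rs rt rl x y Dx Dy.
have rxx z : D z -> r z z by move=> Dz; exact: (nbhs_singleton (rl z Dz)).
pose E := [set d | D d -> r x d]; pose E' := [set d | D d -> ~ r x d].
suff : D `&` E^° = D by move=> h; rewrite -h in Dy; case: Dy => Dy /nbhs_singleton/(_ Dy).
apply: cD.
- exists x; split=> //; have := rl x Dx; apply: filterS => d h Dd; exact: h.
- by exists E^°; first exact: open_interior.
- exists (~` (E'^°)); first by rewrite closedC; exact: open_interior.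
  rewrite eqEsubset; split=> d [Dd].
    move=> /nbhs_singleton/(_ Dd) xd; split=> // /nbhs_singleton/(_ Dd); exact.
  move=> nE; split=> //.
  have [xd|nxd] := pselect (r x d).
    by have := rl d Dd; apply: filterS => e h De; apply: rt xd (h De).
  exfalso; apply: nE; have := rl d Dd; apply: filterS => e h De xe.
  by apply: nxd; apply: rt xe (rs _ _ (h De)).
Qed.

Section GL.
Context (R : realType) (A : cstarAlg R).

Definition glmx n (T : 'M[A]_n) := exists S, T *m S = 1%:M /\ S *m T = 1%:M.

(** Components of GL_n: unlike those of U_n they are stable under small perturbations and elementary
    operations. [glc_U0] and [U0_glc] compare the two. *)
Definition glc n : 'M[A]_n -> set 'M[A]_n := connected_component (@glmx n).

Lemma glmx1 n : glmx (1%:M : 'M[A]_n).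
Proof. by exists 1%:M; rewrite mulmx1. Qed.

Lemma glmxM n (S T : 'M[A]_n) : glmx S -> glmx T -> glmx (S *m T).
Proof.
move=> [S' [s1 s2]] [T' [t1 t2]]; exists (T' *m S'); split.
  by rewrite mulmxA -(mulmxA S) t1 mulmx1.
by rewrite mulmxA -(mulmxA T') s2 mulmx1.
Qed.

Lemma unitary_glmx n (u : 'M[A]_n) : is_unitarymx u -> glmx u.
Proof. by move=> /andP[/eqP h1 /eqP h2]; exists (adjmx u). Qed.

(** Neumann series invert both [S' T] and [T S']; the resulting left and right inverses of [T]
    coincide. *)
Lemma glmx_near n (S S' T : 'M[A]_n) : S *m S' = 1%:M -> S' *m S = 1%:M ->
  mn (T - S) * mn S' < 1 -> glmx T.
Proof.
move=> h1 h2 h.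
have hl : nrm (1 - (S' *m T : mxC A n)) < 1.
  apply: le_lt_trans h; rewrite mulrC.
  have -> : 1 - (S' *m T : mxC A n) = (S' *m (S - T) : mxC A n).
    by rewrite mulmxBr h2.
  by apply: le_trans (mnM _ _) _; rewrite -(nrm_mxC (T - S)) -nrm_mxC nrmBC.
have hr : nrm (1 - (T *m S' : mxC A n)) < 1.
  apply: le_lt_trans h.
  have -> : 1 - (T *m S' : mxC A n) = ((S - T) *m S' : mxC A n).
    by rewrite mulmxBl h1.
  by apply: le_trans (mnM _ _) _; rewrite -(nrm_mxC (T - S)) -nrm_mxC nrmBC.
have [X [X1 _ _]] := neumann hl; have [Y [_ Y2 _]] := neumann hr.
have e1 : (X *m S') *m T = 1%:M by rewrite -mulmxA; exact: X1.
have e2 : T *m (S' *m Y) = 1%:M by rewrite mulmxA; exact: Y2.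
exists (X *m S'); split=> //.
suff -> : X *m S' = S' *m Y by [].
by rewrite -[LHS]mulmx1 -e2 mulmxA e1 mul1mx.
Qed.

Lemma glc_refl n (T : 'M[A]_n) : glmx T -> glc T T.
Proof. exact: connected_component_refl. Qed.
Lemma glc_sym n (S T : 'M[A]_n) : glc S T -> glc T S.
Proof. exact: connected_component_sym. Qed.
Lemma glc_trans n (S T Q : 'M[A]_n) : glc S T -> glc T Q -> glc S Q.
Proof. exact: connected_component_trans. Qed.
Lemma glc_glmx n (S T : 'M[A]_n) : glc S T -> glmx T.
Proof. exact: connected_component_sub. Qed.

Lemma glc_map n m (f : 'M[A]_n -> 'M[A]_m) (S T : 'M[A]_n) :
  continuous f -> (forall u, glmx u -> glmx (f u)) -> glc S T -> glc (f S) (f T).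
Proof.
move=> cf fU [C [Cx CU Cc] Cy].
exists (f @` C); last by exists T.
split; first by exists S.
- by move=> _ [u Cu <-]; apply: fU; exact: CU.
- by apply: connected_continuous_connected => //; exact: continuous_subspaceT.
Qed.

Lemma glc_mull n (w S T : 'M[A]_n) : glmx w -> glc S T -> glc (w *m S) (w *m T).
Proof.
move=> gw; apply: (@glc_map _ _ (mulmx w)); first exact: mulmx_continuousl.
by move=> u; exact: glmxM.
Qed.

Lemma glc_mulr n (w S T : 'M[A]_n) : glmx w -> glc S T -> glc (S *m w) (T *m w).
Proof.
move=> gw; apply: (@glc_map _ _ (fun v => v *m w)); first exact: mulmx_continuousr.
by move=> u gu; exact: glmxM.
Qed.

Lemma glc_linpath n (S T : 'M[A]_n) :
  (forall t, 0 <= t <= 1 -> glmx (linpath S T t)) -> glc S (S + T).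
Proof.
move=> h; exists (linpath S T @` `[0, 1]); last first.
  by exists 1; [rewrite /= in_itv/= ler01 lexx|rewrite linpath1].
split.
- by exists 0; [rewrite /= in_itv/= ler01 lexx|rewrite linpath0].
- by move=> _ [t + <-]; rewrite /= in_itv/=; exact: h.
- apply: connected_continuous_connected; first exact: segment_connected.
  by apply: continuous_subspaceT; exact: linpath_continuous.
Qed.

Lemma mn_mxscale_real n m (t : R) (T : 'M[A]_(m, n)) :
  mn (mxscale t%:C T) = `|t| * mn T.
Proof. by rewrite mn_mxscale normc_def /= expr0n addr0 sqrtr_sqr. Qed.

Lemma glc_near n (S S' T : 'M[A]_n) : S *m S' = 1%:M -> S' *m S = 1%:M ->
  mn (T - S) * mn S' < 1 -> glc S T.
Proof.
move=> h1 h2 h; rewrite -(subrK S T) addrC; apply: glc_linpath => t /andP[t0 t1].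
apply: (glmx_near h1 h2); apply: le_lt_trans h.
rewrite /linpath addrAC subrr add0r mn_mxscale_real ger0_norm//.
by rewrite -mulrA ler_piMl// mulr_ge0 ?mn_ge0.
Qed.

Lemma glc_nbhs n (S : 'M[A]_n) : glmx S -> nbhs S (glc S).
Proof.
move=> [S' [h1 h2]]; apply/nbhs_mnP.
have s0 : 0 < mn S' + 1 by rewrite ltr_wpDl// mn_ge0.
exists (mn S' + 1)^-1; first by rewrite invr_gt0.
move=> T TS; apply: (glc_near h1 h2).
have := mn_ge0 (T - S); have := mn_ge0 S'.
move: TS; rewrite -[_^-1]mul1r ltr_pdivlMr//; nra.
Qed.

End GL.

(** * Polar decomposition *)

Section Polar.
Context (R : realType) (C : cstarAlg R).
Implicit Types g h p q u v w x y : C.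

(** It suffices to compare with the root of [pos_sqrt], which commutes with the other one. For
    commuting roots and [d = x - y], the positive elements [d x d] and [d y d] add up to 0, so both
    vanish, and their difference is [d^3]. *)
Lemma pos_sqrt_uniq p q : pos p -> pos q -> p * p = q * q -> p = q.
Proof.
suff main x y : pos x -> pos y -> x * x = y * y ->
    (forall c, c * (x * x) = x * x * c -> c * y = y * c) -> x = y.
  move=> pp pq pqE; have [k [_ kE pk kc]] := pos_sqrt (pos_sqr (proj1 pp)).
  have pk' : p = k by apply: main.
  rewrite pk'; symmetry; apply: main => //; first by rewrite kE pqE.
  by rewrite -pqE.
move=> px py xy yc; have xyC : x * y = y * x by apply: yc; rewrite mulrA.
have d0 : (x - y) * (x + y) = 0.
  have -> : (x - y) * (x + y) = x * x - y * y by ccring.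
  by rewrite xy subrr.
have [xs _] := px; have [ys _] := py.
have ds : star (x - y) = x - y by rewrite starB xs ys.
have s0 : (x - y) * x * (x - y) + (x - y) * y * (x - y) = 0.
  have -> : (x - y) * x * (x - y) + (x - y) * y * (x - y) =
     (x - y) * (x + y) * (x - y) by ncring.
  by rewrite d0 mul0r.
have p1 : pos ((x - y) * x * (x - y)) by have := pos_conj (x - y) px; rewrite ds.
have p2 : pos ((x - y) * y * (x - y)) by have := pos_conj (x - y) py; rewrite ds.
have z1 : (x - y) * x * (x - y) = 0.
  apply: pos_anti => //; move/eqP: s0; rewrite addr_eq0 => /eqP ->.
  by rewrite opprK.
have z2 : (x - y) * y * (x - y) = 0 by move: s0; rewrite z1 add0r.
apply/eqP; rewrite -subr_eq0; apply/eqP; apply: sqr_eq0 => //; apply: sqr_eq0.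
  by rewrite starM ds.
have -> : (x - y) * (x - y) * ((x - y) * (x - y)) =
  ((x - y) * x * (x - y) - (x - y) * y * (x - y)) * (x - y) by ncring.
by rewrite z1 z2 subrr mul0r.
Qed.

Definition unitary_elt u := star u * u = 1 /\ u * star u = 1.

(** Chosen by its characteristic property, since a formula is available only locally; for invertible
    [g] the choice is unique by [polar_uniq]. *)
Definition polar g : C := xget 1 [set u | unitary_elt u /\ pos (star u * g)].

Lemma polar_uniq g u v : unitary_elt u -> unitary_elt v ->
  pos (star u * g) -> pos (star v * g) -> invertible (A := C) g -> u = v.
Proof.
move=> [u1 u2] [v1 v2] pu pv [g' [gg' _]].
have pE w : unitary_elt w -> pos (star w * g) ->
    (star w * g) * (star w * g) = star g * g.
  move=> [w1 w2] [ws _]; rewrite -{1}ws starM starK.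
  by rewrite -mulrA [w * (_ * _)]mulrA w2 mul1r.
have e : star u * g = star v * g by apply: pos_sqrt_uniq => //; rewrite !pE.
have e' : star u = star v by rewrite -[star u]mulr1 -gg' mulrA e -mulrA gg' mulr1.
by rewrite -[u]starK e' starK.
Qed.

Lemma nrm_unitary u : unitary_elt u -> nrm u <= 1.
Proof.
move=> [u1 _]; rewrite -(ler_pXn2r (n := 2)) ?nnegrE ?nrm_ge0// expr1n -nrmC u1.
exact: nrm1.
Qed.

Lemma polar_id u : unitary_elt u -> polar u = u.
Proof.
move=> uu; have [u1 u2] := uu; rewrite /polar; case: xgetP => [v _ [vv pv]|]; last first.
  by move=> /(_ u); case; split=> //; rewrite u1 -(rc1 C); exact: pos_rc.
apply: (@polar_uniq u) => //; last by exists (star u).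
by rewrite u1 -(rc1 C); exact: pos_rc.
Qed.

(* Local formula: u = g w^-1 t^{-1/2} with w = sqrt(g* g / t), for one fixed t. *)
Lemma polar_local g0 : invertible (A := C) g0 -> exists d t r : R,
  [/\ 0 < d, 0 < t, 0 <= r < 1 & forall g, nrm (g - g0) <= d ->
   [/\ nrm (1 - rc C t^-1 * (star g * g)) <= 1,
       nrm (sq_lim (1 - rc C t^-1 * (star g * g))) <= r &
      exists k, [/\ k * (1 - sq_lim (1 - rc C t^-1 * (star g * g))) = 1,
        (1 - sq_lim (1 - rc C t^-1 * (star g * g))) * k = 1,
        nrm k <= (1 - r)^-1 &
        invertible (A := C) g ->
          [/\ unitary_elt (polar g), pos (star (polar g) * g) &
            polar g = rc C (Num.sqrt t)^-1 * (g * k)]]]].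
Proof.
move=> [g0' [g1 g2]]; set h0 := star g0 * g0.
have ph0 : pos h0 by exact: pos_starM.
have [|| e e0 pe] := @pos_invertible_lb R C h0 (g0' * star g0') ph0.
- by rewrite /h0 mulrA -(mulrA (star g0)) g1 mulr1 -starM g2 star1.
- by rewrite /h0 mulrA -(mulrA g0') -starM g1 star1 mulr1 g2.
(* Since [h0 >= e], the norm of [t - h0] is at most [t - e]. The radius [d] below keeps [h] within
   [e / 2] of [h0], so [y = 1 - h / t] has norm at most [rho = 1 - e / (2 t)] on the whole ball. *)
pose t := nrm h0 + 1 + e; have t0 : 0 < t by rewrite /t ltr_wpDl// addr_ge0 ?nrm_ge0.
have te : 0 < t - e by rewrite /t addrK ltr_wpDl// nrm_ge0.
have n0 : nrm (rc C t - h0) <= t - e.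
  apply: pos_le_nrm; first exact: ltW.
    apply: pos_shift; first by case: ph0.
    by rewrite /t -addrA lerDl addr_ge0// ltW.
  by rewrite (_ : _ - _ = h0 - rc C e)// rcB; ncring.
pose M := nrm g0 + 1; have M0 : 0 < M by rewrite ltr_wpDl// nrm_ge0.
pose d := Num.min 1 (e / (4 * M)).
have d0 : 0 < d by rewrite lt_min ltr01 divr_gt0// mulr_gt0.
pose rho := 1 - e / (2 * t).
have rho1 : rho < 1 by rewrite /rho ltrBlDr ltrDl divr_gt0// mulr_gt0.
have rho0 : 0 <= rho.
  by rewrite /rho subr_ge0 ler_pdivrMr ?mulr_gt0// mul1r; lra.
(* The root below 1 of [rho + r^2 = 2 r], as [sq_lim_le] requires. *)
pose r := 1 - Num.sqrt (1 - rho).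
have sq1 : Num.sqrt (1 - rho) ^+ 2 = 1 - rho by rewrite sqr_sqrtr// subr_ge0 ltW.
have sq0 : 0 < Num.sqrt (1 - rho) by rewrite sqrtr_gt0 subr_gt0.
have sqle : Num.sqrt (1 - rho) <= 1.
  by rewrite -(ler_pXn2r (n := 2)) ?nnegrE ?sqrtr_ge0// sq1 expr1n lerBlDr lerDl.
exists d, t, r; split=> //.
  by rewrite /r; apply/andP; split; lra.
move=> g gd; set h := star g * g; set y := 1 - _.
have gM : nrm g <= M.
  apply: le_trans (nrm_le_dist _ g0) _; rewrite /M lerD2l; apply: le_trans gd _.
  by rewrite ge_min lexx.
have hh : nrm (h - h0) <= e / 2.
  have -> : h - h0 = star g * (g - g0) + star (g - g0) * g0.
    by rewrite /h /h0 starB; ncring.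
  apply: le_trans (nrmD _ _) _.
  have := nrmM (star g) (g - g0); have := nrmM (star (g - g0)) g0; rewrite !nrm_star.
  have dM : d * (4 * M) <= e.
    by rewrite -ler_pdivlMr ?mulr_gt0// ge_min lexx orbT.
  have := nrm_ge0 (g - g0); have := nrm_ge0 g0; have := nrm_ge0 g.
  have : nrm g0 <= M by rewrite /M lerDl.
  nra.
have yE : y = rc C t^-1 * (rc C t - h).
  by rewrite mulrBr -rcM mulVf ?gt_eqF// rc1.
have yr : nrm y <= rho.
  rewrite yE nrm_rcM gtr0_norm ?invr_gt0// ler_pdivrMl// /rho mulrBr mulr1.
  have -> : t * (e / (2 * t)) = e / 2 by field; rewrite gt_eqF.
  have -> : rc C t - h = (rc C t - h0) - (h - h0) by ncring.
  by apply: le_trans (nrmD _ _) _; rewrite nrmN; lra.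
have y1 : nrm y <= 1 by apply: le_trans yr (ltW rho1).
have zr : nrm (sq_lim y) <= r.
  apply: (@sq_lim_le R C _ rho) => //; first by rewrite /r subr_ge0.
  by rewrite /r; nra.
have r1 : 0 < 1 - r by rewrite /r; lra.
set z := sq_lim y in zr *; split=> //.
have hs : star h = h by rewrite starM starK.
have ys : star y = y by rewrite /y starB star1 starM star_rc hs rcC.
have zs : star z = z by exact: sq_lim_star.
have [|k [k1 k2 kc]] := @neumann R C (1 - z).
  by rewrite opprB addrC subrK; apply: le_lt_trans zr _; lra.
have kr : nrm k <= (1 - r)^-1.
  rewrite -[_^-1]mul1r ler_pdivlMr//.
  have kE : k = 1 + z * k by rewrite -[X in X + _]k2; ncring.
  have := nrmD 1 (z * k); rewrite -kE; have := nrmM z k; have := nrm1 C.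
  by have := nrm_ge0 k; nra.
exists k; split=> // -[g' [gg' g'g]].
have w2 : (1 - z) * (1 - z) = rc C t^-1 * h.
  by rewrite sq_sqrt1m// /y opprB addrC subrK.
have ks : star k = k.
  have h1 : star k * (1 - z) = 1.
    have es : star (1 - z) = 1 - z by rewrite starB star1 zs.
    by rewrite -es -starM k2 star1.
  by rewrite -[star k]mulr1 -k2 mulrA h1 mul1r.
pose s := Num.sqrt t; have s0 : 0 < s by rewrite sqrtr_gt0.
have sE : s * s = t by rewrite -expr2 sqr_sqrtr// ltW.
pose u := rc C s^-1 * (g * k).
have us : star u = rc C s^-1 * (k * star g) by rewrite /u starM star_rc starM ks -rcC.
have u1 : star u * u = 1.
  have -> : star u * u = k * (rc C (s^-1 * s^-1) * h) * k.
    rewrite us /u rcM /h; set S := rc C s^-1.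
    have cS x : x * S = S * x by rewrite rcC.
    have -> : S * (k * star g) * (S * (g * k)) = S * (k * star g * S) * (g * k) by ncring.
    have -> : k * (S * S * (star g * g)) * k = k * S * S * star g * g * k by ncring.
    by rewrite (cS k) -(mulrA S k) !cS; ncring.
  by rewrite -invfM sE -w2 mulrA k1 mul1r k2.
have u2 : u * star u = 1.
  pose u' := rc C s * ((1 - z) * g').
  have uu' : u * u' = 1.
    rewrite /u /u'; have -> : rc C s^-1 * (g * k) * (rc C s * ((1 - z) * g')) =
      rc C s^-1 * (g * k * rc C s) * ((1 - z) * g') by ncring.
    rewrite -rcC [rc C s^-1 * _]mulrA -rcM mulVf ?gt_eqF// rc1 mul1r.
    by rewrite mulrA -(mulrA g) k1 mulr1 gg'.
  suff -> : star u = u' by [].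
  by rewrite -[star u]mulr1 -uu' mulrA u1 mul1r.
have uu : unitary_elt u by [].
have pu : pos (star u * g).
  have -> : star u * g = rc C s * (1 - z).
    rewrite us -!mulrA -/h.
    have -> : h = rc C t * ((1 - z) * (1 - z)) by rewrite w2 rcKV// gt_eqF.
    have -> : k * (rc C t * ((1 - z) * (1 - z))) = rc C t * (k * (1 - z) * (1 - z)).
      by rewrite mulrA -rcC; ncring.
    by rewrite k1 mul1r mulrA -rcM -sE mulKf// gt_eqF.
  apply: pos_scale; first exact: ltW.
  split; first by rewrite starB star1 zs.
  exists 1 => //; rewrite rc1 opprB addrC subrK.
  by apply: le_trans zr _; lra.
suff -> : polar g = u by split.
rewrite /polar; case: xgetP => [v _ [vv pv]|]; last by move=> /(_ u); case.
by apply: (@polar_uniq g) => //; exists g'.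
Qed.

Lemma polarP g : invertible (A := C) g ->
  unitary_elt (polar g) /\ pos (star (polar g) * g).
Proof.
move=> ig; have [d [t [r [d0 _ _ /(_ g)]]]] := polar_local ig.
rewrite subrr nrm0 => /(_ (ltW d0))[_ _ [k [_ _ _ /(_ ig)[]]]] //.
Qed.

(** Both 1 and [p] are bounded below by some [c > 0], and this condition is convex. *)
Lemma pos_segment p p' (t : R) : pos p -> p * p' = 1 -> p' * p = 1 ->
  0 <= t -> t <= 1 -> exists k : C,
  k * (1 + t%:C *: (p - 1)) = 1 /\ (1 + t%:C *: (p - 1)) * k = 1.
Proof.
move=> pp p1 p2 t0 t1; have [e e0 pe] := pos_invertible_lb pp p1 p2.
pose c := Num.min 1 e; have c0 : 0 < c by rewrite lt_min ltr01.
pose q := rc C (1 - t) * rc C (1 - c) + rc C t * (p - rc C c).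
have pq : pos q.
  apply: posD.
    by apply: pos_scale; [rewrite subr_ge0|apply: pos_rc; rewrite subr_ge0 ge_min lexx].
  apply: pos_scale t0 _.
  have -> : p - rc C c = (p - rc C e) + rc C (e - c) by rewrite rcB; ncring.
  by apply: posD pe _; apply: pos_rc; rewrite subr_ge0 ge_min lexx orbT.
have -> : 1 + t%:C *: (p - 1) = rc C c + q.
  by rewrite rcE /q !rcB rc1; ncring.
by have [k [_ k1 k2 _ _]] := pos_inv c0 pq; exists k.
Qed.

Lemma polar_continuous g0 (e : R) : invertible (A := C) g0 -> 0 < e ->
  exists2 d : R, 0 < d & forall g, invertible (A := C) g -> nrm (g - g0) < d ->
    unitary_elt (polar g) /\ nrm (polar g - polar g0) <= e.
Proof.
move=> ig0 e0; have [d [t [r [d0 t0 /andP[r0 r1] H]]]] := polar_local ig0.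
have H0 := H g0; rewrite subrr nrm0 ltW// in H0; have {H0} [y01 z0r [k0 [k01 k02 k0r H0]]] := H0 isT.
have {H0} [u0 _ p0] := H0 ig0.
have q0 : 0 < 1 - r by rewrite subr_gt0.
pose s := Num.sqrt t; have s0 : 0 < s by rewrite sqrtr_gt0.
pose G := nrm g0 + d; have G0 : 0 < G by rewrite ltr_wpDl// nrm_ge0.
pose q := (1 - r)^-1; have q1 : 0 < q by rewrite invr_gt0.
(* A Lipschitz constant of [g k / s]: [g] is bounded by [G], [k] by [q], the root is Lipschitz with
   constant [q (2 G) / t] as a function of [g], and passing to the inverse [k] costs [q^2]. *)
pose L := s^-1 * (q + G * (q * (q * (t^-1 * (2 * G)) * q))).
have L0 : 0 < L by rewrite mulr_gt0 ?invr_gt0// ltr_wpDr// !mulr_ge0 ?invr_ge0// ltW.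
exists (Num.min d (e / L)); first by rewrite lt_min d0 divr_gt0.
move=> g ig; rewrite lt_min => /andP[/ltW gd ge].
have [y1 zr [k [k1 k2 kr /(_ ig)[u1 _ p1]]]] := H g gd.
split=> //.
apply: (@le_trans _ _ (L * nrm (g - g0))); last first.
  by rewrite mulrC -ler_pdivlMr// ltW.
rewrite p1 p0 -mulrBr nrm_rcM gtr0_norm ?invr_gt0// -/s /L -mulrA ler_pM2l ?invr_gt0//.
set z := sq_lim _ in zr k1 k2 *; set z0 := sq_lim _ in z0r k01 k02 *.
have gG : nrm g <= G by apply: le_trans (nrm_le_dist _ g0) _; rewrite lerD2l.
have g0G : nrm g0 <= G by rewrite lerDl ltW.
have D0 := nrm_ge0 (g - g0).
have zz : nrm (z - z0) <= q * (t^-1 * (2 * G)) * nrm (g - g0).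
  have := sq_lim_lip y1 y01 zr z0r; rewrite -/z -/z0 => lip.
  have hy : nrm (1 - rc C t^-1 * (star g * g) - (1 - rc C t^-1 * (star g0 * g0))) <=
       t^-1 * (2 * G) * nrm (g - g0).
    have -> : 1 - rc C t^-1 * (star g * g) - (1 - rc C t^-1 * (star g0 * g0)) =
       rc C t^-1 * - (star g * (g - g0) + star (g - g0) * g0).
      by rewrite starB; ncring.
    rewrite nrm_rcM gtr0_norm ?invr_gt0// nrmN -mulrA ler_pM2l ?invr_gt0//.
    apply: le_trans (nrmD _ _) _.
    have := nrmM (star g) (g - g0); have := nrmM (star (g - g0)) g0; rewrite !nrm_star.
    nra.
  rewrite /q -!mulrA mulrC -ler_pdivrMr ?invr_gt0// invrK mulrC.
  apply: le_trans lip _; apply: (@le_trans _ _ (t^-1 * (2 * G) * nrm (g - g0))).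
    have := nrm_ge0 (1 - rc C t^-1 * (star g * g) - (1 - rc C t^-1 * (star g0 * g0))).
    lra.
  by rewrite !mulrA.
have kk : nrm (k - k0) <= q * (q * (t^-1 * (2 * G)) * nrm (g - g0)) * q.
  have -> : k - k0 = k * (z - z0) * k0.
    have -> : k * (z - z0) * k0 = k * ((1 - z0) * k0) - (k * (1 - z)) * k0 by ncring.
    by rewrite k1 k02 mulr1 mul1r.
  apply: le_trans (nrmM _ _) _; apply: ler_pM => //; rewrite ?nrm_ge0//.
  by apply: le_trans (nrmM _ _) _; apply: ler_pM => //; rewrite nrm_ge0.
have -> : g * k - g0 * k0 = (g - g0) * k + g0 * (k - k0) by ncring.
apply: le_trans (nrmD _ _) _; rewrite [leRHS]mulrDl; apply: lerD.
  by apply: le_trans (nrmM _ _) _; rewrite mulrC ler_wpM2r.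
apply: le_trans (nrmM _ _) _; rewrite -!mulrA; apply: ler_pM => //; rewrite ?nrm_ge0//.
by apply: le_trans kk _; rewrite le_eqVlt; apply/orP; left; apply/eqP; ring.
Qed.

End Polar.

Section UnitaryComponents.
Context (R : realType) (A : cstarAlg R).

Lemma unitary_eltP n (u : 'M[A]_n) :
  is_unitarymx u <-> unitary_elt (u : mxC A n).
Proof. by split=> [/andP[/eqP h1 /eqP h2]|[h1 h2]]; [split|apply/andP; split; apply/eqP]. Qed.

Definition polarmx n (g : 'M[A]_n) : 'M[A]_n := polar (g : mxC A n).

Lemma polarmx_unitary n (g : 'M[A]_n) : glmx g -> is_unitarymx (polarmx g).
Proof.
move=> gg; apply/unitary_eltP.
by have [] := @polarP R (mxC A n) g gg.
Qed.

Lemma polarmx_id n (u : 'M[A]_n) : is_unitarymx u -> polarmx u = u.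
Proof. by move=> /unitary_eltP; exact: polar_id. Qed.

Lemma polarmx_component n (g h : 'M[A]_n) : glc g h ->
  connected_component [set u | is_unitarymx u] (polarmx g) (polarmx h).
Proof.
move=> [C [Cg CG Cc] Ch]; exists (@polarmx n @` C); last by exists h.
split; first by exists g.
- by move=> _ [x /CG gx <-]; exact: polarmx_unitary.
- apply: connected_continuous_connected => //.
  apply: continuous_in_subspaceT => x /set_mem/CG gx P /nbhs_mnP[e e0 eP].
  have e20 : 0 < e / 2 by rewrite divr_gt0.
  have [d d0 H] := @polar_continuous R (mxC A n) x _ gx e20.
  have [d' d'0 gd'] : exists2 d' : R, 0 < d' & forall T, mn (T - x) < d' -> glmx T.
    apply/nbhs_mnP; have := glc_nbhs gx; apply: filterS; exact: glc_glmx.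
  apply/nbhs_mnP; exists (Num.min d d'); first by rewrite lt_min d0.
  move=> T; rewrite lt_min => /andP[Td Td']; apply: eP.
  have [_] := H T (gd' T Td') Td; move=> h'; apply: le_lt_trans h' _.
  by rewrite gtr_pMr// invf_lt1// ltr1n.
Qed.

Lemma glc_polar n (g : 'M[A]_n) : glmx g -> glc (polarmx g) g.
Proof.
move=> gg; have uu := polarmx_unitary gg; set u := polarmx g in uu *.
have pu : pos ((adjmx u *m g) : mxC A n).
  by have [] := @polarP R (mxC A n) g gg.
rewrite -[g in glc _ g](mul1mx g); have /andP[/eqP u1 /eqP u2] := uu.
rewrite -u2 -mulmxA -{1}[u]mulmx1; apply: glc_mull; first exact: unitary_glmx.
set p := adjmx u *m g in pu *.
rewrite -[p](subrK 1%:M) addrC; apply: glc_linpath => t /andP[t0 t1].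
have gp : glmx p by apply: glmxM => //; apply: unitary_glmx; exact: is_unitarymxV.
have [p' [p1 p2]] := gp.
have [k [k1 k2]] := @pos_segment R (mxC A n) p p' t pu p1 p2 t0 t1.
exists k; rewrite /linpath; split; [exact: k2|exact: k1].
Qed.

(* The polar decomposition retracts GL_n onto U_n. *)
Lemma glc_U0 n (u v : 'M[A]_n) : is_unitarymx u -> is_unitarymx v ->
  glc u v -> U0 (u *m adjmx v).
Proof.
move=> uu vu guv; have vV := is_unitarymxV vu.
have /andP[_ /eqP v2] := vu.
have := glc_mulr (unitary_glmx vV) guv; rewrite v2 => /glc_sym/polarmx_component.
by rewrite !polarmx_id// ?is_unitarymx1// is_unitarymxM.
Qed.

Lemma U0_glc n (u v : 'M[A]_n) : is_unitarymx v -> U0 (u *m adjmx v) -> glc u v.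
Proof.
move=> vu [C [C1 CU Cc] Cuv].
have : glc (u *m adjmx v) 1%:M.
  apply: glc_sym; exists C => //; split=> // x /CU; exact: unitary_glmx.
move=> /(glc_mulr (unitary_glmx vu)); rewrite -mulmxA mul1mx.
by have /andP[/eqP -> _] := vu; rewrite mulmx1.
Qed.

End UnitaryComponents.

(** * Stable rank and stability of K_1 *)

Section Continuity.
Context (R : realType) (A : cstarAlg R) (T : topologicalType).

Lemma continuous_nrm (f : T -> A) t (d : R) : continuous f -> 0 < d ->
  nbhs t [set s | nrm (f s - f t) < d].
Proof.
move=> cf d0; have h : nbhs (f t) [set a | nrm (a - f t) < d].
  by apply/nbhs_nrmP; exists d.
exact: (cf t _ h).
Qed.

Lemma continuous_mn m n (f : T -> 'M[A]_(m, n)) t (d : R) : continuous f -> 0 < d ->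
  nbhs t [set s | mn (f s - f t) < d].
Proof.
move=> cf d0; have h : nbhs (f t) [set a | mn (a - f t) < d].
  by apply/nbhs_mnP; exists d.
exact: (cf t _ h).
Qed.

Lemma cmul_continuous (f g : T -> A) : continuous f -> continuous g ->
  continuous (fun t => f t * g t).
Proof.
move=> cf cg t P /nbhs_nrmP[e e0 eP].
pose M := nrm (f t) + nrm (g t) + 1.
have M0 : 0 < M by rewrite ltr_wpDl// addr_ge0 ?nrm_ge0.
pose d := Num.min 1 (e / (2 * M)).
have d0 : 0 < d by rewrite lt_min ltr01 divr_gt0 ?mulr_gt0.
have hf := continuous_nrm t cf d0.
have hg := continuous_nrm t cg d0.
apply: filterS2 hf hg => s /= fs gs; apply: eP.
have -> : f s * g s - f t * g t = (f s - f t) * (g s - g t) +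
   (f t * (g s - g t) + (f s - f t) * g t) by ncring.
apply: le_lt_trans (nrmD _ _) _.
have := nrmD (f t * (g s - g t)) ((f s - f t) * g t).
have := nrmM (f s - f t) (g s - g t); have := nrmM (f t) (g s - g t).
have := nrmM (f s - f t) (g t).
have := nrm_ge0 (f t); have := nrm_ge0 (g t).
have := nrm_ge0 (f s - f t); have := nrm_ge0 (g s - g t).
have dM : d * (2 * M) <= e by rewrite -ler_pdivlMr ?mulr_gt0// ge_min lexx orbT.
have d1 : d <= 1 by rewrite ge_min lexx.
move: fs gs; rewrite /M in M0 dM; set a := nrm _; set b := nrm _; set c := nrm _; set c' := nrm _.
nra.
Qed.

Lemma entry_continuous m n (f : T -> 'M[A]_(m, n)) i j : continuous f ->
  continuous (fun t => f t i j : A).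
Proof.
move=> cf t P /nbhs_nrmP[e e0 eP].
apply: filterS (continuous_mn t cf e0) => s /= fs; apply: eP.
by apply: le_lt_trans fs; have := mn_entry (f s - f t) i j; rewrite !mxE.
Qed.

Lemma mulmx_continuous m n p (f : T -> 'M[A]_(m, n)) (g : T -> 'M[A]_(n, p)) :
  continuous f -> continuous g -> continuous (fun t => f t *m g t).
Proof.
move=> cf cg t P /nbhs_mxP[e e0 eP].
have H : \forall s \near t, forall i j, nrm ((f s *m g s) i j - (f t *m g t) i j) < e.
  apply: filter_forall => i; apply: filter_forall => j.
  have c : continuous (fun s => \sum_k f s i k * g s k j).
    apply: sum_continuous => k.
    by apply: cmul_continuous; exact: entry_continuous.
  by apply: filterS (continuous_nrm t c e0) => s /=; rewrite !mxE.
by apply: filterS H => s hs; apply: eP.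
Qed.

Lemma addmx_continuous m n (f g : T -> 'M[A]_(m, n)) :
  continuous f -> continuous g -> continuous (fun t => f t + g t).
Proof.
move=> cf cg t P /nbhs_mnP[e e0 eP].
have e2 : 0 < e / 2 by rewrite divr_gt0.
have hf := continuous_mn t cf e2.
have hg := continuous_mn t cg e2.
apply: filterS2 hf hg => s /= fs gs; apply: eP.
rewrite opprD addrACA; apply: le_lt_trans (mnD _ _) _; lra.
Qed.

Lemma mnN m n (S : 'M[A]_(m, n)) : mn (- S) = mn S.
Proof.
have le (Q : 'M[A]_(m, n)) : mn (- Q) <= mn Q.
  apply: mn_le => [|v]; first exact: mn_ge0.
  by rewrite mulNmx /vn ipNl ipNr opprK; exact: mnP.
by apply/eqP; rewrite eq_le le -{1}[S]opprK le.
Qed.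

Lemma oppmx_continuous m n (f : T -> 'M[A]_(m, n)) :
  continuous f -> continuous (fun t => - f t).
Proof.
move=> cf t P /nbhs_mnP[e e0 eP].
have hf := continuous_mn t cf e0.
by apply: filterS hf => s /= fs; apply: eP; rewrite -opprD mnN.
Qed.

Lemma mxsub_continuous m n m' n' (r : 'I_m' -> 'I_m) (c : 'I_n' -> 'I_n)
    (f : T -> 'M[A]_(m, n)) (g : T -> 'M[A]_(m', n')) :
  (forall t i j, g t i j = f t (r i) (c j)) -> continuous f -> continuous g.
Proof.
move=> gE cf t P /nbhs_mxP[e e0 eP].
apply: filterS (continuous_mn t cf e0) => s /= fs; apply: eP => i j; rewrite !gE.
by apply: le_lt_trans fs; have := mn_entry (f s - f t) (r i) (c j); rewrite !mxE.
Qed.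

End Continuity.

Section StableRank.
Context (R : realType) (A : cstarAlg R).

Definition lu k (a : 'cV[A]_k) := exists c : 'rV[A]_k, c *m a = 1%:M.

(* Stable rank at most k, for columns: the star turns right ideals into left ones. *)
Definition csr k := forall (a : 'cV[A]_k) (e : R), 0 < e ->
  exists2 b : 'cV[A]_k, mn (b - a) < e & lu b.

Lemma stable_rank_csr s : stable_rank_le A s -> csr s.
Proof.
move=> sr a e e0.
have [|b [bO bI]] := sr [set b : 'rV[A]_s | mn (b - adjmx a) < e]^° _ (open_interior _).
  by exists (adjmx a); apply/nbhs_mnP; exists e.
exists (adjmx b).
  have /nbhs_singleton /= := bO; apply: le_lt_trans.
  have -> : adjmx b - a = adjmx (b - adjmx a).
    by apply/matrixP => i j; rewrite !mxE starB starK.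
  exact: mn_adj_le.
have : [set: A] 1 by []; rewrite -bI => -[c _ cE].
exists (adjmx c^T); apply/matrixP => i j; rewrite !ord1 !mxE eqxx mulr1n.
rewrite -[RHS]star1 -cE star_sum; apply: eq_bigr => l _.
by rewrite !mxE starM.
Qed.

Lemma lu_open k (a : 'cV[A]_k) : lu a ->
  exists2 e : R, 0 < e & forall b, mn (b - a) < e -> lu b.
Proof.
move=> [c ca]; have c0 : 0 < mn c + 1 by rewrite ltr_wpDl// mn_ge0.
exists (mn c + 1)^-1; first by rewrite invr_gt0.
move=> b ba.
have [|Q [_ Q2]] := @glmx_near R A 1 1%:M 1%:M (c *m b) (mulmx1 _) (mulmx1 _).
  have -> : c *m b - 1%:M = c *m (b - a) by rewrite mulmxBr ca.
  have n1 : mn (1%:M : 'M[A]_1) <= 1 by rewrite -nrm_mxC nrm1.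
  move: ba; rewrite -[_^-1]mul1r ltr_pdivlMr// => ba.
  have := mnM c (b - a); have := mn_ge0 (b - a); have := mn_ge0 c.
  have := mn_ge0 (c *m (b - a)); nra.
by exists (Q *m c); rewrite -mulmxA.
Qed.

Lemma lu_col_mx k l (a : 'cV[A]_k) (b : 'cV[A]_l) : lu a -> lu (col_mx a b).
Proof. by move=> [c ca]; exists (row_mx c 0); rewrite mul_row_col ca mul0mx addr0. Qed.

Lemma mn_col_mx0 k l (a : 'cV[A]_k) : mn (col_mx a (0 : 'cV[A]_l)) <= mn a.
Proof.
apply: mn_le => [|v]; first exact: mn_ge0.
rewrite mul_col_mx mul0mx; suff -> : vn (col_mx (a *m v) (0 : 'cV_l)) = vn (a *m v).
  exact: mnP.
rewrite /vn /ip big_split_ord /= [X in _ + X]big1 ?addr0 => [|i _]; last first.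
  by rewrite col_mxEd mxE mulr0.
by congr (Num.sqrt (nrm _)); apply: eq_bigr => i _; rewrite col_mxEu.
Qed.

Lemma csr_mono s k : (s <= k)%N -> csr s -> csr k.
Proof.
move=> /subnKC <- sr; elim: (k - s)%N => [|d IH]; first by rewrite addn0.
rewrite addnS -addn1 => a e e0; rewrite -[a]vsubmxK.
have [b ba lb] := IH (usubmx a) e e0.
exists (col_mx b (dsubmx a)); last exact: lu_col_mx.
by rewrite opp_col_mx add_col_mx subrr; apply: le_lt_trans (mn_col_mx0 _ _) ba.
Qed.

(** Bass's stable range condition with control of [z]. For [E = v - d] with [v] left invertible near
    [d], multiplying [E] into [p d + r b = 1] gives [v = (1 + E p) d + E r b]; so
    [z = (1 + E p)^-1 E r] is small with [E] and [d + z b] is left equivalent to [v]. *)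
Lemma bass k (d : 'cV[A]_k) (b : 'M[A]_1) (p : 'rV[A]_k) (r : 'M[A]_1) (e : R) :
  csr k -> p *m d + r *m b = 1%:M -> 0 < e ->
  exists2 z : 'cV[A]_k, mn z < e & lu (d + z *m b).
Proof.
move=> sr pr e0.
pose M := mn p + mn r + 1.
have M0 : 0 < M by rewrite ltr_wpDl// addr_ge0 ?mn_ge0.
pose f := Num.min (1 / (2 * M)) (e / (2 * M)).
have f0 : 0 < f by rewrite lt_min !divr_gt0 ?mulr_gt0.
have [v vd [c cv]] := sr d f f0; set E := v - d in vd.
have n1 : mn (1%:M : 'M[A]_k) <= 1 by rewrite -nrm_mxC nrm1.
have f1 : f * (2 * M) <= 1 by rewrite -ler_pdivlMr ?mulr_gt0// ge_min lexx.
have fe : f * (2 * M) <= e by rewrite -ler_pdivlMr ?mulr_gt0// ge_min lexx orbT.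
have E0 := mn_ge0 E; have p0 := mn_ge0 p; have r0 := mn_ge0 r.
have Ep : mn (E *m p) <= 1 / 2.
  apply: le_trans (mnM _ _) _; rewrite /M in f1.
  have := ler_wpM2r p0 (ltW vd); have := mulr_ge0 (ltW f0) r0; lra.
have [|Q [Q1 Q2]] := @glmx_near R A k 1%:M 1%:M (1%:M + E *m p) (mulmx1 _) (mulmx1 _).
  by rewrite addrC addKr; have := mn_ge0 (E *m p); nra.
have Q2n : mn Q <= 2.
  have QE : Q = 1%:M - Q *m (E *m p) by rewrite -Q2 mulmxDr mulmx1 addrK.
  have := mnD 1%:M (- (Q *m (E *m p))); rewrite -QE mnN.
  by have := mnM Q (E *m p); have := mn_ge0 Q; nra.
exists (Q *m E *m r).
  apply: le_lt_trans (mnM _ _) _; have := mnM Q E => h.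
  have h1 : mn (Q *m E) <= 2 * f.
    by apply: le_trans h _; apply: ler_pM => //; [exact: mn_ge0|exact: ltW].
  have := ler_wpM2r r0 h1; rewrite /M in fe.
  have := mulr_ge0 (ltW f0) p0; lra.
have -> : d + Q *m E *m r *m b = Q *m v.
  have -> : v = (1%:M + E *m p) *m d + E *m (r *m b).
    rewrite mulmxDl mul1mx -addrA -mulmxA -mulmxDr pr mulmx1 /E addrC subrK //.
  by rewrite mulmxDr !mulmxA Q2 mul1mx.
exists (c *m (1%:M + E *m p)).
by rewrite mulmxA -(mulmxA c) Q1 mulmx1.
Qed.

Lemma linpath_cst m n (S : 'M[A]_(m, n)) t : linpath S 0 t = S.
Proof. by apply/matrixP => i j; rewrite linpathE [X in _ * X]mxE mulr0 addr0. Qed.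

(** * Reduction from GL_{k+1} to GL_k *)

Section Reduction.
Variable k : nat.
Implicit Types (g h : 'M[A]_(k + 1)) (x : 'rV[A]_k) (y : 'cV[A]_k).

(** Adding [x] times the upper rows to the last row makes the lower right entry equal to 1. *)
Definition valid g x := x *m ursubmx g = 1%:M - drsubmx g.

(** The upper left block left over once the lower right entry is 1 and the last column has been
    cleared; see [redE]. *)
Definition red g x : 'M[A]_k :=
  ulsubmx g - ursubmx g *m (dlsubmx g + x *m ulsubmx g).

Definition uppert (y : 'cV[A]_k) : 'M[A]_(k + 1) := block_mx 1%:M y 0 1%:M.
Definition lowert (x : 'rV[A]_k) : 'M[A]_(k + 1) := block_mx 1%:M 0 x 1%:M.

Lemma uppertD y y' : uppert y *m uppert y' = uppert (y + y').
Proof. by rewrite mulmx_block !mul1mx !mulmx1 !mulmx0 !mul0mx !addr0 !add0r addrC. Qed.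
Lemma lowertD x x' : lowert x *m lowert x' = lowert (x + x').
Proof. by rewrite mulmx_block !mul1mx !mulmx1 !mulmx0 !mul0mx !addr0 !add0r. Qed.
Lemma uppert0 : uppert 0 = 1%:M. Proof. by rewrite /uppert -scalar_mx_block. Qed.
Lemma lowert0 : lowert 0 = 1%:M. Proof. by rewrite /lowert -scalar_mx_block. Qed.

Lemma uppert_gl y : glmx (uppert y).
Proof. by exists (uppert (- y)); rewrite !uppertD subrr addNr uppert0. Qed.
Lemma lowert_gl x : glmx (lowert x).
Proof. by exists (lowert (- x)); rewrite !lowertD subrr addNr lowert0. Qed.

Lemma uppert_glc y : glc 1%:M (uppert y).
Proof.
have -> : uppert y = 1%:M + block_mx 0 y 0 0.
  by rewrite -uppert0 add_block_mx !addr0 add0r.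
apply: glc_linpath => t _; suff -> : linpath 1%:M (block_mx 0 y 0 0) t =
  uppert (mxscale t%:C y) by exact: uppert_gl.
have s0 m n : mxscale t%:C (0 : 'M[A]_(m, n)) = 0.
  by apply/matrixP => i j; rewrite !mxE scaler0.
rewrite /linpath -uppert0 /mxscale map_block_mx -!/(mxscale _ _) !s0 add_block_mx.
by rewrite !addr0 add0r.
Qed.

Lemma lowert_glc x : glc 1%:M (lowert x).
Proof.
have -> : lowert x = 1%:M + block_mx 0 0 x 0.
  by rewrite -lowert0 add_block_mx !addr0 add0r.
apply: glc_linpath => t _; suff -> : linpath 1%:M (block_mx 0 0 x 0) t =
  lowert (mxscale t%:C x) by exact: lowert_gl.
have s0 m n : mxscale t%:C (0 : 'M[A]_(m, n)) = 0.
  by apply/matrixP => i j; rewrite !mxE scaler0.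
rewrite /linpath -lowert0 /mxscale map_block_mx -!/(mxscale _ _) !s0 add_block_mx.
by rewrite !addr0 add0r.
Qed.

Lemma redE g x : valid g x ->
  uppert (- ursubmx g) *m (lowert x *m g) =
  block_mx (red g x) 0 (dlsubmx g + x *m ulsubmx g) 1%:M.
Proof.
rewrite /valid => vx; rewrite -[in lowert x *m g](submxK g) /uppert /lowert !mulmx_block.
rewrite !mul1mx !mul0mx !addr0 !add0r vx.
rewrite subrK mulmx1 subrr [x *m _ + _]addrC; congr block_mx.
by rewrite mulNmx.
Qed.

Lemma red_gl g x : glmx g -> valid g x -> glmx (red g x).
Proof.
move=> gg vx.
have : glmx (block_mx (red g x) 0 (dlsubmx g + x *m ulsubmx g) 1%:M : 'M[A]_(k + 1)).
  rewrite -redE//; apply: glmxM; first exact: uppert_gl.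
  by apply: glmxM => //; exact: lowert_gl.
set r := _ + _ => -[S [S1 S2]].
move: S1 S2; rewrite -[S]submxK !mulmx_block !mul0mx !mulmx1 !mulmx0 !addr0 !add0r.
rewrite scalar_mx_block => /eq_block_mx[e1 _ _ _] /eq_block_mx[f1 f2 _ _].
by exists (ulsubmx S); split=> //; move: f1; rewrite f2 mul0mx addr0.
Qed.

(** Validity is an affine condition on [x] and [red] is affine in [x], so two choices are joined by
    a segment of invertibles. *)
Lemma red_convex g x x' : glmx g -> valid g x -> valid g x' ->
  glc (red g x) (red g x').
Proof.
move=> gg vx vx'.
have -> : red g x' = red g x + - (ursubmx g *m ((x' - x) *m ulsubmx g)).
  rewrite /red -addrA -opprD -mulmxDr; congr (_ - _ *m _).
  by rewrite -addrA -mulmxDl [x + _]addrC subrK.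
apply: glc_linpath => t _.
have -> : linpath (red g x) (- (ursubmx g *m ((x' - x) *m ulsubmx g))) t =
    red g (linpath x (x' - x) t).
  rewrite /red linpath_mulr /linpath [in RHS]addrA [in RHS]mulmxDr [in RHS]opprD.
  rewrite [in RHS]addrA; congr (_ + _).
  rewrite -mxscale_mulr; apply/matrixP => i j; rewrite !mxE.
  by rewrite scalerN.
apply: red_gl => //; rewrite /valid linpath_mulr mulmxBl vx vx' subrr.
exact: linpath_cst.
Qed.

Definition generic g := glmx g /\ lu (ursubmx g).

Lemma generic_valid g : generic g -> exists x, valid g x.
Proof.
move=> [_ [c ca]]; exists ((1%:M - drsubmx g) *m c).
by rewrite /valid -mulmxA ca mulmx1.
Qed.

Definition same_red g h := [/\ generic g, generic h &
  forall x x', valid g x -> valid h x' -> glc (red g x) (red h x')].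

Lemma same_red_sym g h : same_red g h -> same_red h g.
Proof. by move=> [gg gh H]; split=> // x x' vx vx'; apply: glc_sym; exact: H. Qed.

Lemma same_red_trans g h f : same_red g h -> same_red h f -> same_red g f.
Proof.
move=> [gg gh H] [_ gf H']; split=> // x x' vx vx'.
have [z vz] := generic_valid gh.
exact: glc_trans (H _ _ vx vz) (H' _ _ vz vx').
Qed.

(** A left inverse [c0] of the column of [g0], corrected by the inverse [Q] of [c0] times the column
    of [g], gives a valid [x] depending continuously on [g]; by [red_convex] any other valid choice
    is equivalent. *)
Lemma same_red_local g0 : generic g0 ->
  nbhs g0 [set g | generic g -> same_red g0 g].
Proof.
move=> gg0; have [g0gl [c0 c0a]] := gg0.
(* The inverse [Q] is carried as an extra diagonal block of [G], which makes [Phi] a polynomial in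
   the entries. Its continuity at [diag(g0, 1)] is all that is used. *)
pose Phi (G : 'M[A]_((k + 1) + 1)) := red (ulsubmx G)
  ((1%:M - drsubmx (ulsubmx G)) *m drsubmx G *m c0).
have cid : continuous (fun G : 'M[A]_((k + 1) + 1) => G) by move=> G; exact: cvg_id.
have ccst m n (D : 'M[A]_(m, n)) : continuous (fun _ : 'M[A]_((k + 1) + 1) => D).
  exact: cst_continuous.
have cul : continuous (fun G : 'M[A]_((k + 1) + 1) => ulsubmx G).
  by apply: mxsub_continuous cid => t i j; rewrite !mxE.
have cPhi : continuous Phi.
  have c1 : continuous (fun G : 'M[A]_((k + 1) + 1) => ulsubmx (ulsubmx G)).
    by apply: mxsub_continuous cul => t i j; rewrite !mxE.
  have c2 : continuous (fun G : 'M[A]_((k + 1) + 1) => ursubmx (ulsubmx G)).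
    by apply: mxsub_continuous cul => t i j; rewrite !mxE.
  have c3 : continuous (fun G : 'M[A]_((k + 1) + 1) => dlsubmx (ulsubmx G)).
    by apply: mxsub_continuous cul => t i j; rewrite !mxE.
  have c4 : continuous (fun G : 'M[A]_((k + 1) + 1) => drsubmx (ulsubmx G)).
    by apply: mxsub_continuous cul => t i j; rewrite !mxE.
  have c5 : continuous (fun G : 'M[A]_((k + 1) + 1) => drsubmx G).
    by apply: mxsub_continuous cid => t i j; rewrite !mxE.
  rewrite /Phi /red; apply: addmx_continuous => //; apply: oppmx_continuous.
  apply: mulmx_continuous => //; apply: addmx_continuous => //.
  apply: mulmx_continuous => //; apply: mulmx_continuous => //.
  apply: mulmx_continuous => //; apply: addmx_continuous => //.
  exact: oppmx_continuous.
pose x0 := (1%:M - drsubmx g0) *m c0.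
have vx0 : valid g0 x0 by rewrite /valid -mulmxA c0a mulmx1.
pose G0 : 'M[A]_((k + 1) + 1) := block_mx g0 0 0 1%:M.
have PhiG0 : Phi G0 = red g0 x0 by rewrite /Phi block_mxKul block_mxKdr mulmx1.
have : nbhs G0 (Phi @^-1` glc (red g0 x0)).
  by apply: cPhi; rewrite PhiG0; apply: glc_nbhs; exact: red_gl.
move=> /nbhs_mxP[e e0 eP].
pose m := mn c0 + 1; have m0 : 0 < m by rewrite ltr_wpDl// mn_ge0.
pose d := Num.min (e / (2 * m)) (1 / (2 * m)).
have d0 : 0 < d by rewrite lt_min !divr_gt0// mulr_gt0.
have dm : d * (2 * m) <= e by rewrite -ler_pdivlMr ?mulr_gt0// ge_min lexx.
have dm1 : d * (2 * m) <= 1 by rewrite -ler_pdivlMr ?mulr_gt0// ge_min lexx orbT.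
have m1 : 1 <= m by rewrite lerDr mn_ge0.
apply/nbhs_mnP; exists d => // g gd gg; split=> // x x' vx vx'.
apply: glc_trans (red_convex g0gl vx vx0) _.
have n1 : mn (1%:M : 'M[A]_1) <= 1 by rewrite -nrm_mxC nrm1.
have ca : mn (c0 *m ursubmx g - 1%:M) <= mn c0 * d.
  rewrite -c0a -mulmxBr; apply: le_trans (mnM _ _) _; rewrite ler_wpM2l ?mn_ge0//.
  apply: mn_le; first exact: ltW.
  move=> v; have := mnP (g - g0) (col_mx 0 v).
  have -> : vn (col_mx (0 : 'cV_k) v) = vn v.
    rewrite /vn /ip big_split_ord /= big1 ?add0r => [|i _]; last by rewrite col_mxEu mxE mulr0.
    by congr (Num.sqrt (nrm _)); apply: eq_bigr => i _; rewrite col_mxEd.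
  move=> h; apply: (@le_trans _ _ (mn (g - g0) * vn v)); last first.
    by rewrite ler_wpM2r ?vn_ge0// ltW.
  apply: le_trans h; rewrite -[g - g0]submxK mul_block_col !mulmx0 !add0r.
  rewrite -(ler_pXn2r (n := 2)) ?nnegrE ?vn_ge0// !vn2.
  have -> : (ursubmx g - ursubmx g0) = ursubmx (g - g0) by apply/matrixP => i j; rewrite !mxE.
  set B := _ *m v; set D := _ *m v.
  have -> : ip (col_mx B D) (col_mx B D) = ip B B + ip D D.
    rewrite /ip big_split_ord /=; congr (_ + _); apply: eq_bigr => i _.
      by rewrite col_mxEu.
    by rewrite col_mxEd.
  apply: nrm_mono; first exact: ip_pos.
  by rewrite addrC addKr; exact: ip_pos.
have [|Q [Q1 Q2]] := @glmx_near R A 1 1%:M 1%:M (c0 *m ursubmx g) (mulmx1 _) (mulmx1 _).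
  have := mn_ge0 (c0 *m ursubmx g - 1%:M); have := mn_ge0 c0; rewrite /m in dm1 m0; nra.
set rho := c0 *m ursubmx g in ca Q1 Q2.
have Qn : mn Q <= 2.
  have QE : Q = 1%:M - Q *m (rho - 1%:M) by rewrite mulmxBr Q2 mulmx1 opprB addrC subrK.
  have := mnD 1%:M (- (Q *m (rho - 1%:M))); rewrite -QE mnN.
  have := mnM Q (rho - 1%:M); have := mn_ge0 Q; have := mn_ge0 (rho - 1%:M).
  have := mn_ge0 c0; rewrite /m in dm1; nra.
have Q1n : mn (Q - 1%:M) < e.
  have -> : Q - 1%:M = - (Q *m (rho - 1%:M)) by rewrite mulmxBr Q2 mulmx1 opprB.
  rewrite mnN; apply: le_lt_trans (mnM _ _) _.
  have := mn_ge0 Q; have := mn_ge0 (rho - 1%:M); have := mn_ge0 c0; rewrite /m in dm; nra.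
pose x1 := (1%:M - drsubmx g) *m Q *m c0.
have vx1 : valid g x1 by rewrite /valid -!mulmxA -/rho Q2 mulmx1.
apply: glc_trans (red_convex (proj1 gg) vx1 vx').
have := eP (block_mx g 0 0 Q); rewrite /preimage /= /Phi block_mxKul block_mxKdr; apply.
have de : d < e.
  apply: (@lt_le_trans _ _ (d * (2 * m))) => //.
  by rewrite ltr_pMr//; rewrite /m in m1 *; have := mn_ge0 c0; lra.
move=> i j; have e1 : nrm (0 : A) < e by rewrite nrm0.
rewrite /G0; case: (split_ordP i) => i' ->; case: (split_ordP j) => j' ->.
- rewrite !block_mxEul; apply: lt_trans de; apply: le_lt_trans gd.
  by have := mn_entry (g - g0) i' j'; rewrite !mxE.
- by rewrite !block_mxEur !mxE subrr.
- by rewrite !block_mxEdl !mxE subrr.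
- rewrite !block_mxEdr; apply: le_lt_trans Q1n.
  by have := mn_entry (Q - 1%:M) i' j'; rewrite !mxE.
Qed.

Lemma same_red_path g D : (forall t, 0 <= t <= 1 -> generic (linpath g D t)) ->
  same_red g (g + D).
Proof.
move=> H.
pose r (s t : R) := same_red (linpath g D s) (linpath g D t).
suff : r 0 1 by rewrite /r linpath0 linpath1.
apply: (@locally_constant R `[0, 1] r).
- exact: segment_connected.
- by move=> s t; exact: same_red_sym.
- by move=> s t u; exact: same_red_trans.
- move=> t; rewrite /= in_itv /= => /H gt.
  have ht : nbhs t (linpath g D @^-1`
      [set h | generic h -> same_red (linpath g D t) h]).
    by apply: linpath_continuous; exact: same_red_local.
  apply: filterS ht => s /= hs.
  by rewrite in_itv /= => /H /hs.
- by rewrite /= in_itv/= lexx ler01.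
- by rewrite /= in_itv/= lexx ler01.
Qed.

Lemma uppert_mul y g : uppert y *m g =
  block_mx (ulsubmx g + y *m dlsubmx g) (ursubmx g + y *m drsubmx g)
    (dlsubmx g) (drsubmx g).
Proof. by rewrite -{1}[g]submxK mulmx_block !mul1mx !mul0mx !add0r. Qed.

Lemma uppert_ur y g : ursubmx (uppert y *m g) = ursubmx g + y *m drsubmx g.
Proof. by rewrite uppert_mul block_mxKur. Qed.

Lemma same_red_segment g y D : glmx g ->
  (forall t, 0 <= t <= 1 -> lu (ursubmx g + linpath y D t *m drsubmx g)) ->
  same_red (uppert y *m g) (uppert (y + D) *m g).
Proof.
move=> gg H.
have e1 t : linpath (uppert y *m g) (block_mx 0 D 0 0 *m g) t = uppert (linpath y D t) *m g.
  rewrite -linpath_mulr; congr (_ *m _).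
  have s0 m n : mxscale t%:C (0 : 'M[A]_(m, n)) = 0.
    by apply/matrixP => i j; rewrite !mxE scaler0.
  by rewrite /linpath /uppert /mxscale map_block_mx -!/(mxscale _ _) !s0 add_block_mx !addr0.
have -> : uppert (y + D) *m g = uppert y *m g + block_mx 0 D 0 0 *m g.
  by rewrite -[RHS]linpath1 e1 linpath1.
apply: same_red_path => t /H lt; rewrite e1; split; last by rewrite uppert_ur.
by apply: glmxM => //; exact: uppert_gl.
Qed.

Lemma same_red_diag (w w' : 'M[A]_k) g h : w *m w' = 1%:M -> w' *m w = 1%:M ->
  let W : 'M[A]_(k + 1) := block_mx w 0 0 1%:M in
  generic g -> generic h ->
  same_red (W *m g) (W *m h) -> same_red g h.
Proof.
move=> ww' w'w W gg gh [_ _ H]; split=> // x x' vx vx'.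
have WE f : W *m f = block_mx (w *m ulsubmx f) (w *m ursubmx f) (dlsubmx f) (drsubmx f).
  by rewrite -{1}[f]submxK mulmx_block !mul1mx !mul0mx !add0r !addr0.
have vW f z : valid f z -> valid (W *m f) (z *m w').
  rewrite /valid WE block_mxKur block_mxKdr => <-.
  by rewrite mulmxA -(mulmxA z) w'w mulmx1.
have rW f z : red (W *m f) (z *m w') = w *m red f z.
  rewrite /red WE block_mxKur block_mxKul block_mxKdl mulmxBr; congr (_ - _).
  by rewrite -(mulmxA z) (mulmxA w') w'w mul1mx mulmxA.
have gw' : glmx w' by exists w.
have := glc_mull gw' (H _ _ (vW _ _ vx) (vW _ _ vx')).
by rewrite !rW !mulmxA w'w !mul1mx.
Qed.

End Reduction.

(** The core of injective stability: the upper elementary operation used to reach generic position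
    does not affect the reduction. One needs a path of generic matrices from [y] to 0, and the
    stable range condition one size lower provides the room for it. *)
Lemma same_red_uppert l (g : 'M[A]_((l + 1) + 1)) (y : 'cV[A]_(l + 1)) :
  csr l -> generic g -> generic (uppert y *m g) -> same_red g (uppert y *m g).
Proof.
move=> sr.
suff main (f : 'M[A]_((l + 1) + 1)) (z : 'cV[A]_(l + 1)) (al : 'cV[A]_l) (p : 'rV[A]_l) :
    ursubmx f = col_mx al 0 -> p *m al = 1%:M ->
    generic f -> generic (uppert z *m f) -> same_red f (uppert z *m f).
  move=> gg gyg; have [ggl [c ca]] := gg.
  set a := ursubmx g in ca.
  have ca' : lsubmx c *m usubmx a + rsubmx c *m dsubmx a = 1%:M.
    by rewrite -mul_row_col hsubmxK vsubmxK.
  have [z _ [p pa]] := bass sr ca' (@ltr01 R).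
  set al := usubmx a + z *m dsubmx a in pa.
  (* [uppert z] makes the first [l] entries of the column left unimodular, then [p] serves to clear
     the last one. Multiplying by [diag(w, 1)] multiplies all reductions by [w]. *)
  pose w : 'M[A]_(l + 1) := lowert (- dsubmx a *m p) *m uppert z.
  have [w' [ww' w'w]] : glmx w by apply: glmxM; [exact: lowert_gl|exact: uppert_gl].
  have wa : w *m a = col_mx al 0.
    rewrite -[X in w *m X]vsubmxK /w -mulmxA /uppert mul_block_col.
    rewrite mul1mx mul0mx mul1mx add0r -/al /lowert mul_block_col !mul1mx mul0mx addr0.
    by rewrite -mulmxA pa mulmx1 addNr.
  pose W : 'M[A]_((l + 1) + 1) := block_mx w 0 0 1%:M.
  have WE f : W *m f = block_mx (w *m ulsubmx f) (w *m ursubmx f) (dlsubmx f) (drsubmx f).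
    by rewrite -{1}[f]submxK mulmx_block !mul1mx !mul0mx !add0r !addr0.
  have Wgl : glmx W.
    exists (block_mx w' 0 0 1%:M); rewrite !mulmx_block !mul0mx !mulmx0 !mulmx1 !addr0 !add0r.
    by rewrite ww' w'w -scalar_mx_block.
  have Wgen f : generic f -> generic (W *m f).
    move=> [fgl [d df]]; split; first exact: glmxM.
    by exists (d *m w'); rewrite WE block_mxKur mulmxA -(mulmxA d) w'w mulmx1.
  have Wy : W *m (uppert y *m g) = uppert (w *m y) *m (W *m g).
    rewrite !mulmxA; congr (_ *m _); rewrite /W /uppert !mulmx_block.
    by rewrite !mul0mx !mul1mx !mulmx0 !mulmx1 !addr0 !add0r.
  apply: (same_red_diag ww' w'w) => //; rewrite -/W Wy; apply: (main _ _ al p) => //.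
  - by rewrite WE block_mxKur.
  - exact: Wgen.
  - by rewrite -Wy; exact: Wgen.
move=> fal pal [fgl _] [_ gz]; rewrite uppert_ur in gz.
set b := drsubmx f in gz.
have colE (y1 : 'cV[A]_l) (y2 : 'M[A]_1) : ursubmx f + col_mx y1 y2 *m b =
    col_mx (al + y1 *m b) (y2 *m b).
  by rewrite fal mul_col_mx add_col_mx add0r.
pose z1 := usubmx z; pose z2 := dsubmx z.
have zE : z = col_mx z1 z2 by rewrite vsubmxK.
rewrite zE colE in gz.
have [e e0 eP] := lu_open gz.
have b0 : 0 < mn b + 1 by rewrite ltr_wpDl// mn_ge0.
have pb : p *m (al + z1 *m b) + (- (p *m z1)) *m b = 1%:M.
  by rewrite mulmxDr pal mulNmx mulmxA addrK.
have [s sn [p' ps]] := bass sr pb (divr_gt0 e0 b0).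
have smx t : mxscale t%:C (0 : 'M[A]_1) = 0 by apply/matrixP => i j; rewrite !mxE scaler0.
have smxc m t : mxscale t%:C (0 : 'cV[A]_m) = 0 by apply/matrixP => i j; rewrite !mxE scaler0.
have linc (y1 d1 : 'cV[A]_l) (y2 d2 : 'M[A]_1) t :
    linpath (col_mx y1 y2) (col_mx d1 d2) t = col_mx (linpath y1 d1 t) (linpath y2 d2 t).
  by rewrite /linpath /mxscale map_col_mx add_col_mx.
have step (y1 y1' : 'cV[A]_l) (y2 y2' : 'M[A]_1) :
    (forall t, 0 <= t <= 1 -> lu (col_mx (al + linpath y1 (y1' - y1) t *m b)
       (linpath y2 (y2' - y2) t *m b))) ->
    same_red (uppert (col_mx y1 y2) *m f) (uppert (col_mx y1' y2') *m f).
  move=> H; have -> : col_mx y1' y2' = col_mx y1 y2 + col_mx (y1' - y1) (y2' - y2).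
    by rewrite add_col_mx !(addrC _ (_ - _)) !subrK.
  by apply: same_red_segment => // t /H; rewrite linc colE.
apply: same_red_sym; rewrite zE.
(* Four segments from [(z1, z2)] to [(0, 0)]. The first stays in a neighbourhood where the column is
   unimodular; along the second the upper part alone is unimodular, by the choice of [s]; along the
   third the last entry is [b], which absorbs any change of the upper part; along the fourth the
   upper part is [al]. *)
apply: (@same_red_trans _ _ (uppert (col_mx (z1 + s) z2) *m f)).
  apply: step => t /andP[t0 t1]; apply: eP.
  rewrite subrr linpath_cst opp_col_mx add_col_mx subrr; apply: le_lt_trans (mn_col_mx0 _ _) _.
  have -> : al + linpath z1 (z1 + s - z1) t *m b - (al + z1 *m b) = mxscale t%:C s *m b.
    rewrite [z1 + s]addrC addrK opprD addrACA subrr add0r /linpath mulmxDl.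
    by rewrite [z1 *m b + _]addrC addrK.
  apply: le_lt_trans (mnM _ _) _; rewrite mn_mxscale_real ger0_norm//.
  have h1 : t * mn s * mn b <= mn s * mn b by rewrite ler_wpM2r ?ler_piMl ?mn_ge0.
  by move: sn; rewrite ltr_pdivlMr//; have := mn_ge0 s; lra.
apply: (@same_red_trans _ _ (uppert (col_mx (z1 + s) 1%:M) *m f)).
  apply: step => t _; rewrite subrr linpath_cst; apply: lu_col_mx; exists p'.
  by move: ps; rewrite mulmxDl addrA.
apply: (@same_red_trans _ _ (uppert (col_mx 0 1%:M) *m f)).
  apply: step => t _; rewrite subrr linpath_cst mul1mx; set q := linpath _ _ _.
  exists (row_mx p (- (p *m q))); rewrite mul_row_col mulmxDr pal mulNmx.
  by rewrite mulmxA addrK.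
have -> : f = uppert (col_mx 0 0) *m f by rewrite col_mx0 uppert0 mul1mx.
rewrite [in X in same_red X _]col_mx0 uppert0 mul1mx.
apply: step => t _; rewrite subrr linpath_cst mul0mx addr0.
by apply: lu_col_mx; exists p.
Qed.

Section Stability.
Variable k : nat.
Hypothesis srk : csr k.
Implicit Types (g : 'M[A]_(k + 1)) (h : 'M[A]_k).

(** The last row of the inverse of [g] is a left inverse of its last column, which is what [bass]
    asks for. *)
Lemma lastcol_bass g (e : R) : glmx g -> 0 < e ->
  exists2 y : 'cV[A]_k, mn y < e & lu (ursubmx g + y *m drsubmx g).
Proof.
move=> [g' [_]]; rewrite -[g]submxK -[g']submxK mulmx_block scalar_mx_block.
move=> /eq_block_mx[_ _ _ h]; rewrite block_mxKur block_mxKdr.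
exact: (bass srk h).
Qed.

Lemma stable_surj g : glmx g -> exists2 h : 'M[A]_k, glmx h &
  glc g (block_mx h 0 0 1%:M).
Proof.
move=> gg; have [y _ ly] := lastcol_bass gg (@ltr01 R).
have gen : generic (uppert y *m g).
  by split; [apply: glmxM => //; exact: uppert_gl|rewrite uppert_ur].
have [x vx] := generic_valid gen.
exists (red (uppert y *m g) x); first by apply: red_gl => //; case: gen.
have gl1 : glmx (uppert y *m g) by case: gen.
have h1 : glc g (uppert y *m g).
  by have := glc_mulr gg (uppert_glc y); rewrite mul1mx.
apply: glc_trans h1 _.
have h2 : glc (uppert y *m g) (lowert x *m (uppert y *m g)).
  by have := glc_mulr gl1 (lowert_glc x); rewrite mul1mx.
apply: glc_trans h2 _.
have gl2 : glmx (lowert x *m (uppert y *m g)) by apply: glmxM => //; exact: lowert_gl.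
have := glc_mulr gl2 (uppert_glc (- ursubmx (uppert y *m g))); rewrite mul1mx redE//.
move=> h3; apply: glc_trans h3 _; set r := dlsubmx _ + _; set h := red _ _.
have gh : glmx h by apply: red_gl.
have gb : glmx (block_mx h 0 0 1%:M : 'M[A]_(k + 1)).
  have [h' [hh' h'h]] := gh; exists (block_mx h' 0 0 1%:M).
  rewrite !mulmx_block !mul0mx !mulmx0 !mulmx1 !addr0 !add0r.
  by rewrite hh' h'h -scalar_mx_block.
have := glc_mull gb (lowert_glc r); rewrite mulmx1 => /glc_sym.
by rewrite /lowert mulmx_block !mul0mx !mulmx0 !mulmx1 !mul1mx !addr0 !add0r.
Qed.

(** A reduction for every invertible [g], generic or not: the common class of the reductions of the
    generic matrices near [g]. It is unique because generic matrices are dense. *)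
Definition near_red g (h : 'M[A]_k) :=
  nbhs g [set g' | generic g' -> forall x, valid g' x -> glc h (red g' x)].

Lemma near_red_uniq g h h' : glmx g -> near_red g h -> near_red g h' -> glc h h'.
Proof.
move=> gg ng ng'.
have : nbhs g ([set g' | generic g' -> forall x, valid g' x -> glc h (red g' x)] `&`
    [set g' | generic g' -> forall x, valid g' x -> glc h' (red g' x)] `&` glc g).
  by apply: filterI; [exact: filterI|exact: glc_nbhs].
move=> /nbhs_mxP[e e0 eP].
have [b bn lb] := srk (ursubmx g) e0.
pose g' : 'M[A]_(k + 1) := block_mx (ulsubmx g) b (dlsubmx g) (drsubmx g).
have [] := eP g'.
  move=> i j; rewrite -[in X in nrm (_ - X)](submxK g) /g'.
  case: (split_ordP i) => i' ->; case: (split_ordP j) => j' ->.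
  - by rewrite !block_mxEul subrr nrm0.
  - rewrite !block_mxEur; apply: le_lt_trans bn.
    by have := mn_entry (b - ursubmx g) i' j'; rewrite !mxE.
  - by rewrite !block_mxEdl subrr nrm0.
  - by rewrite !block_mxEdr subrr nrm0.
move=> [/= H H'] /glc_glmx gg'.
have gen : generic g' by split=> //; rewrite block_mxKur.
have [x vx] := generic_valid gen.
exact: glc_trans (H gen x vx) (glc_sym (H' gen x vx)).
Qed.

End Stability.

Section InjectiveStability.
Variable l : nat.
Hypothesis srl : csr l.
Let k := (l + 1)%N.
Let srk : csr k := csr_mono (leq_addr 1 l) srl.
Implicit Types (g : 'M[A]_(k + 1)) (h : 'M[A]_k).

(** Fix [y] such that [uppert y *m g] is generic. For generic [f] near [g] the reduction of [f] is
    that of [uppert y *m f], by [same_red_uppert], which is locally constant. *)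
Lemma near_red_exists g : glmx g -> exists h, near_red g h.
Proof.
move=> gg; have [y _ ly] := lastcol_bass srk gg (@ltr01 R).
have gen : generic (uppert y *m g).
  by split; [apply: glmxM => //; exact: uppert_gl|rewrite uppert_ur].
have [x vx] := generic_valid gen.
exists (red (uppert y *m g) x).
have cU : continuous (fun f : 'M[A]_(k + 1) => uppert y *m f) by exact: mulmx_continuousl.
have h1 : nbhs g ((fun f : 'M[A]_(k + 1) => uppert y *m f) @^-1`
    [set f | generic f -> same_red (uppert y *m g) f]).
  by apply: cU; exact: same_red_local.
have [e e0 eP] := lu_open ly.
have h2 : nbhs g [set f : 'M[A]_(k + 1) | lu (ursubmx (uppert y *m f))].
  have c2 : continuous (fun f : 'M[A]_(k + 1) => ursubmx (uppert y *m f)).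
    by apply: mxsub_continuous cU => t i j; rewrite !mxE.
  by apply: (c2 g); apply/nbhs_mnP; exists e => // b; rewrite uppert_ur; exact: eP.
apply: filterS2 h1 h2 => f /= hf1 hf2 genf z vz.
have genyf : generic (uppert y *m f).
  by split=> //; apply: glmxM; [exact: uppert_gl|case: genf].
have [_ _ H1] := hf1 genyf.
have [_ _ H2] := same_red_uppert srl genf genyf.
have [z' vz'] := generic_valid genyf.
exact: glc_trans (H1 _ _ vx vz') (glc_sym (H2 _ _ vz vz')).
Qed.

Lemma near_red_glc g g' : glc g g' ->
  exists h h', [/\ near_red g h, near_red g' h' & glc h h'].
Proof.
move=> [D [Dg DG cD] Dg'].
pose r f f' := [/\ glmx f, glmx f' &
   exists h h', [/\ near_red f h, near_red f' h' & glc h h']].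
have [] : r g g'; last by [].
apply: (locally_constant cD) => //.
- move=> f f' [gf gf' [h [h' [n n' /glc_sym hh']]]]; split=> //; by exists h', h.
- move=> f1 f2 f3 [g1 g2 [h1 [h2 [n1 n2 h12]]]] [_ g3 [h2' [h3 [n2' n3 h23]]]].
  split=> //; exists h1, h3; split=> //; apply: glc_trans h12 _.
  exact: glc_trans (near_red_uniq srk g2 n2 n2') h23.
- move=> f /DG gf; have [h nh] := near_red_exists gf.
  apply: filterS2 (glc_nbhs gf) (nbhs_interior nh) => f' /glc_glmx gf' nf' _; split=> //; exists h, h; split=> //.
  apply: glc_refl.
  have [e e0 [b _ lb]] : exists2 e : R, 0 < e &
     exists2 b : 'cV[A]_k, mn (b - ursubmx f) < e & lu b.
    by exists 1 => //; exact: srk.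
  move: (nh) => /nbhs_mxP[e' e'0 eP'].
  have [b' b'n lb'] := srk (ursubmx f) e'0.
  have := near_red_uniq srk gf nh nh; exact: glc_glmx.
Qed.

(** A small unimodular column [b] next to [u] makes the matrix generic; then [x = 0] is valid and
    the reduction is exactly [u]. *)
Lemma near_red_block (u : 'M[A]_k) h : glmx u ->
  near_red (block_mx u 0 0 1%:M) h -> glc h u.
Proof.
move=> gu /nbhs_mxP[e e0 eP].
have [b bn lb] := srk 0 e0; rewrite subr0 in bn.
pose g' : 'M[A]_(k + 1) := block_mx u b 0 1%:M.
have gl' : glmx g'.
  have [u' [uu' u'u]] := gu.
  exists (block_mx u' (- (u' *m b)) 0 1%:M); rewrite !mulmx_block.
  rewrite !mul0mx !mulmx0 !mulmx1 !addr0 !add0r uu' u'u.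
  by rewrite mulmxN mulmxA uu' mul1mx addNr subrr -scalar_mx_block.
have gen : generic g' by split=> //; rewrite block_mxKur.
have v0 : valid g' 0 by rewrite /valid mul0mx block_mxKdr subrr.
have := eP g' _ gen 0 v0.
rewrite /red block_mxKul block_mxKur block_mxKdl mul0mx addr0 mulmx0 subr0.
apply.
move=> i j; rewrite /g'; case: (split_ordP i) => i' ->; case: (split_ordP j) => j' ->.
- by rewrite !block_mxEul subrr nrm0.
- rewrite !block_mxEur mxE subr0; apply: le_lt_trans bn; exact: mn_entry.
- by rewrite !block_mxEdl subrr nrm0.
- by rewrite !block_mxEdr subrr nrm0.
Qed.

Lemma stable_inj (u : 'M[A]_k) : glmx u ->
  glc (block_mx u 0 0 1%:M : 'M[A]_(k + 1)) 1%:M -> glc u 1%:M.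
Proof.
move=> gu; rewrite scalar_mx_block => /near_red_glc[h [h' [n n' hh']]].
apply: glc_trans (near_red_block (glmx1 _ _) n').
exact: glc_trans (glc_sym (near_red_block gu n)) hh'.
Qed.

End InjectiveStability.

End StableRank.

Section K1Stability.
Context (R : realType) (A : cstarAlg R).

Lemma k1class_eqP m n (u : unitary A m) (v : unitary A n) :
  k1class u = k1class v <-> exists k, [/\ (m <= k)%N, (n <= k)%N &
    U0 (pad k (val u) *m adjmx (pad k (val v)))].
Proof.
split=> [/k1piP/asboolP//|h]; apply/k1piP/asboolP; exact: h.
Qed.

Lemma glc_pad k n (S T : 'M[A]_n) : (n <= k)%N -> glc S T -> glc (pad k S) (pad k T).
Proof.
move=> nk; apply: glc_map; first exact: pad_continuous.
by move=> u [v [uv vu]]; exists (pad k v); rewrite -!padM// uv vu pad1.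
Qed.

Lemma stable_inj_pad l m (u : 'M[A]_m) : csr A l -> m = (l + 1)%N -> glmx u ->
  glc (pad (m + 1) u) 1%:M -> glc u 1%:M.
Proof. by move=> sr e; subst m => gu; rewrite padE; exact: stable_inj. Qed.

Lemma stable_inj_iter l d (u : 'M[A]_(l + 1)) : csr A l -> glmx u ->
  glc (pad (l + 1 + d) u) 1%:M -> glc u 1%:M.
Proof.
move=> sr gu; elim: d => [|d IH].
  rewrite addn0; have -> : pad (l + 1) u = u; last by [].
  apply/matrixP => i j; rewrite mxE.
  case: insubP => [i' _ ei|]; last by rewrite ltn_ord.
  case: insubP => [j' _ ej|]; last by rewrite ltn_ord.
  by congr (u _ _); apply: val_inj.
rewrite -(@pad_pad R A (l + 1 + d)) ?leq_addr ?leq_add2l// addnS -addn1 => h.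
apply: IH; apply: (@stable_inj_pad (l + d)) => //.
- by apply: csr_mono sr; rewrite leq_addr.
- by rewrite addnAC.
- by apply: glc_glmx; apply: glc_pad; [exact: leq_addr|exact: glc_refl].
Qed.

(** An equality of classes is witnessed at some larger size and is brought down one size at a time;
    [stable_inj] at size [l + 1] uses stable rank at most [l]. *)
Lemma K1_inj l (v w : unitary A (l + 1)) : csr A l ->
  k1class v = k1class w <-> U0 (val v *m adjmx (val w)).
Proof.
move=> sr; have vu := valP v; have wu := valP w.
split=> [/k1class_eqP[k [vk _ Uk]]|Uvw]; last first.
  apply/k1class_eqP; exists (l + 1)%N; split=> //.
  by rewrite adjmx_pad -padM//; exact: U0_pad.
have wV := is_unitarymxV wu; have vwu := is_unitarymxM vu wV.
move: Uk; rewrite adjmx_pad -padM// => Uk.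
have : glc (val v *m adjmx (val w)) 1%:M.
  apply: (@stable_inj_iter l (k - (l + 1))) => //; first exact: unitary_glmx.
  by rewrite subnKC//; apply: U0_glc; rewrite ?is_unitarymx1// adjmx1 mulmx1.
move=> /(glc_U0 vwu (is_unitarymx1 A _)).
by rewrite adjmx1 mulmx1.
Qed.

Lemma stable_surj_pad k m (u : unitary A m) : csr A k -> m = (k + 1)%N ->
  exists v : unitary A k, k1class u = k1class v.
Proof.
move=> sr e; subst m; have uu := valP u.
have [h gh uh] := stable_surj sr (unitary_glmx uu).
exists (exist _ (polarmx h) (polarmx_unitary gh)).
apply/k1class_eqP; exists (k + 1)%N; split; rewrite ?leq_addr//=.
have pu : is_unitarymx (pad (k + 1) (polarmx h)).
  by apply: is_unitarymx_pad; rewrite ?leq_addr// polarmx_unitary.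
have -> : pad (k + 1) (val u) = val u.
  apply/matrixP => i j; rewrite mxE.
  case: insubP => [i' _ ei|]; last by rewrite ltn_ord.
  case: insubP => [j' _ ej|]; last by rewrite ltn_ord.
  by congr (val u _ _); apply: val_inj.
apply: glc_U0 => //; apply: glc_trans uh _; rewrite -padE; apply: glc_sym.
by apply: glc_pad; [exact: leq_addr|exact: glc_polar].
Qed.

Lemma K1_surj n m (u : unitary A m) : csr A n ->
  exists v : unitary A n, k1class u = k1class v.
Proof.
move=> sr; have [mn|/ltnW nm] := leqP m n.
  exists (exist _ (pad n (val u)) (is_unitarymx_pad mn (valP u))).
  apply/k1class_eqP; exists n; split=> //=; rewrite pad_pad//.
  have /andP[_ /eqP ->] := is_unitarymx_pad mn (valP u); exact: U0_1.
have [d] := ubnPeq (m - n)%N; elim: d m u nm => [|d IH] m u nm /eqP md.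
  have e : m = n by apply/eqP; rewrite eqn_leq nm andbT -subn_eq0 md.
  by subst m; exists u.
have e : m = (n + d + 1)%N by rewrite addn1 -addnS -md subnKC.
have [v ->] := stable_surj_pad u (csr_mono (leq_addr d n) sr) e.
by apply: IH; rewrite ?leq_addr// addKn.
Qed.

End K1Stability.

(** * Real rank zero: unitaries in U_0 by chains of bounded length *)

Section RealRankZero.
Context (R : realType).

Definition rr0 (A : cstarAlg R) := forall (a : A) (e : R), star a = a -> 0 < e ->
  exists b : A, [/\ star b = b, invertible b & nrm (b - a) < e].

Lemma real_rank_zero_rr0 (A : cstarAlg R) : real_rank_zero A -> rr0 A.
Proof.
move=> h a e sa e0; have /h cl : self_adjoint (A := A) a by [].
have nb : nbhs a [set b | nrm (b - a) < e] by apply/nbhs_nrmP; exists e.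
by have [b [[sb ib] ab]] := cl _ nb; exists b.
Qed.

Lemma star_inverse (A : cstarAlg R) (a b : A) :
  star a = a -> a * b = 1 -> b * a = 1 -> star b = b.
Proof.
move=> sa ab ba.
have h1 : star b * a = 1 by rewrite -{1}sa -starM ab star1.
by rewrite -[star b]mulr1 -ab mulrA h1 mul1r.
Qed.

(** Perturb the corner [c] to an invertible [c1], then, by induction, the Schur complement
    [a - v c1^-1 v^*] to an invertible [b]. Undoing the elimination leaves the off-diagonal blocks
    untouched and changes each diagonal block by less than [e] in every entry. *)
Lemma rr0_entry (A : cstarAlg R) n (x : 'M[A]_n) (e : R) : rr0 A -> adjmx x = x ->
  0 < e -> exists y : 'M[A]_n, [/\ adjmx y = y, glmx y &
    forall i j, nrm (y i j - x i j) < e].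
Proof.
move=> rA; elim: n x e => [|n IH] x e xs e0.
  exists x; split=> //; last by case.
  by exists x; split; apply/matrixP; case.
rewrite -addn1 in x xs *.
set a := ulsubmx x; set v := ursubmx x; set c := drsubmx x.
have xE : x = block_mx a v (adjmx v) c.
  rewrite -[LHS]submxK -/a -/v -/c; congr block_mx.
  apply/matrixP => i j; rewrite adjmxE !mxE -[in LHS]xs adjmxE //.
have as_ : adjmx a = a.
  by apply/matrixP => i j; rewrite adjmxE !mxE -[in RHS]xs adjmxE.
have cs_ : star (c 0 0) = c 0 0.
  by rewrite !mxE -[in RHS]xs adjmxE.
have [c1 [c1s [c2 [c12 c21]] c1n]] := rA _ _ cs_ e0.
have c2s := star_inverse c1s c12 c21.
pose C1 : 'M[A]_1 := c1%:M; pose C2 : 'M[A]_1 := c2%:M.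
have C12 : C1 *m C2 = 1%:M by rewrite -scalar_mxM c12.
have C21 : C2 *m C1 = 1%:M by rewrite -scalar_mxM c21.
have adj1 (z : A) : adjmx (z%:M : 'M[A]_1) = (star z)%:M.
  by apply/matrixP => i j; rewrite adjmxE !ord1 !mxE eqxx.
pose w := v *m C2.
have adjB n1 n2 (S T : 'M[A]_(n1, n2)) : adjmx (S - T) = adjmx S - adjmx T.
  by apply/matrixP => i j; rewrite !mxE starB.
have adjD n1 n2 (S T : 'M[A]_(n1, n2)) : adjmx (S + T) = adjmx S + adjmx T.
  by apply/matrixP => i j; rewrite !mxE starD.
have wv : adjmx (w *m adjmx v) = w *m adjmx v.
  by rewrite /w !adjmxM adjmxK adj1 c2s mulmxA.
have hs : adjmx (a - w *m adjmx v) = a - w *m adjmx v by rewrite adjB as_ wv.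
have [b [bs [b' [bb' b'b]] bn]] := IH _ e hs e0.
exists (block_mx (b + w *m adjmx v) v (adjmx v) C1); split.
- apply/matrixP => i j; rewrite adjmxE.
  case: (split_ordP i) => i' ->; case: (split_ordP j) => j' ->.
  + rewrite !block_mxEul -adjmxE; congr (fun_of_matrix _ _ _).
    by rewrite adjD bs wv.
  + by rewrite block_mxEdl block_mxEur -adjmxE adjmxK.
  + by rewrite block_mxEdl block_mxEur -adjmxE.
  + by rewrite !block_mxEdr -adjmxE adj1 c1s.
- have -> : block_mx (b + w *m adjmx v) v (adjmx v) C1 =
    uppert w *m block_mx b 0 0 C1 *m lowert (C2 *m adjmx v).
    rewrite /uppert /lowert !mulmx_block !mul0mx !mulmx0 !mulmx1 !mul1mx !addr0 !add0r.
    rewrite /w -!mulmxA C21 mulmx1; congr block_mx; last by rewrite mulmxA C12 mul1mx.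
    by rewrite (mulmxA C1) C12 mul1mx mulmxA.
  apply: glmxM; last exact: lowert_gl.
  apply: glmxM; first exact: uppert_gl.
  exists (block_mx b' 0 0 C2); rewrite !mulmx_block !mul0mx !mulmx0 !addr0 !add0r.
  by rewrite bb' b'b C12 C21 -scalar_mx_block.
- move=> i j; rewrite xE.
  case: (split_ordP i) => i' ->; case: (split_ordP j) => j' ->.
  + rewrite !block_mxEul; have := bn i' j'; congr (nrm _ < e).
    have addE (S T : 'M[A]_n) : (S + T) i' j' = S i' j' + T i' j' by rewrite mxE.
    have oppE (S : 'M[A]_n) : (- S) i' j' = - S i' j' by rewrite mxE.
    by rewrite !(addE, oppE); ncring.
  + by rewrite !block_mxEur subrr nrm0.
  + by rewrite !block_mxEdl subrr nrm0.
  + rewrite !block_mxEdr !ord1; suff -> : C1 0 0 = c1 by [].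
    by rewrite mxE eqxx.
Qed.

Lemma rr0_mxC (A : cstarAlg R) n : rr0 A -> rr0 (mxC A n).
Proof.
move=> rA x e xs e0.
pose d : R := e / (n * n).+1%:R.
have d0 : 0 < d by rewrite divr_gt0 ?ltr0Sn.
have [y [ys [y' yy'] yn]] := @rr0_entry A n x d rA xs d0.
exists y; split=> //; first by exists y'.
apply: le_lt_trans (mn_le_mxsum ((y : 'M[A]_n) - x)) _.
apply: (@le_lt_trans _ _ (\sum_(i < n) \sum_(j < n) d)).
  apply: ler_sum => i _; apply: ler_sum => j _; apply: ltW.
  by have := yn i j; rewrite !mxE.
rewrite !sumr_const !card_ord -!mulrnA -mulr_natr /d.
by rewrite mulrAC ltr_pdivrMr ?ltr0Sn// ltr_pM2l// ltr_nat.
Qed.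

End RealRankZero.

(** * Norms of band matrices *)

Section BandNorm.
Context (R : realType) (A : cstarAlg R).

Lemma rc_nat (m : nat) : rc A m%:R = m%:R.
Proof. by elim: m => [|m IH]; rewrite ?rc0// -natr1 rcD IH rc1 natr1. Qed.

Lemma sum_cst (I : finType) (P : pred I) (a : A) :
  \sum_(j | P j) a = rc A #|P|%:R * a.
Proof. by rewrite sumr_const rc_nat mulr_natl. Qed.

(** The difference is half of the sum over [i, j] of the positive elements
    [star (x i - x j) * (x i - x j)]. *)
Lemma pos_sum_sqr (I : finType) (P : pred I) (x : I -> A) :
  pos (rc A #|P|%:R * (\sum_(i | P i) star (x i) * x i) -
       star (\sum_(i | P i) x i) * (\sum_(i | P i) x i)).
Proof.
set S := \sum_(i | P i) x i; set Q := \sum_(i | P i) star (x i) * x i.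
have h : pos (\sum_(i | P i) \sum_(j | P j) star (x i - x j) * (x i - x j)).
  by apply: pos_sum => i _; apply: pos_sum => j _; exact: pos_starM.
suff E : \sum_(i | P i) \sum_(j | P j) star (x i - x j) * (x i - x j) =
   rc A 2 * (rc A #|P|%:R * Q - star S * S).
  have h2 : (0 : R) <= 2^-1 by rewrite invr_ge0.
  by have := pos_scale h2 h; rewrite E rcK ?pnatr_eq0.
transitivity (\sum_(i | P i) (rc A #|P|%:R * (star (x i) * x i) - star (x i) * S
    - star S * x i + Q)).
  apply: eq_bigr => i Pi.
  rewrite (eq_bigr (fun j => (star (x i) * x i - star (x i) * x j) +
     (- (star (x j) * x i) + star (x j) * x j))); last by move=> j _; rewrite starB; ncring.
  rewrite big_split/= big_split/= sum_cst sumrN -mulr_sumr big_split/= sumrN -mulr_suml.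
  by rewrite -star_sum !addrA.
rewrite !big_split/= -mulr_sumr !sumrN -mulr_suml -star_sum -mulr_sumr sum_cst rc2.
by rewrite -/S -/Q; ncring.
Qed.

(** A Schur test. The bound does not see the size [n] of the matrix; this is what makes the length
    of a chain of unitaries disappear from the estimates. *)
Lemma mn_band n (P : rel 'I_n) (r : nat) (T : 'M[A]_n) (t : R) : 0 <= t ->
  (forall i, (#|[pred j | P i j]| <= r)%N) -> (forall j, (#|[pred i | P i j]| <= r)%N) ->
  (forall i j, ~~ P i j -> T i j = 0) -> (forall i j, nrm (T i j) <= t) ->
  mn T <= r%:R * t.
Proof.
move=> t0 Pr Pc T0 Tt; have rt : 0 <= r%:R * t by rewrite mulr_ge0.
apply: mn_le => // v.
rewrite -(ler_pXn2r (n := 2)) ?nnegrE ?mulr_ge0 ?vn_ge0// exprMn !vn2.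
have -> : (r%:R * t) ^+ 2 * nrm (ip v v) = nrm (rc A ((r%:R * t) ^+ 2) * ip v v).
  by rewrite nrm_rcM ger0_norm ?exprn_ge0.
apply: nrm_mono; first exact: ip_pos.
pose w j := star (v j 0) * v j 0.
have pw j : pos (w j) by exact: pos_starM.
apply: (@pos_le_trans _ _ _ (\sum_i rc A (r%:R * t ^+ 2) * \sum_(j | P i j) w j)).
  rewrite /ip -sumrB; apply: pos_sum => i _.
  have -> : (T *m v) i 0 = \sum_(j | P i j) T i j * v j 0.
    rewrite mxE [RHS]big_mkcond /=; apply: eq_bigr => j _.
    by case: ifPn => // /T0 ->; rewrite mul0r.
  apply: (@pos_le_trans _ _ _ (rc A r%:R * \sum_(j | P i j) star (T i j * v j 0) * (T i j * v j 0))).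
    apply: pos_le_trans (pos_sum_sqr (P i) (fun j => T i j * v j 0)) _.
    rewrite -mulrBl -rcB; apply: pos_scale; first by rewrite subr_ge0 ler_nat; exact: Pr.
    by apply: pos_sum => j _; exact: pos_starM.
  rewrite rcM -mulrA -mulrBr; apply: pos_scale => //.
  rewrite mulr_sumr -sumrB; apply: pos_sum => j Pj.
  rewrite starM /w.
  have -> : rc A (t ^+ 2) * (star (v j 0) * v j 0) - star (v j 0) * star (T i j) * (T i j * v j 0)
     = star (v j 0) * (rc A (t ^+ 2) - star (T i j) * T i j) * v j 0.
    by rewrite mulrBr mulrBl !mulrA rcC.
  apply: pos_conj; apply: pos_shift; first by rewrite starM starK.
  by rewrite nrmC ler_pXn2r ?nnegrE ?nrm_ge0.
have -> : (r%:R * t) ^+ 2 = r%:R * t ^+ 2 * r%:R by ring.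
rewrite -mulr_sumr rcM -mulrA -mulrBr.
apply: pos_scale; first by rewrite mulr_ge0 ?exprn_ge0.
rewrite (exchange_big_dep xpredT)//= /ip mulr_sumr -sumrB; apply: pos_sum => j _.
rewrite sum_cst -/(w j) -mulrBl -rcB.
by apply: pos_scale => //; rewrite subr_ge0 ler_nat; exact: Pc.
Qed.

End BandNorm.

(** * Chains of invertible elements *)

Section Chains.
Context (R : realType) (C : cstarAlg R).
Implicit Types (u v w g : C).

Definition ginv (kap : R) g g' :=
  [/\ g * g' = 1, g' * g = 1, nrm g <= kap & nrm g' <= kap].

Definition gchain (kap eta : R) (K : nat) u v :=
  exists g g' : nat -> C, [/\ g 0%N = u, g K = v,
    forall j, ginv kap (g j) (g' j) &
    forall j, nrm (g j.+1 - g j) <= eta].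

Lemma gchain_cat kap eta K L u v w : gchain kap eta K u v -> gchain kap eta L v w ->
  gchain kap eta (K + L) u w.
Proof.
move=> [g [g' [g0 gK gi gs]]] [h [h' [h0 hL hi hs]]].
exists (fun j => if (j <= K)%N then g j else h (j - K)%N).
exists (fun j => if (j <= K)%N then g' j else h' (j - K)%N); split.
- by rewrite leq0n.
- case: leqP => h1; last by rewrite addKn.
  have L0 : L = 0%N by apply/eqP; rewrite -leqn0 -(leq_add2l K) addn0.
  by rewrite L0 addn0 gK -h0 -hL L0.
- by move=> j; case: ifP.
- move=> j; case: (leqP j K) => jK.
    case: (leqP j.+1 K) => jK'; first exact: gs.
    have -> : j = K by apply/eqP; rewrite eqn_leq jK.
    by rewrite subSnn gK -h0; exact: hs.
  by rewrite ifF ?subSn ?(ltnW jK)//; apply/negbTE; rewrite -ltnNge ltnW.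
Qed.

Lemma gchain_step kap eta u u' v v' : ginv kap u u' -> ginv kap v v' -> 0 <= eta ->
  nrm (v - u) <= eta -> gchain kap eta 1 u v.
Proof.
move=> iu iv e0 uv; exists (fun j => if j is 0 then u else v).
exists (fun j => if j is 0 then u' else v'); split=> // -[|j]//.
by rewrite subrr nrm0.
Qed.

Lemma gchain_path kap eta (L : R) (p p' : R -> C) (K : nat) : (0 < K)%N ->
  0 <= L -> L <= eta * K%:R ->
  (forall s, 0 <= s <= 1 -> ginv kap (p s) (p' s)) ->
  (forall s t, 0 <= s <= 1 -> 0 <= t <= 1 -> nrm (p s - p t) <= L * `|s - t|) ->
  gchain kap eta K (p 0) (p 1).
Proof.
move=> K0 L0 LK ip pL; have KR : 0 < K%:R :> R by rewrite ltr0n.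
(* The conditions of [gchain] bear on all indices; [minn] keeps the sequence constant after [K]. *)
pose s (j : nat) : R := (minn j K)%:R / K%:R.
have s01 j : 0 <= s j <= 1.
  by rewrite /s divr_ge0//= ler_pdivrMr// mul1r ler_nat geq_minr.
exists (p \o s), (p' \o s); split=> /=.
- by rewrite /s min0n mul0r.
- by rewrite /s minnn divff ?gt_eqF.
- by move=> j; exact: ip.
- move=> j; apply: le_trans (pL _ _ (s01 _) (s01 _)) _.
  have : `|s j.+1 - s j| <= K%:R^-1.
    rewrite /s -mulrBl normrM [X in _ * X]ger0_norm ?invr_ge0//.
    rewrite ler_piMl ?invr_ge0//; case: (leqP j.+1 K) => jK.
      by rewrite (minn_idPl (ltnW jK)) -natr1 addrAC subrr add0r normr1.
    by rewrite (minn_idPr (jK : (K <= j)%N)) subrr normr0.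
  move=> h; apply: (@le_trans _ _ (L * K%:R^-1)); first by rewrite ler_wpM2l.
  by rewrite ler_pdivrMr.
Qed.

Lemma gchain_mono kap kap' eta K u v : kap <= kap' -> gchain kap eta K u v ->
  gchain kap' eta K u v.
Proof.
move=> kk [g [g' [g0 gK gi gs]]]; exists g, g'; split=> // j.
by have [h1 h2 h3 h4] := gi j; split=> //; apply: le_trans kk.
Qed.

End Chains.

(** * A unitary as p - q + i y *)

Section UnitaryParts.
Context (R : realType) (C : cstarAlg R).
Implicit Types (d k u w W x y p q : C).
Local Notation rc := (rc C).
Local Notation ii := (ii C).

Lemma nrm_sa_sqr k : star k = k -> nrm (k * k) = nrm k ^+ 2.
Proof. by move=> ks; rewrite -nrmC ks. Qed.

(** Real and imaginary part; [ppart] and [qpart] are the positive and negative parts of the real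
    one. The triple [(y, p, q)] lies on a sphere ([part_sqr]) and [p q = 0]. *)
Definition rpart W := rc 2^-1 * (W + star W).
Definition ipart W := rc 2^-1 * (- ii * (W - star W)).
(** The absolute value, for [d] of norm at most 1. The explicit root lets [sq_lim_unif] control it
    uniformly over all algebras. *)
Definition dabs d := 1 - sq_lim (1 - d * d).
Definition ppart W := rc 2^-1 * (dabs (rpart W) + rpart W).
Definition qpart W := rc 2^-1 * (dabs (rpart W) - rpart W).

Lemma rc_half2 x : rc 2^-1 * x + rc 2^-1 * x = x.
Proof.
rewrite -mulrDl -rcD (_ : 2^-1 + 2^-1 = 1 :> R) ?rc1 ?mul1r//.
by field.
Qed.

Lemma double_inj x y : x + x = y + y -> x = y.
Proof.
move=> h; apply: (@rc_inj R C 2); first by rewrite pnatr_eq0.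
by rewrite rc2 !mulrDl !mul1r.
Qed.

Section Props.
Variable W : C.
Hypothesis uW : unitary_elt W.
Let d := rpart W.
Let y := ipart W.
Let m := dabs d.
Let p := ppart W.
Let q := qpart W.

Let d2 : d + d = W + star W. Proof. exact: rc_half2. Qed.
Let y2 : y + y = - ii * (W - star W). Proof. exact: rc_half2. Qed.

Let ds : star d = d.
Proof. by rewrite /d /rpart starM star_rc starD starK -rcC [star W + _]addrC. Qed.

Lemma ipart_sa : star y = y.
Proof.
rewrite /y /ipart starM star_rc starM starN star_ii opprK starB starK -rcC.
by rewrite -iiC; congr (_ * _); ncring.
Qed.

Let Wdy : W = d + ii * y.
Proof.
apply: double_inj.
have -> : d + ii * y + (d + ii * y) = (d + d) + ii * (y + y) by ncring.
rewrite d2 y2; have -> : ii * (- ii * (W - star W)) = - (ii * ii) * (W - star W) by ncring.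
by rewrite iiM; ncring.
Qed.

Let Wdy' : star W = d - ii * y.
Proof. by rewrite Wdy starD starM star_ii ds ipart_sa mulrN -iiC. Qed.

Let dy : d * y = y * d.
Proof.
have [u1 u2] := uW.
apply: double_inj; apply: double_inj.
have -> : d * y + d * y + (d * y + d * y) = (d + d) * (y + y) by ncring.
have -> : y * d + y * d + (y * d + y * d) = (y + y) * (d + d) by ncring.
rewrite d2 y2; have -> : (W + star W) * (- ii * (W - star W)) =
   - (W * ii) * (W - star W) - (star W * ii) * (W - star W) by ncring.
rewrite -!iiC; have -> : - (ii * W) * (W - star W) - ii * star W * (W - star W) =
  - ii * (W * W - W * star W + star W * W - star W * star W) by ncring.
have -> : - ii * (W - star W) * (W + star W) =
  - ii * (W * W + W * star W - star W * W - star W * star W) by ncring.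
by rewrite u1 u2; congr (_ * _); ncring.
Qed.

Let dy1 : d * d + y * y = 1.
Proof.
have [_ u2] := uW; rewrite -u2 Wdy' Wdy.
have := dy => e; have -> : (d + ii * y) * (d - ii * y) = d * d - (ii * ii) * (y * y).
  by ccring.
by rewrite iiM; ncring.
Qed.

Let dn : nrm d <= 1.
Proof.
rewrite /d /rpart nrm_rcM ger0_norm ?invr_ge0// ler_pdivrMl//.
by apply: le_trans (nrmD _ _) _; rewrite nrm_star; have := nrm_unitary uW; lra.
Qed.

Let d1n : nrm (1 - d * d) <= 1. Proof. exact: sq1_pos. Qed.

Let mm : m * m = d * d.
Proof. by rewrite /m /dabs sq_sqrt1m// opprB addrC subrK. Qed.

Let cm c : c * d = d * c -> c * m = m * c.
Proof.
move=> cd; apply: cmB; first exact: cm1.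
by apply: sq_lim_comm => //; apply: cmB; [exact: cm1|apply: cmM].
Qed.

Let ms : star m = m.
Proof. by rewrite /m /dabs starB star1 sq_lim_star// starB star1 starM ds. Qed.

Let mpos : pos m.
Proof.
split=> //; exists 1 => //; rewrite rc1 opprB addrC subrK; exact: sq_lim_le1.
Qed.

Let mpm : pos (m + d) /\ pos (m - d).
Proof.
have [m' [pm m'E h1 h2 _]] := abs_exists ds.
have -> : m = m' by apply: pos_sqrt_uniq => //; rewrite mm m'E.
by [].
Qed.

Let p2 : p + p = m + d. Proof. exact: rc_half2. Qed.
Let q2 : q + q = m - d. Proof. exact: rc_half2. Qed.

Lemma ppart_pos : pos p.
Proof. by case: mpm => h _; apply: pos_scale => //; rewrite invr_ge0. Qed.
Lemma qpart_pos : pos q.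
Proof. by case: mpm => _ h; apply: pos_scale => //; rewrite invr_ge0. Qed.

Let dm : d * m = m * d. Proof. exact: cm. Qed.
Let ym : y * m = m * y. Proof. by apply: cm; rewrite dy. Qed.

Lemma part_comm : [/\ p * q = q * p, y * p = p * y & y * q = q * y].
Proof.
have cp c : c * d = d * c -> c * p = p * c.
  by move=> cd; apply: cmM; [exact: cm_rc|apply: cmD => //; exact: cm].
have cq c : c * d = d * c -> c * q = q * c.
  by move=> cd; apply: cmM; [exact: cm_rc|apply: cmB => //; exact: cm].
split; [|by apply: cp; rewrite dy|by apply: cq; rewrite dy].
by apply: cq; symmetry; apply: cp.
Qed.

Lemma part_mul0 : p * q = 0.
Proof.
apply: double_inj; apply: double_inj; rewrite !addr0.
have -> : p * q + p * q + (p * q + p * q) = (p + p) * (q + q) by ncring.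
rewrite p2 q2; have := dm => e; have -> : (m + d) * (m - d) = m * m - d * d by ccring.
by rewrite mm subrr.
Qed.

Lemma part_sqr : y * y + p * p + q * q = 1.
Proof.
apply: double_inj; apply: double_inj.
have -> : y * y + p * p + q * q + (y * y + p * p + q * q) +
   (y * y + p * p + q * q + (y * y + p * p + q * q)) =
   (y * y + y * y + y * y + y * y) + ((p + p) * (p + p) + (q + q) * (q + q)) by ncring.
rewrite p2 q2; have := dm => e.
have -> : (m + d) * (m + d) + (m - d) * (m - d) = m * m + m * m + (d * d + d * d) by ccring.
by rewrite mm -dy1; ncring.
Qed.

Lemma part_sum : W = p - q + ii * y.
Proof.
rewrite {1}Wdy; congr (_ + _); apply: double_inj.
have -> : p - q + (p - q) = (p + p) - (q + q) by ncring.
by rewrite p2 q2; ncring.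
Qed.

Let mn1 : nrm m <= 1.
Proof.
rewrite -(ler_pXn2r (n := 2)) ?nnegrE ?nrm_ge0// -nrm_sa_sqr// mm nrm_sa_sqr//.
by rewrite ler_pXn2r ?nnegrE ?nrm_ge0.
Qed.

Lemma part_nrm : [/\ nrm y <= 1, nrm p <= 1 & nrm q <= 1].
Proof.
split; rewrite nrm_rcM ger0_norm ?invr_ge0// ler_pdivrMl//.
- rewrite mulNr nrmN nrm_iiM; apply: le_trans (nrmD _ _) _; rewrite nrmN nrm_star.
  by have := nrm_unitary uW; lra.
- by apply: le_trans (nrmD _ _) _; move: mn1 dn; rewrite /m /d; lra.
- by apply: le_trans (nrmD _ _) _; rewrite nrmN; move: mn1 dn; rewrite /m /d; lra.
Qed.

End Props.

Lemma parts_one : [/\ ipart 1 = 0, ppart 1 = 1 & qpart 1 = 0].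
Proof.
have d1 : rpart 1 = 1 by rewrite /rpart star1 -rc2 -rcM mulVf ?rc1.
have m1 : dabs 1 = 1.
  rewrite /dabs mulr1 subrr; have -> : sq_lim 0 = 0 :> C; last by rewrite subr0.
  apply: nrm0_eq0; apply/eqP; rewrite eq_le nrm_ge0 andbT.
  by apply: (@sq_lim_le R C 0 0 0); rewrite ?nrm0// expr0n mulr0 addr0.
split.
- by rewrite /ipart star1 subrr !mulr0.
- by rewrite /ppart d1 m1 -rc2 -rcM mulVf ?rc1.
- by rewrite /qpart d1 m1 subrr mulr0.
Qed.

End UnitaryParts.

(** Only the absolute value fails to be Lipschitz; for it [sq_lim_unif] gives a modulus valid in
    every algebra. *)
Lemma parts_unif (R : realType) (e : R) : 0 < e -> exists2 dl : R, 0 < dl &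
  forall (C : cstarAlg R) (W W' : C), unitary_elt W -> unitary_elt W' ->
    nrm (W - W') <= dl -> [/\ nrm (ipart W - ipart W') <= e,
      nrm (ppart W - ppart W') <= e & nrm (qpart W - qpart W') <= e].
Proof.
move=> e0; have [dl dl0 H] := sq_lim_unif e0.
exists (Num.min e (dl / 2)); first by rewrite lt_min e0 divr_gt0.
move=> C W W' uW uW'; rewrite le_min => /andP[We Wd].
have dnn (V : C) : unitary_elt V -> star (rpart V) = rpart V /\ nrm (rpart V) <= 1.
  move=> uV; split; first by rewrite /rpart starM star_rc starD starK -rcC [star V + _]addrC.
  rewrite /rpart nrm_rcM ger0_norm ?invr_ge0// ler_pdivrMl//.
  by apply: le_trans (nrmD _ _) _; rewrite nrm_star; have := nrm_unitary uV; lra.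
have [ds dn] := dnn W uW; have [ds' dn'] := dnn W' uW'.
have dd : nrm (rpart W - rpart W') <= nrm (W - W').
  rewrite /rpart -mulrBr nrm_rcM ger0_norm ?invr_ge0// ler_pdivrMl//.
  have -> : W + star W - (W' + star W') = (W - W') + star (W - W') by rewrite starB; ncring.
  by apply: le_trans (nrmD _ _) _; rewrite nrm_star; lra.
have yy : nrm (ipart W - ipart W') <= nrm (W - W').
  rewrite /ipart -mulrBr -mulrBr nrm_rcM ger0_norm ?invr_ge0// ler_pdivrMl//.
  rewrite mulNr nrmN nrm_iiM.
  have -> : W - star W - (W' - star W') = (W - W') - star (W - W') by rewrite starB; ncring.
  by apply: le_trans (nrmD _ _) _; rewrite nrmN nrm_star; lra.
have mm : nrm (dabs (rpart W) - dabs (rpart W')) <= e.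
  have -> : dabs (rpart W) - dabs (rpart W') =
     sq_lim (1 - rpart W' * rpart W') - sq_lim (1 - rpart W * rpart W).
    by rewrite /dabs; ncring.
  apply: H; [exact: sq1_pos|exact: sq1_pos|].
  have -> : 1 - rpart W' * rpart W' - (1 - rpart W * rpart W) =
      (rpart W - rpart W') * rpart W + rpart W' * (rpart W - rpart W') by ncring.
  apply: le_trans (nrmD _ _) _.
  have := nrmM (rpart W - rpart W') (rpart W); have := nrmM (rpart W') (rpart W - rpart W').
  have := nrm_ge0 (rpart W - rpart W'); nra.
split; first exact: le_trans yy We.
- rewrite /ppart -mulrBr nrm_rcM ger0_norm ?invr_ge0// ler_pdivrMl// opprD addrACA.
  by apply: le_trans (nrmD _ _) _; lra.
- rewrite /qpart -mulrBr nrm_rcM ger0_norm ?invr_ge0// ler_pdivrMl//.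
  have -> : dabs (rpart W) - rpart W - (dabs (rpart W') - rpart W') =
   (dabs (rpart W) - dabs (rpart W')) - (rpart W - rpart W') by ncring.
  by apply: le_trans (nrmD _ _) _; rewrite nrmN; lra.
Qed.

(** * The segment from a unitary to its edge element *)

Section Segment.
Context (R : realType) (C : cstarAlg R).
Variables (y p q : C).
Local Notation rc := (rc C).
Local Notation ii := (ii C).
Hypotheses (ys : star y = y) (pp : pos p) (pq : pos q) (q1 : nrm q <= 1)
  (y1 : nrm y <= 1)
  (cpq : p * q = q * p) (cyp : y * p = p * y) (cyq : y * q = q * y)
  (pq0 : p * q = 0) (sum1 : y * y + p * p + q * q = 1).

(* The limit of the corner entry of psi (site_mx) as the mesh of the chain tends to 0. *)
Definition edge : C := 1 - q * q - q * q * q * q + (1 + 1) * (ii * y * q * q).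

Let u := p - q + ii * y.
Let a := 1 - q * q - q * q * q * q.
Let b := (1 + 1) * (y * q * q).
Let r := p - q.
Let ro := r * a + y * b.
Let io := r * b - y * a.

Let ps : star p = p. Proof. by case: pp. Qed.
Let qs : star q = q. Proof. by case: pq. Qed.
Let yyE : y * y = 1 - p * p - q * q. Proof. by rewrite -sum1; ncring. Qed.

(** [ro] is the real part of [star u * edge]. Using [p q = 0], one gets [1/4 + ro = p + (q - 1/2)^2
    + q^2 ((1 - q)(1 + 2 q) + q^3)]. *)
Let ro_pos : pos (rc (1 / 4) + ro).
Proof.
have h4 : rc (1 / 4) = rc 2^-1 * rc 2^-1 by rewrite -rcM; congr (rc _); field.
have h2 : rc 2^-1 + rc 2^-1 = 1 by have := rc_half2 (1 : C); rewrite !mulr1.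
have c2 := rcC (A := C) 2^-1 q.
have -> : rc (1 / 4) + ro = p + (q - rc 2^-1) * (q - rc 2^-1) +
    (q * q) * ((1 - q) * (1 + q + q) + q * q * q).
  have -> : ro = p - q + q * q * q + q * q * q * q * q + (1 + 1) * (q * q) - (1 + 1) * (q * q * q * q)
      - (p * q) * q - (p * q) * (q * q * q).
    rewrite /ro /b; have -> : y * ((1 + 1) * (y * q * q)) = (1 + 1) * ((y * y) * q * q) by ncring.
    rewrite yyE; have -> : (1 - p * p - q * q) * q * q = q * q - q * q * q * q - p * (p * q) * q by ncring.
    have -> : p * (p * q) * q = 0 by rewrite pq0 mulr0 mul0r.
    by rewrite subr0 /r /a; ncring.
  rewrite pq0 !mul0r !subr0 h4.
  have -> : (q - rc 2^-1) * (q - rc 2^-1) = q * q - (rc 2^-1 + rc 2^-1) * q + rc 2^-1 * rc 2^-1.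
    by ccring.
  by rewrite h2; ncring.
have pos1q : pos (1 - q) by rewrite -(rc1 C); apply: pos_shift.
have pos1 : pos (1 : C) by rewrite -(rc1 C); apply: pos_rc.
have pqq : pos (q * q) by apply: pos_sqr.
apply: posD.
  by apply: posD => //; apply: pos_sqr; rewrite starB qs star_rc.
apply: posM => //; last by ncring.
apply: posD; last by apply: posM => //; ncring.
by apply: posM => //; [apply: posD => //; exact: posD|ncring].
Qed.

Let edgeE : edge = a + ii * b.
Proof.
rewrite /edge -/a; congr (_ + _).
by rewrite /b; ccring.
Qed.

(** The modulus of [edge] is [1 - q^2 + q^4 = (q^2 - 1/2)^2 + 3/4]. *)
Let abs_edge : pos (a * a + b * b - rc (9 / 16)).
Proof.
have h : a * a + b * b = (1 - q * q + q * q * q * q) * (1 - q * q + q * q * q * q).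
  rewrite /b; have -> : (1 + 1) * (y * q * q) * ((1 + 1) * (y * q * q)) =
     (1 + 1) * (1 + 1) * (y * y) * (q * q * q * q) by ccring.
  rewrite yyE; have -> : (1 + 1) * (1 + 1) * (1 - p * p - q * q) * (q * q * q * q) =
     (1 + 1) * (1 + 1) * (1 - q * q) * (q * q * q * q) - (1 + 1) * (1 + 1) * (p * (p * q) * (q * q * q)).
    by ncring.
  by rewrite pq0 !(mulr0, mul0r) subr0 /a; ncring.
have h2 : rc 2^-1 + rc 2^-1 = 1 by have := rc_half2 (1 : C); rewrite !mulr1.
have c2 := rcC (A := C) 2^-1 q.
have sq : 1 - q * q + q * q * q * q = (q * q - rc 2^-1) * (q * q - rc 2^-1) + rc (3 / 4).
  have -> : rc (3 / 4) = 1 - rc 2^-1 * rc 2^-1.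
    by rewrite -{1}(rc1 C) -rcM -rcB; congr (rc _); field.
  have -> : (q * q - rc 2^-1) * (q * q - rc 2^-1) =
    q * q * q * q - (rc 2^-1 + rc 2^-1) * (q * q) + rc 2^-1 * rc 2^-1 by ccring.
  by rewrite h2; ncring.
set z := 1 - q * q + q * q * q * q in h sq *.
have psq : pos ((q * q - rc 2^-1) * (q * q - rc 2^-1)).
  by apply: pos_sqr; rewrite starB star_rc starM qs.
have p1 : pos (z - rc (3 / 4)) by rewrite sq addrK.
have p2 : pos (z + rc (3 / 4)).
  rewrite sq -addrA -rcD; apply: posD => //; apply: pos_rc; lra.
have -> : a * a + b * b - rc (9 / 16) = (z - rc (3 / 4)) * (z + rc (3 / 4)).
  have c3 := rcC (A := C) (3 / 4) z.
  have -> : (z - rc (3 / 4)) * (z + rc (3 / 4)) = z * z - rc (3 / 4) * rc (3 / 4) by ccring.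
  by rewrite h -rcM; congr (_ - rc _); field.
apply: posM => //; have c3 := rcC (A := C) (3 / 4) z; by ccring.
Qed.

Let as_ : star a = a.
Proof. by rewrite /a !(starB, starM) star1 qs !mulrA. Qed.
Let bs : star b = b.
Proof.
rewrite /b starM starD star1 !starM ys qs.
by ccring.
Qed.
Let ca c : c * q = q * c -> c * a = a * c.
Proof.
by move=> cq; apply: cmB; [apply: cmB; [exact: cm1|exact: cmM]|do 3 apply: cmM => //].
Qed.
Let cb c : c * q = q * c -> c * y = y * c -> c * b = b * c.
Proof.
move=> cq cy; apply: cmM; first by apply: cmD; exact: cm1.
by apply: cmM => //; apply: cmM.
Qed.

(** After the factor [u] is taken out, the segment joins 1 to [star u * edge], whose real part is at
    least [-1/4] and whose modulus is at least [3/4]; such a segment stays away from 0. All elements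
    involved commute, so this scalar picture is valid. *)
Lemma edge_path (t : R) : 0 <= t <= 1 -> exists g' : C,
  ginv 25 (rc (1 - t) * u + rc t * edge) g'.
Proof.
move=> /andP[t0 t1].
have cay : y * a = a * y by apply: ca.
have cap : p * a = a * p by apply: ca.
have cab : a * b = b * a by apply: cb; [symmetry; apply: ca|rewrite cay].
have cby : y * b = b * y by apply: cb.
have cbp : p * b = b * p by apply: cb.
have caq : q * a = a * q by apply: ca.
have cbq : q * b = b * q by apply: cb.
have cry : r * y = y * r by rewrite /r; ccring.
have cra : r * a = a * r by rewrite /r; ccring.
have crb : r * b = b * r by rewrite /r; ccring.
have rs : star r = r by rewrite starB ps qs.
have ros : star ro = ro.
  by rewrite /ro starD (starM r) (starM y) as_ bs rs ys; ccring.
have ios : star io = io.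
  by rewrite /io starB (starM r) (starM y) as_ bs rs ys; ccring.
have croio : ro * io = io * ro by rewrite /ro /io; ccring.
have r2y2 : r * r + y * y = 1.
  have -> : r * r + y * y = (y * y + p * p + q * q) - (p * q + p * q) by rewrite /r; ccring.
  by rewrite sum1 pq0 addr0 subr0.
have us : star u = r - ii * y by rewrite /u starD starM star_ii ys -/r rs mulrN -iiC.
have uu : star u * u = 1.
  rewrite us /u -/r; have -> : (r - ii * y) * (r + ii * y) = r * r - (ii * ii) * (y * y) by ccring.
  by rewrite iiM mulN1r opprK.
have uu' : u * star u = 1.
  rewrite us /u -/r; have -> : (r + ii * y) * (r - ii * y) = r * r - (ii * ii) * (y * y) by ccring.
  by rewrite iiM mulN1r opprK.
pose al := rc (1 - t) + rc t * ro; pose be := rc t * io.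
pose Z := al + ii * be.
have ct (c : C) : rc t * c = c * rc t by rewrite rcC.
have ct' (c : C) : rc (1 - t) * c = c * rc (1 - t) by rewrite rcC.
have cii (c : C) : ii * c = c * ii by rewrite iiC.
have uZ : rc (1 - t) * u + rc t * edge = u * Z.
  have e1 : edge = u * (ro + ii * io).
    rewrite edgeE /u -/r /ro /io.
    have -> : (r + ii * y) * (r * a + y * b + ii * (r * b - y * a)) =
      (r * r - (ii * ii) * (y * y)) * a + ii * ((r * r + y * y) * b)
       + (1 + ii * ii) * (r * y * b).
      by ccring.
    by rewrite iiM mulN1r opprK r2y2 subrr mul0r addr0 !mul1r.
  rewrite e1 /Z /al /be ct' (ct (u * _)) -!mulrA -mulrDr; congr (_ * _).
  by rewrite -(ct (ro + _)); have := cii (rc t) => e; ccring.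
have als : star al = al by rewrite /al starD starM !star_rc ros -ct.
have bes : star be = be by rewrite /be starM star_rc ios -ct.
have calbe : al * be = be * al by rewrite /al /be; ccring.
have Zs : star Z = al - ii * be by rewrite /Z starD starM star_ii als bes mulrN -iiC.
have ZZ : star Z * Z = al * al + be * be.
  rewrite Zs /Z; have -> : (al - ii * be) * (al + ii * be) = al * al - (ii * ii) * (be * be) by ccring.
  by rewrite iiM mulN1r opprK.
have ZZ' : Z * star Z = al * al + be * be.
  rewrite Zs /Z; have -> : (al + ii * be) * (al - ii * be) = al * al - (ii * ii) * (be * be) by ccring.
  by rewrite iiM mulN1r opprK.
have roio : ro * ro + io * io = a * a + b * b.
  rewrite /ro /io; have -> : (r * a + y * b) * (r * a + y * b) + (r * b - y * a) * (r * b - y * a) =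
     (r * r + y * y) * (a * a + b * b) by ccring.
  by rewrite r2y2 mul1r.
have t10 : 0 <= 1 - t by rewrite subr_ge0.
pose h := al * al + be * be - rc (5^-1).
have ph : pos h.
  (* The lower bound for [|Z|^2 - 1/5] that results from the bounds on [ro] and on the modulus of
     [edge]; completing the square leaves [7 / 165]. The inverse is then bounded by [5 * 5]. *)
  pose f := (1 - t) ^+ 2 - (1 - t) * t / 2 + t ^+ 2 * (9 / 16) - 5^-1.
  have f0 : 0 <= f.
    have -> : f = 33 / 16 * (t - 20 / 33) ^+ 2 + 7 / 165 by rewrite /f; field.
    by rewrite addr_ge0// mulr_ge0// exprn_even_ge0.
  have -> : h = rc f + rc (2 * (1 - t) * t) * (rc (1 / 4) + ro) + rc (t ^+ 2) * (a * a + b * b - rc (9 / 16)).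
    rewrite -roio /h /al /be.
    have -> : (rc (1 - t) + rc t * ro) * (rc (1 - t) + rc t * ro) + rc t * io * (rc t * io) =
      rc (1 - t) * rc (1 - t) + (1 + 1) * rc (1 - t) * rc t * ro + rc t * rc t * (ro * ro + io * io).
      by have e := ct' (rc t); ccring.
    rewrite -rc2 -!rcM -expr2.
    have -> : rc f = rc ((1 - t) ^+ 2) - rc 5^-1 - rc (2 * (1 - t) * t * (1 / 4)) +
        rc (t ^+ 2 * (9 / 16)).
      by rewrite -rcB -rcB -rcD; congr (rc _); rewrite /f; field.
    have e1 : rc (2 * (1 - t) * t) * (rc (1 / 4) + ro) =
        rc (2 * (1 - t) * t * (1 / 4)) + rc (2 * (1 - t) * t) * ro.
      by rewrite [X in _ = X + _]rcM; ncring.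
    have e2 : rc (t ^+ 2) * (ro * ro + io * io - rc (9 / 16)) =
        rc (t ^+ 2) * (ro * ro + io * io) - rc (t ^+ 2 * (9 / 16)).
      by rewrite [X in _ = _ - X]rcM; ncring.
    rewrite e1 e2 -[t * t]expr2.
    set z1 := rc ((1 - t) ^+ 2); set z2 := rc (t ^+ 2); set z3 := rc (2 * (1 - t) * t).
    set z4 := rc (_ * (1 / 4)); set z5 := rc (_ * (9 / 16)); set z6 := rc 5^-1.
    by ncring.
  apply: posD; last by apply: pos_scale => //; rewrite exprn_ge0.
  apply: posD; first exact: pos_rc.
  by apply: pos_scale => //; rewrite !mulr_ge0.
have e5 : 0 < (5^-1 : R) by rewrite invr_gt0.
have [g [_ g1 g2 gn gc]] := pos_inv e5 ph.
have hE : rc 5^-1 + h = al * al + be * be by rewrite /h addrC subrK.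
rewrite hE in g1 g2.
have Zr : Z * (star Z * g) = 1 by rewrite mulrA ZZ' g2.
have Zl : star Z * g * Z = 1.
  have cZ c : c * al = al * c -> c * be = be * c -> c * g = g * c.
    move=> c1 c2'; apply: gc; rewrite /h; apply: cmB; last exact: cm_rc.
    by apply: cmD; apply: cmM.
  have -> : star Z * g = g * star Z.
    apply: cZ; rewrite Zs; [|]; have := cii al; have := cii be => e1 e2.
      by ccring.
    by ccring.
  by rewrite -mulrA ZZ g1.
have un : nrm u <= 1 by apply: nrm_unitary.
have qq1 : nrm (q * q) <= 1 by rewrite nrm_sa_sqr// expr_le1 ?nrm_ge0.
have an : nrm a <= 3.
  apply: le_trans (nrmD _ _) _; rewrite nrmN; have := nrmD 1 (- (q * q)).
  rewrite nrmN; have -> : q * q * q * q = (q * q) * (q * q) by rewrite !mulrA.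
  have := nrmM (q * q) (q * q); have := nrm1 C; have := nrm_ge0 (q * q); nra.
have bn : nrm b <= 2.
  rewrite /b -rc2 nrm_rcM ger0_norm// -[leRHS]mulr1 ler_pM2l//.
  rewrite -mulrA; apply: le_trans (nrmM _ _) _; rewrite mulr_ile1 ?nrm_ge0//.
have en : nrm edge <= 5.
  rewrite edgeE; apply: le_trans (nrmD _ _) _; rewrite nrm_iiM; lra.
exists (star Z * g * star u); rewrite uZ; split.
- by rewrite -mulrA (mulrA Z) Zr mul1r uu'.
- by rewrite -(mulrA _ (star u)) (mulrA (star u)) uu mul1r Zl.
- rewrite -uZ; apply: le_trans (nrmD _ _) _; rewrite !nrm_rcM !ger0_norm//.
  have := nrm_ge0 u; have := nrm_ge0 edge; nra.
- have Zn : nrm (star Z) <= 5.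
    rewrite nrm_star; have -> : Z = star u * (rc (1 - t) * u + rc t * edge).
      by rewrite uZ mulrA uu mul1r.
    apply: le_trans (nrmM _ _) _; rewrite nrm_star.
    have := nrmD (rc (1 - t) * u) (rc t * edge); rewrite !nrm_rcM !ger0_norm//.
    have := nrm_ge0 u; have := nrm_ge0 edge.
    have := nrm_ge0 (rc (1 - t) * u + rc t * edge); nra.
  apply: le_trans (nrmM _ _) _; rewrite nrm_star.
  have := nrmM (star Z) g; rewrite invrK in gn.
  have := nrm_ge0 g; have := nrm_ge0 (star Z); have := nrm_ge0 u; have := nrm_ge0 (star Z * g).
  nra.
Qed.

Lemma edge_nrm : nrm edge <= 5.
Proof.
have h01 : 0 <= (1 : R) <= 1 by rewrite ler01 lexx.
have qq1 : nrm (q * q) <= 1 by rewrite nrm_sa_sqr// expr_le1 ?nrm_ge0.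
have an : nrm a <= 3.
  apply: le_trans (nrmD _ _) _; rewrite nrmN; have := nrmD 1 (- (q * q)).
  rewrite nrmN; have -> : q * q * q * q = (q * q) * (q * q) by rewrite !mulrA.
  have := nrmM (q * q) (q * q); have := nrm1 C; have := nrm_ge0 (q * q); nra.
have bn : nrm b <= 2.
  rewrite /b -rc2 nrm_rcM ger0_norm// -[leRHS]mulr1 ler_pM2l//.
  rewrite -mulrA; apply: le_trans (nrmM _ _) _; rewrite mulr_ile1 ?nrm_ge0//.
rewrite edgeE; apply: le_trans (nrmD _ _) _; rewrite nrm_iiM; lra.
Qed.

End Segment.

(** * The path from an invertible self-adjoint element to its sign *)

Section SignPath.
Context (R : realType) (C : cstarAlg R).
Implicit Types (f h m X : C).
Local Notation rc := (rc C).
Local Notation ii := (ii C).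

(* psi h is invertible for every self-adjoint h, and psi h = 1 if h * h = 1. *)
Definition psi_root h := h - ii * (1 - h * h).
Definition psi h := psi_root h * psi_root h.

Lemma psi_root_nrm h : nrm h <= 2 -> nrm (psi_root h) <= 7.
Proof.
move=> hn; apply: le_trans (nrmD _ _) _; rewrite nrmN nrm_iiM.
have := nrmD 1 (- (h * h)); rewrite nrmN; have := nrmM h h; have := nrm1 C.
have := nrm_ge0 h; nra.
Qed.

Lemma psi_lip h k : nrm h <= 2 -> nrm k <= 2 -> nrm (psi h - psi k) <= 70 * nrm (h - k).
Proof.
move=> hn kn; rewrite /psi sqrB.
have d5 : nrm (psi_root h - psi_root k) <= 5 * nrm (h - k).
  have -> : psi_root h - psi_root k = (h - k) + ii * ((h - k) * h + k * (h - k)).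
    by rewrite -sqrB /psi_root; ncring.
  apply: le_trans (nrmD _ _) _; rewrite nrm_iiM.
  have := nrmD ((h - k) * h) (k * (h - k)).
  have := nrmM (h - k) h; have := nrmM k (h - k).
  have := nrm_ge0 (h - k); have := nrm_ge0 h; have := nrm_ge0 k; nra.
have := psi_root_nrm hn; have := psi_root_nrm kn.
move: d5; set a := psi_root h; set b := psi_root k => d5 a7 b7.
apply: le_trans (nrmD _ _) _; have := nrmM (a - b) a; have := nrmM b (a - b).
have := nrm_ge0 (a - b); have := nrm_ge0 a; have := nrm_ge0 b; nra.
Qed.

(** With [z = 1 - h^2], the factor [h - i z] has the inverse [(h + i z) (h^2 + z^2)^-1], and
    [h^2 + z^2 = 3/4 + (h^2 - 1/2)^2]. *)
Lemma psi_inv h : star h = h -> nrm h <= 2 -> exists k, ginv 100 (psi h) k.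
Proof.
move=> hs hn; pose z := 1 - h * h.
have zs : star z = z by rewrite /z starB star1 starM hs.
have hz : h * z = z * h by rewrite /z; ncring.
have h2 : rc 2^-1 + rc 2^-1 = 1 by have := rc_half2 (1 : C); rewrite !mulr1.
have c2 := rcC (A := C) 2^-1 h.
have pp : pos (h * h + z * z - rc (3 / 4)).
  have -> : h * h + z * z - rc (3 / 4) = (h * h - rc 2^-1) * (h * h - rc 2^-1).
    have -> : (h * h - rc 2^-1) * (h * h - rc 2^-1) =
       h * h * (h * h) - (rc 2^-1 + rc 2^-1) * (h * h) + rc 2^-1 * rc 2^-1 by ccring.
    have -> : rc (3 / 4) = 1 - rc 2^-1 * rc 2^-1.
      by rewrite -{1}(rc1 C) -rcM -rcB; congr (rc _); field.
    by rewrite h2 /z; ncring.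
  by apply: pos_sqr; rewrite starB starM hs star_rc.
have e34 : 0 < (3 / 4 : R) by rewrite divr_gt0.
have [g [_ g1 g2 gn gc]] := pos_inv e34 pp.
have sE : rc (3 / 4) + (h * h + z * z - rc (3 / 4)) = h * h + z * z by rewrite addrC subrK.
rewrite sE in g1 g2.
have cg c : c * h = h * c -> c * g = g * c.
  move=> ch; apply: gc; apply: cmB; last exact: cm_rc.
  have cz : c * z = z * c by apply: cmB; [exact: cm1|exact: cmM].
  by apply: cmD; exact: cmM.
pose N := psi_root h; pose N' := h + ii * z.
have NN' : N * N' = h * h + z * z.
  have -> : N * N' = h * h - (ii * ii) * (z * z) by rewrite /N /N' /psi_root -/z; ccring.
  by rewrite iiM mulN1r opprK.
have N'N : N' * N = h * h + z * z.
  have -> : N' * N = h * h - (ii * ii) * (z * z) by rewrite /N /N' /psi_root -/z; ccring.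
  by rewrite iiM mulN1r opprK.
have gh : h * g = g * h by apply: cg.
have gz : z * g = g * z by apply: cg; rewrite hz.
have gN' : N' * g = g * N' by rewrite /N'; ccring.
have r1 : N * (N' * g) = 1 by rewrite mulrA NN' g2.
have r2 : (N' * g) * N = 1 by rewrite gN' -mulrA N'N g1.
have N'n : nrm N' <= 7.
  apply: le_trans (nrmD _ _) _; rewrite nrm_iiM.
  have := nrmD 1 (- (h * h)); rewrite nrmN; have := nrmM h h; have := nrm1 C.
  by rewrite /z; have := nrm_ge0 h; nra.
have gn' : nrm g <= 4 / 3.
  by apply: le_trans gn _; rewrite invf_div.
have N'gn : nrm (N' * g) <= 10.
  by have := nrmM N' g; have := nrm_ge0 N'; have := nrm_ge0 g; nra.
exists ((N' * g) * (N' * g)); split.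
- by rewrite /psi -/N -mulrA (mulrA N (N' * g)) r1 mul1r r1.
- by rewrite /psi -/N -mulrA (mulrA (N' * g) N) r2 mul1r r2.
- rewrite /psi -/N; have := psi_root_nrm hn; rewrite -/N; have := nrmM N N.
  by have := nrm_ge0 N; nra.
- by have := nrmM (N' * g) (N' * g); have := nrm_ge0 (N' * g); nra.
Qed.

(** [psi h - 1] is divisible by [1 - h^2]: where [h] is nearly a symmetry, [psi h] is nearly 1. *)
Lemma psi1E h : psi h - 1 = (- 1 - (1 + 1) * (ii * h) - (1 - h * h)) * (1 - h * h).
Proof.
rewrite /psi /psi_root; set z := 1 - h * h.
have hz : h * z = z * h by rewrite /z; ncring.
have -> : (h - ii * z) * (h - ii * z) = h * h - (1 + 1) * (ii * h * z) + (ii * ii) * (z * z).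
  by ccring.
by rewrite iiM /z; ncring.
Qed.

(** The path is [psi] of the segment from [X] to [F = X |X|^-1], and [psi F = 1] as [F^2 = 1]. Along
    the segment [1 - H^2] is a bounded multiple of [1 - X^2], so smallness against [f] persists up
    to a constant. *)
Lemma sign_path X X' f (eps : R) : star X = X -> X * X' = 1 -> X' * X = 1 ->
  nrm X <= 2 -> 0 <= eps -> nrm ((1 - X * X) * f) <= eps -> nrm (f * (1 - X * X)) <= eps ->
  exists P Q : R -> C, [/\ P 0 = psi X, P 1 = 1,
   forall s, 0 <= s <= 1 -> [/\ ginv 100 (P s) (Q s),
     nrm ((P s - 1) * f) <= 20 * eps & nrm (f * (P s - 1)) <= 20 * eps] &
   forall s t, 0 <= s <= 1 -> 0 <= t <= 1 -> nrm (P s - P t) <= 210 * `|s - t|].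
Proof.
move=> Xs XX' X'X Xn e0 ef fe.
have X's := star_inverse Xs XX' X'X.
have [m [pm mm _ _ mc]] := abs_exists Xs; have [ms _] := pm.
have mX : X * m = m * X by apply: mc.
have X'm : X' * m = m * X'.
  by rewrite -[LHS]mulr1 -XX' mulrA -(mulrA X') -mX mulrA X'X mul1r.
pose m' := m * (X' * X').
have mm' : m * m' = 1.
  by rewrite /m' mulrA mm -mulrA (mulrA X X') XX' mul1r.
have m'm : m' * m = 1.
  rewrite /m'; have -> : m * (X' * X') * m = m * m * (X' * X') by ccring.
  by rewrite mm -mulrA (mulrA X X') XX' mul1r.
have m's := star_inverse ms mm' m'm.
have Xm' : X * m' = m' * X.
  rewrite /m'; have XX : X * X' = X' * X by rewrite XX' X'X.
  by ccring.
pose F := X * m'.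
have Fs : star F = F by rewrite /F starM m's Xs Xm'.
have m'm' : m * m' = m' * m by rewrite mm' m'm.
have FF : F * F = 1.
  rewrite /F; have -> : X * m' * (X * m') = X * X * m' * m' by ccring.
  by rewrite -mm -mulrA -mulrA (mulrA m m') mm' mul1r mm'.
have Fn : nrm F <= 1 by apply: nrm_unitary; rewrite /unitary_elt Fs.
have XF : X * F = m by rewrite /F mulrA -mm -mulrA mm' mulr1.
have FX : F * X = m by rewrite /F Xm' -mulrA -mm mulrA m'm mul1r.
have one0 : 0 < (1 : R) by [].
have [k [_ k1 k2 kn kc]] := pos_inv one0 pm.
rewrite rc1 in k1 k2; rewrite invr1 in kn.
have kX : X * k = k * X by apply: kc.
have km : m * k = k * m by apply: kc.
have omm : 1 - m = k * (1 - X * X).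
  rewrite -mm; have -> : 1 - m * m = (1 + m) * (1 - m) by ncring.
  by rewrite mulrA k1 mul1r.
pose H s := rc (1 - s) * X + rc s * F.
have Hs s : star (H s) = H s by rewrite /H starD (starM (rc (1 - s)) X) (starM (rc s) F) !star_rc Xs Fs -!rcC.
have Hn s : 0 <= s <= 1 -> nrm (H s) <= 2.
  move=> /andP[s0 s1]; have s10 : 0 <= 1 - s by rewrite subr_ge0.
  apply: le_trans (nrmD _ _) _; rewrite !nrm_rcM !ger0_norm//.
  by have := nrm_ge0 X; have := nrm_ge0 F; nra.
(* Since [X F = |X| = m] and [F^2 = 1], one has [1 - H^2 = (1 - s)^2 (1 - X^2) + 2 s (1 - s) (1 -
   m)], and [1 - m = (1 + m)^-1 (1 - X^2)]. *)
pose r s := rc ((1 - s) * (1 - s)) + rc (2 * s * (1 - s)) * k.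
have HH s : 1 - H s * H s = r s * (1 - X * X).
  rewrite /r [RHS]mulrDl -(mulrA (rc (2 * s * (1 - s))) k) -omm.
  have -> : H s * H s = rc (1 - s) * rc (1 - s) * (X * X) +
      rc s * rc (1 - s) * (F * X + X * F) + rc s * rc s * (F * F).
    rewrite /H; move: F FX XF FF {Fs Fn H Hs Hn} => F FX XF FF.
    have XFc : X * F = F * X by rewrite XF FX.
    by set a := rc (1 - s); set b := rc s; ccring.
  rewrite XF FX FF mulr1 -!rcM.
  have -> : m + m = rc 2 * m by rewrite rc2; ncring.
  have -> : rc (s * (1 - s)) * (rc 2 * m) = rc (2 * s * (1 - s)) * m.
    by rewrite mulrA -rcM; congr (rc _ * _); ring.
  have e1 : rc ((1 - s) * (1 - s)) + rc (2 * s * (1 - s)) + rc (s * s) = 1.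
    by rewrite -!rcD -(rc1 C); congr (rc _); ring.
  rewrite -[in LHS]e1; set z1 := rc ((1 - s) * (1 - s)); set z2 := rc (2 * s * (1 - s)); set z3 := rc (s * s).
  by ncring.
have rX s : r s * (1 - X * X) = (1 - X * X) * r s.
  rewrite /r; have c3 : (1 - X * X) * k = k * (1 - X * X) by ccring.
  symmetry; apply: cmD; first exact: cm_rc.
  by apply: cmM => //; exact: cm_rc.
have rn s : 0 <= s <= 1 -> nrm (r s) <= 2.
  move=> /andP[s0 s1]; have s10 : 0 <= 1 - s by rewrite subr_ge0.
  apply: le_trans (nrmD _ _) _; rewrite nrm_rcM.
  have := nrm_rc C ((1 - s) * (1 - s)).
  by rewrite !ger0_norm ?mulr_ge0//; have := nrm_ge0 k; nra.
pose th s := - 1 - (1 + 1) * (ii * H s) - (1 - H s * H s).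
have thn s : 0 <= s <= 1 -> nrm (th s) <= 10.
  move=> /Hn hn; rewrite /th -rc2.
  have := nrmD (- 1 - rc 2 * (ii * H s)) (- (1 - H s * H s)).
  have := nrmD (- 1) (- (rc 2 * (ii * H s))).
  have := nrmD 1 (- (H s * H s)).
  rewrite !nrmN nrm_rcM nrm_iiM ger0_norm//; have := nrmM (H s) (H s); have := nrm1 C.
  by have := nrm_ge0 (H s); nra.
have [Q HQ] : exists Q : R -> C, forall s, 0 <= s <= 1 -> ginv 100 (psi (H s)) (Q s).
  have /choice[Q HQ] : forall s, exists k, 0 <= s <= 1 -> ginv 100 (psi (H s)) k.
    move=> s; have [s01|ns] := pselect (0 <= s <= 1).
      by have [k' hk'] := psi_inv (Hs s) (Hn s s01); exists k'.
    by exists 0 => /ns.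
  by exists Q.
exists (fun s => psi (H s)), Q; split.
- by rewrite /H subr0 rc1 rc0 mul1r mul0r addr0.
- rewrite /H subrr rc1 rc0 mul1r mul0r add0r /psi /psi_root FF subrr mulr0 subr0 //.
- move=> s s01; split; first exact: HQ.
    rewrite psi1E -/(th s) HH -!mulrA.
    apply: le_trans (nrmM _ _) _; have -> : 20 * eps = 10 * (2 * eps) by ring.
    apply: ler_pM; rewrite ?nrm_ge0 ?thn//; apply: le_trans (nrmM _ _) _.
    by apply: ler_pM; rewrite ?nrm_ge0 ?rn.
  rewrite psi1E -/(th s).
  have -> : th s * (1 - H s * H s) = (1 - X * X) * (r s * th s).
    have -> : th s * (1 - H s * H s) = (1 - H s * H s) * th s.
      by rewrite /th; have := iiC (H s) => e; ccring.
    by rewrite HH rX mulrA.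
  rewrite mulrA; apply: le_trans (nrmM _ _) _; rewrite (mulrC 20).
  apply: ler_pM; rewrite ?nrm_ge0//; apply: le_trans (nrmM _ _) _.
  have -> : (20 : R) = 2 * 10 by ring.
  by apply: ler_pM; rewrite ?nrm_ge0 ?rn ?thn.
(* [210 = 70 * 3]: the segment has speed at most [|X| + |F| <= 3]. *)
- move=> s t s01 t01; apply: le_trans (psi_lip (Hn s s01) (Hn t t01)) _.
  have -> : H s - H t = rc (t - s) * X + rc (s - t) * F.
    by rewrite /H !rcB; ncring.
  have := nrmD (rc (t - s) * X) (rc (s - t) * F); rewrite !nrm_rcM (distrC t).
  have := nrm_ge0 X; have := nrm_ge0 F; have : 0 <= `|s - t| by []; nra.
Qed.

End SignPath.

Lemma sum_pick (V : nmodType) n a (F : nat -> V) : (a < n)%N ->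
  \sum_(k < n) (if k == a :> nat then F k else 0) = F a.
Proof.
move=> an; rewrite (bigD1 (Ordinal an))//= eqxx big1 ?addr0// => k.
by rewrite -(inj_eq val_inj)/= => /negPf->.
Qed.

(** * The matrix coding a chain of unitaries *)

Section SiteMatrix.
Context (R : realType) (C : cstarAlg R).
Variables (y p q : nat -> C) (N : nat) (om : R).
Hypotheses (ys : forall i, star (y i) = y i) (ps : forall i, star (p i) = p i)
  (qs : forall i, star (q i) = q i).
Hypotheses (cyp : forall i, y i * p i = p i * y i) (cyq : forall i, y i * q i = q i * y i)
  (pq0 : forall i, p i * q i = 0) (qp0 : forall i, q i * p i = 0)
  (sum1 : forall i, y i * y i + p i * p i + q i * q i = 1).
Hypotheses (q1 : forall i, nrm (q i) <= 1) (qN : q N = 0) (om0 : 0 <= om).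
Hypotheses (yom : forall i, (i < N)%N -> nrm (y i - y i.+1) <= om)
  (pom : forall i, (i < N)%N -> nrm (p i - p i.+1) <= om)
  (qom : forall i, (i < N)%N -> nrm (q i - q i.+1) <= om).
Let n := N.+1.

(** [p] couples the two copies of a site and [q] couples neighbouring sites. In the square the
    diagonal entries are close to [y^2 + p^2 + q^2] everywhere but in the first copy of site 0,
    where [q 0] has no partner. *)
Definition site_g (i j : nat) : C :=
  if i == j then p i else if i == j.+1 then q j else 0.
Definition site_gs (i j : nat) : C :=
  if i == j then p i else if j == i.+1 then q i else 0.
Definition site_y (i j : nat) : C := if i == j then y i else 0.

Definition natmx (m : nat -> nat -> C) : 'M[C]_n := \matrix_(i, j) m i j.

Let mulG (m : nat -> nat -> C) (i j : 'I_n) : (natmx site_g *m natmx m) i j =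
  p i * m i j + (if (i : nat) is i'.+1 then q i' * m i' j else 0).
Proof.
rewrite mxE; under eq_bigr => k _ do rewrite !mxE.
transitivity (\sum_(k < n) ((if k == i :> nat then p i * m k j else 0) +
   (if (i : nat) is i'.+1 then (if k == i' :> nat then q k * m k j else 0) else 0))).
  apply: eq_bigr => k _; rewrite /site_g (eq_sym (k : nat) i).
  case: (i : nat) => [|i']; first by case: eqP; rewrite ?addr0 ?mul0r.
  have [<-|ik] := eqVneq i'.+1 k; first by rewrite (gtn_eqF (leqnn _)) addr0.
  by rewrite eqSS eq_sym add0r; case: eqP; rewrite ?mul0r.
rewrite big_split/= (sum_pick (fun k => p i * m k j))//; congr (_ + _).
case ei : (i : nat) => [|i']; first by rewrite big1.
by rewrite (sum_pick (fun k => q k * m k j))// ltnW// -ei.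
Qed.

Let mulGs (m : nat -> nat -> C) (i j : 'I_n) : (natmx site_gs *m natmx m) i j =
  p i * m i j + q i * m i.+1 j.
Proof.
rewrite mxE; under eq_bigr => k _ do rewrite !mxE.
transitivity (\sum_(k < n) ((if k == i :> nat then p i * m k j else 0) +
   (if k == i.+1 :> nat then q i * m k j else 0))).
  apply: eq_bigr => k _; rewrite /site_gs (eq_sym (k : nat) i).
  have [<-|ik] := eqVneq (i : nat) k; first by rewrite (ltn_eqF (leqnn _)) addr0.
  by rewrite add0r; case: eqP; rewrite ?mul0r.
rewrite big_split/= (sum_pick (fun k => p i * m k j))//; congr (_ + _).
have [iN|iN] := ltnP i.+1 n; first by rewrite (sum_pick (fun k => q i * m k j)).
(* At the last site the missing neighbour comes with the factor [q N = 0]. *)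
rewrite big1 => [|k _]; last by rewrite ltn_eqF// (leq_trans (ltn_ord k)).
have -> : (i : nat) = N by apply/eqP; rewrite eqn_leq -ltnS ltn_ord -ltnS.
by rewrite qN mul0r.
Qed.

Let mulYl (m : nat -> nat -> C) (i j : 'I_n) : (natmx site_y *m natmx m) i j =
  y i * m i j.
Proof.
rewrite mxE; under eq_bigr => k _ do rewrite !mxE.
rewrite -(sum_pick (fun k => y i * m k j) (ltn_ord i)); apply: eq_bigr => k _.
by rewrite /site_y eq_sym; case: eqP => //; rewrite mul0r.
Qed.

Let mulYr (m : nat -> nat -> C) (i j : 'I_n) : (natmx m *m natmx site_y) i j =
  m i j * y j.
Proof.
rewrite mxE; under eq_bigr => k _ do rewrite !mxE.
rewrite -(sum_pick (fun k => m i k * y k) (ltn_ord j)); apply: eq_bigr => k _.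
by rewrite /site_y; case: eqP => //; rewrite mulr0.
Qed.

(* As y^2 + p^2 + q^2 = 1, pq = 0 and consecutive sites are close, the square of
   site_mx is close to 1 - q_0^2 e_00. *)
Definition site_mx : 'M[C]_(n + n) :=
  block_mx (- natmx site_y) (natmx site_g) (natmx site_gs) (natmx site_y).

Lemma site_mx_sa : adjmx site_mx = site_mx.
Proof.
apply/matrixP => i j; rewrite adjmxE /site_mx.
case: (split_ordP i) => i' ->; case: (split_ordP j) => j' ->;
  rewrite ?(block_mxEul, block_mxEur, block_mxEdl, block_mxEdr) !mxE.
- rewrite starN /site_y eq_sym; case: eqP => [->|]; by rewrite ?ys ?star0.
- rewrite /site_gs /site_g eq_sym; case: eqP => [->|_]; first by rewrite ps.
  by case: eqP; rewrite ?qs ?star0.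
- rewrite /site_gs /site_g eq_sym; case: eqP => [->|_]; first by rewrite ps.
  by case: eqP; rewrite ?qs ?star0.
- rewrite /site_y eq_sym; case: eqP => [->|]; by rewrite ?ys ?star0.
Qed.

Definition corner_mx k (a : C) : 'M[C]_k :=
  \matrix_(i, j) if (i == 0 :> nat) && (j == 0 :> nat) then a else 0.

Definition site_err : 'M[C]_(n + n) :=
  site_mx *m site_mx - 1%:M + corner_mx (n + n) (q 0%N * q 0%N).

(** The site of an index, both blocks being indexed by sites. [near_site] relates at most two copies
    of three sites, whence the 6 of [card_near]. *)
Let site (i : 'I_(n + n)) : nat := if (i < n)%N then (i : nat) else ((i : nat) - n)%N.
Let near_site (i j : 'I_(n + n)) := (site i <= (site j).+1)%N && (site j <= (site i).+1)%N.

Let card_near i : (#|[pred j | near_site i j]| <= 6)%N.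
Proof.
rewrite cardE -(size_map val).
pose s := site i.
have -> : 6%N = size [:: s.-1; s; s.+1; (n + s.-1)%N; (n + s)%N; (n + s.+1)%N] by [].
apply: uniq_leq_size; first by rewrite (map_inj_uniq val_inj) enum_uniq.
move=> x /mapP[j]; rewrite mem_enum inE /near_site -/s /site => /andP[h1 h2] ->.
rewrite !inE; move: h1 h2; have -> : val j = j :> nat by []; move: s (j : nat) => s k.
case: ltnP => jn h1 h2; lia.
Qed.

Let site_l (i : 'I_n) : site (lshift n i) = i.
Proof. by rewrite /site /= ltn_ord. Qed.
Let site_r (i : 'I_n) : site (rshift n i) = i.
Proof. by rewrite /site /= ltnNge leq_addr addKn. Qed.

Let nrmM1 (a b : C) (c : R) : nrm a <= 1 -> nrm b <= c -> nrm (a * b) <= c.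
Proof. by move=> a1 bc; apply: le_trans (nrmM _ _) _; rewrite -[c]mul1r; apply: ler_pM; rewrite ?nrm_ge0. Qed.
Let nrmMr1 (a b : C) (c : R) : nrm a <= 1 -> nrm b <= c -> nrm (b * a) <= c.
Proof. by move=> a1 bc; apply: le_trans (nrmM _ _) _; rewrite -[c]mulr1; apply: ler_pM; rewrite ?nrm_ge0. Qed.

Let om2 (x : C) : nrm x <= om -> nrm x <= 2 * om.
Proof. by move=> h; apply: le_trans h _; rewrite mulr_natl mulr2n lerDl. Qed.

Let site_errE : site_err = block_mx
   (natmx site_y *m natmx site_y + natmx site_g *m natmx site_gs - 1%:M + corner_mx n (q 0%N * q 0%N))
   (- (natmx site_y *m natmx site_g) + natmx site_g *m natmx site_y)
   (- (natmx site_gs *m natmx site_y) + natmx site_y *m natmx site_gs)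
   (natmx site_gs *m natmx site_g + natmx site_y *m natmx site_y - 1%:M).
Proof.
rewrite /site_err /site_mx mulmx_block !mulNmx !mulmxN opprK.
have -> : corner_mx (n + n) (q 0%N * q 0%N) = block_mx (corner_mx n (q 0%N * q 0%N)) 0 0 0.
  apply/matrixP => i j; case: (split_ordP i) => i' ->; case: (split_ordP j) => j' ->;
  rewrite ?(block_mxEul, block_mxEur, block_mxEdl, block_mxEdr) !mxE//=.
  by rewrite andbF.
rewrite [1%:M]scalar_mx_block opp_block_mx !add_block_mx.
by rewrite !oppr0 !addr0.
Qed.

(** Products at one site vanish ([p q = 0]) or commute ([y] with [p] and [q]) exactly, so every
    remaining entry is a difference of values at neighbouring sites times an element of norm at most
    1, or two such terms. *)
Let err_entry i j : nrm (site_err i j) <= 2 * om /\ (~~ near_site i j -> site_err i j = 0).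
Proof.
have om20 : 0 <= 2 * om by rewrite mulr_ge0.
rewrite site_errE /near_site; case: (split_ordP i) => i' ->; case: (split_ordP j) => j' ->;
  rewrite ?(site_l, site_r).
- rewrite block_mxEul; have := mulYl site_y i' j'; have := mulG site_gs i' j'.
  move: (natmx site_y *m natmx site_y) (natmx site_g *m natmx site_gs) => M1 M2 e2 e1.
  rewrite !mxE e1 e2 {e1 e2} -(inj_eq val_inj) /=; move: (ltn_ord i').
  move: (i' : nat) (j' : nat) => a b an; rewrite /site_y /site_gs.
  have [<-{b}|ab] := eqVneq a b.
    rewrite leqnSn /= ; split=> //; rewrite mulr1n.
    case: a an => [|a] an /=.
      rewrite addr0 -(sum1 0); set x := y 0%N * y 0%N; set z := p 0%N * p 0%N.
      by rewrite opprD addrA addrN add0r addNr nrm0.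
    rewrite addr0 (ltn_eqF (ltnSn _)) eqxx -(sum1 a.+1).
    set x := y _ * y _; set z := p _ * p _.
    have -> : x + (z + q a * q a) - (x + z + q a.+1 * q a.+1) = q a * q a - q a.+1 * q a.+1.
      by ncring.
    rewrite sqrB; apply: le_trans (nrmD _ _) _; have aN : (a < N)%N by [].
    have h1 := nrmMr1 (q1 a) (qom aN); have h2 := nrmM1 (q1 a.+1) (qom aN); lra.
  have -> : (a == 0%N) && (b == 0%N) = false.
    by apply/negP => /andP[/eqP a0 /eqP b0]; rewrite a0 b0 eqxx in ab.
  rewrite mulr0 add0r subr0 addr0.
  suff -> : p a * (if b == a.+1 then q a else 0) +
    match a with 0%N => 0 | i0.+1 => q i0 * (if i0 == b then p i0 else if b == i0.+1 then q i0 else 0) end = 0.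
    by rewrite nrm0.
  have -> : p a * (if b == a.+1 then q a else 0) = 0 by case: ifP; rewrite ?pq0 ?mulr0.
  rewrite add0r; case: a an ab => [|a]// an ab.
  by case: ifP; rewrite ?qp0// (eq_sym b) (negPf ab) mulr0.
- rewrite block_mxEur; have := mulYl site_g i' j'; have := mulYr site_g i' j'.
  move: (natmx site_y *m natmx site_g) (natmx site_g *m natmx site_y) => M1 M2 e2 e1.
  rewrite !mxE e1 e2 {e1 e2}; move: (ltn_ord i').
  move: (i' : nat) (j' : nat) => a b an; rewrite /site_g.
  have [<-{b}|ab] := eqVneq a b; first by rewrite leqnSn cyp addNr nrm0.
  have [ab1|ab1] := eqVneq a b.+1; last by rewrite mulr0 mul0r oppr0 addr0 nrm0.
  move: an; rewrite ab1 => bn.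
  rewrite leqnn (leq_trans (leqnSn _))//; split=> //; apply: om2.
  rewrite -cyq addrC -mulrBl; apply: nrmMr1 => //; exact: yom.
- rewrite block_mxEdl; have := mulYr site_gs i' j'; have := mulYl site_gs i' j'.
  move: (natmx site_gs *m natmx site_y) (natmx site_y *m natmx site_gs) => M1 M2 e2 e1.
  rewrite !mxE e1 e2 {e1 e2}; move: (ltn_ord j').
  move: (i' : nat) (j' : nat) => a b bn; rewrite /site_gs.
  have [<-{b bn}|ab] := eqVneq a b; first by rewrite leqnSn cyp addNr nrm0.
  have [ab1|ab1] := eqVneq b a.+1; last by rewrite mulr0 mul0r oppr0 addr0 nrm0.
  move: bn; rewrite ab1 => bn.
  rewrite leqnn (leq_trans (leqnSn _))//; split=> //; apply: om2.
  rewrite cyq addrC -mulrBr; apply: nrmM1 => //; exact: yom.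
- rewrite block_mxEdr; have := mulYl site_y i' j'; have := mulGs site_g i' j'.
  move: (natmx site_y *m natmx site_y) (natmx site_gs *m natmx site_g) => M1 M2 e2 e1.
  rewrite !mxE e1 e2 {e1 e2} -(inj_eq val_inj) /=; move: (ltn_ord i') (ltn_ord j').
  move: (i' : nat) (j' : nat) => a b an bn; rewrite /site_y /site_g.
  have [<-{b bn}|ab] := eqVneq a b.
    rewrite leqnSn (gtn_eqF (leqnn _)) eqxx; split=> //.
    rewrite mulr1n -(sum1 a) (addrC (p a * p a + _)) addrA addrN nrm0 //.
  rewrite mulr0 subr0 addr0 eqSS.
  have [ab1|ab1] := eqVneq a b.+1.
    move: an; rewrite ab1 => bN; rewrite gtn_eqF ?leqnSn// gtn_eqF// mulr0 addr0.
    rewrite -[p _ * _]subr0 -(pq0 b) -mulrBl -nrmN -mulNr opprB.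
    rewrite leqnn (leq_trans (leqnSn _))//; split=> //; apply: om2.
    by apply: nrmMr1 => //; exact: pom.
  rewrite mulr0 add0r (negPf ab).
  have [ba|ba] := eqVneq a.+1 b; last by rewrite mulr0 nrm0.
  move: bn; rewrite -ba => aN; rewrite leqnn (leq_trans (leqnSn _))//; split=> //; apply: om2.
  rewrite -[q _ * _]subr0 -(qp0 a) -mulrBr -nrmN -mulrN opprB.
  by apply: nrmM1 => //; exact: pom.
Qed.

(** At most 6 nonzero entries in each row and column, each of norm at most [2 om]; the number [N] of
    sites does not enter. *)
Lemma site_err_small : mn site_err <= 12 * om.
Proof.
have -> : 12 * om = 6%:R * (2 * om) by ring.
apply: (@mn_band R C (n + n) near_site 6).
- by rewrite mulr_ge0.
- exact: card_near.
- move=> j; apply: leq_trans (card_near j); apply/eq_leq/eq_card => i.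
  by rewrite !inE /near_site andbC.
- by move=> i j /(proj2 (err_entry i j)).
- by move=> i j; case: (err_entry i j).
Qed.

Lemma site_mx00 : site_mx 0 0 = - y 0%N.
Proof.
have -> : (0 : 'I_(n + n)) = lshift n 0 by apply: val_inj.
by rewrite /site_mx block_mxEul !mxE.
Qed.

End SiteMatrix.

Section Corner.
Context (R : realType) (C : cstarAlg R).

Lemma corner_mulr n (T : 'M[C]_n.+1) (a : C) : (T *m corner_mx n.+1 a) 0 0 = T 0 0 * a.
Proof.
rewrite mxE (bigD1 0)//= big1 ?addr0 ?mxE// => k k0; rewrite mxE.
by rewrite (negPf (_ : (k : nat) != 0%N)) ?mulr0.
Qed.

Lemma corner_mull n (T : 'M[C]_n.+1) (a : C) : (corner_mx n.+1 a *m T) 0 0 = a * T 0 0.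
Proof.
rewrite mxE (bigD1 0)//= big1 ?addr0 ?mxE// => k k0; rewrite mxE.
by rewrite andbC (negPf (_ : (k : nat) != 0%N)) ?mul0r.
Qed.

Lemma cornerM n (a b : C) : corner_mx n.+1 a *m corner_mx n.+1 b = corner_mx n.+1 (a * b).
Proof.
apply/matrixP => i j; rewrite mxE (bigD1 0)//= big1 ?addr0 ?mxE/= ?andbT => [|k k0].
  by case: eqP => _ /=; rewrite ?mul0r//; case: eqP; rewrite ?mulr0.
by rewrite mxE andbC (negPf (_ : (k : nat) != 0%N)) ?mul0r.
Qed.

Lemma corner_nrm n (a : C) : mn (corner_mx n.+1 a) <= nrm a.
Proof.
apply: le_trans (mn_le_mxsum _) _; rewrite /mxsum (bigD1 0)//= (bigD1 0)//= mxE/=.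
rewrite big1 => [|j j0]; last by rewrite mxE/= (negPf (_ : (j : nat) != 0%N)) ?nrm0.
rewrite big1 ?addr0// => i i0; rewrite big1// => j _.
by rewrite mxE/= (negPf (_ : (i : nat) != 0%N)) ?nrm0.
Qed.

Lemma corner_star n (a : C) : star a = a -> adjmx (corner_mx n.+1 a) = corner_mx n.+1 a.
Proof.
by move=> sa; apply/matrixP => i j; rewrite adjmxE !mxE andbC; case: ifP; rewrite ?sa ?star0.
Qed.

Lemma rc_mxC n r (T : 'M[C]_n) i j : (rc (mxC C n) r * T : mxC C n) i j = rc C r * T i j.
Proof. by rewrite -!rcE mxE. Qed.

Lemma ii_mxC n (T : 'M[C]_n) i j : (ii (mxC C n) * T : mxC C n) i j = ii C * T i j.
Proof. by rewrite /ii -!scaleAlc !mul1r mxE. Qed.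

Lemma nrm_projection (f : C) : star f = f -> f * f = f -> nrm f <= 1.
Proof.
move=> fs ff; have := nrmC f; rewrite fs ff expr2 => h.
have [h0|] := leP (nrm f) 0; first by apply: le_trans h0 ler01.
by move=> f0; move: h => /esym/eqP; rewrite -subr_eq0 -{3}[nrm f]mulr1 -mulrBr mulf_eq0
  (gt_eqF f0)/= subr_eq0 => /eqP ->.
Qed.

End Corner.

(** * Self-adjoint elements whose square is close to 1 off a corner *)

Section Abstract.
Context (R : realType) (D : cstarAlg R).
Implicit Types H X Q E f : D.

Lemma almost_proj_nrm H Q E : star H = H -> 1 - H * H = Q - E -> nrm Q <= 1 ->
  nrm E <= 1 / 100 -> nrm H <= 9 / 5.
Proof.
move=> Hs HE Qn En.
rewrite -(ler_pXn2r (n := 2)) ?nnegrE ?nrm_ge0 ?divr_ge0// -nrm_sa_sqr//.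
have -> : H * H = 1 - (1 - H * H) by rewrite opprB addrC subrK.
rewrite HE; apply: le_trans (nrmD _ _) _; rewrite nrmN.
by have := nrmD Q (- E); rewrite nrmN; have := nrm1 D; rewrite expr2; lra.
Qed.

Definition psi_rem H := - 1 - (1 + 1) * (ii D * H) - (1 - H * H).

Lemma psi_remE H Q E : 1 - H * H = Q - E -> psi H = 1 + psi_rem H * Q - psi_rem H * E.
Proof. by move=> HE; rewrite -[psi H](subrK 1) psi1E -/(psi_rem H) HE mulrBr addrC addrA. Qed.

Lemma psi_rem_nrm H : nrm H <= 9 / 5 -> nrm (psi_rem H) <= 10.
Proof.
move=> Hn; rewrite /psi_rem -rc2.
have := nrmD (- 1 - rc D 2 * (ii D * H)) (- (1 - H * H)).
have := nrmD (- 1) (- (rc D 2 * (ii D * H))); have := nrmD 1 (- (H * H)).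
rewrite !nrmN nrm_rcM nrm_iiM ger0_norm//; have := nrmM H H; have := nrm1 D.
by have := nrm_ge0 H; nra.
Qed.

(** [f] annihilates [Q], so against [f] only the error [E] and the displacement of [H^2] to [X^2]
    remain; the latter is at most [d (2 + 9/5)]. *)
Lemma near_proj H X Q E f e d : nrm H <= 9 / 5 -> nrm (X - H) <= d -> d <= 1 / 10 ->
  1 - H * H = Q - E -> Q * f = 0 -> f * Q = 0 -> nrm f <= 1 -> nrm E <= e ->
  [/\ nrm X <= 2, nrm ((1 - X * X) * f) <= e + 4 * d & nrm (f * (1 - X * X)) <= e + 4 * d].
Proof.
move=> Hn XH d1 HE Qf fQ fn En.
have Xn : nrm X <= 2 by have := nrmD (X - H) H; rewrite subrK; lra.
have dd : nrm (H * H - X * X) <= 4 * d.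
  rewrite sqrB; apply: le_trans (nrmD _ _) _; have := nrmM (H - X) H; have := nrmM X (H - X).
  rewrite nrmBC in XH; have := nrm_ge0 (H - X); have := nrm_ge0 H; have := nrm_ge0 X.
  nra.
have XE : 1 - X * X = (1 - H * H) + (H * H - X * X) by ncring.
have nf0 := nrm_ge0 f; have n1 := nrm_ge0 E; have n2 := nrm_ge0 (H * H - X * X).
split=> //; rewrite XE HE.
  rewrite mulrDl mulrBl Qf sub0r; apply: le_trans (nrmD _ _) _; rewrite nrmN.
  by have := nrmM E f; have := nrmM (H * H - X * X) f; nra.
rewrite mulrDr mulrBr fQ sub0r; apply: le_trans (nrmD _ _) _; rewrite nrmN.
by have := nrmM f E; have := nrmM f (H * H - X * X); nra.
Qed.

Lemma half_inv (x : D) : nrm (1 - x) <= 1 / 2 ->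
  exists g : D, [/\ g * x = 1, x * g = 1 & nrm g <= 2].
Proof.
move=> x1; have x2 : nrm (1 - x) < 1 by lra.
have [g [g1 g2 _]] := neumann x2; exists g; split=> //.
have h1 : g = 1 + g * (1 - x) by rewrite mulrBr mulr1 g1 addrC subrK.
have h2 := nrmM g (1 - x); have h3 := nrmD 1 (g * (1 - x)); rewrite -h1 in h3.
by have := nrm1 D; have := nrm_ge0 g; nra.
Qed.

(** [d] is an approximate inverse of [c] on both sides; correcting it by an inverse of [c d] of norm
    at most 2 gives the bound [100 * 2]. *)
Lemma near_inv2 (c d : D) : nrm c <= 100 -> nrm d <= 100 -> nrm (1 - c * d) <= 1 / 2 ->
  nrm (1 - d * c) <= 1 / 2 -> exists c', ginv 200 c c'.
Proof.
move=> cn dn cd dc.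
have [g [_ cg gn]] := half_inv cd; have [k [kc _ _]] := half_inv dc.
have e : k * d = d * g by rewrite -[k * d]mulr1 -cg -!mulrA (mulrA d c) mulrA mulrA kc mul1r.
exists (d * g); split.
- by rewrite mulrA.
- by rewrite -e -mulrA.
- by apply: le_trans cn _; rewrite ler_nat.
- apply: le_trans (nrmM _ _) _.
  by have := nrm_ge0 d; have := nrm_ge0 g; nra.
Qed.

Lemma mul_shiftl (P f Q : D) : P * f * Q = (P - 1) * f * Q + f * Q.
Proof. by rewrite mulrBl mul1r mulrBl subrK. Qed.
Lemma mul_shiftr (P f Q : D) : Q * f * P = Q * (f * (P - 1)) + Q * f.
Proof. by rewrite mulrBr mulr1 mulrBr mulrA subrK. Qed.

Lemma e200 (e : R) : 200 * e <= 1 -> e <= 1 / 200. Proof. lra. Qed.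

End Abstract.

(** * The path of corner entries *)

Section SitePath.
Context (R : realType) (C : cstarAlg R).
Variables (y p q : nat -> C) (N : nat) (om : R).
Hypotheses (ys : forall i, star (y i) = y i) (ps : forall i, star (p i) = p i)
  (qs : forall i, star (q i) = q i).
Hypotheses (cyp : forall i, y i * p i = p i * y i) (cyq : forall i, y i * q i = q i * y i)
  (pq0 : forall i, p i * q i = 0) (qp0 : forall i, q i * p i = 0)
  (sum1 : forall i, y i * y i + p i * p i + q i * q i = 1).
Hypotheses (q1 : forall i, nrm (q i) <= 1) (qN : q N = 0) (om0 : 0 <= om).
Hypotheses (yom : forall i, (i < N)%N -> nrm (y i - y i.+1) <= om)
  (pom : forall i, (i < N)%N -> nrm (p i - p i.+1) <= om)
  (qom : forall i, (i < N)%N -> nrm (q i - q i.+1) <= om).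
Hypotheses (rrC : rr0 C) (om_small : 12 * om <= 1 / 100 / 100).
Let n := (N + N.+1)%N.
Let D := mxC C n.+1.
Let H : D := site_mx y p q N.
Let E : D := site_err y p q N.
Let co (a : C) : D := corner_mx n.+1 a.
Let q2 : C := q 0%N * q 0%N.

Let Hs : star H = H. Proof. exact: site_mx_sa. Qed.
Let En : nrm E <= 12 * om. Proof. exact: site_err_small. Qed.
Let HHE : 1 - H * H = co q2 - E.
Proof.
have -> : E = H * H - 1 + co q2 by [].
by ncring.
Qed.
Let q2n : nrm q2 <= 1.
Proof. by apply: le_trans (nrmM _ _) _; have := q1 0; have := nrm_ge0 (q 0%N); nra. Qed.
Let con a : nrm (co a) <= nrm a. Proof. exact: corner_nrm. Qed.

Let Hn : nrm H <= 9 / 5.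
Proof.
apply: (almost_proj_nrm Hs HHE); first exact: le_trans (con _) q2n.
apply: le_trans En _; apply: le_trans om_small _; lra.
Qed.

Let f : D := 1 - co 1.
Let coM a b : co a * co b = co (a * b). Proof. exact: cornerM. Qed.
Let fs : star f = f.
Proof. by rewrite /f starB star1 /co star_mxC corner_star ?star1. Qed.
Let ff : f * f = f.
Proof. by rewrite /f mulrBr mulr1 mulrBl mul1r coM mulr1 subrr subr0. Qed.
Let fn : nrm f <= 1. Proof. exact: nrm_projection. Qed.
Let cof : co q2 * f = 0. Proof. by rewrite /f mulrBr coM !mulr1 subrr. Qed.
Let fco : f * co q2 = 0. Proof. by rewrite /f mulrBl coM !mul1r subrr. Qed.

Let entry00 (T : D) : nrm ((T : 'M[C]_n.+1) 0 0) <= nrm T.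
Proof. exact: mn_entry. Qed.

(** If [E] were 0, [psi1E] with [1 - H^2 = q^2 e_00] and [H_00 = - y] would give exactly [edge]. The
    two terms containing [E] cost [12 om] and [10 * 12 om]. *)
Let psiH : nrm ((psi H : 'M[C]_n.+1) 0 0 - edge (y 0%N) (q 0%N)) <= 132 * om.
Proof.
have h00 : (H : 'M[C]_n.+1) 0 0 = - y 0%N := site_mx00 y p q N.
pose th : D := psi_rem H.
have psiE : psi H = 1 + th * co q2 - th * E := psi_remE HHE.
have thn : nrm th <= 10 := psi_rem_nrm Hn.
have th00 : (th : 'M[C]_n.+1) 0 0 = - 1 + (1 + 1) * (ii C * y 0%N) - (q2 - (E : 'M[C]_n.+1) 0 0).
  have e1 : ((co q2 : 'M[C]_n.+1) 0 0) = q2 by rewrite mxE.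
  rewrite /th /psi_rem HHE -rc2; set K := rc D 2 * (ii D * H).
  have eK : (K : 'M[C]_n.+1) 0 0 = - ((1 + 1) * (ii C * y 0%N)).
    by rewrite /K rc_mxC ii_mxC h00 rc2 !mulrN.
  have -> : (- 1 - K - (co q2 - E) : 'M[C]_n.+1) 0 0 =
    - ((1%:M : 'M[C]_n.+1) 0 0) - (K : 'M[C]_n.+1) 0 0 -
      ((co q2 : 'M[C]_n.+1) 0 0 - (E : 'M[C]_n.+1) 0 0).
    by rewrite !mxE.
  by rewrite eK e1 opprK mxE eqxx.
have e2 : (psi H : 'M[C]_n.+1) 0 0 =
    1 + (th : 'M[C]_n.+1) 0 0 * q2 - ((th * E : D) : 'M[C]_n.+1) 0 0.
  rewrite psiE -corner_mulr; set T := th * E; rewrite -mul_mxC -/(co q2).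
  set S := th * co q2.
  have -> : (1 + S - T : 'M[C]_n.+1) 0 0 =
    ((1%:M : 'M[C]_n.+1) 0 0) + (S : 'M[C]_n.+1) 0 0 - (T : 'M[C]_n.+1) 0 0 by rewrite !mxE.
  by rewrite mxE eqxx.
have -> : (psi H : 'M[C]_n.+1) 0 0 - edge (y 0%N) (q 0%N) =
    (E : 'M[C]_n.+1) 0 0 * q2 - ((th * E : D) : 'M[C]_n.+1) 0 0.
  rewrite e2 th00 /edge /q2; set a := (E : 'M[C]_n.+1) 0 0; set b := ((th * E : D) : 'M[C]_n.+1) 0 0.
  by ncring.
apply: le_trans (nrmD _ _) _; rewrite nrmN.
have -> : 132 * om = 12 * om + 10 * (12 * om) by ring.
apply: lerD; apply: le_trans; [exact: nrmM| |exact: entry00|].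
  rewrite -[12 * om]mulr1; apply: ler_pM => //; rewrite ?nrm_ge0//.
  exact: le_trans (entry00 E) En.
by apply: le_trans (nrmM _ _) _; apply: ler_pM; rewrite ?nrm_ge0.
Qed.

(** From [P Q = 1] the corner entries satisfy [1 - P_00 Q_00 = (P f Q)_00 = ((P - 1) f Q)_00],
    because [(f Q)_00 = 0]. So the corner of [P] is almost inverted by that of [Q]. *)
Let corner_inv (P Q : D) (e : R) : ginv 100 P Q -> nrm ((P - 1) * f) <= e ->
  nrm (f * (P - 1)) <= e -> 200 * e <= 1 ->
  exists c', ginv 200 ((P : 'M[C]_n.+1) 0 0) c'.
Proof.
move=> [PQ QP Pn Qn] Pf fP e1.
set c := (P : 'M[C]_n.+1) 0 0; set d := (Q : 'M[C]_n.+1) 0 0.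
have split1 (S T : D) : S * T = 1 ->
    1 - (S : 'M[C]_n.+1) 0 0 * (T : 'M[C]_n.+1) 0 0 = ((S * f * T : D) : 'M[C]_n.+1) 0 0.
  move=> ST; have -> : S * f * T = 1 - S * co 1 * T.
    by rewrite /f mulrBr mulr1 mulrBl ST.
  have -> : (1 - S * co 1 * T : 'M[C]_n.+1) 0 0 =
     (1%:M : 'M[C]_n.+1) 0 0 - ((S *m (co 1 *m T)) : 'M[C]_n.+1) 0 0.
    by rewrite mulmxA !mxE.
  rewrite mxE eqxx; congr (_ - _).
  have -> : (co 1 : 'M[C]_n.+1) = co 1 *m co 1 by rewrite cornerM mulr1.
  by rewrite -mulmxA mulmxA mxE (bigD1 0)//= big1 ?addr0 ?corner_mulr ?corner_mull
    ?mulr1 ?mul1r// => k k0; rewrite !mxE big1 ?mul0r// => l _;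
    rewrite !mxE andbC (negPf (_ : (k : nat) != 0%N)) ?mulr0.
have fz (T : D) : ((f * T : D) : 'M[C]_n.+1) 0 0 = 0.
  have -> : f * T = T - co 1 * T by rewrite /f mulrBl mul1r.
  have -> : (T - co 1 * T : 'M[C]_n.+1) 0 0 =
     (T : 'M[C]_n.+1) 0 0 - ((co 1 *m T) : 'M[C]_n.+1) 0 0 by rewrite !mxE.
  by rewrite corner_mull mul1r subrr.
have zf (T : D) : ((T * f : D) : 'M[C]_n.+1) 0 0 = 0.
  have -> : T * f = T - T * co 1 by rewrite /f mulrBr mulr1.
  have -> : (T - T * co 1 : 'M[C]_n.+1) 0 0 =
     (T : 'M[C]_n.+1) 0 0 - ((T *m co 1) : 'M[C]_n.+1) 0 0 by rewrite !mxE.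
  by rewrite corner_mulr mulr1 subrr.
have addE (S T : D) : ((S + T : D) : 'M[C]_n.+1) 0 0 =
   (S : 'M[C]_n.+1) 0 0 + (T : 'M[C]_n.+1) 0 0 by rewrite !mxE.
have {}e1 := e200 e1.
have cd : nrm (1 - c * d) <= 1 / 2.
  rewrite split1//; rewrite mul_shiftl addE fz addr0; apply: le_trans (entry00 _) _; apply: le_trans (nrmM _ _) _.
  have -> : (1 / 2 : R) = (1 / 200) * 100 by field.
  by apply: ler_pM; rewrite ?nrm_ge0//; apply: le_trans Pf _.
have dc : nrm (1 - d * c) <= 1 / 2.
  rewrite split1//; rewrite mul_shiftr addE zf addr0; apply: le_trans (entry00 _) _; apply: le_trans (nrmM _ _) _.
  have -> : (1 / 2 : R) = 100 * (1 / 200) by field.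
  by apply: ler_pM; rewrite ?nrm_ge0//; apply: le_trans fP _.
apply: (@near_inv2 _ _ c d) => //; exact: le_trans (entry00 _) _.
Qed.

(** Real rank zero of the matrix algebra moves [H] to an invertible [X] at distance [e1]; the corner
    entries along [sign_path] stay invertible, start near [edge] and end at 1. *)
Lemma site_path (e1 : R) : 0 < e1 -> e1 <= 1 / 100 / 400 -> exists c c' : R -> C,
  [/\ forall s, 0 <= s <= 1 -> ginv 200 (c s) (c' s),
      forall s t, 0 <= s <= 1 -> 0 <= t <= 1 -> nrm (c s - c t) <= 210 * `|s - t|,
      c 1 = 1 & nrm (c 0 - edge (y 0%N) (q 0%N)) <= 70 * e1 + 132 * om].
Proof.
move=> e10 e1s.
(* The error of [near_proj]; [sign_path] multiplies it by 20, and [corner_inv] needs the result to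
   be at most [1 / 200]. *)
pose eps := 12 * om + 4 * e1.
have eps1 : 200 * (20 * eps) <= 1 by rewrite /eps; have := om_small; lra.
have e0 : 0 <= eps by rewrite addr_ge0 ?mulr_ge0// ltW.
have e110 : e1 <= 1 / 10 by lra.
have [X [Xs [X' [XX' X'X]] XH]] := rr0_mxC (n := n.+1) rrC Hs e10.
have {}XH : nrm (X - H) <= e1 by apply: ltW.
have [Xn ef fe] := near_proj Hn XH e110 HHE cof fco fn En.
have [P [Q [P0 P1 PQ PL]]] := sign_path Xs XX' X'X Xn e0 ef fe.
have /choice[c' Hc'] : forall s, exists k, 0 <= s <= 1 ->
    ginv 200 ((P s : 'M[C]_n.+1) 0 0) k.
  move=> s; have [s01|ns] := pselect (0 <= s <= 1); last by exists 0 => /ns.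
  have [h1 h2 h3] := PQ s s01.
  by have [k hk] := corner_inv h1 h2 h3 eps1; exists k.
have subE (S T : D) : (S : 'M[C]_n.+1) 0 0 - (T : 'M[C]_n.+1) 0 0 =
   ((S - T : D) : 'M[C]_n.+1) 0 0 by rewrite !mxE.
exists (fun s => (P s : 'M[C]_n.+1) 0 0), c'; split=> //.
- by move=> s t s01 t01; rewrite subE; apply: le_trans (entry00 _) _; exact: PL.
- by rewrite P1 mxE eqxx.
- rewrite P0.
  have -> : (psi X : 'M[C]_n.+1) 0 0 - edge (y 0%N) (q 0%N) =
    ((psi X - psi H : D) : 'M[C]_n.+1) 0 0 + ((psi H : 'M[C]_n.+1) 0 0 - edge (y 0%N) (q 0%N)).
    by rewrite -subE; ncring.
  apply: le_trans (nrmD _ _) _; apply: lerD; last exact: psiH.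
  apply: le_trans (entry00 _) _; apply: le_trans (psi_lip Xn _) _.
    by apply: le_trans Hn _; rewrite ler_pdivrMr// -natrM ler_nat.
  by rewrite ler_wpM2l.
Qed.

End SitePath.

(** [K] and [dl] depend on [eta] only, not on [N] or the algebra. The chain follows the segment from
    [W 0] to [edge], makes one step to the start of the corner path, and follows that path to 1. *)
Lemma rr0_chain (R : realType) (eta : R) : 0 < eta -> exists (K : nat) (dl : R), 0 < dl /\
  forall (C : cstarAlg R), rr0 C -> forall (N : nat) (W : nat -> C),
    (forall i, unitary_elt (W i)) -> W N = 1 ->
    (forall i, (i < N)%N -> nrm (W i - W i.+1) <= dl) -> gchain 200 eta K (W 0%N) 1.
Proof.
move=> eta0.
(* The gap between [edge] and the corner path is [70 e1 + 132 om]; each term gets [eta / 2]. The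
   absolute bounds are those required by [site_path]. *)
pose om := Num.min (eta / 264) (1 / 400 / 400) : R.
pose e1 := Num.min (eta / 140) (1 / 100 / 400) : R.
have om0 : 0 < om by rewrite lt_min; apply/andP; split; lra.
have e10 : 0 < e1 by rewrite lt_min; apply/andP; split; lra.
have om1 : om <= eta / 264 by rewrite ge_min lexx.
have om2 : om <= 1 / 400 / 400 by rewrite ge_min lexx orbT.
have e11 : e1 <= eta / 140 by rewrite ge_min lexx.
have e12 : e1 <= 1 / 100 / 400 by rewrite ge_min lexx orbT.
have [dl dl0 Hdl] := parts_unif om0.
pose K0 := (Num.truncn (210 / eta)).+1.
have K0P : 210 <= eta * K0%:R.
  by rewrite -ler_pdivrMl// mulrC ltW// truncnS_gt.
exists (K0 + (1 + K0))%N, dl; split=> // C rC N W UW WN Wd.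
pose y i := ipart (W i); pose p i := ppart (W i); pose q i := qpart (W i).
have ys i : star (y i) = y i by apply: ipart_sa.
have pp i : pos (p i) := ppart_pos (UW i).
have pq i : pos (q i) := qpart_pos (UW i).
have cc i := part_comm (UW i).
have pq0 i : p i * q i = 0 := part_mul0 (UW i).
have qp0 i : q i * p i = 0 by have [<- _ _] := cc i; exact: pq0.
have cyp i : y i * p i = p i * y i by have [_ ? _] := cc i.
have cyq i : y i * q i = q i * y i by have [_ _ ?] := cc i.
have cpq i : p i * q i = q i * p i by have [? _ _] := cc i.
have sum1 i : y i * y i + p i * p i + q i * q i = 1 := part_sqr (UW i).
have y1 i : nrm (y i) <= 1 by have [? _ _] := part_nrm (UW i).
have q1 i : nrm (q i) <= 1 by have [_ _ ?] := part_nrm (UW i).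
have qN : q N = 0 by rewrite /q WN; have [_ _ ->] := parts_one C.
have Wom i : (i < N)%N -> [/\ nrm (y i - y i.+1) <= om, nrm (p i - p i.+1) <= om &
   nrm (q i - q i.+1) <= om] by move=> iN; apply: Hdl => //; exact: Wd.
have oms : 12 * om <= 1 / 100 / 100 by lra.
have [c [c' [cc' cL c1 c0]]] := site_path ys (fun i => proj1 (pp i)) (fun i => proj1 (pq i))
  cyp cyq pq0 qp0 sum1 q1 qN (ltW om0) (fun i h => let: And3 a _ _ := Wom i h in a)
  (fun i h => let: And3 _ a _ := Wom i h in a) (fun i h => let: And3 _ _ a := Wom i h in a)
  rC oms e10 e12.
have z1 : 0 <= (1 : R) <= 1 by rewrite ler01 lexx.
have z0 : 0 <= (0 : R) <= 1 by rewrite ler01 lexx.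
set ed := edge (y 0%N) (q 0%N) in c0.
pose pth (t : R) := rc C (1 - t) * W 0%N + rc C t * ed.
have /choice[pth' Hp'] : forall t, exists k, 0 <= t <= 1 -> ginv 25 (pth t) k.
  move=> t; have [t01|nt] := pselect (0 <= t <= 1); last by exists 0 => /nt.
  have [k hk] := edge_path (ys 0%N) (pp 0%N) (pq 0%N) (q1 0%N) (y1 0%N) (cpq 0%N) (cyp 0%N)
    (cyq 0%N) (pq0 0%N) (sum1 0%N) t01.
  by exists k => _; rewrite /pth [W 0%N]part_sum.
have pth0 : pth 0 = W 0%N by rewrite /pth subr0 rc1 rc0 mul1r mul0r addr0.
have pth1 : pth 1 = ed by rewrite /pth subrr rc1 rc0 mul0r mul1r add0r.
have ch1 : gchain 200 eta K0 (W 0%N) ed.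
  rewrite -pth0 -pth1; apply: (@gchain_mono _ _ 25); first by rewrite ler_nat.
  apply: (@gchain_path _ _ 25 eta 210 pth pth') => // s t _ _.
  have -> : pth s - pth t = rc C (s - t) * (ed - W 0%N).
    by rewrite /pth !rcB rc1; ncring.
  rewrite nrm_rcM mulrC; apply: ler_wpM2r => //.
  have := nrmD ed (- W 0%N); rewrite nrmN; have := nrm_unitary (UW 0%N).
  have := edge_nrm (pq 0%N) (q1 0%N) (y1 0%N) (cyq 0%N); rewrite -/ed; lra.
apply: gchain_cat ch1 _; apply: (@gchain_cat _ _ _ _ _ _ _ (c 0)); last first.
  rewrite -c1; apply: (@gchain_path _ _ 200 eta 210 c c') => //.
have [e1' e2' e3' e4'] := Hp' 1 z1; rewrite pth1 in e1' e2' e3'.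
apply: (@gchain_step _ _ 200 eta ed (pth' 1) (c 0) (c' 0)).
- by split=> //; [apply: le_trans e3' _|apply: le_trans e4' _]; rewrite ler_nat.
- exact: cc'.
- exact: ltW.
- by apply: le_trans c0 _; lra.
Qed.

Section Chains.
Context (R : realType).

Lemma mn_le_entries (A : cstarAlg R) m n (T : 'M[A]_(m, n)) (t : R) :
  (forall i j, nrm (T i j) <= t) -> mn T <= (m * n)%:R * t.
Proof.
move=> h; apply: le_trans (mn_le_mxsum _) _.
apply: (@le_trans _ _ (\sum_(i < m) \sum_(j < n) t)).
  by apply: ler_sum => i _; apply: ler_sum => j _.
by rewrite !sumr_const !card_ord -mulrnA mulr_natl mulnC.
Qed.

(** Being joined by chains of mesh [e] is an equivalence relation that holds locally. No bound on
    [N] is obtained, nor is one needed at this point. *)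
Lemma unitary_chain (A : cstarAlg R) n (u : 'M[A]_n) (e : R) : U0 u -> 0 < e ->
  exists N (W : nat -> 'M[A]_n), [/\ forall i, is_unitarymx (W i), W 0%N = u, W N = 1%:M &
    forall i, (i < N)%N -> mn (W i - W i.+1) <= e].
Proof.
move=> Uu e0.
have [C [C1 CD Cc] Cu] := Uu.
pose rr x y := exists N (W : nat -> 'M[A]_n),
  [/\ forall i, is_unitarymx (W i), W 0%N = x, W N = y &
    forall i, (i < N)%N -> mn (W i - W i.+1) <= e].
apply: (@locally_constant _ C rr Cc) => //.
- move=> x y [N [W [WU W0 WN Wd]]]; exists N, (fun i => W (N - i)%N).
  split; [by move=> i; exact: WU|by rewrite subn0|by rewrite subnn|move=> i iN].
  rewrite -mnN opprB; have -> : (N - i)%N = (N - i.+1).+1 by rewrite subnSK.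
  by apply: Wd; rewrite ltn_subrL (leq_trans _ iN).
- move=> x y z [N [W [WU W0 WN Wd]]] [M [V [VU V0 VM Vd]]].
  exists (N + M)%N, (fun i => if (i <= N)%N then W i else V (i - N)%N); split.
  + by move=> i; case: ifP.
  + by [].
  + case: leqP => [h|_]; last by rewrite addKn.
    have M0 : M = 0%N by lia.
    by subst M; rewrite addn0 WN -V0.
  + move=> i iNM; case: (ltngtP i N) => iN.
    * by apply: Wd.
    * rewrite subSn 1?ltnW//; apply: Vd; lia.
    * rewrite iN subSnn WN -V0; apply: Vd; lia.
- move=> x Cx; apply/nbhs_mnP; exists e => // y yx Cy.
  exists 1%N, (fun i => if i is 0 then x else y); split.
  - by case=> [|i]; [exact: (CD x)|exact: (CD y)].
  - by [].
  - by [].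
  - by move=> i; rewrite ltnS leqn0 => /eqP ->; rewrite -mnN opprB; exact: ltW.
Qed.

(** The tolerance [eta] depends on [n] and [r] but not on the length [K], since each step is
    justified separately. The step size [2 * eta] is the mesh [eta] plus the tolerance. *)
Lemma approx_chain_glc n (r : R) : 0 <= r -> exists2 eta : R, 0 < eta &
  forall (A : cstarAlg R) K (g g' : nat -> 'M[A]_n) (x y : 'M[A]_n),
    (forall j, (j <= K)%N -> [/\ forall a b, nrm (g' j a b) <= r,
      forall a b, nrm ((g j *m g' j - 1%:M) a b) <= eta &
      forall a b, nrm ((g' j *m g j - 1%:M) a b) <= eta]) ->
    (forall j, (j < K)%N -> forall a b, nrm ((g j.+1 - g j) a b) <= 2 * eta) ->
    (forall a b, nrm ((x - g 0%N) a b) <= eta) -> (forall a b, nrm ((y - g K) a b) <= eta) ->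
  glc x y.
Proof.
move=> r0; pose m : R := (n * n)%:R + 1.
have m1 : 1 <= m by rewrite lerDr.
have m0 : 0 < m by apply: lt_le_trans m1.
have d0 : 0 < 8 * m * m * (r + 1) by rewrite !mulr_gt0// ltr_wpDl.
(* Two demands: [m * eta <= 1 / 2] turns the approximate inverses into inverses of norm at most
   [2 m r], and [(2 m eta) (2 m r) < 1] is the condition of [glc_near] for one step. *)
pose eta : R := (8 * m * m * (r + 1))^-1.
have eta0 : 0 < eta by rewrite invr_gt0.
have etaE : eta * (8 * m * m * (r + 1)) = 1 by rewrite mulVf// gt_eqF.
have e1 : m * eta <= 1 / 2.
  have h : 0 <= eta * m by rewrite mulr_ge0// ltW.
  have h2 : 1 <= m * (r + 1) by nra.
  nra.
have e2 : 4 * (m * m * r * eta) < 1.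
  have h : 0 < m * m by rewrite mulr_gt0.
  have h2 : 0 < eta * (m * m) by rewrite mulr_gt0.
  have h3 : 0 <= eta * (m * m) * r by rewrite mulr_ge0// ltW.
  nra.
exists eta => // A K g g' x y Hg Hs Hx Hy.
have mle p q (T : 'M[A]_n) : p <= q -> (forall a b, nrm (T a b) <= p) -> 0 <= p -> mn T <= m * q.
  move=> pq h p0; apply: le_trans (mn_le_entries h) _.
  by apply: ler_pM => //; rewrite ?ler0n// lerDl.
have near1 p (S T : 'M[A]_n) j : (j <= K)%N -> (S = g j) -> 0 <= p -> p <= 2 * eta ->
   (forall a b, nrm ((T - S) a b) <= p) -> glc S T.
  move=> jK -> p0 p2 TS; have [h1 h2 h3] := Hg j jK.
  have n1 : nrm (1 - (g j *m g' j : mxC A n)) <= 1 / 2.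
    rewrite nrmBC nrm_mxC; apply: le_trans e1; apply: (mle eta) => //; exact: ltW.
  have n2 : nrm (1 - (g' j *m g j : mxC A n)) <= 1 / 2.
    rewrite nrmBC nrm_mxC; apply: le_trans e1; apply: (mle eta) => //; exact: ltW.
  have [k [_ k2 kn]] := half_inv n1; have [l [l1 _ _]] := half_inv n2.
  have {}k2 : (g j *m g' j) *m k = 1%:M := k2.
  have {}l1 : l *m (g' j *m g j) = 1%:M := l1.
  have i1 : g j *m (g' j *m k) = 1%:M by rewrite mulmxA.
  have e : g' j *m k = l *m g' j.
    by rewrite -[LHS]mul1mx -l1 -!mulmxA i1 mulmx1.
  have i2 : (g' j *m k) *m g j = 1%:M by rewrite e -mulmxA l1.
  apply: (glc_near i1 i2).
  have b1 : mn (T - g j) <= m * (2 * eta) by apply: (mle p).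
  have b2 : mn (g' j *m k) <= (m * r) * 2.
    apply: le_trans (mnM _ _) _; apply: ler_pM; rewrite ?mn_ge0//.
    by apply: (mle r).
  apply: le_lt_trans e2.
  have -> : 4 * (m * m * r * eta) = m * (2 * eta) * (m * r * 2) by ring.
  by apply: ler_pM; rewrite ?mn_ge0.
have eta2 : eta <= 2 * eta by rewrite mulr_natl mulr2n lerDl ltW.
have eta00 := ltW eta0.
have c0 : glc (g 0%N) x by apply: (near1 eta _ _ 0%N).
have cx := glc_sym c0.
have cy : glc (g K) y by apply: (near1 eta _ _ K).
have main : forall j, (j <= K)%N -> glc (g 0%N) (g j).
  elim=> [|j IH] jK; first exact: glc_trans c0 cx.
  apply: glc_trans (IH (ltnW jK)) _; apply: (near1 (2 * eta) _ _ j) => //.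
  - exact: ltnW.
  - by rewrite mulr_ge0.
  - exact: Hs.
exact: glc_trans cx (glc_trans (main K _) cy).
Qed.

End Chains.

Local Notation tval := Defs.tval.
Local Notation fsym := Defs.fsym.

(** * Definable predicates *)

Fixpoint tsub (L : language) (I J : finType) (g : I -> srt L) (h : J -> srt L)
    (sg : forall k, term h (g k)) s (t : term g s) : term h s :=
  match t with
  | Var k => sg k
  | App f ts => App (fun k => tsub sg (ts k))
  end.

Definition tweak (L : language) (J : finType) (h : J -> srt L) s0 s (t : term h s) :
    term (ext_ctx h s0) s :=
  tsub (h := ext_ctx h s0) (fun k => Var (ext_ctx h s0) (Some k)) t.

Lemma tval_tsub (R : realType) (L : language) (M : structure R L) (I J : finType)
    (g : I -> srt L) (h : J -> srt L) (sg : forall k, term h (g k)) s (t : term g s)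
    (w : env M h) : tval w (tsub sg t) = tval (fun k => tval w (sg k)) t.
Proof.
elim: t => //= f ts IH; congr fint; apply: functional_extensionality_dep => k; exact: IH.
Qed.

Lemma tval_tweak (R : realType) (L : language) (M : structure R L) (J : finType)
    (h : J -> srt L) s0 s (t : term h s) (w : env M h) (x : M s0) :
  tval (ext_env w x) (tweak s0 t) = tval w t.
Proof. by rewrite tval_tsub. Qed.

(* An interpretation of the sorts and symbols of L in L'; it serves both for
   substituting terms inside L and for moving formulas of L to L'. *)
Section Interpretation.
Context (R : realType) (L L' : language) (es : srt L -> srt L').
Variable ef : forall (f : fsym L) (J : finType) (h : J -> srt L'),
  (forall k : arity f, term h (es (fdom k))) -> term h (es (fcod f)).

Fixpoint ttr (I J : finType) (g : I -> srt L) (h : J -> srt L')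
    (sg : forall k, term h (es (g k))) s (t : term g s) : term h (es s) :=
  match t with
  | Var k => sg k
  | App f ts => ef (fun k => ttr sg (ts k))
  end.

Definition lift_sub (I J : finType) (g : I -> srt L) (h : J -> srt L')
    (sg : forall k, term h (es (g k))) s :
    forall k, term (ext_ctx h (es s)) (es (ext_ctx g s k)) :=
  fun o => match o return term (ext_ctx h (es s)) (es (ext_ctx g s o)) with
           | Some k => tweak (es s) (sg k)
           | None => Var (ext_ctx h (es s)) None
           end.

Fixpoint ftr (I : finType) (g : I -> srt L) (p : formula R g) :
    forall (J : finType) (h : J -> srt L'), (forall k, term h (es (g k))) -> formula R h :=
  match p in formula _ g return
    forall (J : finType) (h : J -> srt L'), (forall k, term h (es (g k))) -> formula R h with
  | Dist _ _ _ t u => fun J h sg => Dist R (ttr sg t) (ttr sg u)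
  | Conn _ _ _ _ cc q => fun J h sg => Conn cc (fun i => ftr (q i) sg)
  | SupF _ _ s q => fun J h sg => SupF (ftr q (lift_sub sg s))
  | InfF _ _ s q => fun J h sg => InfF (ftr q (lift_sub sg s))
  end.

Variables (M : structure R L) (M' : structure R L').
Variable cm : forall s, M' (es s) -> M s.
Hypothesis cmd : forall s (x y : M' (es s)), mdist (cm x) (cm y) = mdist x y.
Hypothesis cms : forall s (y : M s), exists x : M' (es s), cm x = y.
Hypothesis cmf : forall f (J : finType) (h : J -> srt L')
    (ts : forall k : arity f, term h (es (fdom k))) (w : env M' h),
  cm (tval w (ef ts)) = fint (fun k => cm (tval w (ts k))).

Lemma tval_ttr (I J : finType) (g : I -> srt L) (h : J -> srt L')
    (sg : forall k, term h (es (g k))) s (t : term g s) (w : env M' h) :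
  cm (tval w (ttr sg t)) = tval (fun k => cm (tval w (sg k))) t.
Proof.
elim: t => //= f ts IH; rewrite cmf; congr fint.
by apply: functional_extensionality_dep => k; exact: IH.
Qed.

(** By surjectivity of [cm] the quantifiers on both sides range over the same values; the atomic
    case uses that [cm] is isometric. *)
Lemma fval_ftr (I : finType) (g : I -> srt L) (p : formula R g) (J : finType)
    (h : J -> srt L') (sg : forall k, term h (es (g k))) (w : env M' h) :
  fval (ftr p sg) w = fval p (fun k => cm (tval w (sg k))).
Proof.
have liftE (I' J' : finType) (g' : I' -> srt L) (h' : J' -> srt L')
    (sg' : forall k, term h' (es (g' k))) s (w' : env M' h') (x : M' (es s)) :
    (fun k => cm (tval (ext_env w' x) (lift_sub sg' s k))) =
    ext_env (g := g') (fun k => cm (tval w' (sg' k))) (cm x).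
  by apply: functional_extensionality_dep => -[k|] //=; rewrite tval_tweak.
have rangeE (I' J' : finType) (g' : I' -> srt L) (h' : J' -> srt L') s
    (q : formula R (ext_ctx g' s)) (sg' : forall k, term h' (es (g' k))) (w' : env M' h') :
    (forall (J : finType) (h : J -> srt L') (sg : forall k, term h (es (ext_ctx g' s k)))
      (w : env M' h), fval (ftr q sg) w = fval q (fun k => cm (tval w (sg k)))) ->
    range (fun x => fval (ftr q (lift_sub sg' s)) (ext_env w' x)) =
    range (fun x => fval q (ext_env (fun k => cm (tval w' (sg' k))) x)).
  move=> IH; apply/seteqP; split=> [_ [x _ <-]|_ [y _ <-]].
    by exists (cm x) => //; rewrite IH liftE.
  by have [x <-] := cms y; exists x => //; rewrite IH liftE.
elim: p J h sg w => {I g} [I g s t u|I g n c cc q IH|I g s q IH|I g s q IH] J h sg w /=.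
- by rewrite -cmd !tval_ttr.
- by congr c; apply/rowP => i; rewrite !mxE IH.
- by rewrite (rangeE _ _ _ _ _ _ _ _ IH).
- by rewrite (rangeE _ _ _ _ _ _ _ _ IH).
Qed.

End Interpretation.

Section SupInf.
Context (R : realType).

(** No boundedness is assumed: either both sets have a supremum, or neither has and both sups take
    the default value 0. *)
Lemma sup_dist T (X : set T) (f g : T -> R) (e : R) : 0 <= e ->
  (forall x, X x -> `|f x - g x| <= e) ->
  `|sup [set f x | x in X] - sup [set g x | x in X]| <= e.
Proof.
move=> e0 fg; suff main : forall (f' g' : T -> R), (forall x, X x -> `|f' x - g' x| <= e) ->
    sup [set f' x | x in X] <= sup [set g' x | x in X] + e.
  rewrite ler_distl; have h1 := main f g fg.
  have h2 : sup [set g x | x in X] <= sup [set f x | x in X] + e.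
    by apply: main => x Xx; rewrite distrC fg.
  by lra.
move=> {fg f g} f' g' fg1.
have bnd (f g : T -> R) : (forall x, X x -> `|f x - g x| <= e) ->
    has_sup [set f x | x in X] -> has_sup [set g x | x in X].
  move=> h [[z [x Xx _]] [B HB]]; split; first by exists (g x), x.
  exists (B + e) => _ [y Xy <-]; have := h y Xy; rewrite ler_distl => /andP[h1 _].
  by have := HB _ (imageP f Xy); move: h1; lra.
have [hf|nf] := pselect (has_sup [set f' x | x in X]).
  have [ne ub] := bnd _ _ fg1 hf; apply: ge_sup; first by case: hf.
  move=> _ [x Xx <-]; have := fg1 x Xx; rewrite ler_distl => /andP[_ h].
  by have := ub_le_sup ub (imageP g' Xx); lra.
rewrite !sup_out//; first by rewrite add0r.
by move=> /(bnd g' f') h; apply: nf; apply: h => x Xx; rewrite distrC fg1.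
Qed.

Lemma infE T (X : set T) (f : T -> R) : inf [set f x | x in X] = - sup [set - f x | x in X].
Proof. by rewrite /inf image_comp. Qed.

Lemma inf_dist T (X : set T) (f g : T -> R) (e : R) : 0 <= e ->
  (forall x, X x -> `|f x - g x| <= e) ->
  `|inf [set f x | x in X] - inf [set g x | x in X]| <= e.
Proof.
move=> e0 fg; rewrite !infE -opprD normrN; apply: sup_dist => // x Xx.
by rewrite -opprD normrN fg.
Qed.

Lemma le_sup_img T (X : set T) (f : T -> R) B x : (forall x, X x -> f x <= B) -> X x ->
  f x <= sup [set f x | x in X].
Proof.
by move=> fB Xx; apply: ub_le_sup; [exists B => _ [y Xy <-]; exact: fB|exists x].
Qed.

Lemma sup_img_le T (X : set T) (f : T -> R) B : X !=set0 -> (forall x, X x -> f x <= B) ->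
  sup [set f x | x in X] <= B.
Proof. by move=> [x Xx] fB; apply: ge_sup; [exists (f x), x|move=> _ [y Xy <-]; exact: fB]. Qed.

Lemma inf_img_le T (X : set T) (f : T -> R) B x : (forall x, X x -> B <= f x) -> X x ->
  inf [set f x | x in X] <= f x.
Proof.
move=> fB Xx; rewrite infE lerNl.
by apply: (@le_sup_img _ X (fun x => - f x) (- B)) => // y Xy; rewrite lerN2 fB.
Qed.

Lemma le_inf_img T (X : set T) (f : T -> R) B : X !=set0 -> (forall x, X x -> B <= f x) ->
  B <= inf [set f x | x in X].
Proof.
by move=> X0 fB; rewrite infE lerNr; apply: sup_img_le => // x Xx; rewrite lerN2 fB.
Qed.

Lemma inf_img_lt T (X : set T) (f : T -> R) B : X !=set0 ->
  inf [set f x | x in X] < B -> exists2 x, X x & f x < B.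
Proof.
move=> X0 h; apply: contrapT => nx; suff : B <= inf [set f x | x in X] by rewrite leNgt h.
by apply: le_inf_img => // x Xx; rewrite leNgt; apply/negP => fx; apply: nx; exists x.
Qed.

Lemma inf_img_eq T (X : set T) (f : T -> R) B x : (forall x, X x -> B <= f x) -> X x ->
  f x = B -> inf [set f x | x in X] = B.
Proof.
move=> fB Xx fx; apply/eqP; rewrite eq_le -{1}fx (@inf_img_le _ _ _ B)//=.
by apply: le_inf_img => //; exists x.
Qed.

End SupInf.

Section Closure.
Context (R : realType) (L : language) (Idx : Type) (M : Idx -> structure R L).
Local Notation dp := (definable_predicate (M := M)).

Lemma dp_ext (I : finType) (g : I -> srt L) (P Q : forall i, env (M i) g -> R) :
  (forall i v, P i v = Q i v) -> dp P -> dp Q.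
Proof. by move=> PQ dP e e0; have [p Hp] := dP e e0; exists p => i v; rewrite -PQ. Qed.

Lemma dp_formula (I : finType) (g : I -> srt L) (p : formula R g) :
  dp (fun i (v : env (M i) g) => fval p v).
Proof. by move=> e e0; exists p => i v; rewrite subrr normr0 ltW. Qed.

Lemma dp_lim (I : finType) (g : I -> srt L) (P : forall i, env (M i) g -> R) :
  (forall e : R, 0 < e -> exists2 Q : forall i, env (M i) g -> R, dp Q &
     forall i v, `|Q i v - P i v| <= e) -> dp P.
Proof.
move=> h e e0; have e2 : 0 < e / 2 by rewrite divr_gt0.
have [Q dQ QP] := h _ e2; have [p Hp] := dQ _ e2; exists p => i v.
have := Hp i v; have := QP i v; rewrite !ler_distl => /andP[h1 h2] /andP[h3 h4].
by apply/andP; split; lra.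
Qed.

(** Uniform continuity is asked of the connective because its arguments are only approximated by
    formulas and no bound on them is at hand. *)
Lemma dp_conn (I : finType) (g : I -> srt L) n (c : 'rV[R]_n -> R)
    (P : 'I_n -> forall i, env (M i) g -> R) :
  (forall e : R, 0 < e -> exists2 d : R, 0 < d & forall x y : 'rV[R]_n,
     (forall j, `|x 0 j - y 0 j| <= d) -> `|c x - c y| <= e) ->
  (forall j, dp (P j)) -> dp (fun i v => c (\row_j P j i v)).
Proof.
move=> ucc dP.
have cc : continuous c.
  move=> x A /nbhs_ballP[e /= e0 eA]; have e2 : 0 < e / 2 by rewrite divr_gt0.
  have [d d0 H] := ucc _ e2.
  apply/nbhs_ballP; exists d => //= y [_ xy]; apply: eA.
  apply: (@le_lt_trans _ _ (e / 2)); last by rewrite gtr_pMr// invf_lt1// ltr1n.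
  by apply: H => j; have := xy 0 j; rewrite /ball/= => /ltW.
move=> e e0; have [d d0 H] := ucc e e0.
have /choice[p Hp] : forall j, exists p : formula R g,
  forall i (v : env (M i) g), `|fval p v - P j i v| <= d by move=> j; exact: dP.
by exists (Conn cc p) => i v; apply: H => j; rewrite !mxE.
Qed.

Lemma dp1 (I : finType) (g : I -> srt L) (c : R -> R) (K : R)
    (P : forall i, env (M i) g -> R) : 0 < K ->
  (forall x y, `|c x - c y| <= K * `|x - y|) -> dp P -> dp (fun i v => c (P i v)).
Proof.
move=> K0 cK dP.
apply: (@dp_ext _ _ (fun i v => (fun r : 'rV[R]_1 => c (r 0 0)) (\row_(j < 1) P i v))).
  by move=> i v; rewrite mxE.
apply: (@dp_conn I g 1 (fun r => c (r 0 0)) (fun=> P)) => // e e0; exists (e / K); first by rewrite divr_gt0.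
move=> x y /(_ 0) h; apply: le_trans (cK _ _) _.
by rewrite -ler_pdivlMl// mulrC.
Qed.

Lemma dp2 (I : finType) (g : I -> srt L) (c : R -> R -> R) (K : R)
    (P Q : forall i, env (M i) g -> R) : 0 < K ->
  (forall x y x' y', `|c x y - c x' y'| <= K * (`|x - x'| + `|y - y'|)) -> dp P -> dp Q ->
  dp (fun i v => c (P i v) (Q i v)).
Proof.
move=> K0 cK dP dQ; pose PQ (j : 'I_2) := if j == 0 then P else Q.
apply: (@dp_ext _ _ (fun i v => (fun r : 'rV[R]_2 => c (r 0 0) (r 0 1)) (\row_j PQ j i v))).
  by move=> i v; rewrite !mxE.
apply: (@dp_conn I g 2 (fun r => c (r 0 0) (r 0 1)) PQ) => // [e e0|j]; last by rewrite /PQ; case: ifP.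
exists (e / (2 * K)); first by rewrite divr_gt0 ?mulr_gt0.
move=> x y h; apply: le_trans (cK _ _ _ _) _.
have := h 0; have := h 1; rewrite !ler_pdivlMr ?mulr_gt0//; lra.
Qed.

Lemma dp_cst (I : finType) (g : I -> srt L) (r : R) : dp (fun i (v : env (M i) g) => r).
Proof.
apply: (@dp_ext _ _ (fun i v => (fun=> r) (\row_(j < 0) (fun _ _ _ => 0 : R) j i v))) => //.
apply: (@dp_conn I g 0 (fun=> r) (fun _ _ _ => 0)); last by case.
by move=> e e0; exists 1 => // x y _; rewrite subrr normr0 ltW.
Qed.

Section Ops.
Variables (I : finType) (g : I -> srt L) (P Q : forall i, env (M i) g -> R).
Arguments P : clear implicits.
Arguments Q : clear implicits.
Hypotheses (dP : dp P) (dQ : dp Q).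

Lemma dp_sub : dp (fun i v => P i v - Q i v).
Proof.
apply: (@dp2 _ _ (fun x y => x - y) 1) => // x y x' y'.
by rewrite mul1r opprB addrCA addrA -addrA addrCA -[`|y - y'|]normrN opprB
  (_ : x - y + (y' - x') = (x - x') + (y' - y)) ?ler_normD//; ring.
Qed.

Lemma dp_scale (k : R) : dp (fun i v => k * P i v).
Proof.
apply: (@dp1 _ _ ( *%R k) (`|k| + 1)) => [|x y|//]; first by rewrite ltr_wpDl.
by rewrite -mulrBr normrM ler_wpM2r// lerDl.
Qed.

Lemma dp_opp : dp (fun i v => - P i v).
Proof. by apply: (@dp1 _ _ -%R 1) => // x y; rewrite mul1r -opprD normrN. Qed.

Lemma dp_abs : dp (fun i v => `|P i v|).
Proof. by apply: (@dp1 _ _ (fun x => `|x|) 1) => // x y; rewrite mul1r ler_dist_dist. Qed.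

Lemma dp_max : dp (fun i v => Num.max (P i v) (Q i v)).
Proof.
apply: (@dp2 _ _ Num.max 1) => // x y x' y'; rewrite mul1r.
have := ler_norm (x - x'); have := ler_norm (y - y').
have := ler_norm (x' - x); have := ler_norm (y' - y); rewrite (distrC x') (distrC y').
by rewrite ler_norml /Num.max => *; case: ifP; case: ifP; lra.
Qed.

Lemma dp_min : dp (fun i v => Num.min (P i v) (Q i v)).
Proof.
apply: (@dp2 _ _ Num.min 1) => // x y x' y'; rewrite mul1r.
have := ler_norm (x - x'); have := ler_norm (y - y').
have := ler_norm (x' - x); have := ler_norm (y' - y); rewrite (distrC x') (distrC y').
by rewrite ler_norml /Num.min => *; case: ifP; case: ifP; lra.
Qed.

End Ops.

Lemma dp_bigmax (I : finType) (g : I -> srt L) (T : Type) (r : seq T)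
    (P : T -> forall i, env (M i) g -> R) :
  (forall k, dp (P k)) -> dp (fun i v => \big[Num.max/0]_(k <- r) P k i v).
Proof.
move=> dP; elim: r => [|k r IH].
  by apply: dp_ext (dp_cst _ 0) => i v; rewrite big_nil.
by apply: dp_ext (dp_max (dP k) IH) => i v; rewrite big_cons.
Qed.

Lemma dp_sup (I : finType) (g : I -> srt L) s (P : forall i, env (M i) (ext_ctx g s) -> R) :
  dp P -> dp (fun i v => sup [set P i (ext_env v x) | x in [set: M i s]]).
Proof.
move=> dP e e0; have [p Hp] := dP e e0; exists (SupF p) => i v /=.
by apply: sup_dist => [|x _]; [exact: ltW|exact: Hp].
Qed.

Lemma dp_dist (I : finType) (g : I -> srt L) s (t u : term g s) :
  dp (fun i (v : env (M i) g) => mdist (tval v t) (tval v u)).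
Proof. exact: (dp_formula (Dist R t u)). Qed.

Lemma dp_subst (I J : finType) (g : I -> srt L) (h : J -> srt L)
    (sg : forall k, term h (g k)) (P : forall i, env (M i) g -> R) :
  dp P -> dp (fun i (w : env (M i) h) => P i (fun k => tval w (sg k))).
Proof.
move=> dP e e0; have [p Hp] := dP e e0.
exists (@ftr R L L id (fun f J h ts => App ts) _ _ p _ _ sg) => i v.
rewrite (@fval_ftr R L L id _ (M i) (M i) (fun=> id))//.
by move=> s y; exists y.
Qed.

Lemma dp_inf_set (I J : finType) (g : I -> srt L) (h : J -> srt L)
    (X : forall i, set (env (M i) g)) (P : forall i, env (M i) (sum_ctx g h) -> R) :
  definable_set X -> dp P ->
  dp (fun i (w : env (M i) h) => inf [set P i (sum_env v w) | v in X i]).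
Proof.
move=> [_ dX] dP; apply: dp_lim => e e0; have [p Hp] := dP e e0.
have [_ di] := dX _ _ p; exists (fun i w => inf [set fval p (sum_env v w) | v in X i]) => //.
by move=> i w; apply: inf_dist => [|v _]; [exact: ltW|exact: Hp].
Qed.

Section Family.
Variables (I : finType) (g : I -> srt L) (s : srt L).

(** A sup over tuples is an iterated sup. Inhabitants and the bound [B] keep each partial sup away
    from the default value of [sup]. *)
Lemma dp_sup_ord n (P : forall i, env (M i) (sum_ctx (fun _ : 'I_n => s) g) -> R) (B : R) :
  (forall i, exists x : M i s, True) ->
  (forall i v, P i v <= B) -> dp P ->
  dp (fun i (w : env (M i) g) =>
    sup [set P i (sum_env v w) | v in [set: env (M i) (fun _ : 'I_n => s)]]).
Proof.
move=> inh; elim: n P => [|n IH] P PB dP.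
  have sg0 : forall k : 'I_0 + I, term g (sum_ctx (fun _ : 'I_0 => s) g k).
    by case=> [[]//|k]; exact: (Var g k).
  pose sg (k : 'I_0 + I) : term g (sum_ctx (fun _ : 'I_0 => s) g k) :=
    match k return term g (sum_ctx (fun _ : 'I_0 => s) g k) with
    | inl j => sg0 (inl j) | inr k => Var g k end.
  apply: dp_ext (dp_subst sg dP) => i w.
  have e (v : env (M i) (fun _ : 'I_0 => s)) : (fun k => tval w (sg k)) = sum_env v w.
    by apply: functional_extensionality_dep => -[[]|k].
  pose v0 : env (M i) (fun _ : 'I_0 => s) := fun j => match (notF (ltn_ord j)) with end.
  have -> : [set P i (sum_env v w) | v in [set: env (M i) (fun _ : 'I_0 => s)]] =
            [set P i (sum_env v0 w)].
    apply/seteqP; split=> [_ [v _ <-]|_ ->]; last by exists v0.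
    by rewrite /= -!e.
  by rewrite sup1 (e v0).
pose c1 : option ('I_n + I) -> srt L := ext_ctx (sum_ctx (fun _ : 'I_n => s) g) s.
pose sg (k : 'I_n.+1 + I) : term c1 (sum_ctx (fun _ : 'I_n.+1 => s) g k) :=
  match k return term c1 (sum_ctx (fun _ : 'I_n.+1 => s) g k) with
  | inl j => if unlift ord0 j is Some j' then Var c1 (Some (inl j')) else Var c1 None
  | inr k => Var c1 (Some (inr k)) end.
pose Q i (v : env (M i) (sum_ctx (fun _ : 'I_n => s) g)) :=
  sup [set P i (fun k => tval (ext_env v x) (sg k)) | x in [set: M i s]].
have dQ : dp Q := dp_sup (dp_subst sg dP).
have QB i v : Q i v <= B by apply: sup_img_le => //; have [x _] := inh i; exists x.
apply: dp_ext (IH Q QB dQ) => i w.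
have [x0 _] := inh i.
have e (v : env (M i) (fun _ : 'I_n => s)) x :
    (fun k => tval (ext_env (sum_env v w) x) (sg k)) =
    sum_env (fun j : 'I_n.+1 => if unlift ord0 j is Some j' then v j' else x) w.
  by apply: functional_extensionality_dep => -[j|k] //=; case: unlift.
apply/eqP; rewrite eq_le; apply/andP; split.
  apply: sup_img_le; first by exists (fun=> x0).
  move=> v _; apply: sup_img_le; first by exists x0.
  by move=> x _; rewrite e; apply: (@le_sup_img _ _ _ (fun v => P i (sum_env v w)) B).
apply: sup_img_le; first by exists (fun=> x0).
move=> v _; apply: le_trans (@le_sup_img _ _ _ _ B (fun j => v (lift ord0 j)) _ _) => //.
apply: le_trans (@le_sup_img _ _ _ _ B (v ord0) _ _) => //.
rewrite e le_eqVlt; apply/orP; left; apply/eqP; congr (P i (sum_env _ w)).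
by apply/funext => j; case: unliftP => [j'|] ->.
Qed.

Lemma dp_sup_fam (J : finType) (P : forall i, env (M i) (sum_ctx (fun _ : J => s) g) -> R)
    (B : R) :
  (forall i, exists x : M i s, True) ->
  (forall i v, P i v <= B) -> dp P ->
  dp (fun i (w : env (M i) g) =>
    sup [set P i (sum_env v w) | v in [set: env (M i) (fun _ : J => s)]]).
Proof.
move=> inh PB dP; pose c1 := sum_ctx (fun _ : 'I_#|J| => s) g.
pose sg (k : J + I) : term c1 (sum_ctx (fun _ : J => s) g k) :=
  match k return term c1 (sum_ctx (fun _ : J => s) g k) with
  | inl j => Var c1 (inl (enum_rank j)) | inr k => Var c1 (inr k) end.
have dQ := dp_subst sg dP.
apply: dp_ext (@dp_sup_ord #|J| _ B inh _ dQ) => // i w.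
congr sup; apply/seteqP; split=> [_ [v _ <-]|_ [v _ <-]].
  exists (fun j => v (enum_rank j)) => //; congr (P i _).
  by apply: functional_extensionality_dep => -[j|k].
exists (fun j => v (enum_val j)) => //; congr (P i _).
by apply: functional_extensionality_dep => -[j|k] //=; rewrite enum_rankK.
Qed.

Lemma dp_inf_fam (J : finType) (P : forall i, env (M i) (sum_ctx (fun _ : J => s) g) -> R)
    (B : R) :
  (forall i, exists x : M i s, True) ->
  (forall i v, B <= P i v) -> dp P ->
  dp (fun i (w : env (M i) g) =>
    inf [set P i (sum_env v w) | v in [set: env (M i) (fun _ : J => s)]]).
Proof.
move=> inh PB dP.
apply: dp_ext (dp_opp (@dp_sup_fam J _ (- B) inh _ (dp_opp dP))) => [i w|i v].
  by rewrite infE.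
by rewrite lerN2.
Qed.

End Family.

End Closure.

Lemma dp_translate (R : realType) (L L' : language) (Idx : Type) (M : Idx -> structure R L)
    (M' : Idx -> structure R L') (es : srt L -> srt L')
    (ef : forall (f : fsym L) (J : finType) (h : J -> srt L'),
      (forall k : arity f, term h (es (fdom k))) -> term h (es (fcod f)))
    (cm : forall i s, M' i (es s) -> M i s) (I J : finType) (g : I -> srt L) (h : J -> srt L')
    (sg : forall k, term h (es (g k))) (P : forall i, env (M i) g -> R) :
  (forall i s (x y : M' i (es s)), mdist (cm i s x) (cm i s y) = mdist x y) ->
  (forall i s (y : M i s), exists x : M' i (es s), cm i s x = y) ->
  (forall i f (J : finType) (h : J -> srt L')
    (ts : forall k : arity f, term h (es (fdom k))) (w : env (M' i) h),
    cm i _ (tval w (ef f J h ts)) = fint (fun k => cm i _ (tval w (ts k)))) ->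
  definable_predicate P ->
  definable_predicate (fun i (w : env (M' i) h) => P i (fun k => cm i _ (tval w (sg k)))).
Proof.
move=> h1 h2 h3 dP e e0; have [p Hp] := dP e e0.
exists (@ftr R L L' es ef _ _ p _ _ sg) => i v.
by rewrite (@fval_ftr R L L' es ef (M i) (M' i) (cm i)).
Qed.

Lemma heine_cantor_rV (R : realType) n (c : 'rV[R]_n -> R) (B e : R) : continuous c -> 0 < e ->
  exists2 d : R, 0 < d & forall x y : 'rV[R]_n, (forall j, `|x 0 j| <= B) ->
    (forall j, `|x 0 j - y 0 j| <= d) -> `|c x - c y| <= e.
Proof.
move=> cc e0; have e2 : 0 < e / 2 by rewrite divr_gt0.
pose K : set 'rV[R]_n := [set x | forall j, `[- B, B]%classic (x 0 j)].
have cK : compact K.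
  by apply: (@rV_compact R n (fun=> `[- B, B]%classic)) => j; exact: segment_compact.
move/compact_near_coveringP : cK => cK.
pose P (d : R) (x : 'rV[R]_n) := forall y : 'rV[R]_n,
  (forall j, `|x 0 j - y 0 j| <= d) -> `|c x - c y| <= e.
have : \forall d \near (0 : R)^'+, K `<=` P d.
  apply: cK => x Kx.
  have : nbhs x [set y | `|c x - c y| < e / 2].
    by apply: (cc x [set z | `|c x - z| < e / 2]); apply/nbhs_ballP; exists (e / 2).
  move=> /nbhs_ballP[r /= r0 rP].
  have r2 : 0 < r / 2 by rewrite divr_gt0.
  exists (ball x (r / 2), [set d : R | d < r / 2]) => /=.
    split; first exact: nbhsx_ballx.
    exact: nbhs_right_lt.
  move=> [x' d] /= [[_ xx'] dr] y x'y.
  have h1 : `|c x - c x'| < e / 2.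
    apply: rP; split=> // i j; apply: lt_trans (xx' i j) _.
    by rewrite gtr_pMr// invf_lt1// ltr1n.
  have h2 : `|c x - c y| < e / 2.
    apply: rP; split=> // i j; rewrite (ord1 i).
    have a1 : `|x 0 j - x' 0 j| < r / 2 := xx' 0 j.
    have a2 := x'y j; have a3 := ler_distD (x' 0 j) (x 0 j) (y 0 j).
    apply: (le_lt_trans a3); rewrite [ltRHS]splitr.
    apply: ltr_leD => //; exact: le_trans a2 (ltW dr).
  apply: le_trans (ler_distD (c x) _ _) _; rewrite (distrC (c x')) [leRHS]splitr.
  by apply: lerD; exact: ltW.
move=> H; have h0 : \forall d \near (0 : R)^'+, 0 < d by exact: nbhs_right_gt.
have [d [d0 dP]] : exists d : R, 0 < d /\ K `<=` P d.
  by have [d [h1 h2]] := @filter_ex _ _ (at_right_proper_filter (0 : R)) _ (filterI h0 H); exists d.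
exists d => // x y xB xy; apply: dP => // j /=.
by rewrite in_itv/= -ler_norml.
Qed.

Lemma common_delta (R : realType) (T : finType) (Q : T -> R -> Prop) :
  (forall k d d', d' <= d -> Q k d -> Q k d') -> (forall k, exists2 d, 0 < d & Q k d) ->
  exists2 d : R, 0 < d & forall k, Q k d.
Proof.
move=> mono h; have /choice[f Hf] : forall k, exists d, 0 < d /\ Q k d.
  by move=> k; have [d d0 Qd] := h k; exists d.
exists (\big[Num.min/1]_k f k).
  by elim/big_ind: _ => // [x y x0 y0|k _]; [rewrite lt_min x0|case: (Hf k)].
by move=> k; apply: mono (proj2 (Hf k)); exact: bigmin_le_cond.
Qed.

Section UniformContinuity.
Context (R : realType) (L : language) (Idx : Type) (M : Idx -> structure R L).

(** What a metric signature prescribes: bounded sorts and moduli of continuity of the symbols, here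
    common to the whole class. All definable predicates inherit a common modulus ([dp_uc]). *)
Definition uc_class :=
  (forall s, exists B : R, forall i (x y : M i s), mdist x y <= B) /\
  (forall (f : fsym L) (e : R), 0 < e -> exists2 d : R, 0 < d &
     forall i (v w : forall k : arity f, M i (fdom k)),
       (forall k, mdist (v k) (w k) <= d) -> mdist (fint v) (fint w) <= e).

Hypothesis ucM : uc_class.

Lemma uc_term (I : finType) (g : I -> srt L) s (t : term g s) (e : R) : 0 < e ->
  exists2 d : R, 0 < d & forall i (v w : env (M i) g),
    (forall k, mdist (v k) (w k) <= d) -> mdist (tval v t) (tval w t) <= e.
Proof.
elim: t e => [k|f ts IH] e e0; first by exists e.
have [d d0 Hd] := (proj2 ucM) f e e0.
have [d' d'0 H'] := @common_delta R (arity f)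
  (fun k r => forall i (v w : env (M i) g), (forall j, mdist (v j) (w j) <= r) ->
     mdist (tval v (ts k)) (tval w (ts k)) <= d)
  (fun k r r' rr h i v w vw => h i v w (fun j => le_trans (vw j) rr)) (fun k => IH k d d0).
by exists d' => // i v w vw /=; apply: Hd => k; exact: H'.
Qed.

Lemma uc_formula (I : finType) (g : I -> srt L) (p : formula R g) :
  (exists B : R, forall i (v : env (M i) g), `|fval p v| <= B) /\
  (forall e : R, 0 < e -> exists2 d : R, 0 < d & forall i (v w : env (M i) g),
    (forall k, mdist (v k) (w k) <= d) -> `|fval p v - fval p w| <= e).
Proof.
have ext_close (I' : finType) (g' : I' -> srt L) s i (v w : env (M i) g') (x : M i s) (d : R) :
    0 < d -> (forall k, mdist (v k) (w k) <= d) ->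
    forall k, mdist (ext_env v x k) (ext_env w x k) <= d.
  by move=> d0 vw [k|] //=; rewrite mdistxx ltW.
elim: p => {I g} [I g s t u|I g n c cc q IH|I g s q [[B HB] IH]|I g s q [[B HB] IH]].
- split; first by have [B HB] := proj1 ucM s; exists B => i v /=; rewrite ger0_norm ?mdist_ge0.
  move=> e e0; have e2 : 0 < e / 2 by rewrite divr_gt0.
  have [d1 d10 H1] := uc_term t e2; have [d2 d20 H2] := uc_term u e2.
  exists (Num.min d1 d2); first by rewrite lt_min d10.
  move=> i v w vw /=.
  have a1 : mdist (tval v t) (tval w t) <= e / 2.
    by apply: H1 => k; apply: le_trans (vw k) _; rewrite ge_min lexx.
  have a2 : mdist (tval v u) (tval w u) <= e / 2.
    by apply: H2 => k; apply: le_trans (vw k) _; rewrite ge_min lexx orbT.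
  have b1 := metric_triangle (tval v t) (tval w t) (tval v u).
  have b2 := metric_triangle (tval w t) (tval w u) (tval v u).
  have b3 := metric_triangle (tval w t) (tval v t) (tval w u).
  have b4 := metric_triangle (tval v t) (tval v u) (tval w u).
  rewrite (metric_sym (tval w u) (tval v u)) in b2.
  rewrite (metric_sym (tval w t) (tval v t)) in b3.
  by rewrite ler_distl; apply/andP; split; lra.
- have /choice[Bs HBs] : forall j, exists B : R, forall i (v : env (M i) g), `|fval (q j) v| <= B.
    by move=> j; case: (IH j).
  pose B := \big[Num.max/0]_j Bs j.
  have BB j : Bs j <= B by exact: le_bigmax.
  split.
    have [d d0 H] := heine_cantor_rV B (cc) (ltr01 (R := R)).
    have cK : compact [set x : 'rV[R]_n | forall j, `[- B, B]%classic (x 0 j)].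
      by apply: (@rV_compact R n (fun=> `[- B, B]%classic)) => j; exact: segment_compact.
    have := continuous_compact (continuous_subspaceT cc) cK.
    move=> /compact_bounded[N [Nr HN]]; exists (N + 1) => i v /=.
    have /= := HN (N + 1); apply; first by rewrite ltrDl.
    exists (\row_k fval (q k) v) => //= j; rewrite in_itv/= mxE -ler_norml.
    exact: le_trans (HBs _ _ _) (BB j).
  move=> e e0; have [d d0 H] := heine_cantor_rV B cc e0.
  have [d' d'0 H'] := @common_delta R _
   (fun k r => forall i (v w : env (M i) g), (forall j, mdist (v j) (w j) <= r) ->
     `|fval (q k) v - fval (q k) w| <= d)
   (fun k r r' rr h i v w vw => h i v w (fun j => le_trans (vw j) rr)) (fun k => proj2 (IH k) d d0).
  exists d' => // i v w vw /=; apply: H => j; rewrite !mxE; last exact: H'.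
  exact: le_trans (HBs _ _ _) (BB j).
- split.
    exists `|B| => i v /=.
    have [[x0 _]|nx] := pselect (exists x : M i s, True); last first.
      rewrite (_ : range (fun x => fval q (ext_env v x)) = set0) ?sup0 ?normr0//; apply/seteqP; split=> // z [x _ _].
      by exfalso; apply: nx; exists x.
    have hB x : - `|B| <= fval q (ext_env v x) <= `|B|.
      by rewrite -ler_norml; apply: le_trans (HB _ _) (ler_norm _).
    rewrite ler_norml; apply/andP; split; last first.
      by apply: sup_img_le; [exists x0|move=> x _; case/andP: (hB x)].
    have /andP[h1 _] := hB x0; apply: le_trans h1 _.
    by apply: (@le_sup_img _ _ _ (fun x => fval q (ext_env v x)) `|B|) => // x _; case/andP: (hB x).
  move=> e e0; have [d d0 H] := IH e e0; exists d => // i v w vw /=.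
  by apply: sup_dist => [|x _]; [exact: ltW|apply: H; exact: ext_close].
- split.
    exists `|B| => i v /=.
    have [[x0 _]|nx] := pselect (exists x : M i s, True); last first.
      rewrite (_ : range (fun x => fval q (ext_env v x)) = set0) ?inf0 ?normr0//; apply/seteqP; split=> // z [x _ _].
      by exfalso; apply: nx; exists x.
    have hB x : - `|B| <= fval q (ext_env v x) <= `|B|.
      by rewrite -ler_norml; apply: le_trans (HB _ _) (ler_norm _).
    rewrite ler_norml; apply/andP; split.
      by apply: le_inf_img; [exists x0|move=> x _; case/andP: (hB x)].
    have /andP[_ h1] := hB x0; apply: le_trans h1.
    by apply: (@inf_img_le _ _ _ (fun x => fval q (ext_env v x)) (- `|B|)) => // x _; case/andP: (hB x).
  move=> e e0; have [d d0 H] := IH e e0; exists d => // i v w vw /=.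
  by apply: inf_dist => [|x _]; [exact: ltW|apply: H; exact: ext_close].
Qed.

Lemma dp_uc (I : finType) (g : I -> srt L) (P : forall i, env (M i) g -> R) :
  definable_predicate P -> forall e : R, 0 < e -> exists2 d : R, 0 < d &
  forall i (v w : env (M i) g), (forall k, mdist (v k) (w k) <= d) -> `|P i v - P i w| <= e.
Proof.
move=> dP e e0; have e3 : 0 < e / 3 by rewrite divr_gt0.
have [p Hp] := dP _ e3; have [_ /(_ _ e3)[d d0 H]] := uc_formula p.
exists d => // i v w vw; have := H i v w vw; have := Hp i v; have := Hp i w.
by rewrite !ler_norml => /andP[? ?] /andP[? ?] /andP[? ?]; apply/andP; split; lra.
Qed.

(* sup over the zero set of D is the limit of the penalised sups of p - K D. *)
Lemma definable_zero_set (J : finType) (s : srt L)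
    (D : forall i, env (M i) (fun _ : J => s) -> R) :
  definable_predicate D -> (forall i v, 0 <= D i v) ->
  (forall i, exists v, D i v = 0) ->
  (forall e : R, 0 < e -> exists2 d : R, 0 < d & forall i (v : env (M i) (fun _ : J => s)),
     D i v <= d -> exists u, D i u = 0 /\ forall k, mdist (v k) (u k) <= e) ->
  (forall i, exists x : M i s, True) ->
  definable_set (fun i => [set v | D i v = 0]).
Proof.
move=> dD D0 Dne stab inh; have ucD := dp_uc dD.
split.
  move=> i v cv /=; apply/eqP; rewrite eq_le D0 andbT; apply/ler_addgt0Pl => e e0.
  rewrite addr0; have [d d0 H] := ucD e e0.
  have [|u [/= u0 uv]] := cv [set u | forall k, mdist (v k) (u k) < d].
    have FF : Filter (nbhs (v : prod_topology (fun k : J => M i s))) := nbhs_filter _.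
    apply: (@filter_forall _ _ (fun k (u : prod_topology (fun k : J => M i s)) =>
       mdist (v k) (u k) < d) _ FF) => k.
    have nd : nbhs (v k) [set y : M i s | mdist (v k) y < d].
      by apply/nbhs_ballP; exists d => // y; rewrite ballEmdist.
    exact: (@proj_continuous J (fun k => M i s) k v _ nd).
  have := H i v u (fun k => ltW (uv k)); rewrite u0 subr0.
  by move=> /(le_trans (ler_norm _)).
suff main : forall (J0 : finType) (h : J0 -> srt L) (P : forall i, env (M i) (sum_ctx (fun _ : J => s) h) -> R),
    definable_predicate P -> (exists B : R, forall i v, `|P i v| <= B) ->
   definable_predicate (fun i (w : env (M i) h) =>
     sup [set P i (sum_env v w) | v in [set v | D i v = 0]]).
  move=> J0 h p; have [[B HB] _] := uc_formula p; split.
    exact: (main J0 h (fun i v => fval p v) (dp_formula M p) (ex_intro _ B HB)).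
  have := main J0 h (fun i v => - fval p v) (dp_opp (dp_formula M p)).
  have HN : exists B0 : R, forall i (v : env (M i) (sum_ctx (fun _ : J => s) h)),
      `|- fval p v| <= B0 by exists B => i v; rewrite normrN.
  by move=> /(_ HN) dN; apply: dp_ext (dp_opp dN) => i w; rewrite infE.
move=> J0 h P dP [B HB]; apply: dp_lim => e e0.
have e2 : 0 < e / 2 by rewrite divr_gt0.
have [d d0 Hd] := dp_uc dP e2; have [d1 d10 H1] := stab d d0.
have B0 : 0 <= `|B| by [].
have BP i v : - `|B| <= P i v <= `|B|.
  by rewrite -ler_norml; apply: le_trans (HB _ _) (ler_norm _).
(* Where [D] exceeds [d1] the penalty is at least [2 |B|], so the penalised value is at most [- |B|]
   and cannot exceed the value at a zero of [D]. *)
pose K : R := 2 * `|B| / d1.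
have K0 : 0 <= K by rewrite divr_ge0 ?mulr_ge0// ltW.
exists (fun i w => sup [set P i (sum_env v w) - K * D i v | v in [set: env (M i) (fun _ : J => s)]]).
  apply: (@dp_sup_fam R L Idx M J0 h s J (fun i v => P i v - K * D i (fun k => v (inl k))) `|B|) => //.
    move=> i v; have /andP[_ h2] := BP i v; have := D0 i (fun k => v (inl k)); nra.
  apply: dp_sub => //; apply: dp_scale.
  exact: (@dp_subst R L Idx M J (J + J0)%type (fun=> s) (sum_ctx (fun=> s) h)
    (fun k => Var (sum_ctx (fun _ : J => s) h) (inl k)) D dD).
move=> i w; have [v0 Dv0] := Dne i; rewrite ler_distl; apply/andP; split; last first.
  apply: sup_img_le; first by exists v0.
  move=> v _; have [Dd|Dd] := leP (D i v) d1; last first.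
    have h1 : 2 * `|B| <= K * D i v.
      by rewrite /K mulrAC -mulrA ler_peMr ?mulr_ge0// ler_pdivlMr// mul1r ltW.
    have /andP[h2 _] := BP i (sum_env v0 w); have /andP[_ h3] := BP i (sum_env v w).
    have h4 := @le_sup_img _ _ [set v | D i v = 0] (fun v => P i (sum_env v w)) `|B| v0
      (fun v _ => proj2 (andP (BP i (sum_env v w)))) Dv0.
    by move: h4 => /=; lra.
  have [u [Du vu]] := H1 i v Dd.
  have h4 := @le_sup_img _ _ [set v | D i v = 0] (fun v => P i (sum_env v w)) `|B| u
      (fun v _ => proj2 (andP (BP i (sum_env v w)))) Du.
  have : `|P i (sum_env v w) - P i (sum_env u w)| <= e / 2.
    by apply: Hd => -[k|k] //=; rewrite mdistxx ltW.
  rewrite ler_distl => /andP[_ h5]; have := mulr_ge0 K0 (D0 i v); move: h4 => /=; lra.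
apply: (@le_trans _ _ (sup [set P i (sum_env v w) | v in [set v | D i v = 0]])).
  by rewrite lerBlDr lerDl ltW.
apply: sup_img_le; first by exists v0.
move=> v /= Dv.
have h4 := @le_sup_img _ _ [set: env (M i) (fun _ : J => s)]
  (fun v => P i (sum_env v w) - K * D i v) `|B| v; rewrite Dv mulr0 subr0 in h4.
apply: h4 => // u _; have /andP[_ h2] := BP i (sum_env u w).
by have := mulr_ge0 K0 (D0 i u); lra.
Qed.

End UniformContinuity.

(** * Definability in C*-algebras *)

(** [w] is the polar part and [u = w p]; then [p - 1 = (1 + p)^-1 (p^2 - 1)] with [(1 + p)^-1] of
    norm at most 1, so no constant is lost. *)
Lemma near_unitary (R : realType) (C : cstarAlg R) (u : C) (d : R) : d <= 1 / 2 ->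
  nrm (star u * u - 1) <= d -> nrm (u * star u - 1) <= d ->
  exists2 w, unitary_elt w & nrm (u - w) <= d.
Proof.
move=> d2 h1 h2.
have n1 : nrm (1 - star u * u) <= 1 / 2 by rewrite nrmBC; lra.
have n2 : nrm (1 - u * star u) <= 1 / 2 by rewrite nrmBC; lra.
have [k [k1 _ _]] := half_inv n1; have [l [_ l2 _]] := half_inv n2.
have iu : invertible (A := C) u.
  exists (star u * l); split; first by rewrite mulrA.
  have -> : star u * l = k * star u.
    by rewrite -[LHS]mul1r -k1 -!mulrA (mulrA u) l2 mulr1.
  by rewrite -mulrA.
have [[w1 w2] pw] := polarP iu; set w := polar u in w1 w2 pw.
pose p := star w * u.
have up : u = w * p by rewrite /p mulrA w2 mul1r.
have [ps _] := pw.
have pp : p * p = star u * u by rewrite /p -{1}ps starM starK -mulrA (mulrA w) w2 mul1r.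
have one0 : 0 < (1 : R) by [].
have [g [_ g1 g2 gn _]] := pos_inv one0 pw; rewrite rc1 in g1; rewrite invr1 in gn.
have e : p - 1 = g * (p * p - 1).
  have -> : p * p - 1 = (1 + p) * (p - 1) by ncring.
  by rewrite mulrA g1 mul1r.
exists w => //.
have -> : u - w = w * (p - 1) by rewrite mulrBr mulr1 -up.
apply: le_trans (nrmM _ _) _; have wn := nrm_unitary (conj w1 w2).
have pn : nrm (p - 1) <= d.
  rewrite e pp; apply: le_trans (nrmM _ _) _; have := nrm_ge0 g; have := nrm_ge0 (star u * u - 1); nra.
by have := nrm_ge0 w; have := nrm_ge0 (p - 1); nra.
Qed.

Section MaxEntry.
Context (R : realType) (A : cstarAlg R).

(** Used in formulas in place of [mn]: a maximum of norms of entries is visibly a formula in the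
    entries. *)
Definition ment m n (T : 'M[A]_(m, n)) : R :=
  \big[Num.max/0]_(k : 'I_m * 'I_n) nrm (T k.1 k.2).

Lemma ment_ge0 m n (T : 'M[A]_(m, n)) : 0 <= ment T.
Proof. exact: bigmax_ge_id. Qed.

Lemma le_ment m n (T : 'M[A]_(m, n)) i j : nrm (T i j) <= ment T.
Proof. exact: (@le_bigmax _ _ _ 0 (fun k => nrm (T k.1 k.2)) (i, j)). Qed.

Lemma ment_le m n (T : 'M[A]_(m, n)) c : 0 <= c -> (forall i j, nrm (T i j) <= c) ->
  ment T <= c.
Proof. by move=> c0 h; apply: bigmax_le => // -[i j] _. Qed.

Lemma ment_mn m n (T : 'M[A]_(m, n)) : ment T <= mn T.
Proof. by apply: ment_le => [|i j]; [exact: mn_ge0|exact: mn_entry]. Qed.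

Lemma mn_ment m n (T : 'M[A]_(m, n)) : mn T <= (m * n)%:R * ment T.
Proof. by apply: mn_le_entries => i j; exact: le_ment. Qed.

Lemma ment0_eq0 m n (T : 'M[A]_(m, n)) : ment T = 0 -> T = 0.
Proof.
move=> T0; apply/matrixP => i j; rewrite mxE; apply: nrm0_eq0.
by apply/eqP; rewrite eq_le nrm_ge0 -T0 le_ment.
Qed.

Lemma ment0 m n : ment (0 : 'M[A]_(m, n)) = 0.
Proof.
apply/eqP; rewrite eq_le ment_ge0 andbT; apply: ment_le => // i j.
by rewrite mxE nrm0.
Qed.

End MaxEntry.

Section CstarTerms.
Context (R : realType) (Idx : Type) (C : Idx -> cstarAlg R).
Local Notation M := (fun i => cstar_str (C i)).
Local Notation dp := (@definable_predicate R (cstar_lang R) Idx M _ _).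

Lemma cball_inh i s : exists x : cstar_str (C i) s, True.
Proof. by exists (mk_cball (A := C i) (n := s) (a := 0) (ball_incl (leq0n s) (mk_cball (ball_zero (C i))))). Qed.

(** One term evaluates to [F] throughout the class. The radius [n] of its target ball is left
    existential, so that sums and products need no bookkeeping of sorts. *)
Definition rep (I : finType) (g : I -> srt (cstar_lang R))
    (F : forall i, env (M i) g -> C i) :=
  exists n (t : term g (n : srt (cstar_lang R))),
    forall i (v : env (M i) g), sval (tval v t) = F i v.

Section Closure.
Variables (I : finType) (g : I -> srt (cstar_lang R)).
Implicit Types F G : forall i, env (M i) g -> C i.

Lemma rep_ext F G : (forall i v, F i v = G i v) -> rep F -> rep G.
Proof. by move=> FG [n [t h]]; exists n, t => i v; rewrite h. Qed.

Lemma rep_var k : rep (fun i (v : env (M i) g) => sval (v k)).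
Proof. by exists (g k), (Var g k). Qed.

Lemma rep_add F G : rep F -> rep G -> rep (fun i v => F i v + G i v).
Proof.
move=> [m [t ht]] [n [u hu]]; exists (m + n)%N.
exists (App (f := OpAdd R m n : fsym (cstar_lang R)) (fun k : bool =>
  match k return term g (if k then m else n : srt (cstar_lang R)) with
  | true => t | false => u end)).
by move=> i v /=; rewrite ht hu.
Qed.

Lemma rep_mul F G : rep F -> rep G -> rep (fun i v => F i v * G i v).
Proof.
move=> [m [t ht]] [n [u hu]]; exists (m * n)%N.
exists (App (f := OpMul R m n : fsym (cstar_lang R)) (fun k : bool =>
  match k return term g (if k then m else n : srt (cstar_lang R)) with
  | true => t | false => u end)).
by move=> i v /=; rewrite ht hu.
Qed.

Lemma rep_star F : rep F -> rep (fun i v => star (F i v)).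
Proof.
move=> [n [t ht]]; exists n.
exists (App (f := OpStar R n : fsym (cstar_lang R)) (fun _ : unit => t)).
by move=> i v /=; rewrite ht.
Qed.

Lemma rep_zero : rep (fun i (v : env (M i) g) => 0).
Proof.
exists 0%N; exists (App (f := OpZero R : fsym (cstar_lang R))
  (fun k : void => match k with end)) => //.
Qed.

Lemma rep_one : rep (fun i (v : env (M i) g) => 1).
Proof.
exists 1%N; exists (App (f := OpOne R : fsym (cstar_lang R))
  (fun k : void => match k with end)) => //.
Qed.

Lemma rep_sum (T : Type) (r : seq T) (F : T -> forall i, env (M i) g -> C i) :
  (forall k, rep (F k)) -> rep (fun i v => \sum_(k <- r) F k i v).
Proof.
move=> rF; elim: r => [|k r IH].
  by apply: rep_ext rep_zero => i v; rewrite big_nil.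
by apply: rep_ext (rep_add (rF k) IH) => i v; rewrite big_cons.
Qed.

Lemma rep_incl n m (t : term g (n : srt (cstar_lang R))) : (n <= m)%N ->
  exists u : term g (m : srt (cstar_lang R)), forall i (v : env (M i) g),
    sval (tval v u) = sval (tval v t).
Proof.
by move=> nm; exists (App (f := OpIncl R nm : fsym (cstar_lang R)) (fun _ : unit => t)).
Qed.

Lemma dp_nrm F G : rep F -> rep G -> dp (fun i v => nrm (F i v - G i v)).
Proof.
move=> [m [t ht]] [n [u hu]].
have [t' ht'] := rep_incl t (leq_maxl m n); have [u' hu'] := rep_incl u (leq_maxr m n).
apply: dp_ext (dp_dist (fun i => cstar_str (C i)) t' u') => i v.
by rewrite -ht -hu -ht' -hu'.
Qed.

Definition repmx p q (F : forall i, env (M i) g -> 'M[C i]_(p, q)) :=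
  forall a b, rep (fun i v => F i v a b).

Lemma repmx_mul p q r (F : forall i, env (M i) g -> 'M[C i]_(p, q))
    (G : forall i, env (M i) g -> 'M[C i]_(q, r)) :
  repmx F -> repmx G -> repmx (fun i v => F i v *m G i v).
Proof.
move=> rF rG a b.
apply: rep_ext (rep_sum (index_enum _) (fun k => rep_mul (rF a k) (rG k b))) => i v.
by rewrite mxE.
Qed.

Lemma repmx_adj p q (F : forall i, env (M i) g -> 'M[C i]_(p, q)) :
  repmx F -> repmx (fun i v => adjmx (F i v)).
Proof. by move=> rF a b; apply: rep_ext (rep_star (rF b a)) => i v; rewrite adjmxE. Qed.

Lemma repmx1 n : repmx (fun i (v : env (M i) g) => 1%:M : 'M[C i]_n).
Proof.
move=> a b; apply: (@rep_ext (fun i v => if a == b then 1 else 0)) => [i v|].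
  by rewrite mxE; case: eqP.
by case: eqP => _; [exact: rep_one|exact: rep_zero].
Qed.

Lemma dp_ment p q (F G : forall i, env (M i) g -> 'M[C i]_(p, q)) :
  repmx F -> repmx G -> dp (fun i v => ment (F i v - G i v)).
Proof.
move=> rF rG.
apply: dp_ext (dp_bigmax (index_enum _) (fun k : 'I_p * 'I_q => dp_nrm (rF k.1 k.2) (rG k.1 k.2))).
by move=> i v; apply: eq_bigr => k _; rewrite !mxE.
Qed.

End Closure.

Lemma cstar_uc : uc_class M.
Proof.
split=> [s|f e e0].
  exists (2 * s%:R) => i x y; apply: le_trans (nrmD _ _) _; rewrite nrmN.
  have h (z : cball (C i) s) : nrm (sval z) <= s%:R.
    by rewrite -lecR -nrmE rmorph_nat; exact: (svalP z).
  by have := h x; have := h y; lra.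
have h i s (z : cball (C i) s) : nrm (sval z) <= s%:R.
  by rewrite -lecR -nrmE rmorph_nat; exact: (svalP z).
case: f => [m n|m n|n|k m n kmn| | |m n mn].
- exists (e / 2) => [|i v w vw]; first by rewrite divr_gt0.
  have := vw true; have := vw false => /= h1 h2.
  have -> : mdist (fint (s := cstar_str (C i)) (f := OpAdd R m n : fsym (cstar_lang R)) v) (fint w) =
    nrm (sval (v true) + sval (v false) - (sval (w true) + sval (w false))) by [].
  rewrite opprD addrACA; apply: le_trans (nrmD _ _) _.
  have {}h1 : nrm (sval (v false) - sval (w false)) <= e / 2 := h1.
  have {}h2 : nrm (sval (v true) - sval (w true)) <= e / 2 := h2.
  lra.
- have mn0 : 0 < (m + n)%:R + 1 :> R by rewrite ltr_wpDl.
  exists (e / ((m + n)%:R + 1)) => [|i v w vw]; first by rewrite divr_gt0.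
  have h1 : nrm (sval (v false) - sval (w false)) <= e / ((m + n)%:R + 1) := vw false.
  have h2 : nrm (sval (v true) - sval (w true)) <= e / ((m + n)%:R + 1) := vw true.
  have -> : mdist (fint (s := cstar_str (C i)) (f := OpMul R m n : fsym (cstar_lang R)) v) (fint w) =
    nrm (sval (v true) * sval (v false) - sval (w true) * sval (w false)) by [].
  have a1 : nrm (sval (v false)) <= n%:R := h i n (v false).
  have a2 : nrm (sval (w true)) <= m%:R := h i m (w true).
  set x := sval (v true) in h2 *; set y := sval (v false) in h1 a1 *.
  set x' := sval (w true) in h2 a2 *; set y' := sval (w false) in h1 *.
  have -> : x * y - x' * y' = (x - x') * y + x' * (y - y') by ncring.
  apply: le_trans (nrmD _ _) _.
  apply: (@le_trans _ _ (e / ((m + n)%:R + 1) * n%:R + m%:R * (e / ((m + n)%:R + 1)))).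
    by apply: lerD; apply: le_trans (nrmM _ _) _; apply: ler_pM; rewrite ?nrm_ge0.
  rewrite mulrC -mulrDl -natrD addnC mulrA ler_pdivrMr// mulrC.
  apply: ler_wpM2l; first exact: ltW.
  by rewrite lerDl.
- exists e => // i v w vw.
  have -> : mdist (fint (s := cstar_str (C i)) (f := OpStar R n : fsym (cstar_lang R)) v) (fint w) =
    nrm (star (sval (v tt)) - star (sval (w tt))) by [].
  by rewrite -starB nrm_star; exact: (vw tt).
- have k0 : 0 < complex.Re `|k| + 1.
    by apply: ltr_wpDl => //; case: (k) => a b; rewrite normc_def /= sqrtr_ge0.
  exists (e / (complex.Re `|k| + 1)) => [|i v w vw]; first by rewrite divr_gt0.
  have -> : mdist (fint (s := cstar_str (C i)) (f := OpScale kmn : fsym (cstar_lang R)) v) (fint w) =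
    nrm (k *: sval (v tt) - k *: sval (w tt)) by [].
  rewrite -scalerBr; have -> (a : C i) : nrm (k *: a) = complex.Re `|k| * nrm a.
    by rewrite {1}/nrm normrZ -{1}(RRe_real (normr_real k)) nrmE -rmorphM.
  have h1 : nrm (sval (v tt) - sval (w tt)) <= e / (complex.Re `|k| + 1) := vw tt.
  rewrite ler_pdivlMr// in h1; apply: le_trans h1.
  by rewrite mulrC ler_wpM2l ?nrm_ge0// lerDl.
- by exists 1 => // i v w vw; rewrite (_ : mdist _ _ = nrm ((0 : C i) - 0))// subrr nrm0 ltW.
- by exists 1 => // i v w vw; rewrite (_ : mdist _ _ = nrm ((1 : C i) - 1))// subrr nrm0 ltW.
- by exists e => // i v w vw; exact: (vw tt).
Qed.

End CstarTerms.

(** * Completion of a quotient as a space of functions *)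

Section FunctionCompletion.
Context (R : realType) (X T : Type) (phi : X -> T -> R) (B : R) (t0 : T).
Hypothesis phiB : forall x t, `|phi x t| <= B.

(** The uniform closure of the functions [phi x], hence the completion of the quotient of [X] by the
    sup pseudometric. *)
Definition fun_closure :=
  {f : T -> R | forall e : R, 0 < e -> exists x, forall t, `|f t - phi x t| <= e}.
Definition fun_dist (f g : fun_closure) : R :=
  sup [set `|sval f t - sval g t| | t in [set: T]].
Implicit Types f g : fun_closure.

Let bound f t : `|sval f t| <= B + 1.
Proof.
have [x Hx] := svalP f 1 ltr01; have := Hx t; have := phiB x t.
by have := ler_normD (sval f t - phi x t) (phi x t); rewrite subrK; lra.
Qed.

Let bound2 f g t : `|sval f t - sval g t| <= 2 * (B + 1).
Proof.
have := ler_normB (sval f t) (sval g t); have := bound f t; have := bound g t; lra.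
Qed.

Let le_dist f g t : `|sval f t - sval g t| <= fun_dist f g.
Proof.
by apply: (@le_sup_img R T [set: T] (fun t => `|sval f t - sval g t|) (2 * (B + 1))) => // s _.
Qed.

Let dist_le f g c : (forall t, `|sval f t - sval g t| <= c) -> fun_dist f g <= c.
Proof. by move=> h; apply: sup_img_le => [|t _]; [exists t0|exact: h]. Qed.

Lemma fun_distxx f : fun_dist f f = 0.
Proof.
apply/eqP; rewrite eq_le dist_le ?(le_trans _ (le_dist f f t0))//= => t.
by rewrite subrr normr0.
Qed.

Lemma fun_dist_pos f g : fun_dist f g = 0 -> f = g.
Proof.
case: f g => [f Hf] [g Hg] d0; apply: eq_exist; apply/funext => t; apply/eqP.
by rewrite -subr_eq0 -normr_le0 -d0; exact: (le_dist (exist _ f Hf) (exist _ g Hg)).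
Qed.

Lemma fun_dist_sym f g : fun_dist f g = fun_dist g f.
Proof. by apply/eqP; rewrite eq_le !dist_le// => t; rewrite distrC. Qed.

Lemma fun_dist_tri g f h : fun_dist f h <= fun_dist f g + fun_dist g h.
Proof.
apply: dist_le => t; apply: le_trans (ler_distD (sval g t) _ _) _.
by apply: lerD.
Qed.

(** The dummy [let]s keep [t0] and [phiB] among the parameters of the type, as the metric axioms
    depend on them. *)
Definition fun_completion : Type := let _ := t0 in let _ := phiB in fun_closure.
HB.instance Definition _ := gen_eqMixin fun_completion.
HB.instance Definition _ := gen_choiceMixin fun_completion.
HB.instance Definition _ := isMetric.Build R fun_completion
  fun_distxx fun_dist_pos fun_dist_sym fun_dist_tri.

Lemma fun_pi_subproof x (e : R) : 0 < e -> exists x', forall t, `|phi x t - phi x' t| <= e.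
Proof. by move=> e0; exists x => t; rewrite subrr normr0 ltW. Qed.

Definition fun_pi (x : X) : fun_completion := exist _ (phi x) (fun_pi_subproof x).

Lemma fun_completed : completed_quotient
  (fun x y => sup [set `|phi x t - phi y t| | t in [set: T]]) fun_pi.
Proof.
split=> //.
  move=> O [q Oq] oO.
  have /nbhs_ballP[e /= e0 eO] : nbhs q O by exact: open_nbhs_nbhs.
  have e2 : 0 < e / 2 by rewrite divr_gt0.
  have [x Hx] := svalP q _ e2; exists (fun_pi x); split; last by exists x.
  apply: eO; rewrite ballEmdist /=; apply: (@le_lt_trans _ _ (e / 2)).
    exact: dist_le.
  by rewrite gtr_pMr// invf_lt1// ltr1n.
move=> F PF cF.
have ce (e : R) : 0 < e -> exists q : fun_completion, F [set r | fun_dist q r < e].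
  move=> e0; have [q Fq] := proj1 (cauchyP F) cF e e0.
  by exists q; move: Fq; rewrite /= /fmap/= ballEmdist.
have evc t : cvg ((fun q : fun_completion => sval q t) @ F).
  apply/cauchy_cvgP/cauchyP => e e0; have [q Fq] := ce e e0.
  exists (sval q t); rewrite /fmap /=; apply: filterS Fq => r /= qr.
  by rewrite /ball/=; apply: le_lt_trans qr; exact: le_dist.
pose f t : R := lim ((fun q : fun_completion => sval q t) @ F).
have fq (e : R) (q : fun_completion) : F [set r | fun_dist q r < e] ->
    forall t, `|sval q t - f t| <= e.
  move=> Fq t; apply: (@closed_cvg _ _ F _ (fun q : fun_completion => sval q t)
    [set z : R | `|sval q t - z| <= e]).
  - have -> : [set z : R | `|sval q t - z| <= e] = closed_ball_ Num.norm (sval q t) e by [].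
    exact: closed_closed_ball_.
  - by apply: filterS Fq => r /= qr; apply: ltW; apply: le_lt_trans qr; exact: le_dist.
  - exact: evc.
have fK (e : R) : 0 < e -> exists x, forall t, `|f t - phi x t| <= e.
  move=> e0; have e2 : 0 < e / 2 by rewrite divr_gt0.
  have [q /fq Fq] := ce _ e2; have [x Hx] := svalP q _ e2.
  exists x => t; apply: le_trans (ler_distD (sval q t) _ _) _.
  by rewrite [leRHS]splitr distrC; apply: lerD.
exists (exist _ f fK : fun_completion) => A /nbhs_ballP[e /= e0 eA].
have e2 : 0 < e / 2 by rewrite divr_gt0.
have [q Fq] := ce _ e2; apply: filterS (Fq) => r /= qr; apply: eA; rewrite ballEmdist /=.
apply: (@le_lt_trans _ _ (fun_dist (exist _ f fK) q + fun_dist q r)).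
  exact: fun_dist_tri.
rewrite [ltRHS]splitr; apply: ler_ltD => //; apply: dist_le => t /=.
by rewrite distrC; exact: fq.
Qed.

End FunctionCompletion.

(** * Definable predicates of the base sorts inside imaginary languages *)

Section SortEmbedding.
Context (R : realType) (L0 : language) (Idx : Type) (M0 : Idx -> structure R L0).
Local Notation base b := (existT (fun S => isort M0 S) _ (ISbase M0 b)).
Variable (T : imsort M0 -> Prop).

(* The sorts of sublang T carry opaque membership proofs, whence the casts. *)
Definition term_irr (J : finType) (h : J -> srt (sublang T)) (x : imsort M0) (p p' : T x)
    (t : term h (exist T x p : srt (sublang T))) : term h (exist T x p' : srt (sublang T)) :=
  eq_rect _ (fun s : srt (sublang T) => term h s) t _
    (f_equal (exist T x) (Prop_irrelevance p p')).

Lemma tval_irr (J : finType) (h : J -> srt (sublang T)) (x : imsort M0) (p p' : T x)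
    (t : term h (exist T x p : srt (sublang T))) i (w : env (substr T i) h) :
  tval w (term_irr p' t) = tval w t :> imcar x i.
Proof.
rewrite /term_irr; move: (f_equal _ _) => e.
have pp : p = p' by exact: Prop_irrelevance.
by subst p'; rewrite (Prop_irrelevance e erefl).
Qed.

Definition app_im (f : imsym M0) (hd : forall k, T (im_dom (f := f) k)) (hc : T (im_cod f))
    (J : finType) (h : J -> srt (sublang T))
    (ts : forall k, term h (exist T (im_dom k) (hd k) : srt (sublang T))) :
    term h (exist T (im_cod f) hc : srt (sublang T)) :=
  let f' : fsym (sublang T) := exist _ f (conj hd hc) in
  term_irr hc (App (f := f') (fun k => term_irr (proj1 (svalP f') k) (ts k))).

Lemma tval_app_im (f : imsym M0) (hd : forall k, T (im_dom (f := f) k)) (hc : T (im_cod f))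
    (J : finType) (h : J -> srt (sublang T))
    (ts : forall k, term h (exist T (im_dom k) (hd k) : srt (sublang T)))
    i (w : env (substr T i) h) :
  tval w (app_im hc ts) = im_int (fun k => tval w (ts k) : imcar (im_dom k) i) :> imcar (im_cod f) i.
Proof.
rewrite tval_irr /=; congr im_int; apply: functional_extensionality_dep => k.
exact: tval_irr.
Qed.

Hypothesis HB : forall b, T (base b).

Definition bsort (b : srt L0) : srt (sublang T) := exist T (base b) (HB b).

Definition bsym (f : fsym L0) (J : finType) (h : J -> srt (sublang T))
    (ts : forall k : arity f, term h (bsort (fdom k))) : term h (bsort (fcod f)) :=
  @app_im (IMbase M0 f) (fun k => HB (fdom k)) (HB (fcod f)) J h ts.

Lemma dp_base (I J : finType) (g : I -> srt L0) (h : J -> srt (sublang T))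
    (sg : forall k, term h (bsort (g k))) (P : forall i, env (M0 i) g -> R) :
  definable_predicate P ->
  definable_predicate (fun i (w : env (substr T i) h) =>
    P i (fun k => tval w (sg k) : M0 i (g k))).
Proof.
move=> dP; apply: (@dp_translate R L0 (sublang T) Idx M0 (substr T) bsort bsym
  (fun i s x => x) I J g h sg P) => //.
  by move=> i s y; exists y.
move=> i f K h' ts w.
exact: (@tval_app_im (IMbase M0 f) (fun k => HB (fdom k)) (HB (fcod f)) K h' ts i w).
Qed.

End SortEmbedding.

Section BaseSorts.
Context (R : realType) (L0 : language) (Idx : Type) (M0 : Idx -> structure R L0).

Definition base_sorts (s : imsort M0) := exists b, s = existT _ _ (ISbase M0 b).

Definition base_sortsE b : base_sorts (existT _ _ (ISbase M0 b)) := ex_intro _ b erefl.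

(** Tells the constructors apart, to exclude that a product, subset or quotient sort equals a base
    sort. *)
Let sort_tag (s : imsort M0) : nat :=
  match projT2 s with
  | ISbase _ => 0 | ISprod _ _ => 1 | ISsub _ _ _ _ => 2 | ISquot _ _ _ _ _ => 3
  end.

Lemma base_uc : uc_class M0 -> uc_class (substr base_sorts).
Proof.
move=> [uc1 uc2]; split.
  by move=> [s [b eb]]; subst s; exact: uc1.
move=> [f [fd fc]] e e0; case: f fd fc => [f|S c n|I S c X k|I S c Q pi] fd fc.
- have [d d0 H] := uc2 f e e0; exists d => // i v w vw; exact: H.
- by exfalso; have [b] := fd tt => /(congr1 sort_tag).
- by exfalso; have [b] := fd tt => /(congr1 sort_tag).
- by exfalso; have [b] := fc => /(congr1 sort_tag).
Qed.

End BaseSorts.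

(** * The unitary group of M_n as a zero set *)

Section UnitarySet.
Context (R : realType) (n : nat).
Local Notation N2 := ('I_n * 'I_n)%type.

Definition mxv (C : cstarAlg R) (v : env (cstar_str C) (fun _ : N2 => 1%N)) : 'M[C]_n :=
  \matrix_(a, b) sval (v (a, b)).

Definition udef (C : cstarAlg R) (u : 'M[C]_n) : R :=
  Num.max (ment (adjmx u *m u - 1%:M)) (ment (u *m adjmx u - 1%:M)).

Lemma udef_ge0 (C : cstarAlg R) (u : 'M[C]_n) : 0 <= udef u.
Proof. by rewrite le_max ment_ge0. Qed.

Lemma udefP (C : cstarAlg R) (u : 'M[C]_n) : udef u = 0 <-> is_unitarymx u.
Proof.
split=> [u0|/andP[/eqP h1 /eqP h2]]; last by rewrite /udef h1 h2 !subrr !ment0 maxxx.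
have le0 (r s : R) : 0 <= r -> 0 <= s -> Num.max r s = 0 -> r = 0 /\ s = 0.
  move=> r0 s0 /eqP; rewrite eq_le ge_max => /andP[/andP[r1 s1] _].
  by split; apply/eqP; rewrite eq_le ?r1 ?s1.
have [/ment0_eq0/eqP h1 /ment0_eq0/eqP h2] := le0 _ _ (ment_ge0 _) (ment_ge0 _) u0.
by rewrite subr_eq0 in h1; rewrite subr_eq0 in h2; rewrite /is_unitarymx h1.
Qed.

Lemma mxv_onto (C : cstarAlg R) (u : 'M[C]_n) : (forall a b, nrm (u a b) <= 1) ->
  exists v, mxv v = u.
Proof.
move=> u1; have h (k : N2) : `|u k.1 k.2| <= 1%:R.
  by rewrite (_ : 1%:R = 1%:C :> R[i])// nrm_le.
by exists (fun k => mk_cball (h k)); apply/matrixP => a b; rewrite mxE.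
Qed.

Lemma unitary_entry (C : cstarAlg R) (u : 'M[C]_n) a b : is_unitarymx u -> nrm (u a b) <= 1.
Proof.
by move=> /unitary_eltP uu; apply: le_trans (mn_entry _ _ _) _; exact: (nrm_unitary uu).
Qed.

Lemma mxv_unitary (C : cstarAlg R) (u : 'M[C]_n) : is_unitarymx u -> exists v, mxv v = u.
Proof. by move=> uu; apply: mxv_onto => a b; exact: unitary_entry. Qed.

(** Almost unitary matrices are near unitary ones by [near_unitary] in [mxC C n], with a modulus
    that depends on [n] only. This is the hypothesis of [definable_zero_set]. *)
Lemma udef_stable (e : R) : 0 < e -> exists2 d : R, 0 < d &
  forall (C : cstarAlg R) (v : env (cstar_str C) (fun _ : N2 => 1%N)), udef (mxv v) <= d ->
    exists w : env (cstar_str C) (fun _ : N2 => 1%N),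
      udef (mxv w) = 0 /\ forall k, mdist (v k) (w k) <= e.
Proof.
move=> e0; pose m : R := Num.min e (1 / 2).
have m0 : 0 < m by rewrite lt_min e0 divr_gt0.
pose d : R := m / ((n * n)%:R + 1).
have n0 : 0 < (n * n)%:R + 1 :> R by rewrite ltr_wpDl.
exists d => [|C v]; first by rewrite divr_gt0.
rewrite ge_max => /andP[h1 h2]; set u := mxv v in h1 h2.
have small (T : 'M[C]_n) : ment T <= d -> mn T <= m.
  move=> Td; apply: le_trans (mn_ment _) _; apply: (@le_trans _ _ ((n * n)%:R * d)).
    by rewrite ler_wpM2l.
  by rewrite /d mulrA ler_pdivrMr// mulrC ler_wpM2l ?lerDl// ltW.
have m2 : m <= 1 / 2 by rewrite ge_min lexx orbT.
have [w wu uw] := @near_unitary R (mxC C n) u m m2 (small _ h1) (small _ h2).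
have {}wu : is_unitarymx (w : 'M[C]_n) by apply/unitary_eltP.
have [v' v'w] := mxv_unitary wu; exists v'; split; first by rewrite v'w; apply/udefP.
move=> [a b]; have -> : mdist (v (a, b)) (v' (a, b)) = nrm ((u - w : 'M[C]_n) a b).
  by rewrite -v'w !mxE.
apply: le_trans (mn_entry _ _ _) _; apply: le_trans uw _.
by rewrite ge_min lexx.
Qed.

Lemma dp_udef (Idx : Type) (C : Idx -> cstarAlg R) :
  @definable_predicate R (cstar_lang R) Idx (fun i => cstar_str (C i)) N2 (fun=> 1%N)
    (fun i v => udef (mxv v)).
Proof.
have rv : @repmx R Idx C N2 (fun=> 1%N) n n (fun i v => mxv v).
  move=> a b; apply: rep_ext (rep_var C (fun=> 1%N : srt (cstar_lang R)) (a, b)) => i v.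
  by rewrite mxE.
by apply: dp_max; apply: dp_ment; do ?[exact: repmx1|apply: repmx_mul|apply: repmx_adj|exact: rv].
Qed.

End UnitarySet.

Section BoolValues.
Context (R : realType).

(** The value 0 stands for truth, so [max] is conjunction and, by [inf_bool], [inf] is existence. *)
Lemma max_bool (b c : bool) : Num.max (~~ b)%:R (~~ c)%:R = (~~ (b && c))%:R :> R.
Proof. by case: b; case: c; rewrite /Num.max /= ?ltxx ?ltr01 ?ltr10. Qed.

Lemma inf_bool T (X : set T) (f : T -> R) (c : T -> bool) (b : bool) : X !=set0 ->
  (forall w, X w -> f w = (~~ c w)%:R) -> (b <-> exists2 w, X w & c w) ->
  inf [set f w | w in X] = (~~ b)%:R.
Proof.
move=> X0 fc; have f0 w : X w -> 0 <= f w by move=> Xw; rewrite fc.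
case: b => [[/(_ isT)[w Xw cw] _]|[_ nb]].
  by apply: (@inf_img_eq R T X f _ w) => //; rewrite fc// cw.
have [w Xw] := X0.
have nc w' : X w' -> c w' = false by move=> Xw'; apply/negP => cw; have : false by apply: nb; exists w'.
by apply: (@inf_img_eq R T X f _ w) => // [w' Xw'|]; rewrite fc ?nc.
Qed.

End BoolValues.

Definition o30 : 'I_3 := Ordinal (isT : (0 < 3)%N).
Definition o31 : 'I_3 := Ordinal (isT : (1 < 3)%N).
Definition o32 : 'I_3 := Ordinal (isT : (2 < 3)%N).
Definition sel3 (T : Type) (x y z : T) (k : 'I_3) : T :=
  match val k with 0 => x | 1 => y | _ => z end.

Lemma sel3_map (S T : Type) (f : S -> T) x y z k : f (sel3 x y z k) = sel3 (f x) (f y) (f z) k.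
Proof. by rewrite /sel3; case: (val k) => [|[|?]]. Qed.

(** * K_1 as an imaginary *)

Lemma bool_dist (R : realType) (b c : bool) : `|b%:R - c%:R| <= 1 :> R.
Proof. by case: b; case: c; rewrite /= ?subrr ?subr0 ?sub0r ?normrN ?normr0 ?normr1. Qed.

Lemma bool_close (R : realType) (b c : bool) (x y z : R) : y = b%:R -> z = c%:R ->
  `|x - y| <= 1 / 4 -> `|x - z| <= 1 / 4 -> y = z.
Proof.
move=> -> ->; rewrite !ler_norml => /andP[h1 h2] /andP[h3 h4].
by case: b c h1 h2 h3 h4 => [] [] //= *; exfalso; lra.
Qed.

Section Core.
Context (R : realType) (A : cstarAlg R) (n : nat).
Local Notation N2 := ('I_n * 'I_n)%type.
Let M0 : models A -> structure R (cstar_lang R) := @model_str R A.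
Let i0 : models A := self A.

(* R3 says that [x] <> [y][z]; only its values at A are prescribed. *)
Variable R3 : forall i, env (M0 i) (fun _ : 'I_3 * N2 => 1%N) -> R.
Arguments R3 : clear implicits.
Hypothesis dR3 : definable_predicate R3.
Hypothesis R3_01 : forall i v, 0 <= R3 i v <= 1.
Hypothesis R3A : forall (v : env (M0 i0) (fun _ : 'I_3 * N2 => 1%N)) (u : 'I_3 -> unitary A n),
  (forall k a b, val (u k) a b = sval (v (k, (a, b)))) ->
  R3 i0 v = (k1class (u o30) != (k1class (u o31) * k1class (u o32))%g)%:R.
Hypothesis surj : forall x : K1 A, exists u : unitary A n, k1class u = x.

Let T0 : imsort M0 -> Prop := @base_sorts R _ _ M0.
Let g0 : N2 -> srt (sublang T0) := fun _ => bsort (@base_sortsE R _ _ M0) 1%N.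
Let mx i (v : env (substr T0 i) g0) : 'M[sval i]_n := mxv (C := sval i) v.
Let X i : set (env (substr T0 i) g0) := [set v | udef (mx v) = 0].

Let Xdef : definable_set X.
Proof.
apply: (@definable_zero_set R (sublang T0) _ (substr T0) (base_uc (cstar_uc (fun i : models A => sval i)))
  N2 (bsort (@base_sortsE R _ _ M0) 1%N) (fun i v => udef (mx v))).
- have := @dp_base R _ _ M0 T0 (@base_sortsE R _ _ M0) N2 N2 (fun _ : N2 => 1%N) g0
    (fun k => Var g0 k) _ (dp_udef n (fun i : models A => sval i)).
  exact.
- by move=> i v; exact: udef_ge0.
- move=> i; have [v vE] := mxv_unitary (is_unitarymx1 (sval i) n).
  by exists v; rewrite /mx vE; apply/udefP; exact: is_unitarymx1.
- move=> e e0; have [d d0 H] := @udef_stable R n e e0.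
  by exists d => // i v /H.
- by move=> i; exact: (@cball_inh R _ (fun i : models A => sval i) i 1%N).
Qed.

Let Us : imsort M0 := existT _ _ (ISsub (fun k => projT2 (sval (g0 k))) X).
Let T1 : imsort M0 -> Prop := fun s => T0 s \/ s = Us.
Let eT1 : eq_sorts T1 := EQset (EQbase M0) Xdef.

Let R3v i (a b c : imcar Us i) : R :=
  R3 i (fun k : 'I_3 * N2 => sval (sel3 a b c k.1) k.2).

Section WithSorts.
Variable (T : imsort M0 -> Prop).
Hypotheses (HB : forall b, T (existT _ _ (ISbase M0 b))) (HU : T Us).

Definition us_sort : srt (sublang T) := exist T Us HU.

Definition coord_term (J : finType) (h : J -> srt (sublang T)) (t : term h us_sort) (k : N2) :
    term h (bsort HB 1%N) :=
  @app_im R _ _ M0 T (IMcoord (fun k => projT2 (sval (g0 k))) X k) (fun _ => HU) (HB 1%N)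
    J h (fun _ : unit => t).

Lemma dp_R3 (J : finType) (h : J -> srt (sublang T)) (x y z : term h us_sort) :
  definable_predicate (fun i (w : env (substr T i) h) =>
    R3v (tval w x : imcar Us i) (tval w y : imcar Us i) (tval w z : imcar Us i)).
Proof.
have := @dp_base R _ _ M0 T HB ('I_3 * N2)%type J (fun _ : 'I_3 * N2 => 1%N) h
  (fun k => coord_term (sel3 x y z k.1) k.2) R3 dR3.
apply: dp_ext => i w; congr (R3 i _); apply/funext => k.
have -> := @tval_app_im R _ _ M0 T (IMcoord (fun k => projT2 (sval (g0 k))) X k.2)
  (fun _ => HU) (HB 1%N) J h (fun _ : unit => sel3 x y z k.1) i w.
by rewrite /= -(sel3_map (fun t : term h us_sort => tval w t : imcar Us i)).
Qed.

End WithSorts.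

Let us1 : srt (sublang T1) := @us_sort T1 (or_intror erefl).
Let HB1 b : T1 (existT _ _ (ISbase M0 b)) := or_introl (@base_sortsE R _ _ M0 b).
Let g1 : unit -> srt (sublang T1) := fun _ => us1.

Let U_inh i : exists x : imcar Us i, True.
Proof.
have [v vE] := mxv_unitary (is_unitarymx1 (sval i) n).
have Xv : X (v : env (substr T0 i) g0).
  by rewrite /X /= /mx vE; apply/udefP; exact: is_unitarymx1.
by exists (exist _ v Xv).
Qed.

Let u1 i : imcar Us i := xget (projT1 (cid (U_inh i))) setT.
Let t0 i : bool -> imcar Us i := fun _ => u1 i.

(** A unitary is represented by the function recording for which [t] one has [[t true] <>
    [v][t false]]. At [A] this function determines the class of [v]; in the other models the induced
    [rho] is still a pseudometric. *)
Let phi i (v : env (substr T1 i) g1) (t : bool -> imcar Us i) : R :=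
  R3v (t true) (v tt : imcar Us i) (t false).

Let phi1 i v t : `|@phi i v t| <= 1.
Proof. by have /andP[h1 h2] := R3_01 (fun k => sval (sel3 (t true) (v tt : imcar Us i) (t false) k.1) k.2);
  rewrite ger0_norm. Qed.

Let Q i : metricType R := fun_completion (t0 i) (@phi1 i).
Let pi i (v : env (substr T1 i) g1) : Q i := fun_pi (t0 i) (@phi1 i) v.
Let rho i (v w : env (substr T1 i) g1) : R :=
  sup [set `|phi v t - phi w t| | t in [set: bool -> imcar Us i]].

Let drho : definable_predicate (fun i (v : env (substr T1 i) (sum_ctx g1 g1)) =>
  rho (fun k => v (inl k)) (fun k => v (inr k))).
Proof.
pose c := sum_ctx (fun _ : bool => us1) (sum_ctx g1 g1).
pose P i (e : env (substr T1 i) c) : R :=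
  `|R3v (e (inl true) : imcar Us i) (e (inr (inl tt)) : imcar Us i) (e (inl false) : imcar Us i) -
    R3v (e (inl true) : imcar Us i) (e (inr (inr tt)) : imcar Us i) (e (inl false) : imcar Us i)|.
apply: (@dp_sup_fam R (sublang T1) _ (substr T1) _ (sum_ctx g1 g1) us1 bool P 1).
- exact: U_inh.
- move=> i v; rewrite /P ler_norml.
  have /andP[h1 h2] := R3_01 (fun k => sval (sel3 (v (inl true) : imcar Us i)
     (v (inr (inl tt)) : imcar Us i) (v (inl false) : imcar Us i) k.1) k.2).
  have /andP[h3 h4] := R3_01 (fun k => sval (sel3 (v (inl true) : imcar Us i)
     (v (inr (inr tt)) : imcar Us i) (v (inl false) : imcar Us i) k.1) k.2).
  rewrite /R3v; apply/andP; split; lra.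
- apply: dp_abs; apply: dp_sub.
    exact: (@dp_R3 T1 HB1 (or_intror erefl) _ c (Var c (inl true)) (Var c (inr (inl tt)))
      (Var c (inl false))).
  exact: (@dp_R3 T1 HB1 (or_intror erefl) _ c (Var c (inl true)) (Var c (inr (inr tt)))
      (Var c (inl false))).
Qed.

Let Qs : imsort M0 := existT _ Q (ISquot (fun k : unit => projT2 (sval (g1 k))) pi).
Let T2 : imsort M0 -> Prop := fun s => T1 s \/ s = Qs.
Let eT2 : eq_sorts T2.
Proof. by apply: (EQquot eT1 drho) => i; exact: fun_completed. Qed.

Let HB2 b : T2 (existT _ _ (ISbase M0 b)) := or_introl (HB1 b).
Let HU2 : T2 Us := or_introl (or_intror erefl).
Let us2 : srt (sublang T2) := us_sort HU2.
Let qs : srt (sublang T2) := exist T2 Qs (or_intror erefl).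
Let HQ : T2 Qs := or_intror erefl.
Let piu i (u : imcar Us i) : Q i := pi ((fun _ => u) : env (substr T1 i) g1).

Let quo (J : finType) (h : J -> srt (sublang T2)) (t : term h us2) : term h qs :=
  @app_im R _ _ M0 T2 (IMquot (fun k : unit => projT2 (sval (g1 k))) pi) (fun _ => HU2) HQ
    J h (fun _ : unit => t).

Let dp_pid (J : finType) (h : J -> srt (sublang T2)) (t : term h us2) (q : term h qs) :
  definable_predicate (fun i (w : env (substr T2 i) h) =>
    mdist (piu (tval w t : imcar Us i)) (tval w q : Q i)).
Proof.
apply: dp_ext (dp_dist (substr T2) (quo t) q) => i w; congr mdist.
exact: (@tval_app_im R _ _ M0 T2 (IMquot (fun k : unit => projT2 (sval (g1 k))) pi)
  (fun _ => HU2) HQ J h (fun _ : unit => t) i w).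
Qed.

Let uu (u : imcar Us i0) : unitary A n :=
  exist _ (mx (i := i0) (sval u)) (proj1 (udefP _) (svalP u)).
Let Kc (u : imcar Us i0) : K1 A := k1class (uu u).

Let Kc_surj x : exists u, Kc u = x.
Proof.
have [u <-] := surj x; have [v vE] := mxv_unitary (valP u).
have Xv : X (v : env (substr T0 i0) g0) by rewrite /X /= /mx vE; apply/udefP; exact: (valP u).
exists (exist _ v Xv); rewrite /Kc; congr k1class; apply: val_inj; exact: vE.
Qed.

Let R3K a b c : R3v (i := i0) a b c = (Kc a != (Kc b * Kc c)%g)%:R.
Proof.
rewrite /R3v (R3A (u := fun k => uu (sel3 a b c k)))// => k x y.
by rewrite /= mxE.
Qed.

Let rhoK (v w : imcar Us i0) :
  rho ((fun _ => v) : env (substr T1 i0) g1) (fun _ => w) = (Kc v != Kc w)%:R.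
Proof.
rewrite /rho /phi; have [e|ne] := eqVneq (Kc v) (Kc w).
  rewrite (_ : [set _ | _ in _] = [set 0]) ?sup1//; apply/seteqP; split.
    by move=> _ [t _ <-]; rewrite !R3K e subrr normr0.
  by move=> _ ->; exists (t0 i0) => //; rewrite !R3K e subrr normr0.
have [e1 He1] := Kc_surj 1%g.
have b1 t : `|phi ((fun _ => v) : env (substr T1 i0) g1) t - phi (fun _ => w) t| <= 1.
  by rewrite /phi (R3K (t true) v (t false)) (R3K (t true) w (t false)); exact: bool_dist.
apply/eqP; rewrite eq_le; apply/andP; split.
  by apply: sup_img_le => [|t _]; [exists (t0 i0)|exact: b1].
(* Testing against [[v]] and 1 separates [[v]] from any other class. *)
pose t (b : bool) := if b then v else e1.
have := @le_sup_img R _ [set: bool -> imcar Us i0]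
  (fun t => `|phi ((fun _ => v) : env (substr T1 i0) g1) t - phi (fun _ => w) t|) 1 t
  (fun t _ => b1 t) I.
by rewrite /phi !R3K /t He1 !mulg1 eqxx ne /= sub0r normrN normr1.
Qed.

Let dpi (v w : imcar Us i0) : mdist (piu v) (piu w) = (Kc v != Kc w)%:R.
Proof. exact: rhoK. Qed.

(** At [A] the completion adds nothing: the functions [phi v] take the values 0 and 1, so two of
    them within [1/4] of [q] coincide. *)
Let pi_surj (q : Q i0) : exists u : imcar Us i0, piu u = q.
Proof.
have e4 : 0 < (1 / 4 : R) by rewrite divr_gt0.
have [v Hv] := svalP q _ e4; exists (v tt); apply: (@mdist_positivity R (Q i0)).
have vv : (fun _ : unit => v tt) = v by apply/funext => -[].
apply/eqP; rewrite eq_le; apply/andP; split; last first.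
  apply: le_trans (@le_sup_img R _ setT (fun t => `|phi v t - sval q t|) (1 / 4) (t0 i0) _ I).
    by [].
  by move=> t _; rewrite distrC; exact: Hv.
apply/ler_addgt0Pl => e e0; rewrite addr0; apply: sup_img_le; first by exists (t0 i0).
move=> t _ /=; pose e' := Num.min e (1 / 4).
have e'0 : 0 < e' by rewrite lt_min e0.
have [w Hw] := svalP q _ e'0; have h1 := Hv t; have h2 := Hw t.
have h3 : e' <= e by rewrite ge_min lexx.
have h4 : e' <= 1 / 4 by rewrite ge_min lexx orbT.
have -> : phi (fun _ => v tt) t = phi w t.
  rewrite vv.
  exact: (bool_close (R3K (t true) (v tt) (t false)) (R3K (t true) (w tt) (t false)) h1
    (le_trans h2 h4)).
by rewrite distrC; apply: le_trans h3.
Qed.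

Let psi (q : Q i0) : imcar Us i0 := projT1 (cid (pi_surj q)).
Let psiK q : piu (psi q) = q. Proof. exact: (projT2 (cid (pi_surj q))). Qed.
Let ph (q : Q i0) : K1 A := Kc (psi q).

Let dq (q r : Q i0) : mdist q r = (ph q != ph r)%:R.
Proof. by rewrite -{1}(psiK q) -{1}(psiK r) dpi. Qed.

Let ph_piu u : ph (piu u) = Kc u.
Proof.
apply/eqP; have := dpi (psi (piu u)) u; rewrite psiK mdistxx -/(ph _).
by case: eqP => // _ /eqP; rewrite eq_sym oner_eq0.
Qed.

Let hp (x : K1 A) : Q i0 := piu (projT1 (cid (Kc_surj x))).
Let hpK x : ph (hp x) = x.
Proof. by rewrite ph_piu; exact: (projT2 (cid (Kc_surj x))). Qed.
Let phK q : hp (ph q) = q.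
Proof. by apply: (@mdist_positivity R); rewrite dq hpK eqxx. Qed.

Let dpiq (u : imcar Us i0) (q : Q i0) : mdist (piu u) q = (~~ (Kc u == ph q))%:R.
Proof. by rewrite dq ph_piu. Qed.

(** At [A] the distance to [f v] is the truth value of the graph of [f], as the metric is
    {0,1}-valued. Each graph is an inf over unitaries representing the arguments and the value,
    subject to conditions in [R3]. *)
Lemma K1_belongs_core : K1_belongs_to_eq A.
Proof.
exists T2; split; first exact: eT2.
exists qs, ph, (fun q r => hp (ph q * ph r)%g), (fun q => hp (ph q)^-1%g), (hp 1%g).
have ninh : [set: 'I_3 -> imcar Us i0] !=set0 by exists (fun _ => u1 i0).
split.
- by exists hp.
- exact: dq.
- by split=> [x y|x|]; rewrite hpK.
- pose c := ext_ctx (fun _ : bool => qs) qs; pose c2 := sum_ctx (fun _ : 'I_3 => us2) c.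
  pose P i (e : env (substr T2 i) c2) : R := Num.max
    (Num.max (mdist (piu (e (inl o30) : imcar Us i)) (e (inr (Some true)) : Q i))
             (mdist (piu (e (inl o31) : imcar Us i)) (e (inr (Some false)) : Q i)))
    (Num.max (mdist (piu (e (inl o32) : imcar Us i)) (e (inr None) : Q i))
       (R3v (e (inl o32) : imcar Us i) (e (inl o30) : imcar Us i) (e (inl o31) : imcar Us i))).
  exists (fun i (w : env (substr T2 i) c) =>
     inf [set P i (sum_env v w) | v in [set: env (substr T2 i) (fun _ : 'I_3 => us2)]]); split.
    apply: (@dp_inf_fam R (sublang T2) _ (substr T2) _ c us2 'I_3 P 0).
    + exact: U_inh.
    + by move=> i v; rewrite /P !le_max mdist_ge0.
    + apply: dp_max; apply: dp_max.
      * exact: (@dp_pid _ c2 (Var c2 (inl o30)) (Var c2 (inr (Some true)))).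
      * exact: (@dp_pid _ c2 (Var c2 (inl o31)) (Var c2 (inr (Some false)))).
      * exact: (@dp_pid _ c2 (Var c2 (inl o32)) (Var c2 (inr None))).
      * exact: (@dp_R3 T2 HB2 HU2 _ c2 (Var c2 (inl o32)) (Var c2 (inl o30)) (Var c2 (inl o31))).
  move=> v y; rewrite dq hpK.
  apply: (@inf_bool R _ _ _ (fun w : 'I_3 -> imcar Us i0 =>
    ((Kc (w o30) == ph (v true)) && (Kc (w o31) == ph (v false))) &&
    ((Kc (w o32) == ph y) && (Kc (w o32) == (Kc (w o30) * Kc (w o31))%g)))) => //.
    by move=> w _; rewrite /P /= !dpiq R3K !max_bool.
  split=> [/eqP e|[w _ /andP[/andP[/eqP <- /eqP <-] /andP[/eqP <- /eqP <-]]]]; last by [].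
  have [a Ha] := Kc_surj (ph (v true)); have [b Hb] := Kc_surj (ph (v false)).
  have [d Hd] := Kc_surj (ph y).
  by exists (sel3 a b d) => //; rewrite /sel3 /= Ha Hb Hd -e !eqxx.
split.
- pose c := ext_ctx (fun _ : unit => qs) qs; pose c2 := sum_ctx (fun _ : 'I_3 => us2) c.
  (* The third unitary is forced into the class 1 by being idempotent, and then must be the product
     of the argument with its candidate inverse. *)
  pose P i (e : env (substr T2 i) c2) : R := Num.max
    (Num.max (mdist (piu (e (inl o30) : imcar Us i)) (e (inr (Some tt)) : Q i))
             (mdist (piu (e (inl o31) : imcar Us i)) (e (inr None) : Q i)))
    (Num.max (R3v (e (inl o32) : imcar Us i) (e (inl o32) : imcar Us i) (e (inl o32) : imcar Us i))
       (R3v (e (inl o32) : imcar Us i) (e (inl o30) : imcar Us i) (e (inl o31) : imcar Us i))).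
  exists (fun i (w : env (substr T2 i) c) =>
     inf [set P i (sum_env v w) | v in [set: env (substr T2 i) (fun _ : 'I_3 => us2)]]); split.
    apply: (@dp_inf_fam R (sublang T2) _ (substr T2) _ c us2 'I_3 P 0).
    + exact: U_inh.
    + by move=> i v; rewrite /P !le_max mdist_ge0.
    + apply: dp_max; apply: dp_max.
      * exact: (@dp_pid _ c2 (Var c2 (inl o30)) (Var c2 (inr (Some tt)))).
      * exact: (@dp_pid _ c2 (Var c2 (inl o31)) (Var c2 (inr None))).
      * exact: (@dp_R3 T2 HB2 HU2 _ c2 (Var c2 (inl o32)) (Var c2 (inl o32)) (Var c2 (inl o32))).
      * exact: (@dp_R3 T2 HB2 HU2 _ c2 (Var c2 (inl o32)) (Var c2 (inl o30)) (Var c2 (inl o31))).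
  move=> v y; rewrite dq hpK.
  apply: (@inf_bool R _ _ _ (fun w : 'I_3 -> imcar Us i0 =>
    ((Kc (w o30) == ph (v tt)) && (Kc (w o31) == ph y)) &&
    ((Kc (w o32) == (Kc (w o32) * Kc (w o32))%g) && (Kc (w o32) == (Kc (w o30) * Kc (w o31))%g)))) => //.
    by move=> w _; rewrite /P /= !dpiq !R3K !max_bool.
  split=> [/eqP e|[w _ /andP[/andP[/eqP <- /eqP <-] /andP[/eqP e1 /eqP e2]]]].
    have [a Ha] := Kc_surj (ph (v tt)); have [b Hb] := Kc_surj (ph y).
    have [d Hd] := Kc_surj 1%g.
    by exists (sel3 a b d) => //; rewrite /sel3 /= Ha Hb Hd -e mulg1 mulgV !eqxx.
  have e3 : Kc (w o32) = 1%g by apply: (mulgI (Kc (w o32))); rewrite -e1 mulg1.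
  by apply/eqP; apply: (mulgI (Kc (w o30))); rewrite mulgV -e2 e3.
- pose c := ext_ctx (@of_void (srt (sublang T2))) qs.
  pose c2 := sum_ctx (fun _ : 'I_3 => us2) c.
  pose P i (e : env (substr T2 i) c2) : R :=
    Num.max (mdist (piu (e (inl o30) : imcar Us i)) (e (inr None) : Q i))
       (R3v (e (inl o30) : imcar Us i) (e (inl o30) : imcar Us i) (e (inl o30) : imcar Us i)).
  exists (fun i (w : env (substr T2 i) c) =>
     inf [set P i (sum_env v w) | v in [set: env (substr T2 i) (fun _ : 'I_3 => us2)]]); split.
    apply: (@dp_inf_fam R (sublang T2) _ (substr T2) _ c us2 'I_3 P 0).
    + exact: U_inh.
    + by move=> i v; rewrite /P !le_max mdist_ge0.
    + apply: dp_max.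
      * exact: (@dp_pid _ c2 (Var c2 (inl o30)) (Var c2 (inr None))).
      * exact: (@dp_R3 T2 HB2 HU2 _ c2 (Var c2 (inl o30)) (Var c2 (inl o30)) (Var c2 (inl o30))).
  move=> v y; rewrite dq hpK.
  apply: (@inf_bool R _ _ _ (fun w : 'I_3 -> imcar Us i0 =>
    (Kc (w o30) == ph y) && (Kc (w o30) == (Kc (w o30) * Kc (w o30))%g))) => //.
    by move=> w _; rewrite /P /= !dpiq R3K max_bool.
  split=> [/eqP e|[w _ /andP[/eqP <- /eqP e1]]].
    have [a Ha] := Kc_surj (ph y).
    by exists (fun _ => a) => //; rewrite Ha -e mulg1 !eqxx.
  by apply/eqP; apply: (mulgI (Kc (w o30))); rewrite -e1 mulg1.
Qed.

End Core.

(** * The chain predicate *)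

Section K1Product.
Context (R : realType) (A : cstarAlg R).

Lemma k1class_mul n (x y z : unitary A n) : val z = val x *m val y ->
  (k1class x * k1class y)%g = k1class z.
Proof.
move=> zE; rewrite /k1class; have -> : (k1pi (Tagged (unitary A) x) * k1pi (Tagged (unitary A) y))%g =
  k1mul (k1pi (Tagged (unitary A) x)) (k1pi (Tagged (unitary A) y)) by [].
rewrite k1mul_pi; apply/k1piP; apply: (@k1eq_pad _ _ (n + n)); rewrite /= ?leq_addr//.
by rewrite padr_mul// /padr /= zE padM// leq_addr.
Qed.

(** The form in which K_1 becomes accessible to formulas: stability puts the product relation into
    one fixed size, and polar decomposition replaces [U_0] by components of GL_n. *)
Lemma K1_glc l (x y z : unitary A (l + 1)) : csr A l ->
  k1class x = (k1class y * k1class z)%g <-> glc (val x) (val y *m val z).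
Proof.
move=> sr; have uyz := is_unitarymxM (valP y) (valP z).
pose yz : unitary A (l + 1) := exist (fun u => is_true (is_unitarymx u)) _ uyz.
rewrite (@k1class_mul _ y z yz)// K1_inj//=.
by split=> [/(U0_glc uyz)//|]; apply: glc_U0 => //; exact: (valP x).
Qed.

Lemma inf_ge0 T (X : set T) (f : T -> R) : (forall x, X x -> 0 <= f x) ->
  0 <= inf [set f x | x in X].
Proof.
move=> f0; have [X0|/nonemptyPn ->] := pselect (X !=set0); first exact: le_inf_img.
by rewrite image_set0 inf0.
Qed.

End K1Product.

Lemma cball_nrm (R : realType) (C : cstarAlg R) m (x : cball C m) : nrm (sval x) <= m%:R.
Proof. by rewrite -lecR -nrmE rmorph_nat; exact: (svalP x). Qed.

Section ChainPredicate.
Context (R : realType) (n r K : nat) (eta : R).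
Local Notation N2 := ('I_n * 'I_n)%type.
Local Notation J := ('I_K.+1 * bool * N2)%type.

(** The boolean selects the chain itself ([true]) or its sequence of inverses ([false]). *)
Definition chain_mx (C : cstarAlg R) (c : env (cstar_str C) (fun _ : J => r)) j b : 'M[C]_n :=
  \matrix_(a, a') sval (c (j, b, (a, a'))).

(** It vanishes on exact chains of mesh at most [eta], with exact inverses and the right ends. The
    inverses are part of the data, so that invertibility is an algebraic condition with a norm bound
    given by the sort [r]. *)
Definition chain_defect (C : cstarAlg R) (c : env (cstar_str C) (fun _ : J => r))
    (x y : 'M[C]_n) : R :=
  let g j := chain_mx c j true in let g' j := chain_mx c j false in
  Num.max
    (Num.max (ment (x - g ord0)) (ment (y - g ord_max)))
    (Num.max
      (\big[Num.max/0]_j Num.max (ment (g j *m g' j - 1%:M)) (ment (g' j *m g j - 1%:M)))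
      (\big[Num.max/0]_(j < K) (ment (g (lift ord0 j) - g (widen_ord (leqnSn K) j)) - eta))).

Definition chain_val (C : cstarAlg R) (x y : 'M[C]_n) : R :=
  inf [set chain_defect c x y | c in [set: env (cstar_str C) (fun _ : J => r)]].

Lemma chain_defect_ge0 (C : cstarAlg R) c (x y : 'M[C]_n) : 0 <= chain_defect c x y.
Proof. by rewrite !le_max ment_ge0. Qed.

Lemma chain_val_ge0 (C : cstarAlg R) (x y : 'M[C]_n) : 0 <= chain_val x y.
Proof. by apply: inf_ge0 => c _; exact: chain_defect_ge0. Qed.

Lemma chain_val_zero (C : cstarAlg R) (x y : 'M[C]_n) (g g' : nat -> 'M[C]_n) :
  g 0%N = x -> g K = y ->
  (forall j, [/\ g j *m g' j = 1%:M, g' j *m g j = 1%:M, mn (g j) <= r%:R & mn (g' j) <= r%:R]) ->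
  (forall j, (j < K)%N -> mn (g j.+1 - g j) <= eta) -> chain_val x y = 0.
Proof.
move=> g0 gK gg gs.
pose G (k : J) : C := if k.1.2 then g k.1.1 k.2.1 k.2.2 else g' k.1.1 k.2.1 k.2.2.
have hG k : `|G k| <= r%:R.
  rewrite -(rmorph_nat (real_complex R)) nrm_le /G.
  by case: (gg k.1.1) => _ _ h1 h2; case: ifP => _; apply: le_trans (mn_entry _ _ _) _.
pose c : env (cstar_str C) (fun _ : J => r) := fun k => mk_cball (hG k).
have ct j : chain_mx c j true = g j by apply/matrixP => a b; rewrite mxE.
have cf j : chain_mx c j false = g' j by apply/matrixP => a b; rewrite mxE.
apply: (@inf_img_eq R _ _ _ 0 c) => // [c' _|]; first exact: chain_defect_ge0.
apply/eqP; rewrite eq_le chain_defect_ge0 andbT /chain_defect !ge_max.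
rewrite !ct /= g0 gK !subrr !ment0 lexx /=; apply/andP; split; apply: bigmax_le => // j _.
  by rewrite ct cf; have [-> -> _ _] := gg j; rewrite !subrr ment0 maxxx.
rewrite !ct subr_le0; apply: le_trans (ment_mn _) _; rewrite lift0 /=; exact: gs.
Qed.

(** The infimum need not be attained, but a chain of defect less than [eta] suffices. The hypothesis
    is the conclusion of [approx_chain_glc] for this [eta]. *)
Lemma chain_val_lt (C : cstarAlg R) (x y : 'M[C]_n) :
  (forall (A : cstarAlg R) K (g g' : nat -> 'M[A]_n) (x y : 'M[A]_n),
    (forall j, (j <= K)%N -> [/\ forall a b, nrm (g' j a b) <= r%:R,
      forall a b, nrm ((g j *m g' j - 1%:M) a b) <= eta &
      forall a b, nrm ((g' j *m g j - 1%:M) a b) <= eta]) ->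
    (forall j, (j < K)%N -> forall a b, nrm ((g j.+1 - g j) a b) <= 2 * eta) ->
    (forall a b, nrm ((x - g 0%N) a b) <= eta) -> (forall a b, nrm ((y - g K) a b) <= eta) ->
    glc x y) ->
  chain_val x y < eta -> glc x y.
Proof.
move=> H; have cne : [set: env (cstar_str C) (fun _ : J => r)] !=set0.
  exists (fun _ => mk_cball (A := C) (n := r) (a := 0) (ball_incl (leq0n r) (mk_cball (ball_zero C)))).
  by [].
move=> /(inf_img_lt cne)[c _].
rewrite /chain_defect !gt_max => /andP[/andP[h1 h2] /andP[h3 h4]].
apply: (H C K (fun j => chain_mx c (inord j) true) (fun j => chain_mx c (inord j) false)).
- move=> j jK; split=> a b.
  + by rewrite mxE; exact: cball_nrm.
  + apply: le_trans (le_ment _ _ _) _; apply: ltW; apply: le_lt_trans h3.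
    apply: le_trans (@le_bigmax _ _ _ 0 (fun j => Num.max (ment (chain_mx c j true *m chain_mx c j false - 1%:M)) (ment (chain_mx c j false *m chain_mx c j true - 1%:M))) (inord j)).
    by rewrite le_max lexx.
  + apply: le_trans (le_ment _ _ _) _; apply: ltW; apply: le_lt_trans h3.
    apply: le_trans (@le_bigmax _ _ _ 0 (fun j => Num.max (ment (chain_mx c j true *m chain_mx c j false - 1%:M)) (ment (chain_mx c j false *m chain_mx c j true - 1%:M))) (inord j)).
    by rewrite le_max lexx orbT.
- move=> j jK a b; apply: le_trans (le_ment _ _ _) _.
  have := @le_bigmax _ _ _ 0 (fun j : 'I_K => ment (chain_mx c (lift ord0 j) true - chain_mx c (widen_ord (leqnSn K) j) true) - eta) (Ordinal jK).
  have -> : lift ord0 (Ordinal jK) = inord j.+1 by apply: val_inj; rewrite /= inordK.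
  have -> : widen_ord (leqnSn K) (Ordinal jK) = inord j.
    by apply: val_inj; rewrite /= inordK// ltnW.
  move=> h; have := le_lt_trans h h4; rewrite ltrBlDr => /ltW.
  by rewrite mulr_natl mulr2n.
- move=> a b; apply: le_trans (le_ment _ _ _) _; apply: ltW.
  by rewrite (_ : inord 0 = ord0)//; apply: val_inj; rewrite /= inordK.
- move=> a b; apply: le_trans (le_ment _ _ _) _; apply: ltW.
  by rewrite (_ : inord K = ord_max)//; apply: val_inj; rewrite /= inordK.
Qed.

Section Dp.
Variables (Idx : Type) (C : Idx -> cstarAlg R).
Local Notation M := (fun i => cstar_str (C i)).

Lemma rep_inr (I J' : finType) (g : I -> srt (cstar_lang R)) (h : J' -> srt (cstar_lang R))
    (F : forall i, env (M i) g -> C i) : rep F ->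
  @rep R Idx C (J' + I)%type (sum_ctx h g) (fun i e => F i (fun k => e (inr k))).
Proof.
move=> [m [t ht]]; exists m, (tsub (fun k => Var (sum_ctx h g) (inr k)) t) => i v.
by rewrite tval_tsub ht.
Qed.

Lemma dp_chain_val (I : finType) (g : I -> srt (cstar_lang R))
    (F G : forall i, env (M i) g -> 'M[C i]_n) : repmx F -> repmx G ->
  definable_predicate (M := M) (fun i (v : env (M i) g) => chain_val (F i v) (G i v)).
Proof.
move=> rF rG; pose c := sum_ctx (fun _ : J => r : srt (cstar_lang R)) g.
apply: (@dp_inf_fam R (cstar_lang R) Idx M I g r J (fun i (e : env (M i) c) =>
  chain_defect (fun k => e (inl k)) (F i (fun k => e (inr k))) (G i (fun k => e (inr k)))) 0).
- by move=> i; exact: (@cball_inh R Idx C i r).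
- by move=> i v; exact: chain_defect_ge0.
have rF' : @repmx R Idx C _ c _ _ (fun i e => F i (fun k => e (inr k))).
  by move=> a b; exact: (rep_inr _ (rF a b)).
have rG' : @repmx R Idx C _ c _ _ (fun i e => G i (fun k => e (inr k))).
  by move=> a b; exact: (rep_inr _ (rG a b)).
have rc j b : @repmx R Idx C _ c _ _ (fun i e => chain_mx (fun k => e (inl k)) j b).
  move=> a a'; apply: rep_ext (rep_var C c (inl (j, b, (a, a')))) => i v.
  by rewrite mxE.
have one := @repmx1 R Idx C _ c n.
apply: dp_max; apply: dp_max; first exact: dp_ment; first exact: dp_ment.
  by apply: dp_bigmax => j; apply: dp_max; apply: dp_ment => //; exact: repmx_mul.
by apply: dp_bigmax => j; apply: dp_sub; [exact: dp_ment|exact: dp_cst].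
Qed.

End Dp.

End ChainPredicate.

(** * Parts (1), (2) and (3) *)

Section Parts.
Context (R : realType).

Lemma finite_stable_rank_csr (A : cstarAlg R) : finite_stable_rank A -> exists l, csr A l.
Proof. by move=> [s /stable_rank_csr]; exists s. Qed.

Lemma K1_surj_all (A : cstarAlg R) l (x : K1 A) : csr A l ->
  exists u : unitary A (l + 1), k1class u = x.
Proof.
move=> sr; have [v vE] := @K1_surj R A (l + 1) _ (tagged (k1rep_of x)) (csr_mono (leq_addr 1 l) sr).
exists v; rewrite -vE -[RHS]k1pi_repr /k1class; congr k1pi.
by case: (k1rep_of x).
Qed.

Definition block3 n (C : cstarAlg R) (v : env (cstar_str C) (fun _ : 'I_3 * ('I_n * 'I_n) => 1%N))
    k : 'M[C]_n := mxv (fun j => v (k, j)).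

(** Turns a dichotomy between the value 0 and values at least [eta] into the truth values 0 and
    1. *)
Definition clip (eta x : R) : R := Num.min 1 (eta^-1 * x).

Lemma clip_01 (eta x : R) : 0 < eta -> 0 <= x -> 0 <= clip eta x <= 1.
Proof.
move=> e0 x0; rewrite /clip le_min ler01 mulr_ge0 ?invr_ge0 ?(ltW e0)//=.
by rewrite ge_min lexx.
Qed.

Lemma clip0 (eta : R) : clip eta 0 = 0.
Proof. by rewrite /clip mulr0; apply/min_idPr; exact: ler01. Qed.

Lemma clip1 (eta x : R) : 0 < eta -> eta <= x -> clip eta x = 1.
Proof. by move=> e0 ex; apply/min_idPl; rewrite mulrC ler_pdivlMr// mul1r. Qed.

Lemma dp_clip (L : language) (Idx : Type) (M : Idx -> structure R L) (I : finType)
    (g : I -> srt L) (P : forall i, env (M i) g -> R) (eta : R) :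
  definable_predicate P -> definable_predicate (fun i v => clip eta (P i v)).
Proof. by move=> dP; apply: dp_min; [exact: dp_cst|exact: dp_scale]. Qed.

Section Index.
Variables (n : nat) (Idx : Type) (C : Idx -> cstarAlg R).
Local Notation N2 := ('I_n * 'I_n)%type.
Local Notation M := (fun i => cstar_str (C i)).

Lemma repmx_pick (I : finType) (g : I -> srt (cstar_lang R)) (s : N2 -> I)
  (F : forall i, env (M i) g -> 'M[C i]_n) :
  (forall i v a b, F i v a b = sval (v (s (a, b)))) -> repmx F.
Proof. by move=> FE a b; apply: rep_ext (rep_var C g (s (a, b))) => i v; rewrite FE. Qed.

(* For X = U_0(M_n), this is 0 if [x] = [y][z] in K_1, and bounded below if not. *)
Definition coset_dist (X : forall i, set (env (M i) (fun _ : N2 => 1%N)))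
    i (v : env (M i) (fun _ : 'I_3 * N2 => 1%N)) : R :=
  inf [set ment (block3 v o30 *m mxv w - block3 v o31 *m block3 v o32) | w in X i].

Lemma dp_coset_dist (X : forall i, set (env (M i) (fun _ : N2 => 1%N))) :
  definable_set X -> definable_predicate (coset_dist X).
Proof.
move=> dX; pose c := sum_ctx (fun _ : N2 => 1%N : srt (cstar_lang R)) (fun _ : 'I_3 * N2 => 1%N).
have rb k : @repmx R Idx C _ c _ _ (fun i e => block3 (fun k => e (inr k)) k).
  by apply: (@repmx_pick _ c (fun p => inr (k, p))) => i v a b; rewrite mxE.
have rw : @repmx R Idx C _ c _ _ (fun i e => mxv (fun k => e (inl k))).
  by apply: (@repmx_pick _ c (fun p => inl p)) => i v a b; rewrite mxE.
apply: (@dp_inf_set R (cstar_lang R) Idx M _ _ _ _ X (fun i (e : env (M i) c) =>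
  ment (block3 (fun k => e (inr k)) o30 *m mxv (fun k => e (inl k)) -
    block3 (fun k => e (inr k)) o31 *m block3 (fun k => e (inr k)) o32))) => //.
by apply: dp_ment; exact: repmx_mul.
Qed.

End Index.

(** If [x w] is closer to [y z] than the stated gap in every entry, the norm distance is less than
    1; as the inverse of the unitary [y z] has norm at most 1, both lie in one component. *)
Lemma coset_distP n (C : cstarAlg R) (x y z : 'M[C]_n) :
  is_unitarymx x -> is_unitarymx y -> is_unitarymx z ->
  (glc x (y *m z) -> exists w : 'M[C]_n, U0 w /\ x *m w = y *m z) /\
  (~ glc x (y *m z) -> forall w : 'M[C]_n, U0 w ->
     ((n * n)%:R + 1)^-1 <= ment (x *m w - y *m z)).
Proof.
move=> ux uy uz; have uyz := is_unitarymxM uy uz; split.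
  move=> h; have := U0V (glc_U0 ux uyz h) => /(U0J (is_unitarymxV ux)).
  rewrite adjmxM !adjmxK => U; exists (adjmx x *m (y *m z)); split.
    move: U; rewrite -!mulmxA; have /andP[/eqP e _] := ux.
    by rewrite e mulmx1.
  by rewrite mulmxA; have /andP[_ /eqP ->] := ux; rewrite mul1mx.
move=> ng w Uw; rewrite leNgt; apply/negP => h; apply: ng.
have n0 : 0 < (n * n)%:R + 1 :> R by rewrite ltr_wpDl.
have sm : mn (x *m w - y *m z) < 1.
  apply: le_lt_trans (mn_ment _) _.
  apply: (@le_lt_trans _ _ (((n * n)%:R + 1) * ment (x *m w - y *m z))).
    by rewrite ler_wpM2r ?ment_ge0 ?lerDl.
  by rewrite mulrC -ltr_pdivlMr// mul1r.
have /andP[/eqP e1 /eqP e2] := uyz.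
have g1 : glc (y *m z) (x *m w).
  apply: (glc_near e2 e1); apply: le_lt_trans sm.
  rewrite -[leRHS]mulr1 ler_wpM2l ?mn_ge0//.
  exact: (nrm_unitary (proj1 (unitary_eltP _) (is_unitarymxV uyz))).
apply: glc_trans (glc_sym g1); rewrite -{1}(mulmx1 x).
apply: glc_mull; first exact: unitary_glmx.
by apply: glc_sym; apply: U0_glc; rewrite ?is_unitarymx1// adjmx1 mulmx1.
Qed.

Lemma coset_clipP l (Idx : Type) (C : Idx -> cstarAlg R) i0
    (X : forall i, set (env (cstar_str (C i)) (fun _ : 'I_(l + 1) * 'I_(l + 1) => 1%N)))
    (v : env (cstar_str (C i0)) (fun _ : 'I_3 * ('I_(l + 1) * 'I_(l + 1)) => 1%N))
    (u : 'I_3 -> unitary (C i0) (l + 1)) :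
  csr (C i0) l -> X i0 = @U0_set R (C i0) (l + 1) ->
  (forall k a b, val (u k) a b = sval (v (k, (a, b)))) ->
  clip (((l + 1) * (l + 1))%:R + 1)^-1 (coset_dist X v) =
    (k1class (u o30) != (k1class (u o31) * k1class (u o32))%g)%:R.
Proof.
move=> sr XA vu.
have e0 : 0 < (((l + 1) * (l + 1))%:R + 1)^-1 :> R by rewrite invr_gt0 ltr_wpDl.
have bE k : block3 v k = val (u k) by apply/matrixP => a b; rewrite mxE vu.
have [h1 h2] := coset_distP (valP (u o30)) (valP (u o31)) (valP (u o32)).
have XE w : X i0 w <-> U0 (mxv w) by rewrite XA.
have X1 : X i0 !=set0.
  have [w wE] := mxv_unitary (is_unitarymx1 (C i0) (l + 1)).
  by exists w; apply/XE; rewrite wE; exact: U0_1.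
case: eqP => [/(K1_glc _ _ _ sr)/h1[w [Uw xw]]|ne].
  have [w' wE] := mxv_unitary (U0_unitary Uw).
  rewrite /coset_dist (@inf_img_eq R _ _ _ 0 w') ?clip0//.
  + by move=> c _; exact: ment_ge0.
  + by apply/XE; rewrite wE.
  + by rewrite !bE wE xw subrr ment0.
apply: clip1 => //; apply: le_inf_img => // w /XE Uw.
by rewrite !bE; apply: h2 => // /(K1_glc _ _ _ sr).
Qed.

Lemma U0_definable_belongs (A : cstarAlg R) : finite_stable_rank A ->
  (forall n, U0_definable A n) -> K1_belongs_to_eq A.
Proof.
move=> /finite_stable_rank_csr[l sr] dU; pose n := (l + 1)%N.
have [X [dX XA]] := dU n.
have cge i v : 0 <= @coset_dist n _ (fun i : models A => sval i) X i v.
  by apply: inf_ge0 => w _; exact: ment_ge0.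
apply: (@K1_belongs_core R A n (fun i v => clip ((n * n)%:R + 1)^-1
  (@coset_dist n _ (fun i : models A => sval i) X i v))).
- by apply: dp_clip; exact: dp_coset_dist.
- by move=> i v; apply: clip_01 => //; rewrite invr_gt0 ltr_wpDl.
- by move=> v u vu; apply: (@coset_clipP l _ (fun i : models A => sval i) (self A)).
- by move=> x; exact: K1_surj_all.
Qed.

Lemma real_rank_zero_belongs (A : cstarAlg R) : finite_stable_rank A ->
  real_rank_zero A -> K1_belongs_to_eq A.
Proof.
move=> /finite_stable_rank_csr[l sr] /real_rank_zero_rr0 rrA; pose n := (l + 1)%N.
(* The norm bound 200 of the chains is known in advance; it determines [eta], and [eta] determines
   [K]. There is no circularity. *)
have [eta e0 Heta] := @approx_chain_glc R n 200%:R (ler0n _ _).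
have [K [dl [dl0 HK]]] := rr0_chain e0.
apply: (@K1_belongs_core R A n (fun i v => clip eta
  (@chain_val R n 200 K eta (sval i) (block3 v o30) (block3 v o31 *m block3 v o32)))).
- have rb k : @repmx R _ (fun i : models A => sval i) _ (fun _ : 'I_3 * ('I_n * 'I_n) => 1%N)
      n n (fun i v => block3 v k).
    by apply: (@repmx_pick n _ _ _ _ (fun p => (k, p))) => i v a b; rewrite mxE.
  by apply: dp_clip; apply: dp_chain_val => //; exact: repmx_mul.
- by move=> i v; apply: clip_01 => //; exact: chain_val_ge0.
- move=> v u vu.
  have bE k : block3 v k = val (u k) by apply/matrixP => a b; rewrite mxE vu.
  rewrite !bE; have ux := valP (u o30).
  have uyz := is_unitarymxM (valP (u o31)) (valP (u o32)).
  case: eqP => [/(K1_glc _ _ _ sr) h|ne]; last first.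
    apply: clip1 => //; rewrite leNgt; apply/negP => /(chain_val_lt Heta) h.
    by apply: ne; apply/(K1_glc _ _ _ sr).
  have Uu := glc_U0 ux uyz h; set y := val (u o31) *m val (u o32) in uyz Uu *.
  have [N [W [WU W0 WN Wd]]] := unitary_chain Uu dl0.
  have [g [g' [g0 gK gi gs]]] := HK (mxC A n) (rr0_mxC rrA) N W
    (fun i => proj1 (unitary_eltP _) (WU i)) WN Wd.
  have [y1 y2] : adjmx y *m y = 1%:M /\ y *m adjmx y = 1%:M.
    by have /andP[/eqP ? /eqP ?] := uyz.
  have yn : mn y <= 1 := nrm_unitary (proj1 (unitary_eltP _) uyz).
  have yn' : mn (adjmx y) <= 1 := nrm_unitary (proj1 (unitary_eltP _) (is_unitarymxV uyz)).
  (* The chain joins the product of [x] with the adjoint of [y] to 1; multiplied by the unitary [y]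
     on the right it joins [x] to [y] with the same bounds. *)
  rewrite (@chain_val_zero R n 200 K eta A _ _ (fun i => (g i : 'M[A]_n) *m y)
    (fun i => adjmx y *m (g' i : 'M[A]_n))) ?clip0//.
  + by rewrite g0 W0 -mulmxA y1 mulmx1.
  + by rewrite gK; exact: mul1mx.
  + move=> j; have [i1 i2 i3 i4] := gi j; split.
    * by rewrite mulmxA -(mulmxA _ y) y2 mulmx1; exact: i1.
    * rewrite mulmxA -(mulmxA (adjmx y)) (i2 : (g' j : 'M[A]_n) *m (g j : 'M[A]_n) = 1%:M).
      by rewrite mulmx1.
    * apply: le_trans (mnM _ _) _; rewrite -[leRHS]mulr1; apply: ler_pM; rewrite ?mn_ge0//.
    * apply: le_trans (mnM _ _) _; rewrite -[leRHS]mul1r; apply: ler_pM; rewrite ?mn_ge0//.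
  + move=> j _; rewrite -mulmxBl; apply: le_trans (mnM _ _) _.
    by rewrite -[leRHS]mulr1; apply: ler_pM; rewrite ?mn_ge0//; exact: gs.
- by move=> x; exact: K1_surj_all.
Qed.

Lemma dp_transfer (L : language) (Idx : Type) (M : Idx -> structure R L) i i'
    (h : forall s, M i s -> M i' s) (I : finType) (g : I -> srt L)
    (P : forall i, env (M i) g -> R) (v : env (M i) g) :
  elementary_map h -> definable_predicate P -> P i v = P i' (fun k => h _ (v k)).
Proof.
move=> eh dP; apply/eqP; rewrite -subr_eq0 -normr_le0; apply/ler_addgt0Pl => e e0; rewrite addr0.
have e2 : 0 < e / 2 by rewrite divr_gt0.
have [p Hp] := dP _ e2; have h1 := Hp i v; have h2 := Hp i' (fun k => h _ (v k)).
rewrite -eh in h2; have := ler_distD (fval p v) (P i v) (P i' (fun k => h _ (v k))).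
by rewrite distrC in h1; move=> h3; apply: le_trans h3 _; rewrite [leRHS]splitr; apply: lerD.
Qed.

Section Embedding.
Variables (A B : cstarAlg R) (j : cstar_embedding A B).

Lemma emb0 : j 0 = 0. Proof. by apply: (addrI (j 0)); rewrite -embD !addr0. Qed.

Lemma embB a b : j (a - b) = j a - j b.
Proof. by apply: (addIr (j b)); rewrite -embD !subrK. Qed.

Lemma emb_nrm a : nrm (j a) = nrm a. Proof. by rewrite /nrm emb_norm. Qed.

Lemma map_emb_mul m n p (u : 'M[A]_(m, n)) (v : 'M[A]_(n, p)) :
  map_mx j (u *m v) = map_mx j u *m map_mx j v.
Proof.
apply/matrixP => a b; rewrite !mxE (big_morph _ (embD j) emb0).
by apply: eq_bigr => k _; rewrite !mxE embM.
Qed.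

Lemma map_emb_adj m n (u : 'M[A]_(m, n)) : map_mx j (adjmx u) = adjmx (map_mx j u).
Proof. by apply/matrixP => a b; rewrite !mxE emb_star. Qed.

Lemma map_emb1 n : map_mx j (1%:M : 'M[A]_n) = 1%:M.
Proof. by apply/matrixP => a b; rewrite !mxE; case: eqP; rewrite ?emb1 ?emb0. Qed.

Lemma map_emb_pad k n (u : 'M[A]_n) : map_mx j (pad k u) = pad k (map_mx j u).
Proof.
apply/matrixP => a b; rewrite !mxE.
have jb (b0 : bool) : j b0%:R = b0%:R by case: b0; rewrite ?emb1 ?emb0.
case: insubP => [a' _ _|_]; last by rewrite jb.
by case: insubP => [b' _ _|_]; rewrite ?mxE ?jb.
Qed.

Lemma map_emb_U0 n (u : 'M[A]_n) : U0 u -> U0 (map_mx j u).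
Proof.
move=> [D [D1 DU Dc] Du]; exists (map_mx j @` D); last by exists u.
split; first by exists 1%:M => //; exact: map_emb1.
- move=> _ [v Dv <-]; exact: (unitary_map_subproof j (exist _ v (DU v Dv))).
- apply: connected_continuous_connected => //; apply: continuous_subspaceT.
  move=> v P /nbhs_mxP[e e0 eP]; apply/nbhs_mxP; exists e => // w wv.
  by apply: eP => a b; rewrite !mxE -embB emb_nrm.
Qed.

Definition K1_map (x : K1 A) : K1 B := k1class (unitary_map j (tagged (k1rep_of x))).

Lemma K1_mapE : K1_induced j K1_map.
Proof.
move=> n u; rewrite /K1_map.
have : k1class (tagged (k1rep_of (k1class u))) = k1class u.
  by rewrite -[RHS]k1pi_repr /k1class; congr k1pi; case: (k1rep_of _).
move: (tagged (k1rep_of (k1class u))) => v /k1class_eqP[k [vk uk /map_emb_U0]].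
rewrite map_emb_mul map_emb_adj !map_emb_pad => U.
by apply/k1class_eqP; exists k.
Qed.

Lemma K1_mapM : {morph K1_map : x y / (x * y)%g}.
Proof.
move=> x y; rewrite -(k1pi_repr x) -(k1pi_repr y).
move: (k1rep_of x) (k1rep_of y) => [m u] [n v].
have -> : (k1pi (existT _ m u) * k1pi (existT _ n v))%g =
  k1class (tagged (mulr_rep (existT _ m u) (existT _ n v))) by exact: k1mul_pi.
have e1 : K1_map (k1pi (existT _ m u)) = k1pi (Tagged (unitary B) (unitary_map j u)) := K1_mapE u.
have e2 : K1_map (k1pi (existT _ n v)) = k1pi (Tagged (unitary B) (unitary_map j v)) := K1_mapE v.
rewrite K1_mapE e1 e2.
have -> : (k1pi (Tagged (unitary B) (unitary_map j u)) * k1pi (Tagged (unitary B) (unitary_map j v)))%g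
  = k1pi (mulr_rep (Tagged (unitary B) (unitary_map j u)) (Tagged (unitary B) (unitary_map j v))).
  exact: k1mul_pi.
apply/k1piP; apply: (@k1eq_pad _ _ (m + n)) => //=.
by rewrite /padr /= map_emb_mul !map_emb_pad.
Qed.

(** The length [N] of a chain in [B] depends on the two classes, but once it is fixed the chain
    predicate is definable and its value 0 passes to [A]. There it only yields approximate chains,
    which are enough by [approx_chain_glc]. Chains of unitaries fit into the unit ball. *)
Lemma K1_map_inj : elementary_embedding j -> injective K1_map.
Proof.
move=> ej x y; rewrite -(k1pi_repr x) -(k1pi_repr y).
move: (k1rep_of x) (k1rep_of y) => [m u] [n v].
have e1 : K1_map (k1pi (existT _ m u)) = k1class (unitary_map j u) := K1_mapE u.
have e2 : K1_map (k1pi (existT _ n v)) = k1class (unitary_map j v) := K1_mapE v.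
rewrite e1 e2 => /k1class_eqP[k [mk nk]].
rewrite /= -!map_emb_pad -map_emb_adj -map_emb_mul => UB.
have [eta e0 Heta] := @approx_chain_glc R k 1%:R (ler0n _ _).
have [N [W [WU W0 WN Wd]]] := unitary_chain UB e0.
have ux := is_unitarymx_pad mk (valP u); have uy := is_unitarymx_pad nk (valP v).
set x' := pad k (val u) in ux UB W0 *; set y' := pad k (val v) in uy UB W0 *.
suff g : glc x' y' by apply/k1class_eqP; exists k; split=> //; exact: glc_U0.
have [vx vxE] := mxv_unitary ux; have [vy vyE] := mxv_unitary uy.
(* The class consists of the two algebras only; [dp_transfer] compares its two members. *)
pose C (b : bool) := if b then A else B.
pose g (k : bool * ('I_k * 'I_k)) : srt (cstar_lang R) := 1%N.
pose P b (w : env (cstar_str (C b)) g) : R :=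
  @chain_val R k 1 N eta (C b) (mxv (fun p => w (true, p))) (mxv (fun p => w (false, p))).
have dP : definable_predicate (M := fun b => cstar_str (C b)) P.
  by apply: dp_chain_val; [apply: (@repmx_pick k _ C _ g (fun p => (true, p)))|
    apply: (@repmx_pick k _ C _ g (fun p => (false, p)))] => i w a b; rewrite mxE.
pose w0 : env (cstar_str (C true)) g := fun q => if q.1 then vx q.2 else vy q.2.
have := @dp_transfer _ _ (fun b => cstar_str (C b)) true false (cball_map j) _ g P w0 ej dP.
rewrite /P.
have -> : mxv (C := C true) (fun p => w0 (true, p)) = x' by rewrite -vxE.
have -> : mxv (C := C true) (fun p => w0 (false, p)) = y' by rewrite -vyE.
have -> : mxv (C := C false) (fun p => cball_map j (w0 (true, p))) = map_mx j x'.
  by rewrite -vxE; apply/matrixP => a b; rewrite !mxE.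
have -> : mxv (C := C false) (fun p => cball_map j (w0 (false, p))) = map_mx j y'.
  by rewrite -vyE; apply/matrixP => a b; rewrite !mxE.
have uJ : is_unitarymx (map_mx j y') := unitary_map_subproof j (exist _ y' uy).
have [j1 j2] : adjmx (map_mx j y') *m map_mx j y' = 1%:M /\ map_mx j y' *m adjmx (map_mx j y') = 1%:M.
  by have /andP[/eqP ? /eqP ?] := uJ.
rewrite (@chain_val_zero R k 1 N eta B _ _ (fun i => W i *m map_mx j y')
  (fun i => adjmx (W i *m map_mx j y'))).
- move=> h; apply: (@chain_val_lt R k 1 N eta A x' y' Heta).
  by have -> : @chain_val R k 1 N eta A x' y' = 0 := h.
- by rewrite W0 map_emb_mul map_emb_adj -mulmxA j1 mulmx1.
- by rewrite WN mul1mx.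
- move=> i; have uW := is_unitarymxM (WU i) uJ; have /andP[/eqP ? /eqP ?] := uW; split=> //.
    exact: (nrm_unitary (proj1 (unitary_eltP _) uW)).
  exact: (nrm_unitary (proj1 (unitary_eltP _) (is_unitarymxV uW))).
- move=> i iN; rewrite -mulmxBl; apply: le_trans (mnM _ _) _.
  rewrite -[leRHS]mulr1; apply: ler_pM; rewrite ?mn_ge0//.
    by rewrite -mnN opprB; exact: Wd.
  exact: (nrm_unitary (proj1 (unitary_eltP _) uJ)).
Qed.

End Embedding.

End Parts.

(** * Elementarity of finite stable rank *)

Section Gap.
Context (R : realType) (A : cstarAlg R).
Local Notation rc := (rc A).

(** By [pos_sum_sqr], 1 is at most a multiple of the sum of [star (c k * b k) * (c k * b k)], which
    is at most [T] times the sum of [star (b k) * b k]. *)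
Lemma gram_lower m (b c : 'I_m -> A) : \sum_k c k * b k = 1 ->
  exists2 d : R, 0 < d & pos (\sum_k star (b k) * b k - rc d).
Proof.
move=> cb; pose T : R := \sum_k nrm (c k) ^+ 2 + 1.
have Tk k : nrm (star (c k) * c k) <= T.
  rewrite nrmC /T (bigD1 k)//= -addrA lerDl addr_ge0//.
  by apply: sumr_ge0 => i _; rewrite sqr_ge0.
have T0 : 0 < T by rewrite ltr_wpDl// sumr_ge0// => i _; rewrite sqr_ge0.
set s := \sum_k star (b k) * b k; set q := \sum_k star (c k * b k) * (c k * b k).
have p1 : pos (rc T * s - q).
  have -> : rc T * s - q = \sum_k star (b k) * (rc T - star (c k) * c k) * b k.
    rewrite /s /q mulr_sumr -sumrB; apply: eq_bigr => k _.
    by rewrite starM mulrBr mulrBl -(rcC T (star (b k))) !mulrA.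
  apply: pos_sum => k _; apply: pos_conj; apply: pos_shift => //.
  by rewrite starM starK.
have p2 := @pos_sum_sqr R A _ predT (fun k => c k * b k).
rewrite cb star1 mulr1 -/q in p2; set M : R := _%:R in p2.
have M0 : 0 <= M by [].
have p3 : pos (rc (M * T) * s - 1).
  have -> : rc (M * T) * s - 1 = rc M * (rc T * s - q) + (rc M * q - 1).
    by rewrite rcM mulrBr -mulrA addrA subrK.
  by apply: posD => //; exact: pos_scale.
have p4 : pos (rc (M * T + 1) * s - 1).
  have -> : rc (M * T + 1) * s - 1 = (rc (M * T) * s - 1) + s.
    by rewrite rcD rc1 mulrDl mul1r addrAC.
  by apply: posD => //; apply: pos_sum => k _; exact: pos_starM.
have MT0 : 0 < M * T + 1 by rewrite ltr_wpDl// mulr_ge0// ltW.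
exists (M * T + 1)^-1; first by rewrite invr_gt0.
have -> : s - rc (M * T + 1)^-1 = rc (M * T + 1)^-1 * (rc (M * T + 1) * s - 1).
  by rewrite mulrBr mulr1 mulrA -rcM mulVf ?gt_eqF// rc1 mul1r.
by apply: pos_scale => //; rewrite invr_ge0 ltW.
Qed.

(* If b* b = h^2 then V = b h^-1 is an isometry and b + e V has the left inverse
   (h + e)^-1 V*, whose norm is at most 1 / e. *)
Lemma gap m (b c : 'I_m -> A) (e : R) : \sum_k c k * b k = 1 -> 0 < e ->
  exists b' c' : 'I_m -> A, [/\ \sum_k c' k * b' k = 1, forall k, nrm (b' k - b k) <= e &
    forall k, nrm (c' k) <= e^-1].
Proof.
move=> cb e0; have [d d0 pd] := gram_lower cb; set s := \sum_k _ in pd.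
have [si [_ s1 s2 _ sc]] := pos_inv d0 pd; rewrite addrC subrK in s1 s2.
have ps : pos s by apply: pos_sum => k _; exact: pos_starM.
have [h [hs hh ph hc]] := pos_sqrt ps.
have hsi : h * si = si * h by apply: sc; rewrite mulrBr mulrBl rcC -hh mulrA.
pose hi := h * si.
have h1 : h * hi = 1 by rewrite /hi mulrA hh.
have h2 : hi * h = 1 by rewrite /hi hsi -mulrA hh.
have his : star hi = hi := star_inverse hs h1 h2.
have [g [_ g1 g2 gn _]] := pos_inv e0 ph.
pose V k := b k * hi.
have VV : \sum_k star (V k) * V k = 1.
  have -> : \sum_k star (V k) * V k = hi * s * hi.
    rewrite /s mulr_sumr mulr_suml; apply: eq_bigr => k _.
    by rewrite /V starM his !mulrA.
  by rewrite -hh mulrA h2 mul1r h1.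
have Vn k : nrm (V k) <= 1.
  rewrite -(ler_pXn2r (n := 2)) ?nnegrE ?nrm_ge0// expr1n -nrmC.
  apply: le_trans (nrm1 A); rewrite -VV; apply: nrm_mono; first exact: pos_starM.
  rewrite (bigD1 k)//= addrAC subrr add0r.
  by apply: pos_sum => i _; exact: pos_starM.
have bV k : b k = V k * h by rewrite /V -mulrA h2 mulr1.
exists (fun k => b k + rc e * V k), (fun k => g * star (V k)); split.
- have -> : \sum_k g * star (V k) * (b k + rc e * V k) = g * (\sum_k star (V k) * V k) * (rc e + h).
    rewrite mulr_sumr mulr_suml; apply: eq_bigr => k _.
    by rewrite {1}bV rcC mulrDr mulrDr addrC !mulrA.
  by rewrite VV mulr1.
- move=> k; rewrite addrC addKr nrm_rcM gtr0_norm// -[leRHS]mulr1.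
  by apply: ler_wpM2l => //; exact: ltW.
- move=> k; apply: le_trans (nrmM _ _) _; rewrite -[leRHS]mulr1; apply: ler_pM; rewrite ?nrm_ge0//.
  by rewrite nrm_star.
Qed.

End Gap.

Section StableRankTransfer.
Context (R : realType) (A B : cstarAlg R) (j : cstar_embedding A B).
Hypothesis ej : elementary_embedding j.

Let C (b : bool) : cstarAlg R := if b then A else B.
Local Notation M := (fun b => cstar_str (C b)).

Section Sentence.
Variables (k m r : nat) (e : R).

(* 0 iff every column of the m-ball is close to a left invertible one, with the
   left inverse in the r-ball. *)
Definition unimod_defect (D : cstarAlg R) (bc : 'I_k * bool -> D) (a : 'I_k -> D) : R :=
  Num.min 1 (Num.max (\big[Num.max/0]_(i < k) (nrm (bc (i, true) - a i) - e))
    (nrm (\sum_i bc (i, false) * bc (i, true) - 1))).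

Definition unimod_val (D : cstarAlg R) : R :=
  sup [set inf [set unimod_defect (fun q => sval (v q)) (fun i => sval (a i))
        | v in [set: env (cstar_str D) (fun _ : 'I_k * bool => r)]]
      | a in [set: env (cstar_str D) (fun _ : 'I_k => m)]].

Lemma unimod_defect_ge0 (D : cstarAlg R) bc (a : 'I_k -> D) : 0 <= unimod_defect bc a.
Proof. by rewrite le_min ler01 le_max nrm_ge0 orbT. Qed.

Lemma unimod_val_transfer : unimod_val A = unimod_val B.
Proof.
pose g0 := @of_void (srt (cstar_lang R)).
pose c1 := sum_ctx (fun _ : 'I_k => m : srt (cstar_lang R)) g0.
pose c2 := sum_ctx (fun _ : 'I_k * bool => r : srt (cstar_lang R)) c1.
pose Q b (v : env (M b) c2) := unimod_defect (fun q => sval (v (inl q) : cball (C b) r))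
  (fun i => sval (v (inr (inl i)) : cball (C b) m)).
have dQ : definable_predicate (M := M) Q.
  apply: dp_min; first exact: dp_cst.
  have rv q : @rep R bool C _ c2 (fun b v => sval (v (inl q) : cball (C b) r)).
    exact: (rep_var C c2 (inl q)).
  have ra i : @rep R bool C _ c2 (fun b v => sval (v (inr (inl i)) : cball (C b) m)).
    exact: (rep_var C c2 (inr (inl i))).
  apply: dp_max.
    by apply: dp_bigmax => i; apply: dp_sub; [exact: dp_nrm|exact: dp_cst].
  by apply: dp_nrm; [apply: rep_sum => i; exact: rep_mul|exact: rep_one].
have Q0 b (v : env (M b) c2) : 0 <= Q b v by exact: unimod_defect_ge0.
have Q1 b (v : env (M b) c2) : Q b v <= 1 by rewrite ge_min lexx.
have dI := @dp_inf_fam R _ bool M _ c1 r ('I_k * bool)%type Q 0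
  (fun b => cball_inh C b r) Q0 dQ.
have dS := @dp_sup_fam R _ bool M _ g0 m 'I_k _ 1 (fun b => cball_inh C b m) _ dI.
have {}dS : definable_predicate (M := M) (fun b (w : env (M b) g0) =>
    sup [set inf [set Q b (sum_env v (sum_env a w)) | v in [set: env (M b) (fun _ : 'I_k * bool => r)]]
     | a in [set: env (M b) (fun _ : 'I_k => m)]]).
  apply: dS => b v; have [x _] := cball_inh C b r.
  apply: le_trans (@inf_img_le R _ _ _ 0 (fun _ => x) _ _) _ => //.
pose w0 : env (M true) g0 := fun x => match x with end.
exact: (@dp_transfer _ _ bool M true false (cball_map j) _ g0 _ w0 ej dS).
Qed.

End Sentence.

(** By [gap], a column can be moved by at most [2 e'] to one with a left inverse bounded by
    [1 / e'], so density of left invertible columns in the [m]-ball gives [unimod_val = 0] for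
    suitable radii, and this value is shared with [B]. In [B] an approximate left inverse is
    corrected by [half_inv]. *)
Lemma csr_elementary l : csr A l -> csr B l.
Proof.
move=> sr a e e0.
(* In [B] the defect is less than [e'], so entries differ by less than [2 e' + e']; the bound
   [1 / 2] serves for inverting the approximate product and keeps the defect below the cut at 1. *)
pose e' : R := Num.min (e / (2 * (l%:R + 1) * 3)) (1 / 2).
have e'0 : 0 < e' by rewrite lt_min !divr_gt0// !mulr_gt0// ltr_wpDl.
have e'e : (l%:R + 1) * (3 * e') <= e / 2.
  have h : e' <= e / (2 * (l%:R + 1) * 3) by rewrite ge_min lexx.
  have l0 : 0 < l%:R + 1 :> R by rewrite ltr_wpDl.
  by move: h; rewrite ler_pdivlMr ?mulr_gt0//; lra.
have e'2 : e' <= 1 / 2 by rewrite ge_min lexx orbT.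
pose m := (Num.truncn (ment a)).+1.
have am i : nrm (a i 0) <= m%:R.
  by apply: le_trans (le_ment _ _ _) _; apply: ltW; exact: truncnS_gt.
(* The ball must contain both the perturbed columns, of norm at most [m + 2 e'], and the left
   inverses, of norm at most [1 / e']. *)
pose r := (m + 1 + (Num.truncn e'^-1).+1)%N.
have rE : e'^-1 <= r%:R.
  apply: (@le_trans _ _ (Num.truncn e'^-1).+1%:R); first by apply: ltW; exact: truncnS_gt.
  by rewrite ler_nat leq_addl.
have rE2 : m%:R + 2 * e' <= r%:R.
  apply: (@le_trans _ _ (m + 1)%:R); last by rewrite ler_nat leq_addr.
  by rewrite natrD; lra.
have vA : unimod_val l m r (2 * e') A = 0.
  have inh : [set: env (cstar_str A) (fun _ : 'I_l => m)] !=set0.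
    by have [x _] := @cball_inh R bool C true m; exists (fun _ => x).
  have z (x : env (cstar_str A) (fun _ : 'I_l => m)) :
     inf [set unimod_defect (2 * e') (fun q => sval (v q)) (fun i => sval (x i))
        | v in [set: env (cstar_str A) (fun _ : 'I_l * bool => r)]] = 0.
    have [b ba [c cb]] := sr (\col_i sval (x i)) e' e'0.
    have cb1 : \sum_i c 0 i * b i 0 = 1.
      by move/matrixP: cb => /(_ 0 0); rewrite !mxE eqxx.
    have [b' [c' [cb' bb' cn']]] := gap cb1 e'0.
    have b'a i : nrm (b' i - sval (x i)) <= 2 * e'.
      have -> : b' i - sval (x i) = (b' i - b i 0) + (b - \col_i sval (x i)) i 0.
        by rewrite !mxE addrA subrK.
      apply: le_trans (nrmD _ _) _; have := bb' i; have := mn_entry (b - \col_i sval (x i)) i 0; lra.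
    have hb q : `|(if q.2 then b' q.1 else c' q.1) : A| <= r%:R.
      rewrite -(rmorph_nat (real_complex R)) nrm_le; case: ifP => _; last exact: le_trans rE.
      apply: le_trans rE2; have := nrmD (b' q.1 - sval (x q.1)) (sval (x q.1)); rewrite subrK.
      by have := b'a q.1; have := cball_nrm (x q.1); lra.
    apply: (@inf_img_eq R _ _ _ 0 (fun q => mk_cball (hb q))) => // [v _|].
      exact: unimod_defect_ge0.
    apply/eqP; rewrite eq_le unimod_defect_ge0 andbT /unimod_defect /= cb' subrr nrm0.
    rewrite ge_min ge_max lexx andbT orbC; apply/orP; left.
    by apply: bigmax_le => // i _; rewrite subr_le0.
  rewrite /unimod_val; have -> : [set inf [set unimod_defect (2 * e') (fun q => sval (v q)) (fun i => sval (x i))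
        | v in [set: env (cstar_str A) (fun _ : 'I_l * bool => r)]]
      | x in [set: env (cstar_str A) (fun _ : 'I_l => m)]] = [set 0].
    apply/seteqP; split=> [_ [x _ <-]|_ ->]; first by rewrite /= z.
    by have [x _] := inh; exists x => //; exact: z.
  by rewrite sup1.
have ha i : `|a i 0| <= m%:R by rewrite -(rmorph_nat (real_complex R)) nrm_le.
pose av : env (cstar_str B) (fun _ : 'I_l => m) := fun i => mk_cball (ha i).
have inhB : [set: env (cstar_str B) (fun _ : 'I_l * bool => r)] !=set0.
  by have [x _] := @cball_inh R bool C false r; exists (fun _ => x).
pose Ib (x : env (cstar_str B) (fun _ : 'I_l => m)) :=
  inf [set unimod_defect (2 * e') (fun q => sval (v q)) (fun i => sval (x i))
        | v in [set: env (cstar_str B) (fun _ : 'I_l * bool => r)]].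
have : Ib av <= 0.
  rewrite -vA unimod_val_transfer; apply: (@le_sup_img R _ [set: _] Ib 1) => // x _.
  have [v _] := inhB.
  apply: le_trans (@inf_img_le R _ _ _ 0 v _ _) _ => //.
    by move=> w _; exact: unimod_defect_ge0.
  by rewrite ge_min lexx.
move=> /le_lt_trans/(_ e'0)/(inf_img_lt inhB)[v _].
rewrite /unimod_defect gt_min ltNge (le_trans e'2) /=; last by lra.
rewrite gt_max => /andP[h1 h2].
exists (\col_i sval (v (i, true))).
  apply: le_lt_trans (mn_le_entries (t := 3 * e') _) _; last first.
    rewrite muln1; apply: (@le_lt_trans _ _ (e / 2)); last by rewrite gtr_pMr// invf_lt1// ltr1n.
    by apply: le_trans e'e; rewrite ler_wpM2r ?mulr_ge0 ?lerDl// ltW.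
  move=> i q; rewrite (ord1 q) !mxE.
  have := @le_bigmax _ _ _ 0 (fun i : 'I_l => nrm (sval (v (i, true)) - sval (av i)) - 2 * e') i.
  by move=> /le_lt_trans/(_ h1) /=; lra.
have n2 : nrm (1 - \sum_i sval (v (i, false)) * sval (v (i, true))) <= 1 / 2.
  by rewrite nrmBC; lra.
have [g [g1 _ _]] := half_inv n2.
exists (\row_i (g * sval (v (i, false)))); apply/matrixP => x y; rewrite !ord1 !mxE eqxx -g1 mulr_sumr.
by apply: eq_bigr => i _; rewrite !mxE mulrA.
Qed.

End StableRankTransfer.

(** * Part (4) *)

Fixpoint gterm_bound (t : gterm) : nat :=
  match t with
  | GVar n => n.+1
  | GOne => 0
  | GInv t => gterm_bound t
  | GMul t u => maxn (gterm_bound t) (gterm_bound u)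
  end.

Fixpoint gformula_bound (p : gformula) : nat :=
  match p with
  | GEq t u => maxn (gterm_bound t) (gterm_bound u)
  | GNot p => gformula_bound p
  | GAnd p q => maxn (gformula_bound p) (gformula_bound q)
  | GForall p => gformula_bound p
  end.

Lemma gval_agree (G : groupType) (e e' : nat -> G) t :
  (forall n, (n < gterm_bound t)%N -> e n = e' n) -> gval e t = gval e' t.
Proof.
elim: t => [n|//|t IH|t IHt u IHu] /= h; first exact: h.
- by rewrite IH.
- rewrite IHt => [|n nt]; last by apply: h; rewrite leq_max nt.
  by rewrite IHu => // n nu; apply: h; rewrite leq_max nu orbT.
Qed.

Lemma gsat_agree (G : groupType) (e e' : nat -> G) p :
  (forall n, (n < gformula_bound p)%N -> e n = e' n) -> gsat e p <-> gsat e' p.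
Proof.
elim: p e e' => [t u|p IH|p IHp q IHq|p IH] e e' /= h.
- rewrite (@gval_agree _ e e' t) => [|n nt]; last by apply: h; rewrite leq_max nt.
  by rewrite (@gval_agree _ e e' u) => // n nu; apply: h; rewrite leq_max nu orbT.
- by have := IH e e' h; tauto.
- suff : (gsat e p <-> gsat e' p) /\ (gsat e q <-> gsat e' q) by tauto.
  split; [apply: IHp|apply: IHq] => n nn; apply: h; rewrite leq_max nn ?orbT//.
- have H x := IH (fun n => if n is m.+1 then e m else x) (fun n => if n is m.+1 then e' m else x).
  by split=> hh x; apply/(H x) => // -[|m] //= mp; apply: h; exact: ltnW.
Qed.

Section Representable.
Context (R : realType) (n : nat) (Idx : Type) (C : Idx -> cstarAlg R).
Local Notation N2 := ('I_n * 'I_n)%type.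
Local Notation M := (fun i => cstar_str (C i)).
Local Notation ctx I := (fun _ : (I * N2)%type => 1%N : srt (cstar_lang R)).
(** [R3] is definable over the whole class but is tied to K_1 only at the good indices, which will
    be [A] and [B]. *)
Variables (R3 : forall i, env (M i) (ctx 'I_3) -> R) (good : Idx -> Prop).
Arguments R3 : clear implicits.
Hypothesis dR3 : definable_predicate (M := M) R3.
Hypothesis goodR3 : forall i, good i -> forall (v : env (M i) (ctx 'I_3))
    (u : 'I_3 -> unitary (C i) n), (forall k a b, val (u k) a b = sval (v (k, (a, b)))) ->
  R3 i v = (k1class (u o30) != (k1class (u o31) * k1class (u o32))%g)%:R.
Hypothesis good_surj : forall i, good i -> forall x : K1 (C i),
  exists u : unitary (C i) n, k1class u = x.

(* Q is polymorphic in the group so that the same predicate serves K_1(A) and K_1(B). *)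
Definition representable (I : finType) (Q : forall G : groupType, (I -> G) -> Prop) :=
  exists P : forall i, env (M i) (ctx I) -> R, definable_predicate (M := M) P /\
    forall i, good i -> forall (v : env (M i) (ctx I)) (u : I -> unitary (C i) n),
      (forall k a b, val (u k) a b = sval (v (k, (a, b)))) ->
      P i v = (~~ `[< Q (K1 (C i)) (fun k => k1class (u k)) >])%:R.

Lemma representable_ext (I : finType) (Q Q' : forall G : groupType, (I -> G) -> Prop) :
  (forall G e, Q G e <-> Q' G e) -> representable Q -> representable Q'.
Proof.
move=> QQ [P [dP HP]]; exists P; split=> // i gi v u vu.
by rewrite (HP i gi v u vu); congr (~~ _)%:R; apply: asbool_equiv_eq.
Qed.

Lemma representable_mul (I : finType) (x y z : I) :
  representable (fun G (e : I -> G) => e x = (e y * e z)%g).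
Proof.
exists (fun i v => R3 i (fun k => v (sel3 x y z k.1, k.2))); split.
  exact: (dp_subst (fun k : 'I_3 * N2 => Var (ctx I) (sel3 x y z k.1, k.2)) dR3).
move=> i gi v u vu; rewrite (goodR3 gi (u := fun k => u (sel3 x y z k)))//.
by congr (~~ _)%:R; apply/eqP/asboolP.
Qed.

Lemma representable_not (I : finType) (Q : forall G : groupType, (I -> G) -> Prop) :
  representable Q -> representable (fun G e => ~ Q G e).
Proof.
move=> [P [dP HP]]; exists (fun i v => 1 - P i v); split.
  by apply: dp_sub => //; exact: dp_cst.
move=> i gi v u vu; rewrite (HP i gi v u vu) asbool_neg.
by case: `[< _ >]; rewrite /= ?subr0 ?subrr.
Qed.

Lemma representable_and (I : finType) (Q Q' : forall G : groupType, (I -> G) -> Prop) :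
  representable Q -> representable Q' -> representable (fun G e => Q G e /\ Q' G e).
Proof.
move=> [P [dP HP]] [P' [dP' HP']]; exists (fun i v => Num.max (P i v) (P' i v)); split.
  exact: dp_max.
by move=> i gi v u vu; rewrite (HP i gi v u vu) (HP' i gi v u vu) max_bool asbool_and.
Qed.

Definition ext_fun (T : Type) (I : finType) (e : I -> T) (x : T) (o : option I) : T :=
  if o is Some k then e k else x.

Lemma unitary_definable : @definable_set R (cstar_lang R) Idx M N2 (fun _ => 1%N)
  (fun i => [set v | udef (mxv v) = 0]).
Proof.
apply: (@definable_zero_set R (cstar_lang R) Idx M (cstar_uc C) N2 1%N (fun i v => udef (mxv v))).
- exact: dp_udef.
- by move=> i v; exact: udef_ge0.
- move=> i; have [v vE] := mxv_unitary (is_unitarymx1 (C i) n).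
  by exists v; rewrite vE; apply/udefP; exact: is_unitarymx1.
- by move=> e e0; have [d d0 H] := @udef_stable R n e e0; exists d => // i v /H.
- by move=> i; exact: cball_inh.
Qed.

(** A quantifier over K_1 is one over the definable set of unitaries of the fixed size, by
    surjectivity; at good indices the infimum of truth values 0 and 1 is attained. *)
Lemma representable_ex (I : finType) (Q : forall G : groupType, (option I -> G) -> Prop) :
  representable Q -> representable (fun G (e : I -> G) => exists x : G, Q G (ext_fun e x)).
Proof.
move=> [P [dP HP]].
pose c := sum_ctx (fun _ : N2 => 1%N : srt (cstar_lang R)) (ctx I).
pose s (k : option I * N2) : N2 + I * N2 :=
  match k with (None, p) => inl p | (Some x, p) => inr (x, p) end.
pose ev i (e : env (M i) c) : env (M i) (ctx (option I)) := fun k =>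
  match k with (None, p) => e (inl p) | (Some x, p) => e (inr (x, p)) end.
have dP' : definable_predicate (M := M) (fun i (e : env (M i) c) => P i (ev i e)).
  pose sg (k : option I * N2) : term c (1%N : srt (cstar_lang R)) :=
    match k with (None, p) => Var c (inl p) | (Some x, p) => Var c (inr (x, p)) end.
  apply: dp_ext (dp_subst (sg : forall k, term c (ctx (option I) k)) dP) => i e.
  by congr (P i _); apply/funext => -[[x|] p].
exists (fun i w => inf [set P i (ev i (sum_env v w)) | v in [set v | udef (mxv v) = 0]]); split.
  exact: (dp_inf_set unitary_definable dP').
move=> i gi w u wu.
have val01 v (Xv : udef (mxv v) = 0) : forall u0 : unitary (C i) n, val u0 = mxv v ->
    P i (ev i (sum_env v w)) =
    (~~ `[< Q (K1 (C i)) (ext_fun (fun k => k1class (u k)) (k1class u0)) >])%:R.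
  move=> u0 u0v; rewrite (HP i gi _ (ext_fun u u0)).
    congr (~~ `[< Q _ _ >])%:R; apply/funext => -[k|] //.
  by move=> [k|] a b /=; [exact: wu|rewrite u0v mxE].
have exu v (Xv : udef (mxv v) = 0) : exists u0 : unitary (C i) n, val u0 = mxv v.
  by exists (exist _ (mxv v) (proj1 (udefP _) Xv)).
apply: (@inf_bool R _ _ _ (fun v => P i (ev i (sum_env v w)) == 0)).
- have [v vE] := mxv_unitary (is_unitarymx1 (C i) n); exists v => /=.
  by rewrite vE; apply/udefP; exact: is_unitarymx1.
- move=> v Xv; have [u0 u0v] := exu v Xv; rewrite (val01 v Xv u0 u0v).
  by case: `[< _ >]; rewrite /= ?eqxx ?oner_eq0.
split=> [/asboolP[x Qx]|[v Xv /eqP P0]].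
  have [u0 u0x] := good_surj gi x; have [v vE] := mxv_unitary (valP u0).
  have Xv : udef (mxv v) = 0 by rewrite vE; apply/udefP; exact: (valP u0).
  exists v => //; rewrite (val01 v Xv u0 (esym vE)) u0x.
  by case: asboolP => // /(_ Qx).
have [u0 u0v] := exu v Xv; move: P0; rewrite (val01 v Xv u0 u0v).
case: asboolP => [Qu _|_ /eqP]; last by rewrite oner_eq0.
by apply/asboolP; exists (k1class u0).
Qed.

(** Terms are unnested, as only the product relation is available: 1 is the solution of [y = y y],
    and [x] is the inverse of [y] when [x y] is such a solution. *)
Lemma representable_term (t : gterm) (I : finType) (x : I) (rho : nat -> I) :
  representable (fun G (e : I -> G) => e x = gval (fun m => e (rho m)) t).
Proof.
elim: t I x rho => [m|//|t IH|t IHt u IHu] I x rho.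
- apply: representable_ext (representable_ex (representable_and
    (@representable_mul (option I) None None None)
    (@representable_mul (option I) (Some x) (Some (rho m)) None))) => G e /=.
  split=> [[y [y1 ->]]|->].
    have -> : y = 1%g by apply: (mulgI y); rewrite -y1 mulg1.
    by rewrite mulg1.
  by exists 1%g; rewrite !mulg1.
- apply: representable_ext (@representable_mul I x x x) => G e /=.
  split=> [h|->]; last by rewrite mulg1.
  by apply: (mulgI (e x)); rewrite -h mulg1.
- apply: representable_ext (representable_ex (representable_and
    (IH (option I) None (fun m => Some (rho m)))
    (representable_ex (representable_and
      (@representable_mul (option (option I)) None None None)
      (@representable_mul (option (option I)) None (Some (Some x)) (Some None)))))) => G e /=.
  split=> [[y [-> [z [z1 ez]]]]|->].
    have {}z1 : z = 1%g by apply: (mulgI z); rewrite -z1 mulg1.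
    by apply: (mulIg (gval (fun m => e (rho m)) t)); rewrite mulVg -ez z1.
  exists (gval (fun m => e (rho m)) t); split=> //; exists 1%g.
  by rewrite mulg1 mulVg.
- apply: representable_ext (representable_ex (representable_and
    (IHt (option I) None (fun m => Some (rho m)))
    (representable_ex (representable_and
      (IHu (option (option I)) None (fun m => Some (Some (rho m))))
      (@representable_mul (option (option I)) (Some (Some x)) (Some None) None))))) => G e /=.
  split=> [[y [-> [z [-> ->]]]]//|->].
  by exists (gval (fun m => e (rho m)) t); split=> //; exists (gval (fun m => e (rho m)) u).
Qed.

Lemma representable_formula (p : gformula) (I : finType) (rho : nat -> I) :
  representable (fun G (e : I -> G) => gsat (fun m => e (rho m)) p).
Proof.
elim: p I rho => [t u|p IH|p IHp q IHq|p IH] I rho.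
- apply: representable_ext (representable_ex (representable_and
    (representable_term t None (fun m => Some (rho m)))
    (representable_term u None (fun m => Some (rho m))))) => G e /=.
  split=> [[y [h1 h2]]|h]; first by rewrite -h1 -h2.
  by exists (gval (fun m => e (rho m)) t).
- exact: (representable_not (IH I rho)).
- exact: (representable_and (IHp I rho) (IHq I rho)).
- apply: representable_ext (representable_not (representable_ex (representable_not
    (IH (option I) (fun m => if m is m'.+1 then Some (rho m') else None))))) => G e /=.
  have E (x : G) : (fun m => ext_fun e x (if m is m'.+1 then Some (rho m') else None)) =
      (fun m => if m is m'.+1 then e (rho m') else x) by apply/funext => -[|m].
  split=> [h x|h [x]]; last by rewrite E; apply; exact: h.
  by apply: contrapT => nx; apply: h; exists x; rewrite E.
Qed.

End Representable.

(** One definable predicate expresses the given formula in K_1 of both algebras, and the elementary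
    embedding preserves its value. The definable set belongs to the theory of [B], of which [A] is a
    model. *)
Lemma K1_elementary (R : realType) (A B : cstarAlg R) (j : cstar_embedding A B) :
  finite_stable_rank A -> elementary_embedding j -> (forall n, U0_definable B n) ->
  group_elementary (K1_map j).
Proof.
move=> /finite_stable_rank_csr[l srA] ej dU; have srB := csr_elementary ej srA.
pose n := (l + 1)%N; have [X [dX XB]] := dU n.
have eBA : elementarily_equivalent (cstar_str B) (cstar_str A).
  move=> p v w; rewrite (ej _ _ p w); congr (fval p _).
  by apply: functional_extensionality_dep; case.
pose iA : models B := exist _ A eBA; pose iB := self B.
pose C (i : models B) := sval i.
have e0 : 0 < ((n * n)%:R + 1)^-1 :> R by rewrite invr_gt0 ltr_wpDl.
pose R3 i (v : env (cstar_str (C i)) (fun _ : 'I_3 * ('I_n * 'I_n) => 1%N)) :=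
  clip ((n * n)%:R + 1)^-1 (coset_dist X v).
have dR3 : definable_predicate (M := fun i => cstar_str (C i)) R3.
  by apply: dp_clip; exact: dp_coset_dist.
have R3B (v : env (cstar_str B) (fun _ : 'I_3 * ('I_n * 'I_n) => 1%N))
    (u : 'I_3 -> unitary B n) : (forall k a b, val (u k) a b = sval (v (k, (a, b)))) ->
  R3 iB v = (k1class (u o30) != (k1class (u o31) * k1class (u o32))%g)%:R.
  by move=> vu; apply: (@coset_clipP R l _ C iB X v u).
(* What [X] is at [A] is not known, so the meaning of [R3] there is imported from [B] along the
   injective homomorphism [K1_map]. *)
have R3A (v : env (cstar_str A) (fun _ : 'I_3 * ('I_n * 'I_n) => 1%N))
    (u : 'I_3 -> unitary A n) : (forall k a b, val (u k) a b = sval (v (k, (a, b)))) ->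
  R3 iA v = (k1class (u o30) != (k1class (u o31) * k1class (u o32))%g)%:R.
  move=> vu.
  have -> := @dp_transfer R _ _ (fun i => cstar_str (C i)) iA iB (cball_map j) _ _ R3 v ej dR3.
  rewrite (R3B _ (fun k => unitary_map j (u k))) => [|k a b]; last by rewrite !mxE vu.
  rewrite -!(K1_mapE j) -K1_mapM; congr (~~ _)%:R.
  by apply/eqP/eqP => [/(K1_map_inj ej)|->].
pose good i := i = iA \/ i = iB.
have gR3 i : good i -> forall (v : env (cstar_str (C i)) (fun _ : 'I_3 * ('I_n * 'I_n) => 1%N))
    (u : 'I_3 -> unitary (C i) n), (forall k a b, val (u k) a b = sval (v (k, (a, b)))) ->
  R3 i v = (k1class (u o30) != (k1class (u o31) * k1class (u o32))%g)%:R.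
  by case=> ->.
have gS i : good i -> forall x : K1 (C i), exists u : unitary (C i) n, k1class u = x.
  by case=> -> x; exact: K1_surj_all.
(* Only the variables below [N] occur in [p]; all others are sent to the index [N], which leaves
   finitely many. *)
move=> p e; pose N := gformula_bound p; pose rho m : 'I_N.+1 := inord (minn m N).
have rhoE m : (m < N)%N -> rho m = m :> nat.
  by move=> mN; rewrite inordK (minn_idPl (ltnW mN))// ltnS ltnW.
have [P [dP HP]] := representable_formula dR3 gR3 gS p rho.
have /choice[u Hu] : forall k : 'I_N.+1, exists u : unitary A n, k1class u = e k.
  by move=> k; exact: K1_surj_all.
have /choice[v Hv] : forall k : 'I_N.+1, exists v, mxv v = val (u k).
  by move=> k; apply: mxv_unitary; exact: (valP (u k)).
pose w : env (cstar_str (C iA)) (fun _ : 'I_N.+1 * ('I_n * 'I_n) => 1%N) := fun k => v k.1 k.2.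
have wu k a b : val (u k) a b = sval (w (k, (a, b))) by rewrite -Hv mxE.
have hA := HP iA (or_introl erefl) w u wu.
have hB := HP iB (or_intror erefl) (fun k => cball_map j (w k)) (fun k => unitary_map j (u k)).
have {}hB := hB (fun k a b => _).
have PAB := @dp_transfer R _ _ (fun i => cstar_str (C i)) iA iB (cball_map j) _ _ P w ej dP.
have {}hB : P iB (fun k => cball_map j (w k)) =
    (~~ `[< gsat (fun m => k1class (unitary_map j (u (rho m)))) p >])%:R.
  by apply: hB => k a b; rewrite !mxE wu.
have sA : gsat e p <-> gsat (fun m => k1class (u (rho m))) p.
  by apply: gsat_agree => m mN; rewrite Hu rhoE.
have sB : gsat (K1_map j \o e) p <-> gsat (fun m => k1class (unitary_map j (u (rho m)))) p.
  by apply: gsat_agree => m mN; rewrite -K1_mapE Hu /= rhoE.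
rewrite sA sB; move: PAB; rewrite hA hB.
by case: asboolP => h1; case: asboolP => h2 //= /eqP; rewrite ?oner_eq0 // eq_sym oner_eq0.
Qed.

Theorem proposition3p12p1 (R : realType) (A : cstarAlg R)
    (srA : finite_stable_rank A) :
  [/\ (forall n : nat, U0_definable A n) -> K1_belongs_to_eq A,
      real_rank_zero A -> K1_belongs_to_eq A,
      forall (B : cstarAlg R) (j : cstar_embedding A B),
        elementary_embedding j ->
        exists h : K1 A -> K1 B,
          [/\ K1_induced j h, {morph h : x y / (x * y)%g} & injective h] &
      forall (B : cstarAlg R) (j : cstar_embedding A B),
        elementary_embedding j ->
        (forall n : nat, U0_definable B n) ->
        exists h : K1 A -> K1 B, K1_induced j h /\ group_elementary h].
Proof.
split.
- exact: U0_definable_belongs.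
- exact: real_rank_zero_belongs.
- move=> B j ej; exists (K1_map j); split; [exact: K1_mapE|exact: K1_mapM|exact: K1_map_inj].
- move=> B j ej dU; exists (K1_map j); split; first exact: K1_mapE.
  exact: K1_elementary.
Qed.
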